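(* Let $0<p,q,u,v<\infty$, let $\alpha,\beta>-2$ be real, and let $\{X_n\}_{n\ge0}$ be a standard random sequence, with associated randomization $\mathcal{R}$. Then $$\mathcal{R}:\mathcal{AT}_{q,\alpha}^{p}\hookrightarrow\mathcal{AT}_{u,\beta}^{v}$$ (i.e. $\mathcal{R}f\in\mathcal{AT}_{u,\beta}^{v}$ almost surely for every $f\in\mathcal{AT}_{q,\alpha}^{p}$) if and only if one of the following conditions holds: (i) $0<p<2$, and either (i.1) $p\le u$ and $\frac1p+\frac{\alpha+2}{q}=\frac12+\frac{\beta+2}{u}$, or (i.2) $\frac1p+\frac{\alpha+2}{q}<\frac12+\frac{\beta+2}{u}$; (ii) $2\le p<\infty$, and either (ii.1) $u\ge\max\{2,q\}$ and $\frac{\alpha+2}{q}=\frac{\beta+2}{u}$, or (ii.2) $\frac{\alpha+2}{q}<\frac{\beta+2}{u}$.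
   Context: $\mathbb{D}$ is the open unit disk, $\mathbb{T}$ the unit circle, $|d\xi|$ Lebesgue (arc length) measure on $\mathbb{T}$, $dA$ Euclidean area measure on $\mathbb{D}$, and $H(\mathbb{D})$ the space of analytic functions on $\mathbb{D}$. For $\xi\in\mathbb{T}$ let $\Gamma(\xi)=\{z\in\mathbb{D}: |1-z\bar\xi|<1-|z|^2\}$. Analytic tent spaces: for $0<p,q<\infty$ and $\alpha>-2$, $\mathcal{AT}_{q,\alpha}^p$ is the space of all $f\in H(\mathbb{D})$ with $$\|f\|_{\mathcal{AT}_{q,\alpha}^p}^p=\int_{\mathbb{T}}\left(\int_{\Gamma(\xi)}|f(z)|^q(1-|z|^2)^\alpha\,dA(z)\right)^{p/q}|d\xi|<\infty .$$ Randomization: a standard random sequence $\{X_n\}_{n\ge0}$ is a sequence of independent identically distributed random variables which are either all Bernoulli ($\mathbb{P}(X=1)=\mathbb{P}(X=-1)=\frac12$), or all Steinhaus (uniformly distributed on the unit circle), or all Gaussian $N(0,1)$ (zero mean, unit variance). For $f(z)=\sum_{n\ge0}a_nz^n\in H(\mathbb{D})$, $(\mathcal{R}f)(z)=\sum_{n=0}^\infty X_na_nz^n$. *)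

(* Defs.v *)
From HB Require Import structures.
From mathcomp Require Import all_boot all_order all_algebra.
From mathcomp Require Import all_classical all_reals all_analysis.
From mathcomp Require Import complex.
Set Implicit Arguments.
Unset Strict Implicit.
Unset Printing Implicit Defensive.
Import Order.TTheory GRing.Theory Num.Theory.
Import numFieldNormedType.Exports.
Local Open Scope classical_set_scope.
Local Open Scope ring_scope.
Local Open Scope complex_scope.

(* The complex plane.  The regular module [R[i]^o] is the copy of [R[i]] that
   carries the norm topology and is a normed module over [R[i]], so that
   [derivable f z 1] below is complex differentiability. *)
Notation Cplx R := (R[i]^o).

(* The modulus as an element of [R]; the library norm [`|z|] lies in [R[i]]. *)
Definition modulus (R : realType) (z : Cplx R) : R :=
  ComplexField.Normc.normc z.

Definition to_plane (R : realType) (z : Cplx R) : R * R :=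
  (complex.Re z, complex.Im z).

Definition of_plane (R : realType) (w : R * R) : Cplx R := w.1 +i* w.2.

Definition circle_pt (R : realType) (t : R) : Cplx R := cos t +i* sin t.

Definition disk (R : realType) : set (Cplx R) := [set z | modulus z < 1].
Arguments disk : clear implicits.

Definition holomorphic_disk (R : realType) (f : Cplx R -> Cplx R) : Prop :=
  forall z, disk R z -> derivable f z 1.

Definition Gamma (R : realType) (xi : Cplx R) : set (Cplx R) :=
  [set z | disk R z /\
           modulus (1 - z * conjc xi : R[i]) < 1 - modulus z ^+ 2].

Definition area (R : realType) :=
  (@lebesgue_measure R \x @lebesgue_measure R)%E.
Arguments area : clear implicits.

Definition cone_integral (R : realType) (q alpha : R) (f : Cplx R -> Cplx R)
    (xi : Cplx R) : \bar R :=
  (\int[area R]_(w in @of_plane R @^-1` Gamma xi)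
     (modulus (f (of_plane w)) `^ q
      * (1 - modulus (of_plane w) ^+ 2) `^ alpha)%:E)%E.

(* The p-th power of the (quasi-)norm; |d xi| is d theta for
   xi = exp(i theta), 0 <= theta <= 2 pi. *)
Definition tent_norm_pow (R : realType) (p q alpha : R)
    (f : Cplx R -> Cplx R) : \bar R :=
  (\int[@lebesgue_measure R]_(t in `[0%R, (2 * pi)%R])
     (cone_integral q alpha f (circle_pt t) `^ (p / q)))%E.

Definition tent_space (R : realType) (p q alpha : R)
    : set (Cplx R -> Cplx R) :=
  [set f | holomorphic_disk f /\ (tent_norm_pow p q alpha f < +oo)%E].

Definition power_terms (R : realType) (a : nat -> Cplx R) (z : Cplx R)
    : nat -> Cplx R := fun n => a n * z ^+ n.

Definition power_expansion (R : realType) (f : Cplx R -> Cplx R)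
    (a : nat -> Cplx R) : Prop :=
  forall z, disk R z -> series (power_terms a z) @ \oo --> f z.

Definition power_sum (R : realType) (a : nat -> Cplx R) : Cplx R -> Cplx R :=
  fun z => limn (series (power_terms a z)).

Section random_sequences.
Context (R : realType) (d : measure_display) (Omega : measurableType d).
Variable P : probability Omega R.
Implicit Types (Y : Omega -> Cplx R) (X : nat -> Omega -> Cplx R).

Definition complex_rv Y : Prop := measurable_fun setT (@to_plane R \o Y).

(* [B] ranges over Borel sets of the plane. *)
Definition rv_event Y (B : set (R * R)) : set Omega :=
  [set om | B (to_plane (Y om))].

Definition mutually_independent X : Prop :=
  forall (s : seq nat) (B : nat -> set (R * R)),
    uniq s -> (forall n, measurable (B n)) ->
    P (\bigcap_(n in [set` s]) rv_event (X n) (B n))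
    = (\prod_(n <- s) P (rv_event (X n) (B n)))%E.

Definition bernoulli_law Y : Prop :=
  P [set om | Y om = 1] = (2^-1)%:E /\ P [set om | Y om = -1] = (2^-1)%:E.

Definition steinhaus_law Y : Prop :=
  forall B : set (R * R), measurable B ->
    P (rv_event Y B) =
    (((2 * pi)^-1)%:E *
      @lebesgue_measure R
        (`[0%R, (2 * pi)%R[ `&` [set t | B (to_plane (circle_pt t))]))%E.

(* The real law N(0,1), on the real axis of the plane. *)
Definition gaussian_law Y : Prop :=
  forall B : set (R * R), measurable B ->
    P (rv_event Y B) = normal_prob (0 : R) 1 [set x | B (x, 0)].

Definition standard_random_sequence X : Prop :=
  [/\ forall n, complex_rv (X n),
      mutually_independent X
    & [\/ (forall n, bernoulli_law (X n)),
          (forall n, steinhaus_law (X n))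
        | (forall n, gaussian_law (X n))]].

(* A function on the disk has at most one expansion [a], its Taylor
   coefficients.  The convergence clause makes the total operator [limn]
   in [power_sum] meaningful at every point of the disk. *)
Definition randomization X (a : nat -> Cplx R) (om : Omega) : nat -> Cplx R :=
  fun n => X n om * a n.

Definition random_embedding X (A B : set (Cplx R -> Cplx R)) : Prop :=
  forall (f : Cplx R -> Cplx R) (a : nat -> Cplx R),
    A f -> power_expansion f a ->
    {ae P, forall om,
      (forall z, disk R z ->
         cvgn (series (power_terms (randomization X a om) z))) /\
      B (power_sum (randomization X a om))}.

End random_sequences.

(* Main.v *)
(* Write [r_k = 1 - 2^-k] and [M_2(r)^2 = sum |a_n|^2 r^(2n)].  The embedding is
   governed by one dyadic sum: [Rf] lies in the target space almost surely if
   and only if [(2^-k)^((beta+2)/u) M_2(r_k)] is [u]-summable, whatever [v] is.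
   The partial sums of [Rf] at a point are subgaussian with variance proxy
   [M_2^2], so their moments are comparable to powers of [M_2]; this bounds the
   expectation of the cone integrals over dyadic annuli, and conversely a
   Paley-Zygmund estimate, uniform in the point, makes the terms of the sum
   occur on a single ray with probability bounded below.
   If [f] is in the source space, the local subharmonicity of [|f|^q] bounds a
   cone integral below by the values of [f] on a ray and on arcs of length
   comparable to [2^-k]; integrating over the circle gives [max 2 q]-summability
   with weight [(alpha+2)/q] when [p >= 2], and [p]-summability with weight
   [(alpha+2)/q + 1/p - 1/2] when [p < 2].  Both are sharp: lacunary series
   whose [k]-th block is a power of a Dirichlet kernel of length [N_k] centred at
   [theta_k] violate the dyadic sum outside the stated range, with [N_k = 1]
   (for [u < q]), [N_k ~ k] with peaks spread over an arc (for [u < 2]), and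
   [N_k = 2^k] with all peaks at one point (for [p < 2]). *)
From HB Require Import structures.
Require Import Defs.
From mathcomp Require Import all_boot all_order all_algebra.
From mathcomp Require Import all_classical all_reals all_analysis.
From mathcomp Require Import measurable_realfun.
From mathcomp Require Import complex ring lra zify.
Set Implicit Arguments.
Unset Strict Implicit.
Unset Printing Implicit Defensive.
Import Order.TTheory GRing.Theory Num.Theory.
Import numFieldNormedType.Exports.
Local Open Scope classical_set_scope.
Local Open Scope ring_scope.

(** * Complex moduli and power series *)

(** The embedding quantifies over functions given with a power expansion, so the complex analysis
    rests on power series alone: Cauchy estimates come from Parseval for polynomials, and the
    submean inequality from a near-maximiser of |f| times a power of the distance to the edge of a
    disc. Random coefficients enter through [Upow], a lower limit of partial sums, which is jointly
    measurable and lets Tonelli exchange expectation, area and angle. The three laws are treated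
    together by exponential moments of Re (c X). Bernoulli and Gaussian variables are real and see
    only Re c, so the lower bound holds for c and ic taken together, not for each. The exponent v
    disappears for two reasons. For necessity, Tonelli yields one angle at which the random cone
    integral is almost surely finite. For sufficiency, a large power of the cone integral is
    compared, slice by slice, with a slice sum of finite expectation whose weights are matched to
    the size of M_2 on each annulus. The extremal examples sit exactly at the divergence of the
    harmonic series. *)

Section modulus_theory.
Variable R : realType.
Implicit Types (z w : Cplx R) (x y t : R).

Lemma eq_ler x y : x = y -> x <= y.
Proof. by move=> ->. Qed.

Lemma modulus_sqr z : modulus z ^+ 2 = complex.Re z ^+ 2 + complex.Im z ^+ 2.
Proof. by case: z => a b; rewrite /modulus /= sqr_sqrtr// addr_ge0// sqr_ge0. Qed.

Lemma modulus_ge0 z : 0 <= modulus z.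
Proof. by case: z => a b; rewrite /modulus /= sqrtr_ge0. Qed.

Lemma modulus0 : modulus (0 : Cplx R) = 0.
Proof. exact: ComplexField.Normc.normc0. Qed.

Lemma modulus1 : modulus (1 : Cplx R) = 1.
Proof. exact: ComplexField.Normc.normc1. Qed.

Lemma modulus_eq0 z : (modulus z == 0) = (z == 0).
Proof.
apply/eqP/eqP => [|->]; last exact: modulus0.
exact: ComplexField.Normc.eq0_normc.
Qed.

Lemma modulus_gt0 z : (0 < modulus z) = (z != 0).
Proof. by rewrite lt_def modulus_ge0 modulus_eq0 andbT. Qed.

Lemma modulusM z w : modulus (z * w) = modulus z * modulus w.
Proof. exact: ComplexField.Normc.normcM. Qed.

Lemma modulusX z n : modulus (z ^+ n) = modulus z ^+ n.
Proof.
by elim: n => [|n IH]; rewrite ?expr0 ?modulus1// !exprS modulusM IH.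
Qed.

Lemma modulusV z : modulus (z^-1) = (modulus z)^-1.
Proof. exact: ComplexField.Normc.normcV. Qed.

Lemma modulusN z : modulus (- z) = modulus z.
Proof. by case: z => a b; rewrite /modulus /= !sqrrN. Qed.

Lemma modulusD z w : modulus (z + w) <= modulus z + modulus w.
Proof. exact: le_normcD. Qed.

Lemma modulusB z w : modulus (z - w) <= modulus z + modulus w.
Proof. by rewrite -(modulusN w) modulusD. Qed.

Lemma modulus_distC z w : modulus (z - w) = modulus (w - z).
Proof. by rewrite -opprB modulusN. Qed.

Lemma modulus_sub_le z w : modulus z - modulus w <= modulus (z - w).
Proof. by rewrite lerBlDr (le_trans _ (modulusD _ _))// subrK. Qed.

Lemma modulus_dist z w : `|modulus z - modulus w| <= modulus (z - w).
Proof.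
rewrite ler_norml modulus_sub_le andbT lerNl opprB.
by rewrite modulus_distC modulus_sub_le.
Qed.

Lemma modulus_sum (I : Type) (s : seq I) (P : pred I) (F : I -> Cplx R) :
  modulus (\sum_(i <- s | P i) F i) <= \sum_(i <- s | P i) modulus (F i).
Proof.
elim/big_ind2 : _ => [|z1 x1 z2 x2 h1 h2|//]; first by rewrite modulus0.
exact: le_trans (modulusD _ _) (lerD h1 h2).
Qed.

Lemma ReD z w : complex.Re (z + w) = complex.Re z + complex.Re w.
Proof. by case: z; case: w. Qed.

Lemma ImD z w : complex.Im (z + w) = complex.Im z + complex.Im w.
Proof. by case: z; case: w. Qed.

Lemma Re_sum (I : Type) (s : seq I) (P : pred I) (F : I -> Cplx R) :
  complex.Re (\sum_(i <- s | P i) F i) = \sum_(i <- s | P i) complex.Re (F i).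
Proof. by apply: (big_morph (@complex.Re R)) => //; exact: ReD. Qed.

Lemma Im_sum (I : Type) (s : seq I) (P : pred I) (F : I -> Cplx R) :
  complex.Im (\sum_(i <- s | P i) F i) = \sum_(i <- s | P i) complex.Im (F i).
Proof. by apply: (big_morph (@complex.Im R)) => //; exact: ImD. Qed.

Lemma normC_modulus z : `|z| = (modulus z)%:C%C.
Proof. by rewrite normc_def; case: z => a b. Qed.

Lemma Re_le_modulus z : `|complex.Re z| <= modulus z.
Proof.
case: z => a b; rewrite /modulus /= -sqrtr_sqr ler_sqrt ?lerDl ?sqr_ge0//.
by rewrite addr_ge0// sqr_ge0.
Qed.

Lemma Im_le_modulus z : `|complex.Im z| <= modulus z.
Proof.
case: z => a b; rewrite /modulus /= -sqrtr_sqr ler_sqrt ?lerDr ?sqr_ge0//.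
by rewrite addr_ge0// sqr_ge0.
Qed.

Lemma modulus_le_ReIm z : modulus z <= `|complex.Re z| + `|complex.Im z|.
Proof.
rewrite -(@ler_pXn2r _ 2)// ?nnegrE ?modulus_ge0 ?addr_ge0//.
rewrite modulus_sqr sqrrD !real_normK ?num_real// [leRHS]addrAC lerDl.
by rewrite mulrn_wge0// mulr_ge0.
Qed.

Lemma modulus_real x : modulus (x%:C%C : Cplx R) = `|x|.
Proof. by rewrite /modulus /= expr0n addr0 sqrtr_sqr. Qed.

Lemma modulus_conjc z : modulus (conjc z) = modulus z.
Proof. by case: z => a b; rewrite /modulus /= sqrrN. Qed.

Lemma modulus_circle_pt t : modulus (circle_pt t) = 1.
Proof. by rewrite /modulus /= cos2Dsin2 sqrtr1. Qed.

Lemma circle_ptD t t' : circle_pt (t + t') = circle_pt t * circle_pt t'.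
Proof.
by rewrite /circle_pt cosD sinD /GRing.mul /=; congr (_ +i* _)%C; rewrite addrC.
Qed.

Lemma circle_pt0 : circle_pt (0 : R) = 1.
Proof. by rewrite /circle_pt cos0 sin0. Qed.

Lemma circle_ptX t n : circle_pt t ^+ n = circle_pt (n%:R * t).
Proof.
elim: n => [|n IH]; first by rewrite expr0 mul0r circle_pt0.
by rewrite exprS IH -circle_ptD -[in RHS](add1n n) natrD mulrDl mul1r.
Qed.

Lemma conjc_circle_pt t : conjc (circle_pt t) = circle_pt (- t).
Proof. by rewrite /circle_pt cosN sinN. Qed.

Lemma circle_ptVr t : circle_pt t * conjc (circle_pt t) = 1.
Proof. by rewrite conjc_circle_pt -circle_ptD subrr circle_pt0. Qed.

End modulus_theory.

Section complex_limits.
Variable R : realType.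
Implicit Types (z w l : Cplx R) (u : nat -> Cplx R).

Lemma cvgC_modulus u l :
  u @ \oo --> l <-> modulus (u n - l) @[n --> \oo] --> (0 : R).
Proof.
split=> [/cvgrPdist_lt h|/cvgrPdist_lt h].
  apply/cvgrPdist_lt => e e0; have e0' : 0 < (e%:C%C : R[i]) by rewrite ltcR.
  move: (h _ e0'); apply: filterS => n.
  by rewrite normC_modulus ltcR sub0r normrN ger0_norm ?modulus_ge0// modulus_distC.
(* A radius that is positive for the order of [R[i]] has zero imaginary part, so real radii
   suffice. *)
apply/cvgrPdist_lt => -[e e']; rewrite ltcE /= => /andP[/eqP -> e0].
move: (h _ e0); apply: filterS => n.
by rewrite normC_modulus sub0r normrN ger0_norm ?modulus_ge0// modulus_distC ltcR.
Qed.

Lemma cvg_modulus u l : u @ \oo --> l -> modulus (u n) @[n --> \oo] --> modulus l.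
Proof.
move=> /cvgC_modulus h; apply/cvgrPdist_lt => e e0.
move/cvgrPdist_lt : h => /(_ e e0); apply: filterS => n.
rewrite sub0r normrN ger0_norm ?modulus_ge0//; apply: le_lt_trans.
by rewrite distrC modulus_dist.
Qed.

Lemma cvgC_ReIm u l :
  complex.Re (u n) @[n --> \oo] --> complex.Re l ->
  complex.Im (u n) @[n --> \oo] --> complex.Im l ->
  u @ \oo --> l.
Proof.
move=> hr hi; apply/cvgC_modulus.
have h0 : `|complex.Re (u n) - complex.Re l| + `|complex.Im (u n) - complex.Im l|
    @[n --> \oo] --> (0 : R).
  rewrite -[X in _ --> X](addr0 0); apply: cvgD.
    rewrite -(normr0 R); apply: cvg_norm; rewrite -(subrr (complex.Re l)).
    by apply: cvgB => //; exact: cvg_cst.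
  rewrite -(normr0 R); apply: cvg_norm; rewrite -(subrr (complex.Im l)).
  by apply: cvgB => //; exact: cvg_cst.
apply: squeeze_cvgr h0; last exact: cvg_cst.
apply: nearW => n; rewrite modulus_ge0 /= (le_trans (modulus_le_ReIm _))//.
by case: (u n) => a b; case: (l) => c d.
Qed.

End complex_limits.

Section power_series.
Variable R : realType.
Implicit Types (z w l : Cplx R) (a : nat -> Cplx R) (r : R).

Lemma lt1_between (x : R) : 0 <= x -> x < 1 -> exists y : R, [/\ 0 < y, y < 1 & x < y].
Proof. by move=> x0 x1; exists ((x + 1) / 2); split; lra. Qed.

Definition psum a n z : Cplx R := \sum_(k < n) a k * z ^+ k.

Lemma series_power_terms a z n : series (power_terms a z) n = psum a n z.
Proof. by rewrite /series /= big_mkord. Qed.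

Definition abs_terms a r : nat -> R := fun k => modulus (a k) * r ^+ k.

(** Radius of convergence at least 1, phrased on moduli: the form in which randomized coefficients
    are controlled before any sum function is available. *)
Definition absconv a := forall r, 0 <= r -> r < 1 -> cvgn (series (abs_terms a r)).

Lemma abs_terms_ge0 a r k : 0 <= r -> 0 <= abs_terms a r k.
Proof. by move=> r0; rewrite mulr_ge0 ?modulus_ge0// exprn_ge0. Qed.

(** Abel's lemma: bounded terms at some s > r are dominated at r by a geometric series of ratio r /
    s. *)
Lemma absconv_of_bounded a : (forall r, 0 <= r -> r < 1 ->
    exists M, forall k, abs_terms a r k <= M) -> absconv a.
Proof.
move=> h r r0 r1.
have [s [s0 s1 rs]] := lt1_between r0 r1.
have [M hM] := h s (ltW s0) s1.
have rs0 : 0 <= r / s by rewrite divr_ge0// ltW.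
have M0 : 0 <= M by apply: le_trans (hM 0%N); exact: abs_terms_ge0 (ltW s0).
have h1 : cvgn (series (fun k => M * (r / s) ^+ k)).
  apply: is_cvg_geometric_series; rewrite ger0_norm//.
  by rewrite ltr_pdivrMr// mul1r.
apply: series_le_cvg h1 => k; first exact: abs_terms_ge0.
  by rewrite mulr_ge0// exprn_ge0.
have -> : abs_terms a r k = abs_terms a s k * (r / s) ^+ k.
  by rewrite /abs_terms -mulrA -exprMn [s * _]mulrC divfK// gt_eqF.
by rewrite ler_wpM2r// exprn_ge0.
Qed.

(** Convergence at the real point r bounds the partial sums, hence the terms, which are differences
    of consecutive partial sums; Abel's lemma applies. *)
Lemma power_expansion_absconv f a : power_expansion f a -> absconv a.
Proof.
move=> h; apply: absconv_of_bounded => r r0 r1.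
have hd : disk R (r%:C%C) by rewrite /disk /mkset modulus_real ger0_norm.
have /cvg_modulus c := h _ hd.
have [M [Mr hM]] := cvg_seq_bounded (cvgP _ c).
exists ((M + 1) + (M + 1)) => k.
have e : abs_terms a r k = modulus (psum a k.+1 (r%:C%C) - psum a k (r%:C%C)).
  rewrite /psum big_ord_recr /= addrAC subrr add0r modulusM modulusX modulus_real.
  by rewrite ger0_norm.
rewrite e (le_trans (modulusB _ _))// -!series_power_terms.
by apply: lerD; rewrite (le_trans (ler_norm _))// hM// ltrDl.
Qed.

Lemma psum_dist_le a r z n m : 0 <= r -> modulus z <= r -> (n <= m)%N ->
  modulus (psum a m z - psum a n z)
    <= series (abs_terms a r) m - series (abs_terms a r) n.
Proof.
move=> r0 zr nm; rewrite -!series_power_terms !sub_series_geq// (le_trans (modulus_sum _ _ _))//.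
apply: ler_sum => k _; rewrite /power_terms modulusM modulusX ler_wpM2l ?modulus_ge0//.
by rewrite lerXn2r ?nnegrE ?modulus_ge0.
Qed.

(** Real and imaginary parts are absolutely convergent real series, and their limits assemble into
    the complex one. *)
Lemma power_sum_cvg a z : absconv a -> disk R z ->
  series (power_terms a z) @ \oo --> power_sum a z.
Proof.
move=> ha hz.
have c : cvgn (series (abs_terms a (modulus z))) by apply: ha; rewrite ?modulus_ge0.
have cR : cvgn (series (fun k => complex.Re (a k * z ^+ k))).
  apply: normed_cvg; apply: series_le_cvg c => k //=.
    by rewrite abs_terms_ge0// modulus_ge0.
  by rewrite (le_trans (Re_le_modulus _))// modulusM modulusX.
have cI : cvgn (series (fun k => complex.Im (a k * z ^+ k))).
  apply: normed_cvg; apply: series_le_cvg c => k //=.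
    by rewrite abs_terms_ge0// modulus_ge0.
  by rewrite (le_trans (Im_le_modulus _))// modulusM modulusX.
have ReS n : complex.Re (series (power_terms a z) n) =
    series (fun k => complex.Re (a k * z ^+ k)) n by exact: Re_sum.
have ImS n : complex.Im (series (power_terms a z) n) =
    series (fun k => complex.Im (a k * z ^+ k)) n by exact: Im_sum.
have h : series (power_terms a z) @ \oo -->
    (Complex (limn (series (fun k => complex.Re (a k * z ^+ k))))
            (limn (series (fun k => complex.Im (a k * z ^+ k)))) : Cplx R).
  apply: cvgC_ReIm => /=.
    by under eq_fun do rewrite ReS.
  by under eq_fun do rewrite ImS.
have -> // : power_sum a z = Complex (limn (series (fun k => complex.Re (a k * z ^+ k))))
            (limn (series (fun k => complex.Im (a k * z ^+ k)))).
exact: cvg_lim h.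
Qed.

Lemma power_expansion_sum f a z : power_expansion f a -> disk R z -> f z = power_sum a z.
Proof.
move=> h hz; rewrite -(cvg_lim _ (h z hz))//.
Qed.

Lemma psum_cvg a z : absconv a -> disk R z ->
  psum a n z @[n --> \oo] --> power_sum a z.
Proof. by move=> ha hz; have := power_sum_cvg ha hz; under eq_cvg do rewrite series_power_terms. Qed.

Lemma power_sum_tail a r z n : absconv a -> 0 <= r -> r < 1 -> modulus z <= r ->
  modulus (power_sum a z - psum a n z)
    <= limn (series (abs_terms a r)) - series (abs_terms a r) n.
Proof.
move=> ha r0 r1 zr; have hz : disk R z by exact: le_lt_trans zr r1.
have h1 : modulus (psum a m z - psum a n z) @[m --> \oo]
    --> modulus (power_sum a z - psum a n z).
  apply: cvg_modulus; apply: cvgB; [exact: psum_cvg|exact: cvg_cst].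
rewrite -(cvg_lim _ h1)//; apply: limr_le; first by apply: cvgP h1.
near=> m; rewrite (le_trans (psum_dist_le _ r0 zr _))//; first by near: m; exact: nbhs_infty_ge.
rewrite lerD2r; apply: nondecreasing_cvgn_le; last exact: ha.
by apply: nondecreasing_series => k _ _; exact: abs_terms_ge0.
Unshelve. all: by end_near. Qed.

Lemma power_sum_unif a r e : absconv a -> 0 <= r -> r < 1 -> 0 < e ->
  exists N, forall n, (N <= n)%N -> forall z, modulus z <= r ->
    modulus (power_sum a z - psum a n z) <= e.
Proof.
move=> ha r0 r1 e0; have /cvgrPdist_le /(_ _ e0) [N _ hN] := ha r r0 r1.
exists N => n Nn z zr; apply: le_trans (power_sum_tail _ ha r0 r1 zr) _.
exact: le_trans (ler_norm _) (hN n Nn).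
Qed.

Lemma power_sum_le a r z : absconv a -> 0 <= r -> r < 1 -> modulus z <= r ->
  modulus (power_sum a z) <= limn (series (abs_terms a r)).
Proof.
move=> ha r0 r1 zr; have := power_sum_tail 0 ha r0 r1 zr.
by rewrite /psum big_ord0 subr0 /series /= big_geq// subr0.
Qed.

Lemma power_expansion_power_sum a : absconv a -> power_expansion (power_sum a) a.
Proof. by move=> ha z hz; exact: power_sum_cvg. Qed.

Lemma power_expansion_cvg f a z : power_expansion f a -> disk R z ->
  psum a n z @[n --> \oo] --> f z.
Proof. by move=> h hz; under eq_cvg do rewrite -series_power_terms; exact: h. Qed.

Lemma power_expansion_unif f a r e : power_expansion f a -> 0 <= r -> r < 1 -> 0 < e ->
  exists N, forall n, (N <= n)%N -> forall z, modulus z <= r ->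
    modulus (f z - psum a n z) <= e.
Proof.
move=> hf r0 r1 e0; have ha := power_expansion_absconv hf.
have [N hN] := power_sum_unif ha r0 r1 e0.
exists N => n Nn z zr; rewrite (power_expansion_sum hf); first exact: hN.
exact: le_lt_trans zr r1.
Qed.

Lemma power_expansion_le f a r : power_expansion f a -> 0 <= r -> r < 1 ->
  exists M, forall z, modulus z <= r -> modulus (f z) <= M.
Proof.
move=> hf r0 r1; exists (limn (series (abs_terms a r))) => z zr.
rewrite (power_expansion_sum hf); last exact: le_lt_trans zr r1.
by apply: power_sum_le => //; exact: power_expansion_absconv hf.
Qed.

End power_series.

(** * Power sums are holomorphic *)

Section power_series_derivable.
Variable R : realType.
Implicit Types (z w h : Cplx R) (a : nat -> Cplx R) (r : R).

(* z^n + n h z^(n-1) is the first-order Taylor polynomial; the remainder is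
   bounded through z^(n+1)' = z^n' z + z^n. *)
Lemma expr_taylor1 r z h n : 0 < r -> modulus z <= r -> modulus (z + h) <= r ->
  modulus ((z + h) ^+ n - z ^+ n - h * (n%:R * z ^+ n.-1))
    <= modulus h ^+ 2 * (n%:R ^+ 2 * r ^+ n / r ^+ 2).
Proof.
move=> r0 zr zhr.
have h1 m : modulus ((z + h) ^+ m - z ^+ m) <= modulus h * (m%:R * r ^+ m / r).
  elim: m => [|m IH]; first by rewrite !expr0 subrr modulus0 mul0r mul0r mulr0.
  have -> : (z + h) ^+ m.+1 - z ^+ m.+1 = (z + h) * ((z + h) ^+ m - z ^+ m) + h * z ^+ m.
    by rewrite !exprS; ring.
  rewrite (le_trans (modulusD _ _))// !modulusM modulusX.
  have h2 : modulus (z + h) * modulus ((z + h) ^+ m - z ^+ m) <= r * (modulus h * (m%:R * r ^+ m / r)).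
    by apply: ler_pM => //; exact: modulus_ge0.
  have h3 : modulus h * modulus z ^+ m <= modulus h * r ^+ m.
    by rewrite ler_wpM2l ?modulus_ge0// lerXn2r ?nnegrE ?modulus_ge0// ltW.
  rewrite (le_trans (lerD h2 h3))// -natr1 exprS le_eqVlt; apply/orP; left; apply/eqP.
  by field; rewrite gt_eqF.
elim: n => [|n IH].
  by rewrite !expr0 subrr mul0r mulr0 subrr modulus0 expr0n /= mul0r mul0r mulr0.
have -> : (z + h) ^+ n.+1 - z ^+ n.+1 - h * (n.+1%:R * z ^+ n.+1.-1) =
    z * ((z + h) ^+ n - z ^+ n - h * (n%:R * z ^+ n.-1)) + h * ((z + h) ^+ n - z ^+ n).
  rewrite -natr1 /= !exprS; case: n {IH} => [|n] /=; first by rewrite !expr0; ring.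
  by rewrite !exprS; ring.
rewrite (le_trans (modulusD _ _))// !modulusM.
have h2 := ler_pM (modulus_ge0 _) (modulus_ge0 _) zr IH.
have h3 := ler_wpM2l (modulus_ge0 h) (h1 n).
apply: le_trans (lerD h2 h3) _.
have -> : r * (modulus h ^+ 2 * (n%:R ^+ 2 * r ^+ n / r ^+ 2)) + modulus h * (modulus h * (n%:R * r ^+ n / r))
   = modulus h ^+ 2 * ((n%:R ^+ 2 + n%:R) * r ^+ n.+1 / r ^+ 2).
  rewrite (exprS r n); move: (r ^+ n) (n%:R : R) (modulus h) => y c m.
  by field; rewrite gt_eqF.
rewrite ler_wpM2l ?sqr_ge0// ler_wpM2r ?invr_ge0 ?exprn_ge0 ?(ltW r0)//.
rewrite ler_wpM2r ?exprn_ge0 ?(ltW r0)// -natr1 sqrrD mulr1 expr1n.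
by have := ler0n R n; lra.
Qed.

(** The factor n^2 is absorbed by enlarging the radius from r to s: n^2 (r / s)^n is bounded. *)
Lemma absconv_sqr a r : absconv a -> 0 <= r -> r < 1 ->
  cvgn (series (fun n => modulus (a n) * (n%:R ^+ 2 * r ^+ n))).
Proof.
move=> ha r0 r1.
have [s [s0 s1 rs]] := lt1_between r0 r1.
pose q := r / s.
have q0 : 0 <= q by rewrite divr_ge0// ltW.
have q1 : q < 1 by rewrite ltr_pdivrMr// mul1r.
have [M hM] : exists M, forall n : nat, n%:R ^+ 2 * q ^+ n <= M.
  (* Since n x <= (1 + x)^n, the product n^2 x^2 q^n is at most (q (1 + x)^2)^n <= 1; this asks for
     x small compared with 1 - q. *)
  have [x x0 hx] : exists2 x, 0 < x & q * (1 + x) ^+ 2 <= 1.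
    exists ((1 - q) / 3); first by rewrite divr_gt0// subr_gt0.
    by have : 0 < 1 - q; [rewrite subr_gt0|nra].
  exists ((x ^+ 2)^-1) => n.
  have b : (n%:R * x) <= (1 + x) ^+ n.
    elim: n => [|n IH]; first by rewrite mul0r expr0.
    have h1 : 1 <= (1 + x) ^+ n by rewrite exprn_ege1// lerDl ltW.
    by rewrite exprS -natr1; nra.
  have b2 : n%:R ^+ 2 * x ^+ 2 <= ((1 + x) ^+ 2) ^+ n.
    rewrite -exprMn exprAC lerXn2r// ?nnegrE.
      by rewrite mulr_ge0// ltW.
    by rewrite exprn_ge0// addr_ge0// ltW.
  rewrite -div1r ler_pdivlMr ?exprn_gt0// mulrAC.
  apply: le_trans (ler_wpM2r (exprn_ge0 n q0) b2) _.
  by rewrite -exprMn mulrC exprn_ile1// mulr_ge0// sqr_ge0.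
have M0 : 0 <= M by apply: le_trans (hM 0%N); rewrite expr0n /= mul0r.
have h1 : cvgn (series (fun k => M * abs_terms a s k)).
  by apply: is_cvg_seriesZ; exact: ha (ltW s0) s1.
apply: series_le_cvg h1 => k.
- by rewrite mulr_ge0 ?modulus_ge0// mulr_ge0// ?sqr_ge0 ?exprn_ge0.
- by rewrite mulr_ge0// abs_terms_ge0// ltW.
- have -> : r = q * s by rewrite /q divfK// gt_eqF.
  rewrite /abs_terms exprMn [leRHS]mulrCA ler_wpM2l ?modulus_ge0// mulrA.
  by rewrite ler_wpM2r// exprn_ge0// ltW.
Qed.

(** The second-order remainders of the monomials, summed with weights |a_k|, bound the total
    remainder by K |h|^2, so the difference quotient is within K |h| of the termwise derivative. *)
Lemma power_sum_derivable a : absconv a -> holomorphic_disk (power_sum a).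
Proof.
move=> ha z hz.
have [r [r0 r1 zr]] := lt1_between (modulus_ge0 z) hz.
pose b n := modulus (a n) * (n%:R ^+ 2 * r ^+ n).
have hb : cvgn (series b) := absconv_sqr ha (ltW r0) r1.
pose K := limn (series b) / r ^+ 2.
pose a' n := n.+1%:R * a n.+1.
have ha' : absconv a'.
  apply: absconv_of_bounded => s s0 s1.
  have [t [t0 t1 st]] := lt1_between s0 s1.
  have [M [_ hM]] := cvg_seq_bounded (cvgP _ (cvg_series_cvg_0 (absconv_sqr ha (ltW t0) t1))).
  exists ((M + 1) / t) => k.
  have {hM} : `|modulus (a k.+1) * (k.+1%:R ^+ 2 * t ^+ k.+1)| <= M + 1.
    by apply: hM => //; rewrite ltrDl.
  move=> /(le_trans (ler_norm _)) hM.
  rewrite ler_pdivlMr// (le_trans _ hM)// /abs_terms /a' modulusM (exprS t).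
  have -> : modulus (k.+1%:R : Cplx R) = k.+1%:R.
    by rewrite (_ : k.+1%:R = (k.+1%:R)%:C%C) ?modulus_real ?ger0_norm// rmorph_nat.
  have st' : s ^+ k <= t ^+ k by rewrite lerXn2r// ?nnegrE// ltW.
  have -> : k.+1%:R * modulus (a k.+1) * s ^+ k * t =
    modulus (a k.+1) * (k.+1%:R * (t * s ^+ k)) by ring.
  rewrite ler_wpM2l ?modulus_ge0// ler_pM ?mulr_ge0 ?exprn_ge0 ?(ltW t0)//.
    by rewrite ler_eXnr// ler1n.
  by rewrite ler_pM2l.
pose D := power_sum a' z.
have key h : modulus (z + h) <= r ->
    modulus (power_sum a (z + h) - power_sum a z - h * D) <= modulus h ^+ 2 * K.
  move=> zhr.
  have c : psum a n.+1 (z + h) - psum a n.+1 z - h * psum a' n z @[n --> \oo]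
     --> power_sum a (z + h) - power_sum a z - h * D.
    apply: cvgB; first apply: cvgB.
    - by rewrite (cvg_shiftS (psum a ^~ (z + h))); apply: psum_cvg => //; exact: le_lt_trans zhr r1.
    - by rewrite (cvg_shiftS (psum a ^~ z)); apply: psum_cvg.
    - by apply: cvgMr; apply: psum_cvg.
  rewrite -(cvg_lim _ (cvg_modulus c))//; apply: limr_le.
    exact: cvgP (cvg_modulus c).
  apply: nearW => n.
  have -> : psum a n.+1 (z + h) - psum a n.+1 z - h * psum a' n z =
      \sum_(k < n.+1) a k * ((z + h) ^+ k - z ^+ k - h * (k%:R * z ^+ k.-1)).
    rewrite /psum -[in LHS]sumrB.
    have -> : h * (\sum_(k < n) a' k * z ^+ k) = \sum_(k < n.+1) a k * (h * (k%:R * z ^+ k.-1)).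
      rewrite big_ord_recl /= mul0r !mulr0 add0r mulr_sumr; apply: eq_bigr => i _.
      by rewrite /a' /bump /= add1n; ring.
    by rewrite -sumrB; apply: eq_bigr => i _; ring.
  rewrite (le_trans (modulus_sum _ _ _))// /K.
  apply: (@le_trans _ _ (\sum_(k < n.+1) modulus h ^+ 2 * (b k / r ^+ 2))).
    apply: ler_sum => k _; rewrite modulusM /b -[_ / r ^+ 2]mulrA [leRHS]mulrCA ler_wpM2l ?modulus_ge0//.
    by rewrite expr_taylor1// ltW.
  rewrite -mulr_sumr ler_wpM2l ?sqr_ge0// -mulr_suml ler_wpM2r ?invr_ge0 ?exprn_ge0 ?(ltW r0)//.
  have := @nondecreasing_cvgn_le _ (series b) _ hb n.+1; rewrite /series /= big_mkord; apply.
  apply: nondecreasing_series => i _ _; rewrite /b mulr_ge0 ?modulus_ge0//.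
  by rewrite mulr_ge0 ?sqr_ge0// exprn_ge0// ltW.
have K0 : 0 <= K.
  rewrite divr_ge0 ?exprn_ge0 ?(ltW r0)//; apply: limr_ge => //.
  apply: nearW => n; rewrite /series /=; apply: sumr_ge0 => i _; rewrite /b mulr_ge0 ?modulus_ge0//.
  by rewrite mulr_ge0 ?sqr_ge0// exprn_ge0// ltW.
apply/cvg_ex; exists D; apply/cvgrPdist_le => -[e e']; rewrite ltcE /= => /andP[/eqP -> e0].
(* The first bound keeps z + h in the disc of radius r, the second makes |h| (K + 1) at most e. *)
pose d := Num.min (r - modulus z) (e / (K + 1)).
have d0 : 0 < d by rewrite lt_min subr_gt0 zr divr_gt0// ltr_wpDl.
near=> h.
have hd : modulus h < d.
  suff : `|h : Cplx R| < (d%:C)%C by rewrite normC_modulus ltcR.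
  by near: h; apply: (@dnbhs0_lt _ (Cplx R)); rewrite ltcR.
have h0 : h != 0 by near: h; apply: (@nbhs_dnbhs_neq (Cplx R) 0).
rewrite normC_modulus lecR modulus_distC /=.
rewrite /= [h *: 1]mulr1 -[h^-1 *: _]/(h^-1 * _) [h + z]addrC.
have hr : modulus (z + h) <= r.
  have : d <= r - modulus z by rewrite /d ge_min lexx.
  by have := modulusD z h; lra.
have -> : h^-1 * (power_sum a (z + h) - power_sum a z) - D =
    h^-1 * (power_sum a (z + h) - power_sum a z - h * D).
  by rewrite [RHS]mulrBr mulKf.
rewrite modulusM modulusV ler_pdivrMl ?modulus_gt0//.
apply: le_trans (key h hr) _; rewrite expr2 -mulrA ler_wpM2l ?modulus_ge0//.
have h1 : modulus h * (K + 1) <= e.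
  by rewrite -ler_pdivlMr ?ltr_wpDl// (le_trans (ltW hd))// /d ge_min lexx orbT.
by rewrite (le_trans _ h1)// ler_wpM2l ?modulus_ge0// lerDl.
Unshelve. all: by end_near. Qed.

End power_series_derivable.

(** * Parseval and local estimates *)

Section parseval.
Variable R : realType.
Implicit Types (z w c : Cplx R) (b : nat -> Cplx R) (r t : R).
Local Notation mu := (@lebesgue_measure R).

Lemma Re_mul_circle_pt c t :
  complex.Re (c * circle_pt t) = complex.Re c * cos t - complex.Im c * sin t.
Proof. by case: c. Qed.

Lemma continuous_comp_mulr (f : R -> R) (k : R) : continuous f ->
  continuous (fun t => f (k * t)).
Proof.
move=> cf t; apply: (@continuous_comp _ _ _ (fun s => k * s) f); last exact: cf.
exact: mulrl_continuous.
Qed.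

Lemma continuous_Re_mul_circle c (k : R) :
  continuous (fun t => complex.Re (c * circle_pt (k * t))).
Proof.
under eq_fun do rewrite Re_mul_circle_pt; move=> t.
apply: cvgB; apply: cvgM; try exact: cvg_cst.
- exact: continuous_comp_mulr (@continuous_cos R) t.
- exact: continuous_comp_mulr (@continuous_sin R) t.
Qed.

Lemma integrable_period (f : R -> R) : continuous f ->
  mu.-integrable `[0%R, (2 * pi)%R] (EFin \o f).
Proof.
move=> cf; apply: continuous_compact_integrable; first exact: segment_compact.
exact: continuous_subspaceT.
Qed.

Lemma sin_period n : sin (n%:R * (2 * pi)) = 0 :> R.
Proof.
elim: n => [|n IH]; first by rewrite mul0r sin0.
by rewrite -natr1 mulrDl mul1r [2 * pi]mulr_natl sinD2pi -[pi *+ 2]mulr_natl.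
Qed.

Lemma cos_period n : cos (n%:R * (2 * pi)) = 1 :> R.
Proof.
elim: n => [|n IH]; first by rewrite mul0r cos0.
by rewrite -natr1 mulrDl mul1r [2 * pi]mulr_natl cosD2pi -[pi *+ 2]mulr_natl.
Qed.

(** The antiderivative of a nonconstant harmonic is again a trigonometric function of n t, so it
    takes equal values at 0 and 2 pi. *)
Lemma integral_circle_harmonic c n : (0 < n)%N ->
  (\int[mu]_(t in `[0%R, (2 * pi)%R]) (complex.Re (c * circle_pt (n%:R * t)))%:E = 0)%E.
Proof.
move=> n0; have n0R : (n%:R : R) != 0 by rewrite pnatr_eq0 -lt0n.
pose F t := complex.Re c * (n%:R^-1 * sin (n%:R * t)) + complex.Im c * (n%:R^-1 * cos (n%:R * t)).
have dF t : is_derive t 1 F (complex.Re (c * circle_pt (n%:R * t))).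
  have d1 : is_derive t 1 (fun s => n%:R * s : R) n%:R.
    by apply: is_derive_eq; rewrite -[_ *: _]/(_ * _) ?scaler0 ?mulr1 ?addr0 ?add0r ?mulr0 ?addr0.
  have d2 : is_derive t 1 (sin \o (fun s => n%:R * s)) (cos (n%:R * t) * n%:R).
    exact: is_derive1_comp.
  have d3 : is_derive t 1 (cos \o (fun s => n%:R * s)) (- sin (n%:R * t) * n%:R).
    exact: is_derive1_comp.
  have d4 : is_derive t 1 (complex.Re c \*o (n%:R^-1 \*o (sin \o (fun s => n%:R * s))) +
     complex.Im c \*o (n%:R^-1 \*o (cos \o (fun s => n%:R * s))) : R -> R)
     (complex.Re c * (n%:R^-1 * (cos (n%:R * t) * n%:R)) + complex.Im c * (n%:R^-1 * (- sin (n%:R * t) * n%:R))).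
    by apply: is_deriveD.
  rewrite Re_mul_circle_pt; apply: is_derive_eq d4 _.
  by field.
have cF : continuous F.
  by move=> t; apply: differentiable_continuous; apply/derivable1_diffP; exact: ex_derive.
have pi2 : 0 < 2 * pi :> R by rewrite mulr_gt0// pi_gt0.
rewrite (@continuous_FTC2 _ _ F 0 (2 * pi))//.
- suff -> : F (2 * pi) = F 0 by rewrite -EFinB subrr.
  by rewrite /F sin_period cos_period [n%:R * 0]mulr0 sin0 cos0.
- by apply: continuous_subspaceT; exact: continuous_Re_mul_circle.
- split => [t _||]; first exact: ex_derive.
  + by apply: cvg_at_right_filter; exact: cF.
  + by apply: cvg_at_left_filter; exact: cF.
- by move=> t _; rewrite derive1E; apply: derive_val.
Qed.

(** Continuity is carried along the induction because it supplies the integrability that splitting a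
    signed integral requires. *)
Lemma integral_circle_sum (c : nat -> Cplx R) N :
  continuous (fun t => \sum_(k < N) complex.Re (c k * circle_pt (k.+1%:R * t))) /\
  (\int[mu]_(t in `[0%R, (2 * pi)%R])
    (\sum_(k < N) complex.Re (c k * circle_pt (k.+1%:R * t)))%:E = 0)%E.
Proof.
elim: N => [|N [IH1 IH2]].
  under eq_fun do rewrite big_ord0; split; first exact: cst_continuous.
  by under eq_integral do rewrite big_ord0; rewrite integral0.
split.
  under eq_fun do rewrite big_ord_recr /=; move=> t.
  by apply: cvgD; [exact: IH1|exact: continuous_Re_mul_circle].
under eq_integral do rewrite big_ord_recr /= EFinD.
rewrite integralD_EFin//=; [|exact: integrable_period|].
  by rewrite IH2 add0e integral_circle_harmonic.
by apply: integrable_period; exact: continuous_Re_mul_circle.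
Qed.

Lemma psum_recl b n z : psum b n.+1 z = b 0%N + z * psum (b \o S) n z.
Proof.
rewrite /psum big_ord_recl expr0 mulr1 mulr_sumr; congr (_ + _).
by apply: eq_bigr => i _; rewrite /= exprS mulrCA.
Qed.

Lemma modulus_sqrD z w :
  modulus (z + w) ^+ 2 = modulus z ^+ 2 + modulus w ^+ 2 + 2 * complex.Re (conjc z * w).
Proof. by rewrite !modulus_sqr; case: z => a b; case: w => c d /=; ring. Qed.

(** Induction peels off the constant term: the rest is z times a shorter sum, and in the squared
    modulus the cross term has only positive frequencies, so its integral vanishes. *)
Lemma parseval_poly b N r :
  continuous (fun t => modulus (psum b N (r%:C%C * circle_pt t)) ^+ 2) /\
  (\int[mu]_(t in `[0%R, (2 * pi)%R]) (modulus (psum b N (r%:C%C * circle_pt t)) ^+ 2)%:E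
   = (2 * pi * \sum_(k < N) modulus (b k) ^+ 2 * r ^+ (2 * k))%:E)%E.
Proof.
elim: N b => [|N IH] b.
  under eq_fun do rewrite /psum big_ord0 modulus0 expr0n.
  split; first exact: cst_continuous.
  under eq_integral do rewrite /psum big_ord0 modulus0 expr0n /=.
  by rewrite integral0 big_ord0 mulr0.
have [c1 e1] := IH (b \o S).
pose c k := conjc (b 0%N) * (b k.+1 * r%:C%C ^+ k.+1).
have [c2 e2] := integral_circle_sum c N.
have E t : modulus (psum b N.+1 (r%:C%C * circle_pt t)) ^+ 2 =
    modulus (b 0%N) ^+ 2 + r ^+ 2 * modulus (psum (b \o S) N (r%:C%C * circle_pt t)) ^+ 2
     + 2 * \sum_(k < N) complex.Re (c k * circle_pt (k.+1%:R * t)).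
  rewrite psum_recl modulus_sqrD; congr (_ + _ + 2 * _).
    by rewrite !modulusM modulus_circle_pt mulr1 modulus_real exprMn real_normK ?num_real.
  rewrite -Re_sum; congr (complex.Re _).
  rewrite /psum !mulr_sumr; apply: eq_bigr => k _.
  by rewrite /c -circle_ptX exprMn !exprS /=; ring.
have c3 : continuous (fun t : R => modulus (b 0%N) ^+ 2 : R) by exact: cst_continuous.
have c4 : continuous (fun t => r ^+ 2 * modulus (psum (b \o S) N (r%:C%C * circle_pt t)) ^+ 2).
  by move=> t; apply: cvgM; [exact: cvg_cst|exact: c1].
have c5 : continuous (fun t => 2 * \sum_(k < N) complex.Re (c k * circle_pt (k.+1%:R * t))).
  by move=> t; apply: cvgM; [exact: cvg_cst|exact: c2].
split.
  under eq_fun do rewrite E; move=> t.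
  apply: cvgD; last exact: c5.
  by apply: cvgD; [exact: c3|exact: c4].
under eq_integral do rewrite E.
transitivity (\int[mu]_(t in `[0%R, (2 * pi)%R]) ((modulus (b 0%N) ^+ 2)%:E +
  ((r ^+ 2 * modulus (psum (b \o S) N (r%:C%C * circle_pt t)) ^+ 2)%:E +
   (2 * \sum_(k < N) complex.Re (c k * circle_pt (k.+1%:R * t)))%:E)))%E.
  by apply: eq_integral => t _; rewrite -!EFinD addrA.
rewrite (@integralD _ _ _ mu _ _ (fun t : R => (modulus (b 0%N) ^+ 2)%:E))//=; last 2 first.
- exact: integrable_period.
- apply: integrableD => //; exact: integrable_period.
rewrite (@integralD _ _ _ mu _ _ (fun t : R => (r ^+ 2 * modulus (psum (b \o S) N (r%:C%C * circle_pt t)) ^+ 2)%:E))//=; last 2 first.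
- exact: integrable_period.
- exact: integrable_period.
have -> : (\int[mu]_(t in `[0%R, (2 * pi)%R]) (modulus (b 0%N) ^+ 2)%:E = (2 * pi * modulus (b 0%N) ^+ 2)%:E)%E.
  by rewrite integral_cst//= lebesgue_measure_itv/= lte_fin mulr_gt0 ?pi_gt0// -EFinB subr0 -EFinM mulrC.
have -> : (\int[mu]_(t in `[0%R, (2 * pi)%R]) (r ^+ 2 * modulus (psum (b \o S) N (r%:C%C * circle_pt t)) ^+ 2)%:E
    = (r ^+ 2 * (2 * pi * \sum_(k < N) modulus ((b \o S) k) ^+ 2 * r ^+ (2 * k)))%:E)%E.
  under eq_integral do rewrite EFinM.
  rewrite integralZl//; last exact: integrable_period.
  by rewrite [RHS]EFinM; congr (_ * _)%E; exact: e1.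
have -> : (\int[mu]_(t in `[0%R, (2 * pi)%R]) (2 * \sum_(k < N) complex.Re (c k * circle_pt (k.+1%:R * t)))%:E = 0)%E.
  under eq_integral do rewrite EFinM.
  rewrite integralZl//; last exact: integrable_period.
  by rewrite -[RHS](mule0 2%:E); congr (_ * _)%E; exact: e2.
rewrite adde0 -EFinD big_ord_recl /= muln0 expr0 mulr1; congr (_%:E).
rewrite [RHS]mulrDr; congr (_ + _); rewrite mulrCA; congr (_ * _).
rewrite mulr_sumr; apply: eq_bigr => i _; rewrite /bump /= add1n mulnS exprD.
by rewrite mulrCA.
Qed.

End parseval.

Section local_estimates.
Variable R : realType.
Implicit Types (z w h : Cplx R) (a b : nat -> Cplx R) (r t : R) (f : Cplx R -> Cplx R).
Local Notation mu := (@lebesgue_measure R).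

(** Cauchy estimates without contour integrals: one term of the Parseval sum is at most the mean of
    the squared modulus. *)
Lemma poly_coef_bound b N (r M : R) : 0 <= r -> 0 <= M ->
  (forall t, modulus (psum b N (r%:C%C * circle_pt t)) <= M) ->
  forall k, (k < N)%N -> modulus (b k) * r ^+ k <= M.
Proof.
move=> r0 M0 hM k kN.
have pi2 : 0 < 2 * pi :> R by rewrite mulr_gt0// pi_gt0.
have [c e] := parseval_poly b N r.
have le1 : (\int[mu]_(t in `[0%R, (2 * pi)%R]) (modulus (psum b N (r%:C%C * circle_pt t)) ^+ 2)%:E
    <= \int[mu]_(t in `[0%R, (2 * pi)%R]) (M ^+ 2)%:E)%E.
  apply: ge0_le_integral => //.
  - by move=> t _; rewrite lee_fin sqr_ge0.
  - by apply/measurable_EFinP; apply: measurable_funTS; exact: continuous_measurable_fun.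
  - by move=> t _; rewrite lee_fin lerXn2r ?nnegrE ?modulus_ge0.
move: le1; rewrite e integral_cst//= lebesgue_measure_itv/= lte_fin pi2 -EFinB subr0 -EFinM lee_fin.
rewrite mulrC ler_pM2r// => le2.
rewrite -(@ler_pXn2r _ 2)// ?nnegrE ?mulr_ge0 ?modulus_ge0 ?exprn_ge0//.
apply: le_trans le2; rewrite exprMn -exprM mulnC (bigD1 (Ordinal kN))//= lerDl.
by apply: sumr_ge0 => i _; rewrite mulr_ge0 ?sqr_ge0 ?exprn_ge0.
Qed.

(* Taylor re-expansion of a partial sum at [w]. *)
Lemma psum_shift a n w : exists b, forall h, psum a n (w + h) = psum b n h.
Proof.
pose p : {poly R[i]} := \poly_(k < n) a k.
pose q := p \Po ('X + w%:P).
exists (fun k => q`_k) => h.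
have -> : psum a n (w + h) = p.[w + h] by rewrite horner_poly.
have -> : p.[w + h] = q.[h] by rewrite horner_comp !hornerE addrC.
apply: horner_coef_wide; rewrite size_comp_poly2 ?size_XaddC//.
exact: size_poly.
Qed.

(** After re-expansion at w, the Cauchy estimates majorize the increment by a geometric series in
    |h| / rho; the restriction to half the radius bounds that series by 2. *)
Lemma poly_lipschitz a n w h (rho M : R) : 0 < rho -> 0 <= M ->
  (forall t, modulus (psum a n (w + rho%:C%C * circle_pt t)) <= M) ->
  modulus h <= rho / 2 ->
  modulus (psum a n (w + h) - psum a n w) <= 2 * M * (modulus h / rho).
Proof.
move=> rho0 M0 hM hh.
have [b hb] := psum_shift a n w.
have cb k : (k < n)%N -> modulus (b k) <= M / rho ^+ k.
  move=> kn; rewrite ler_pdivlMr ?exprn_gt0//.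
  apply: (poly_coef_bound (ltW rho0) M0 _ kn) => t; rewrite -hb; exact: hM.
have := hb 0; rewrite addr0 => ->; rewrite hb.
case: n cb {hb hM} => [|n] cb; first by rewrite /psum !big_ord0 subrr modulus0 !mulr_ge0 ?modulus_ge0 ?invr_ge0 ?(ltW rho0).
rewrite !psum_recl mul0r addr0 addrAC subrr add0r modulusM.
set x := modulus h / rho.
have x0 : 0 <= x by rewrite divr_ge0 ?modulus_ge0 ?(ltW rho0).
have x1 : x <= 2^-1 by rewrite ler_pdivrMr// mulrC.
have e : modulus h = x * rho by rewrite /x divfK// gt_eqF.
apply: (@le_trans _ _ (x * rho * \sum_(k < n) M / rho * 2^-1 ^+ k)).
  rewrite -e ler_wpM2l ?modulus_ge0//.
  rewrite (le_trans (modulus_sum _ _ _))//; apply: ler_sum => k _.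
  rewrite modulusM modulusX e /=.
  apply: (@le_trans _ _ (M / rho ^+ k.+1 * (x * rho) ^+ k)).
    apply: ler_wpM2r; last exact: (cb k.+1 (ltn_ord k)).
    by rewrite exprn_ge0// mulr_ge0// ltW.
  have -> : M / rho ^+ k.+1 * (x * rho) ^+ k = M / rho * x ^+ k.
    rewrite exprMn exprS; have : rho ^+ k != 0 by rewrite expf_neq0// gt_eqF.
    have : rho != 0 by rewrite gt_eqF.
    by move: (rho ^+ k) (x ^+ k) => u v ? ?; field; apply/andP.
  rewrite ler_wpM2l ?divr_ge0 ?(ltW rho0)//.
  by rewrite lerXn2r ?nnegrE.
rewrite -mulr_sumr.
have g : \sum_(k < n) (2^-1 : R) ^+ k <= 2.
  have := subrXX (1 : R) (2^-1 : R) n; rewrite expr1n.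
  under eq_bigr do rewrite expr1n mul1r.
  have : 0 <= (2^-1 : R) ^+ n by rewrite exprn_ge0.
  by move: (\sum_(i < n) _) (_ ^+ n) => s t; lra.
have -> : x * rho * (M / rho * \sum_(k < n) (2^-1 : R) ^+ k) = M * x * \sum_(k < n) (2^-1 : R) ^+ k.
  by field; rewrite gt_eqF.
by rewrite -[2 * M * x]mulrA mulrC ler_wpM2r// mulr_ge0.
Qed.

(** Partial sums approximate f up to e / 3 on the closed disc, so the polynomial estimate applies
    with M + e / 3; since |h| / rho <= 1/2, the total error is at most e. *)
Lemma power_expansion_lipschitz f a w h (rho M : R) : power_expansion f a -> 0 < rho -> 0 <= M ->
  modulus w + rho < 1 ->
  (forall z, modulus (z - w) <= rho -> modulus (f z) <= M) ->
  modulus h <= rho / 2 ->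
  modulus (f (w + h) - f w) <= 2 * M * (modulus h / rho).
Proof.
move=> ha rho0 M0 wr hM hh.
have hdisk z : modulus (z - w) <= rho -> modulus z <= modulus w + rho.
  by move=> zr; have := modulusD (z - w) w; rewrite subrK; lra.
have wr0 : 0 <= modulus w + rho by rewrite addr_ge0 ?modulus_ge0 ?(ltW rho0).
apply/ler_addgt0Pr => e e0.
have [N hN] := power_expansion_unif ha wr0 wr (divr_gt0 e0 (ltr0n _ 3)).
have h0 := modulus_ge0 h.
have hh' : modulus ((w + h) - w) <= rho by rewrite addrAC subrr add0r; lra.
have ww : modulus (w - w) <= rho by rewrite subrr modulus0 ltW.
have n1 := hN N (leqnn _) _ (hdisk _ hh').
have n2 := hN N (leqnn _) _ (hdisk _ ww).
have n3 : modulus (psum a N (w + h) - psum a N w) <= 2 * (M + e / 3) * (modulus h / rho).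
  apply: poly_lipschitz => //; first by rewrite addr_ge0// ltW// divr_gt0.
  move=> t; set z := w + _.
  have zw : modulus (z - w) <= rho.
    by rewrite /z addrAC subrr add0r modulusM modulus_circle_pt mulr1 modulus_real gtr0_norm.
  have := hN N (leqnn _) _ (hdisk _ zw); rewrite modulus_distC => n4.
  have n6 := modulusD (psum a N z - f z) (f z); rewrite subrK in n6.
  by apply: le_trans n6 _; rewrite addrC; apply: lerD => //; exact: hM.
have n5 : modulus (f (w + h) - f w) <= e / 3 + e / 3 +
    modulus (psum a N (w + h) - psum a N w).
  have -> : f (w + h) - f w = (f (w + h) - psum a N (w + h))
    + (psum a N w - f w) + (psum a N (w + h) - psum a N w).
    by rewrite [RHS]addrAC !subrKA.
  apply: le_trans (modulusD _ _) _; rewrite lerD2r.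
  by apply: le_trans (modulusD _ _) _; apply: lerD; [exact: n1|rewrite modulus_distC; exact: n2].
have : modulus h / rho <= 2^-1 by rewrite ler_pdivrMr// mulrC.
have : 0 <= modulus h / rho by rewrite divr_ge0// ltW.
move: n5 n3; move: (modulus (_ - _)) (modulus (_ - _)) (modulus h / rho) => A B y h1 h2 y0 y1.
by move: (ler_wpM2l (ltW e0) y1) h1 h2; clear; lra.
Qed.

End local_estimates.

(** * A submean inequality from near-maximisers *)

Section submean.
Variable R : realType.
Implicit Types (z w h : Cplx R) (a b : nat -> Cplx R) (r t : R) (f : Cplx R -> Cplx R).

(* Near-maximiser of [|f(w)| (rho - |w - z|)^s]: [|f|] stays comparable to
   [|f(w)|] on a disc about [w], which replaces subharmonicity of [|f|^q]. *)
Lemma near_maximiser f a z (rho s : R) : power_expansion f a -> 0 < rho -> 0 < s ->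
  modulus z + rho < 1 ->
  exists w, exists delta : R, [/\ 0 < delta, modulus (w - z) + 2 * delta <= rho,
    modulus (f z) * rho `^ s <= 2 * (modulus (f w) * (2 * delta) `^ s) &
    forall w', modulus (w' - w) <= delta ->
      modulus (f w') <= 2 * 2 `^ s * modulus (f w)].
Proof.
move=> ha rho0 s0 zr.
have zr0 : 0 <= modulus z + rho by rewrite addr_ge0 ?modulus_ge0 ?(ltW rho0).
pose Phi w := modulus (f w) * (rho - modulus (w - z)) `^ s.
pose E := [set Phi w | w in [set w | modulus (w - z) < rho]].
have hz : modulus (z - z) < rho by rewrite subrr modulus0.
have hE : has_sup E.
  split; first by exists (Phi z); exists z.
  have [M hM] := power_expansion_le ha zr0 zr.
  exists (M * rho `^ s) => _ [w hw <-].
  apply: ler_pM; rewrite ?modulus_ge0 ?powR_ge0//.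
    apply: hM.
    by have := modulusD (w - z) z; rewrite subrK; move: hw; rewrite /mkset; lra.
  have := modulus_ge0 (w - z).
  by move=> m0; apply: ge0_ler_powR; rewrite ?nnegrE ?subr_ge0 ?(ltW hw) ?(ltW s0) ?(ltW rho0)// lerBlDr lerDl.
have Phi0 w : 0 <= Phi w by rewrite mulr_ge0 ?modulus_ge0 ?powR_ge0.
have ub w : modulus (w - z) < rho -> Phi w <= sup E.
  by move=> hw; apply: ub_le_sup; [case: hE|exists w].
have [w [hw wmax]] : exists w, modulus (w - z) < rho /\ forall w', modulus (w' - z) < rho -> Phi w' <= 2 * Phi w.
  (* If the supremum is zero then [Phi] vanishes and z itself serves; otherwise some point exceeds
     half the supremum. *)
  have [S0|S0] := leP (sup E) 0.
    exists z; split => // w' hw'; rewrite (le_trans (ub _ hw'))// (le_trans S0)// mulr_ge0//.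
  have [_ [w hw <-] h2] := sup_adherent (divr_gt0 S0 (ltr0n _ 2)) hE.
  by exists w; split => // w' hw'; have := ub _ hw'; lra.
(* Half the distance from w to the edge: on the disc of radius [delta] the weight drops by at most
   the factor 2^s. *)
pose delta := (rho - modulus (w - z)) / 2.
have d0 : 0 < delta by rewrite divr_gt0// subr_gt0.
have d2 : 2 * delta = rho - modulus (w - z) by rewrite /delta; lra.
exists w, delta; split => //.
- by rewrite d2; lra.
- by have := wmax z hz; rewrite /Phi subrr modulus0 subr0 -d2.
- move=> w' hw'.
  have w'z : modulus (w' - z) <= modulus (w - z) + delta.
    have -> : w' - z = (w' - w) + (w - z) by rewrite addrA subrK.
    by have := modulusD (w' - w) (w - z); lra.
  have hw'z : modulus (w' - z) < rho by lra.
  have h1 := wmax w' hw'z.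
  have h2 : delta `^ s <= (rho - modulus (w' - z)) `^ s.
    by apply: ge0_ler_powR; rewrite ?nnegrE ?(ltW s0) ?(ltW d0) ?subr_ge0 ?(ltW hw'z)//; lra.
  have h3 : modulus (f w') * delta `^ s <= 2 * 2 `^ s * modulus (f w) * delta `^ s.
    apply: (@le_trans _ _ (Phi w')); first by rewrite ler_wpM2l ?modulus_ge0.
    apply: le_trans h1 _; rewrite /Phi -d2 powRM ?(ltW d0)//.
    by apply: eq_ler; ring.
  by move: h3; rewrite ler_pM2r// powR_gt0.
Qed.

(** With s = 2 / q, the q-th power of the near-maximality inequality turns weights into areas:
    |f(z)|^q rho^2 is controlled by |f(w)|^q delta^2. The Lipschitz bound then keeps |f| above half
    of |f(w)| near w. *)
Lemma local_lower_bound (q : R) : 0 < q ->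
  exists c, exists kappa : R, [/\ 0 < c, 0 < kappa, kappa <= 2^-1 & forall f a z (rho : R), power_expansion f a -> 0 < rho ->
    modulus z + rho < 1 ->
    exists w delta, [/\ 0 < delta, modulus (w - z) + delta <= rho,
      c * modulus (f z) `^ q * rho ^+ 2 <=
        modulus (f w) `^ q * delta ^+ 2 &
      forall w', modulus (w' - w) <= kappa * delta ->
         2^-1 * modulus (f w) <= modulus (f w')]].
Proof.
move=> q0; pose s := 2 / q.
have s0 : 0 < s by rewrite divr_gt0.
pose K := 2 * 2 `^ s : R.
have K2 : 2 <= K.
  have : (2 : R) `^ 0 <= 2 `^ s by apply: ler_powR; rewrite ?ler1n// ltW.
  by rewrite powRr0 /K; lra.
have K0 : 0 < K by lra.
pose c := (2 `^ q * 4)^-1 : R.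
have c0 : 0 < c by rewrite invr_gt0 mulr_gt0// powR_gt0.
(* On the disc of radius delta one has |f| <= K |f(w)|, so a displacement of delta / (4 K) changes f
   by at most 2 K |f(w)| / (4 K), half of |f(w)|. *)
exists c, ((4 * K)^-1); split => //; first by rewrite invr_gt0 mulr_gt0.
  by rewrite lef_pV2 ?posrE ?mulr_gt0//; lra.
move=> f a z rho ha rho0 zr.
have [w [d [d0 wd hw hK]]] := near_maximiser ha rho0 s0 zr.
have A0 := modulus_ge0 (f w).
exists w, d; split; [exact: d0|by move: wd d0; clear; lra| |].
- have : (modulus (f z) * rho `^ s) `^ q <= (2 * (modulus (f w) * (2 * d) `^ s)) `^ q.
    apply: ge0_ler_powR => //; rewrite ?nnegrE ?mulr_ge0 ?modulus_ge0 ?powR_ge0//.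
    exact: ltW.
  have sq x : 0 <= x -> (x `^ s) `^ q = x ^+ 2.
    by move=> x0; rewrite -powRrM /s divfK ?gt_eqF// powR_mulrn.
  rewrite !powRM ?powR_ge0 ?mulr_ge0 ?modulus_ge0 ?powR_ge0 ?(ltW d0)//.
  rewrite !sq ?(ltW rho0) ?(ltW d0)// => h.
  rewrite /c -mulrA mulrC ler_pdivrMr ?mulr_gt0 ?powR_gt0//.
  by apply: le_trans h _; apply: eq_ler; ring.
- move=> w' hw'.
  have wz := modulusD (w - z) z; rewrite subrK in wz.
  have wd1 : modulus w + d < 1 by move: zr wz wd d0; clear; lra.
  have kd : (4 * K)^-1 * d <= d / 2.
    rewrite mulrC ler_wpM2l ?(ltW d0)// lef_pV2 ?posrE ?mulr_gt0//.
    by move: K2; clear; lra.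
  have := power_expansion_lipschitz ha d0 _ wd1 hK (le_trans hw' kd).
  rewrite [w + _]addrC subrK => /(_ (mulr_ge0 (ltW K0) A0)) h.
  have h2 : modulus (w' - w) / d <= (4 * K)^-1 by rewrite ler_pdivrMr.
  have h3 : 2 * (K * modulus (f w)) * (modulus (w' - w) / d) <= 2^-1 * modulus (f w).
    apply: (@le_trans _ _ (2 * (K * modulus (f w)) * (4 * K)^-1)).
      by rewrite ler_wpM2l// !mulr_ge0// ltW.
    by apply: eq_ler; field; rewrite gt_eqF.
  have := modulus_sub_le (f w) (f w'); rewrite modulus_distC.
  move: (modulus (_ - _)) (modulus (f w)) (modulus (f w')) h h3.
  move=> A B C h h3 h4; move: h h3 h4; clear; rewrite /K; move: (2 `^ s) (_ / d) => k x.
  by lra.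
Qed.

End submean.

(** * Geometry and measurability of the cones *)

Section complex_measurability.
Variables (R : realType) (d : measure_display) (T : measurableType d).
Implicit Types (F G : T -> Cplx R).

(** Measurability is taken coordinatewise, so that ring operations reduce to real measurable
    functions. *)
Definition cmeas F : Prop :=
  measurable_fun setT (fun x => complex.Re (F x)) /\
  measurable_fun setT (fun x => complex.Im (F x)).

Lemma cmeas_cst (z : Cplx R) : cmeas (fun _ => z).
Proof. by split; exact: measurable_cst. Qed.

Lemma cmeasD F G : cmeas F -> cmeas G -> cmeas (fun x => F x + G x).
Proof.
move=> [f1 f2] [g1 g2]; split.
  by under eq_fun do rewrite ReD; exact: measurable_funD.
by under eq_fun do rewrite ImD; exact: measurable_funD.
Qed.

Lemma cmeasN F : cmeas F -> cmeas (fun x => - F x).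
Proof.
move=> [f1 f2]; split.
  rewrite (_ : (fun _ => _) = (fun x => - complex.Re (F x))).
    exact: measurableT_comp.
  by apply/funext => x; case: (F x).
rewrite (_ : (fun _ => _) = (fun x => - complex.Im (F x))).
  exact: measurableT_comp.
by apply/funext => x; case: (F x).
Qed.

Lemma cmeasM F G : cmeas F -> cmeas G -> cmeas (fun x => F x * G x).
Proof.
move=> [f1 f2] [g1 g2]; split.
  rewrite (_ : (fun _ => _) = (fun x => complex.Re (F x) * complex.Re (G x) -
      complex.Im (F x) * complex.Im (G x))).
    by apply: measurable_funB; exact: measurable_funM.
  by apply/funext => x; case: (F x); case: (G x).
rewrite (_ : (fun _ => _) = (fun x => complex.Re (F x) * complex.Im (G x) +
    complex.Im (F x) * complex.Re (G x))).
  by apply: measurable_funD; exact: measurable_funM.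
by apply/funext => x; case: (F x); case: (G x).
Qed.

Lemma cmeasX F n : cmeas F -> cmeas (fun x => F x ^+ n).
Proof.
move=> mF; elim: n => [|n IH]; first exact: cmeas_cst.
by under eq_fun do rewrite exprS; exact: cmeasM.
Qed.

Lemma cmeas_sum (F : nat -> T -> Cplx R) n : (forall k, cmeas (F k)) ->
  cmeas (fun x => \sum_(k < n) F k x).
Proof.
move=> mF; elim: n => [|n IH].
  by under eq_fun do rewrite big_ord0; exact: cmeas_cst.
by under eq_fun do rewrite big_ord_recr; exact: cmeasD.
Qed.

Lemma cmeas_psum (a : T -> nat -> Cplx R) G n : (forall k, cmeas (a ^~ k)) -> cmeas G ->
  cmeas (fun x => psum (a x) n (G x)).
Proof.
move=> ma mG; apply: (cmeas_sum (F := fun k x => a x k * G x ^+ k)) => k.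
by apply: cmeasM => //; exact: cmeasX.
Qed.

Lemma cmeas_modulus F : cmeas F -> measurable_fun setT (fun x => modulus (F x)).
Proof.
move=> [f1 f2].
rewrite (_ : (fun _ => _) = (fun x => Num.sqrt (complex.Re (F x) ^+ 2 + complex.Im (F x) ^+ 2))).
  apply: (@measurableT_comp _ _ _ _ _ _ (@Num.sqrt R)).
    by apply: continuous_measurable_fun; exact: sqrt_continuous.
  by apply: measurable_funD; exact: measurable_funX.
by apply/funext => x; case: (F x).
Qed.

Lemma cmeas_circle_pt (f : T -> R) : measurable_fun setT f ->
  cmeas (fun x => circle_pt (f x)).
Proof.
move=> mf; split => /=.
  apply: (@measurableT_comp _ _ _ _ _ _ (@cos R)) => //.
  by apply: continuous_measurable_fun; exact: continuous_cos.
apply: (@measurableT_comp _ _ _ _ _ _ (@sin R)) => //.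
by apply: continuous_measurable_fun; exact: continuous_sin.
Qed.

Lemma cmeas_of_plane (f : T -> R * R) : measurable_fun setT f ->
  cmeas (fun x => of_plane (f x)).
Proof. by move=> mf; split => /=; exact: measurableT_comp. Qed.

Lemma measurable_lt_set (f g : T -> R) : measurable_fun setT f -> measurable_fun setT g ->
  measurable [set x | f x < g x].
Proof.
move=> mf mg; rewrite -[X in measurable X]setTI.
have := measurable_fun_ltr mf mg => /(_ measurableT [set true] I).
by rewrite setTI; congr measurable; apply/seteqP; split=> x /=.
Qed.

Lemma measurable_le_set (f g : T -> R) : measurable_fun setT f -> measurable_fun setT g ->
  measurable [set x | f x <= g x].
Proof.
move=> mf mg; rewrite (_ : [set x | _] = ~` [set x | g x < f x]).
  by apply: measurableC; exact: measurable_lt_set.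
by apply/seteqP; split=> x /=; rewrite leNgt => /negP.
Qed.

End complex_measurability.

Section plane_geometry.
Variable R : realType.
Implicit Types (z w : Cplx R) (t e r : R) (k n : nat).
Local Notation mu := (@lebesgue_measure R).

Definition eps k : R := 2^-1 ^+ k.

Lemma eps_gt0 k : 0 < eps k.
Proof. by rewrite exprn_gt0// invr_gt0. Qed.

Lemma eps_ge0 k : 0 <= eps k. Proof. exact/ltW/eps_gt0. Qed.

Lemma epsS k : eps k.+1 = eps k / 2.
Proof. by rewrite /eps exprSr. Qed.

Lemma eps0 : eps 0 = 1. Proof. by []. Qed.

Lemma epsD k n : eps (k + n) = eps k * eps n.
Proof. exact: exprD. Qed.

Lemma eps_le1 k : eps k <= 1.
Proof. by rewrite exprn_ile1// invf_le1// ler1n. Qed.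

Lemma epsS_le k : eps k.+1 <= 2^-1.
Proof. by rewrite epsS ler_pdivrMr// mulVf// eps_le1. Qed.

Lemma eps_anti k n : (k <= n)%N -> eps n <= eps k.
Proof. by move=> kn; rewrite -(subnK kn) epsD ler_piMl ?eps_ge0// eps_le1. Qed.

(** Multiplying by the unimodular conjugate turns |1 - z conj xi| into |xi - z|, and the inequality
    alone already forces |z| < 1. *)
Lemma Gamma_circleE t z : Gamma (circle_pt t) z <->
  modulus (circle_pt t - z) < 1 - modulus z ^+ 2.
Proof.
have -> : modulus (circle_pt t - z) = modulus (1 - z * conjc (circle_pt t) : R[i]).
  have -> : 1 - z * conjc (circle_pt t) = (circle_pt t - z) * conjc (circle_pt t).
    by rewrite mulrBl circle_ptVr.
  by rewrite modulusM modulus_conjc modulus_circle_pt mulr1.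
rewrite /Gamma /disk /mkset; split => [[]//|h]; split=> //.
have m0 := modulus_ge0 (1 - z * conjc (circle_pt t) : Cplx R).
have : 0 < 1 - modulus z ^+ 2 by exact: le_lt_trans m0 h.
rewrite subr_gt0 -[ltRHS](expr1n _ 2) ltr_pXn2r// ?nnegrE ?modulus_ge0//.
Qed.

Definition coneset t : set (R * R) := @of_plane R @^-1` Gamma (circle_pt t).

Definition cball z r : set (R * R) := [set w | modulus (of_plane w - z) < r].

Lemma measurable_cball z r : measurable (cball z r).
Proof.
apply: measurable_lt_set; last exact: measurable_cst.
apply: cmeas_modulus; apply: cmeasD; last exact: cmeas_cst.
exact: cmeas_of_plane.
Qed.

(** Joint measurability in angle and point, as Tonelli over circle and disk requires. *)
Lemma measurable_coneset2 : measurable [set tw : R * (R * R) | coneset tw.1 tw.2].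
Proof.
rewrite (_ : [set _ | _] = [set tw : R * (R * R) |
   modulus (circle_pt tw.1 - of_plane tw.2) < 1 - modulus (of_plane tw.2) ^+ 2]).
  have m1 : cmeas (fun tw : R * (R * R) => of_plane tw.2) by exact: cmeas_of_plane.
  apply: measurable_lt_set.
    apply: cmeas_modulus; apply: cmeasD; last exact: cmeasN.
    exact: cmeas_circle_pt.
  apply: measurable_funB; first exact: measurable_cst.
  by apply: measurable_funX; exact: cmeas_modulus.
by apply/seteqP; split => -[t w] /=; rewrite /coneset /preimage /mkset Gamma_circleE.
Qed.

Lemma measurable_coneset t : measurable (coneset t).
Proof.
rewrite (_ : coneset t = xsection [set tw : R * (R * R) | coneset tw.1 tw.2] t).
  by apply: measurable_xsection; exact: measurable_coneset2.
by rewrite /xsection; apply/seteqP; split => w /=; rewrite in_setE.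
Qed.

Lemma area_rect (x1 x2 y1 y2 : R) : x1 <= x2 -> y1 <= y2 ->
  area R (`]x1, x2[ `*` `]y1, y2[) = ((x2 - x1) * (y2 - y1))%:E.
Proof.
have L x y : x <= y -> (mu `]x, y[ = (y - x)%:E)%E.
  move=> xy; rewrite lebesgue_measure_itv/= lte_fin -EFinB.
  by move: xy; rewrite le_eqVlt => /orP[/eqP->|->//]; rewrite ltxx subrr.
move=> hx hy; rewrite /area product_measure1E//.
by rewrite EFinM -(L _ _ hx) -(L _ _ hy).
Qed.

(** An inscribed square is enough: only comparability with r^2 is ever used. *)
Lemma area_cball_ge z r : 0 < r -> ((r ^+ 2)%:E <= area R (cball z r))%E.
Proof.
move=> r0; pose Q := `](complex.Re z - r / 2), (complex.Re z + r / 2)[%classic `*`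
   `](complex.Im z - r / 2), (complex.Im z + r / 2)[%classic.
have -> : ((r ^+ 2)%:E = area R Q)%E.
  by rewrite area_rect; [congr (_%:E); field|lra|lra].
apply: le_measure; rewrite ?inE.
- by apply: measurableX; exact: measurable_itv.
- exact: measurable_cball.
- move=> [x y] [/=]; rewrite !in_itv /= => /andP[x1 x2] /andP[y1 y2].
  rewrite /cball /mkset /= (le_lt_trans (modulus_le_ReIm _))//.
  have -> : complex.Re (of_plane (x, y) - z) = x - complex.Re z by case: (z).
  have -> : complex.Im (of_plane (x, y) - z) = y - complex.Im z by case: (z).
  have h1 : `|x - complex.Re z| < r / 2 by rewrite ltr_norml; apply/andP; split; lra.
  have h2 : `|y - complex.Im z| < r / 2 by rewrite ltr_norml; apply/andP; split; lra.
  lra.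
Qed.

Lemma area_cball_le z r : 0 < r -> (area R (cball z r) <= (4 * r ^+ 2)%:E)%E.
Proof.
move=> r0; pose Q := `](complex.Re z - r), (complex.Re z + r)[%classic `*`
   `](complex.Im z - r), (complex.Im z + r)[%classic.
have -> : ((4 * r ^+ 2)%:E = area R Q)%E.
  by rewrite area_rect; [congr (_%:E); ring|lra|lra].
apply: le_measure; rewrite ?inE.
- exact: measurable_cball.
- by apply: measurableX; exact: measurable_itv.
- move=> [x y] h; rewrite /Q /= !in_itv /=.
  have h1 := le_lt_trans (Re_le_modulus _) h.
  have h2 := le_lt_trans (Im_le_modulus _) h.
  move: h1 h2; have -> : complex.Re (of_plane (x, y) - z) = x - complex.Re z by case: (z).
  have -> : complex.Im (of_plane (x, y) - z) = y - complex.Im z by case: (z).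
  rewrite !ltr_norml => /andP[h1 h2] /andP[h3 h4].
  by split; apply/andP; split; lra.
Qed.

(** The constants involve |alpha| so that both signs are covered; for negative alpha the estimate is
    applied to the reciprocal of x / e. *)
Lemma powR_comparable (alpha e x : R) : 0 < e -> e / 4 <= x -> x <= 4 * e ->
  4 `^ (- `|alpha|) * e `^ alpha <= x `^ alpha <= 4 `^ `|alpha| * e `^ alpha.
Proof.
move=> e0 h1 h2; have x0 : 0 < x by apply: lt_le_trans h1; rewrite divr_gt0.
have y0 : 0 < x / e by rewrite divr_gt0.
have xe : x = x / e * e by rewrite divfK// gt_eqF.
have y1 : x / e <= 4 by rewrite ler_pdivrMr.
have y2 : 4^-1 <= x / e by rewrite ler_pdivlMr// mulrC.
have p0 : 0 < e `^ alpha by rewrite powR_gt0.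
rewrite xe powRM ?(ltW y0) ?(ltW e0)// !ler_pM2r//.
have aux (y s : R) : 4^-1 <= y -> y <= 4 -> 0 <= s -> 4 `^ (- s) <= y `^ s <= 4 `^ s.
  move=> hy1 hy2 s0; have yp : 0 < y by apply: lt_le_trans hy1; rewrite invr_gt0.
  apply/andP; split; last by apply: ge0_ler_powR; rewrite ?nnegrE// ltW.
  have e4 : (4^-1 : R) `^ s * 4 `^ s = 1 by rewrite -powRM ?invr_ge0// mulVf// powR1.
  have -> : (4 : R) `^ (- s) = 4^-1 `^ s.
    by rewrite powRN -[LHS]mul1r -[X in X / _]e4 mulfK// gt_eqF// powR_gt0.
  by apply: ge0_ler_powR; rewrite ?nnegrE ?invr_ge0// ltW.
have [a0|a0] := leP 0 alpha; first by rewrite ger0_norm//; exact: aux.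
rewrite ltr0_norm//.
have := aux (x / e)^-1 (- alpha).
rewrite -powR_inv1 ?(ltW y0)// -powRrM mulN1r opprK; apply.
- by rewrite powR_inv1 ?(ltW y0)// lef_pV2 ?posrE.
- by rewrite powR_inv1 ?(ltW y0)// -(invrK 4) lef_pV2 ?posrE ?invr_gt0.
- by rewrite oppr_ge0 ltW.
Qed.

Lemma lipschitz_of_derive (f df : R -> R) : (forall x : R, is_derive x 1 f (df x)) ->
  (forall x, `|df x| <= 1) -> forall s t, `|f t - f s| <= `|t - s|.
Proof.
move=> hf hdf.
have cf : continuous f.
  by move=> x; apply: differentiable_continuous; apply/derivable1_diffP; exact: ex_derive.
suff h s t : s <= t -> `|f t - f s| <= `|t - s|.
  move=> s t; have [/h//|/ltW/h] := leP s t.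
  by rewrite distrC [leRHS]distrC.
move=> st; have [c _ ->] := @MVT_segment _ f df s t st (fun x _ => hf x) (continuous_subspaceT cf).
by rewrite normrM ler_piMl.
Qed.

Lemma circle_pt_lipschitz s t : modulus (circle_pt t - circle_pt s) <= 2 * `|t - s|.
Proof.
apply: le_trans (modulus_le_ReIm _) _; rewrite mulr_natl mulr2n; apply: lerD.
  have dc (x : R) : is_derive x 1 (@cos R) (- sin x) by exact: is_derive_cos.
  apply: (lipschitz_of_derive dc) => x; by rewrite normrN ler_norml sin_geN1 sin_le1.
have ds (x : R) : is_derive x 1 (@sin R) (cos x) by exact: is_derive_sin.
apply: (lipschitz_of_derive ds) => x; by rewrite ler_norml cos_geN1 cos_le1.
Qed.

Definition dyrad k : R := 1 - eps k.

Lemma dyrad_ge0 k : 0 <= dyrad k. Proof. by rewrite subr_ge0 eps_le1. Qed.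

Lemma dyrad_lt1 k : dyrad k < 1. Proof. by rewrite ltrBlDr ltrDl eps_gt0. Qed.

Definition dyrad_pt k t : Cplx R := (dyrad k)%:C%C * circle_pt t.

Lemma modulus_dyrad_pt k t : modulus (dyrad_pt k t) = dyrad k.
Proof. by rewrite modulusM modulus_circle_pt mulr1 modulus_real ger0_norm// dyrad_ge0. Qed.

Lemma circle_dyrad_pt k t : modulus (circle_pt t - dyrad_pt k t) = eps k.
Proof.
have -> : circle_pt t - dyrad_pt k t = (eps k)%:C%C * circle_pt t.
  by rewrite /dyrad_pt /dyrad rmorphB rmorph1 mulrBl mul1r opprB addrC subrK.
by rewrite modulusM modulus_circle_pt mulr1 modulus_real ger0_norm// eps_ge0.
Qed.

(* Discs about [dyrad_pt k t] of radius a fraction of [eps k] stay in the cone. *)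
Lemma cball_radius k z r t (w : R * R) : modulus (z - dyrad_pt k t) <= eps k / 16 -> r <= eps k / 16 ->
  cball z r w -> 1 - 9 / 8 * eps k < modulus (of_plane w) < 1 - 7 / 8 * eps k.
Proof.
move=> hz hr; rewrite /cball /mkset => hw.
have h1 := modulus_dist (of_plane w) (dyrad_pt k t).
rewrite modulus_dyrad_pt /dyrad in h1.
have h2 : modulus (of_plane w - dyrad_pt k t) < eps k / 8.
  have -> : of_plane w - dyrad_pt k t = (of_plane w - z) + (z - dyrad_pt k t) by rewrite addrA subrK.
  by have := modulusD (of_plane w - z) (z - dyrad_pt k t); move: hz hr hw; clear; lra.
move: (le_lt_trans h1 h2); rewrite ltr_norml; clear => /andP[h1 h2].
by apply/andP; split; lra.
Qed.

(** Points of the disc are within 9/8 eps of the boundary point, while 1 - |w|^2 exceeds 7/8 eps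
    times 2 - 9/8 eps. That product is larger because eps <= 1/2, which [0 < k] provides. *)
Lemma cball_sub_coneset k z r t : (0 < k)%N ->
  modulus (z - dyrad_pt k t) <= eps k / 16 -> r <= eps k / 16 ->
  cball z r `<=` coneset t.
Proof.
move=> k0 hz hr w hw.
have /andP[h1 h2] := cball_radius hz hr hw.
apply/Gamma_circleE.
have h3 : modulus (circle_pt t - of_plane w) <= 9 / 8 * eps k.
  have -> : circle_pt t - of_plane w = (circle_pt t - dyrad_pt k t)
     + ((dyrad_pt k t - z) + (z - of_plane w)) by rewrite !addrA !subrK.
  have := modulusD (circle_pt t - dyrad_pt k t) ((dyrad_pt k t - z) + (z - of_plane w)).
  have := modulusD (dyrad_pt k t - z) (z - of_plane w).
  rewrite circle_dyrad_pt (modulus_distC _ z) (modulus_distC z (of_plane w)).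
  by move: hz hr (hw : modulus (of_plane w - z) < r); clear; lra.
have e2 : eps k <= 2^-1 by case: k k0 {hz hr h1 h2 h3} => // k _; exact: epsS_le.
have e0 := eps_gt0 k.
move: (modulus (of_plane w)) h1 h2 h3 => m h1 h2 h3.
apply: le_lt_trans h3 _; nra.
Qed.

End plane_geometry.

Lemma meas_comp d1 d2 d3 (T1 : measurableType d1) (T2 : measurableType d2)
    (T3 : measurableType d3) (f : T2 -> T3) (g : T1 -> T2) :
  measurable_fun setT f -> measurable_fun setT g -> measurable_fun setT (fun x => f (g x)).
Proof. by move=> mf mg; exact: (measurableT_comp mf mg). Qed.

Section powers.
Variable R : realType.
Implicit Types (x y u : R).

(** At a positive limit this is continuity of a differentiable power; at limit 0, where the power
    need not be differentiable, the estimate is made by hand. *)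
Lemma cvg_powR (y : nat -> R) l u : 0 < u -> (forall n, 0 <= y n) ->
  y @ \oo --> l -> y n `^ u @[n --> \oo] --> l `^ u.
Proof.
move=> u0 y0 yl.
have l0 : 0 <= l.
  rewrite -(cvg_lim _ yl)//; apply: limr_ge; first by apply: cvgP yl.
  exact: nearW.
move: l0; rewrite le_eqVlt => /orP[/eqP l0|l0]; last first.
  have c : {for l, continuous (fun x => x `^ u)}.
    apply: differentiable_continuous; apply/derivable1_diffP.
    exact: (@ex_derive _ _ _ _ _ _ _ (is_derive1_powR u l0)).
  exact: (@continuous_cvg _ _ _ _ _ _ _ _ c yl).
rewrite -l0 powR0 ?gt_eqF//; apply/cvgrPdist_lt => e e0.
rewrite -l0 in yl; move/cvgrPdist_lt : yl => /(_ (e `^ u^-1) (powR_gt0 _ e0)).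
apply: filterS => n; rewrite !sub0r !normrN !ger0_norm ?powR_ge0// => h.
have -> : e = (e `^ u^-1) `^ u by rewrite -powRrM mulVf ?gt_eqF// powRr1// ltW.
by apply: gt0_ltr_powR; rewrite ?nnegrE ?powR_ge0.
Qed.

Lemma poweR_le (x y : \bar R) (r : R) : 0 <= r -> (0 <= x)%E -> (x <= y)%E -> (x `^ r <= y `^ r)%E.
Proof.
move=> r0 x0 xy; apply: gt0_ler_poweR => //; rewrite in_itv/= leey andbT//.
exact: le_trans xy.
Qed.

End powers.

Lemma area_sigma_finite (R : realType) : sigma_finite setT (area R).
Proof.
exists (fun n => cball 0 n.+1%:R).
  apply/seteqP; split=> // w _.
  exists (Num.truncn (modulus (of_plane w))) => //.
  by rewrite /cball /mkset subr0 truncnS_gt.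
move=> n; split; first exact: measurable_cball.
by rewrite (le_lt_trans (area_cball_le _ _))// ltry.
Qed.

(* The library's sigma-finite structure on product measures is shadowed by the
   one for subprobabilities. *)
HB.instance Definition _ (R : realType) := Measure.on (area R).
HB.instance Definition _ (R : realType) := @Measure_isSigmaFinite.Build _
  (measurableTypeR R * measurableTypeR R)%type R (area R) (area_sigma_finite R).

Section cone_functional.
Variable R : realType.
Implicit Types (u beta q alpha t r : R) (a : nat -> Cplx R) (f : Cplx R -> Cplx R).

(* Defined through a lower limit of partial sums so that it is measurable
   jointly with a random choice of the coefficients. *)
Definition Upow u a (w : R * R) : \bar R :=
  limn_einf (fun n => (modulus (psum a n (of_plane w)) `^ u)%:E).

Definition wgt beta (w : R * R) : R := (1 - modulus (of_plane w) ^+ 2) `^ beta.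

Lemma wgt_ge0 beta w : 0 <= wgt beta w. Proof. exact: powR_ge0. Qed.

Lemma limn_einf_ge0 (v : nat -> \bar R) : (forall n, (0 <= v n)%E) -> (0 <= limn_einf v)%E.
Proof.
move=> v0; rewrite limn_einf_lim; apply: lime_ge; first exact: is_cvg_einfs.
by apply: nearW => n; apply: le_ereal_inf_tmp => _ [m _ <-].
Qed.

Lemma Upow_ge0 u a w : (0 <= Upow u a w)%E.
Proof. by apply: limn_einf_ge0 => n; rewrite lee_fin powR_ge0. Qed.

Lemma UpowE u a f w : 0 < u -> power_expansion f a -> disk R (of_plane w) ->
  Upow u a w = (modulus (f (of_plane w)) `^ u)%:E.
Proof.
move=> u0 hf hw.
have h : (modulus (psum a n (of_plane w)) `^ u)%:E @[n --> \oo] -->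
    (modulus (f (of_plane w)) `^ u)%:E.
  apply: cvg_EFin; first exact: nearW.
  apply: cvg_powR => // [n|]; first exact: modulus_ge0.
  by apply: cvg_modulus; exact: power_expansion_cvg hf hw.
by rewrite /Upow is_cvg_limn_einfE; [exact: cvg_lim h|exact: cvgP h].
Qed.

Lemma measurable_wgt beta : measurable_fun setT (wgt beta).
Proof.
apply: (@measurableT_comp _ _ _ _ _ _ (fun x => x `^ beta)) => //.
apply: measurable_funB; first exact: measurable_cst.
by apply: measurable_funX; apply: cmeas_modulus; exact: cmeas_of_plane.
Qed.

Lemma measurable_limn_einf d (T : measurableType d) (g : (T -> \bar R)^nat) :
  (forall n, measurable_fun setT (g n)) ->
  measurable_fun setT (fun x => limn_einf (g ^~ x)).
Proof.
move=> mg; rewrite /limn_einf.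
apply: (@measurableT_comp _ _ _ _ _ _ (@oppe R)) => //.
apply: (@measurable_fun_limn_esup _ _ _ _ (fun n x => - g n x)%E) => n.
exact: measurableT_comp.
Qed.

Lemma measurable_Upow2 d (T : measurableType d) u (a : T -> nat -> Cplx R) :
  (forall k, cmeas (a ^~ k)) ->
  measurable_fun setT (fun x : T * (R * R) => Upow u (a x.1) x.2).
Proof.
move=> ma; apply: (@measurable_limn_einf _ _ (fun n x => (modulus (psum (a x.1) n (of_plane x.2)) `^ u)%:E)) => n.
apply/measurable_EFinP.
apply: (@measurableT_comp _ _ _ _ _ _ (fun x => x `^ u)) => //.
apply: cmeas_modulus; apply: (cmeas_psum (a := fun x : T * (R * R) => a x.1)).
  move=> k; have [h1 h2] := ma k; split.
    by apply: (@meas_comp _ _ _ (T * (R * R))%type T _ _ fst h1); exact: measurable_fst.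
    by apply: (@meas_comp _ _ _ (T * (R * R))%type T _ _ fst h2); exact: measurable_fst.
exact: cmeas_of_plane.
Qed.

Lemma measurable_Upow u a : measurable_fun setT (Upow u a).
Proof.
have h := @measurable_Upow2 _ R u (fun=> a) (fun k => cmeas_cst _ _).
apply: (@meas_comp _ _ _ (R * R)%type (R * (R * R))%type _ _ (fun w => (0, w)) h).
by apply: measurable_fun_pair => //; exact: measurable_cst.
Qed.

(** The varying domain is moved into the integrand as an indicator, after which Tonelli applies. *)
Lemma measurable_section_integral d (T : measurableType d) (F : T * (R * R) -> \bar R)
    (E : set (T * (R * R))) :
  measurable E -> measurable_fun setT F -> (forall x, (0 <= F x)%E) ->
  measurable_fun setT (fun x => \int[area R]_(w in [set w | E (x, w)]) F (x, w))%E.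
Proof.
move=> mE mF F0.
rewrite (_ : (fun x => _) = (fun x => \int[area R]_w (F \_ E) (x, w))%E).
  apply: (measurable_fun_fubini_tonelli_F (m2 := area R) (F \_ E)).
    by apply/(measurable_restrictT _ mE); exact: measurable_funTS.
  by move=> x; rewrite patchE; case: ifP.
apply/funext => x; rewrite integral_mkcond; apply: eq_integral => w _.
by rewrite !patchE; congr (if _ then _ else _); apply/idP/idP; rewrite !in_setE.
Qed.

(** It depends on the coefficients rather than on a function, and on an arbitrary region, so that
    cones, discs and annular slices with random coefficients share one functional. *)
Definition cone_meas u beta a (D : set (R * R)) : \bar R :=
  (\int[area R]_(w in D) (Upow u a w * (wgt beta w)%:E))%E.

Lemma cone_integrand_ge0 u beta a w : (0 <= Upow u a w * (wgt beta w)%:E)%E.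
Proof. by rewrite mule_ge0 ?Upow_ge0// lee_fin wgt_ge0. Qed.

Lemma measurable_cone_integrand u beta a :
  measurable_fun setT (fun w => Upow u a w * (wgt beta w)%:E)%E.
Proof.
apply: emeasurable_funM; first exact: measurable_Upow.
by apply/measurable_EFinP; exact: measurable_wgt.
Qed.

Lemma cone_meas_ge0 u beta a D : (0 <= cone_meas u beta a D)%E.
Proof. by apply: integral_ge0 => w _; exact: cone_integrand_ge0. Qed.

Lemma cone_integralE q alpha a f t : 0 < q -> power_expansion f a ->
  cone_integral q alpha f (circle_pt t) = cone_meas q alpha a (coneset t).
Proof.
move=> q0 hf; apply: eq_integral => w; rewrite inE => hw.
have hd : disk R (of_plane w) by case: hw.
by rewrite (UpowE q0 hf hd) EFinM.
Qed.

Lemma measurable_cone_meas d (T : measurableType d) u beta (a : T -> nat -> Cplx R) (E : set (R * (R * R))) :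
  (forall k, cmeas (a ^~ k)) -> measurable E ->
  measurable_fun setT (fun x : T * R => cone_meas u beta (a x.1) [set w | E (x.2, w)]).
Proof.
move=> ma mE.
pose F (y : (T * R) * (R * R)) := (Upow u (a y.1.1) y.2 * (wgt beta y.2)%:E)%E.
pose E' := [set y : (T * R) * (R * R) | E (y.1.2, y.2)].
apply: (@measurable_section_integral _ _ F E').
- rewrite -[X in measurable X]setTI.
  apply: (_ : measurable_fun setT (fun y : (T * R) * (R * R) => (y.1.2, y.2))) => //.
  by apply: measurable_fun_pair => //; apply: measurableT_comp => //; exact: measurable_snd.
- apply: emeasurable_funM.
    have m2 := @measurable_Upow2 _ T u a ma.
    apply: (@meas_comp _ _ _ ((T * R) * (R * R))%type (T * (R * R))%type _ _ (fun y => (y.1.1, y.2)) m2).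
    by apply: measurable_fun_pair => //; apply: measurableT_comp => //; exact: measurable_fst.
  apply/measurable_EFinP; apply: (@measurableT_comp _ _ _ _ _ _ (wgt beta)) => //.
  exact: measurable_wgt.
- by move=> y; exact: cone_integrand_ge0.
Qed.

Lemma measurable_cone_meas1 u beta a (E : set (R * (R * R))) : measurable E ->
  measurable_fun setT (fun t : R => cone_meas u beta a [set w | E (t, w)]).
Proof.
move=> mE; have h := @measurable_cone_meas _ R u beta (fun=> a) E (fun k => cmeas_cst _ _) mE.
apply: (@meas_comp _ _ _ R (R * R)%type _ _ (fun t => (0, t)) h).
by apply: measurable_fun_pair => //; exact: measurable_cst.
Qed.

End cone_functional.

(** * Lower bounds for cone integrals *)

Section cone_lower_bound.
Variable R : realType.
Implicit Types (u beta q alpha t r : R) (a : nat -> Cplx R) (f : Cplx R -> Cplx R).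

Lemma integral_ge_cst (F : R * R -> \bar R) (D B : set (R * R)) (c : R) :
  measurable D -> measurable B -> B `<=` D -> measurable_fun setT F -> (forall w, (0 <= F w)%E) ->
  0 <= c -> (forall w, B w -> (c%:E <= F w)%E) ->
  (c%:E * area R B <= \int[area R]_(w in D) F w)%E.
Proof.
move=> mD mB BD mF F0 c0 hc; rewrite -integral_cst//.
apply: (@le_trans _ _ (\int[area R]_(w in B) F w)%E).
  by apply: ge0_le_integral => //; exact: measurable_funTS.
by apply: ge0_subset_integral => //; exact: measurable_funTS.
Qed.

(** A constant lower bound on a small disc avoids integrating |f|^q: the constant times the area
    already dominates |f(z)|^q rho^2. *)
Lemma submean_cball q : 0 < q -> exists2 c, 0 < c & forall f a (z : Cplx R) (rho : R),
  power_expansion f a -> 0 < rho -> modulus z + rho < 1 ->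
  exists B : set (R * R), exists2 m : R, 0 <= m & [/\ measurable B, B `<=` cball z rho,
    forall w, B w -> m <= modulus (f (of_plane w)) `^ q &
   ((c * (modulus (f z) `^ q * rho ^+ 2))%:E <= m%:E * area R B)%E].
Proof.
move=> q0; have [c [kappa [c0 k0 k2 H]]] := local_lower_bound q0.
exists (c * (2^-1 `^ q * kappa ^+ 2)); first by rewrite !mulr_gt0 ?powR_gt0 ?exprn_gt0 ?invr_gt0.
move=> f a z rho hf rho0 zr; have [w [d [d0 wd h1 h2]]] := H f a z rho hf rho0 zr.
have kd : 0 < kappa * d by rewrite mulr_gt0.
exists (cball w (kappa * d)), ((2^-1 * modulus (f w)) `^ q); first exact: powR_ge0.
split; first exact: measurable_cball.
- move=> x hx; rewrite /cball /mkset.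
  have -> : of_plane x - z = (of_plane x - w) + (w - z) by rewrite addrA subrK.
  have := modulusD (of_plane x - w) (w - z).
  have : kappa * d <= 2^-1 * d by rewrite ler_pM2r.
  by move: (hx : modulus (of_plane x - w) < _) wd d0; clear; lra.
- move=> x hx; apply: ge0_ler_powR; rewrite ?nnegrE ?modulus_ge0 ?mulr_ge0 ?modulus_ge0 ?(ltW q0)//.
  by apply: h2; exact: ltW.
- apply: (@le_trans _ _ (((2^-1 * modulus (f w)) `^ q)%:E * ((kappa * d) ^+ 2)%:E)%E).
    rewrite -EFinM lee_fin powRM ?modulus_ge0 ?invr_ge0// exprMn.
    have -> : 2^-1 `^ q * modulus (f w) `^ q * (kappa ^+ 2 * d ^+ 2) =
      2^-1 `^ q * kappa ^+ 2 * (modulus (f w) `^ q * d ^+ 2) by ring.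
    have -> : c * (2^-1 `^ q * kappa ^+ 2) * (modulus (f z) `^ q * rho ^+ 2) =
      2^-1 `^ q * kappa ^+ 2 * (c * modulus (f z) `^ q * rho ^+ 2) by ring.
    by apply: ler_wpM2l h1; rewrite mulr_ge0 ?powR_ge0 ?sqr_ge0.
  by apply: lee_wpmul2l; [rewrite lee_fin powR_ge0|exact: area_cball_ge].
Qed.

(** At distance about eps from the circle the weight is comparable to eps^alpha and the disc has
    area about eps^2, whence the exponent alpha + 2. *)
Lemma cone_ball_lower q alpha : 0 < q -> exists2 c, 0 < c &
  forall f a k t z, power_expansion f a -> (0 < k)%N ->
    modulus (z - dyrad_pt k t) <= eps R k / 32 ->
    ((c * (modulus (f z) `^ q * eps R k `^ (alpha + 2)))%:E <=
      cone_meas q alpha a (cball z (eps R k / 32)))%E.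
Proof.
move=> q0; have [c c0 H] := submean_cball q0.
exists (c * (4 `^ (- `|alpha|) / 32 ^+ 2)).
  by rewrite mulr_gt0// divr_gt0 ?exprn_gt0// powR_gt0.
move=> f a k t z hf k0 hz.
have e0 := eps_gt0 R k.
have r0 : 0 < eps R k / 32 by rewrite divr_gt0.
have hz' : modulus (z - dyrad_pt k t) <= eps R k / 16 by apply: le_trans hz _; lra.
have hr' : eps R k / 32 <= eps R k / 16 by lra.
have zr : modulus z + eps R k / 32 < 1.
  have := modulusD (z - dyrad_pt k t) (dyrad_pt k t); rewrite subrK modulus_dyrad_pt /dyrad.
  by move: hz e0; clear; lra.
have [B [m m0 [mB BD hm hB]]] := H f a z _ hf r0 zr.
have hw w : B w -> (4 `^ (- `|alpha|) * eps R k `^ alpha <= wgt alpha w) /\ disk R (of_plane w).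
  move=> /BD /(cball_radius hz' hr') /andP[h1 h2].
  have e2 : eps R k <= 2^-1 by case: k k0 {hz hz' hr' e0 r0 zr hB BD h1 h2} => // k _; exact: epsS_le.
  split.
    have [] : eps R k / 4 <= 1 - modulus (of_plane w) ^+ 2 /\ 1 - modulus (of_plane w) ^+ 2 <= 4 * eps R k.
      by move: (modulus (of_plane w)) h1 h2 => x h1 h2; split; nra.
    by move=> h3 h4; have /andP[] := powR_comparable alpha e0 h3 h4.
  by rewrite /disk /mkset; move: h2 e0; clear; lra.
have mF := measurable_cone_integrand q alpha a.
have BD' : B `<=` cball z (eps R k / 32) by [].
have W0 : 0 <= 4 `^ (- `|alpha|) * eps R k `^ alpha by rewrite mulr_ge0 ?powR_ge0.
apply: le_trans (integral_ge_cst (c := m * (4 `^ (- `|alpha|) * eps R k `^ alpha))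
   (measurable_cball _ _) mB BD' mF (cone_integrand_ge0 _ _ _) (mulr_ge0 m0 W0) _); last first.
  move=> w hB'; have [h1 h2] := hw w hB'.
  by rewrite (UpowE q0 hf h2) -EFinM lee_fin; apply: ler_pM => //; exact: hm.
have -> : c * (4 `^ (- `|alpha|) / 32 ^+ 2) * (modulus (f z) `^ q * eps R k `^ (alpha + 2)) =
   4 `^ (- `|alpha|) * eps R k `^ alpha * (c * (modulus (f z) `^ q * (eps R k / 32) ^+ 2)).
  rewrite powRD; last by rewrite (gt_eqF e0) implybT.
  rewrite (powR_mulrn 2 (ltW e0)) expr_div_n.
  by field.
rewrite EFinM [m * _]mulrC [X in (_ <= X * _)%E]EFinM -muleA.
by apply: lee_wpmul2l.
Qed.

(** Moduli in each disc lie between 1 - 9/8 eps and 1 - 7/8 eps, and halving eps separates these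
    ranges. *)
Lemma trivIset_cball_rad t : trivIset setT (fun k => cball (dyrad_pt k.+1 t) (eps R k.+1 / 32)).
Proof.
apply/trivIsetP.
have aux k n (w : R * R) : (k < n)%N -> cball (dyrad_pt k.+1 t) (eps R k.+1 / 32) w ->
    cball (dyrad_pt n.+1 t) (eps R n.+1 / 32) w -> False.
  move=> kn.
  have e0 m := eps_gt0 R m.
  have hz m : modulus (dyrad_pt m t - dyrad_pt m t) <= eps R m / 16.
    by rewrite subrr modulus0 divr_ge0// ltW.
  have hr m : eps R m / 32 <= eps R m / 16 by move: (e0 m); clear; lra.
  move=> /(cball_radius (hz _) (hr _)) /andP[h1 h2] /(cball_radius (hz _) (hr _)) /andP[h3 h4].
  have : eps R n.+1 <= eps R k.+1 / 2 by rewrite -epsS eps_anti// ltnS.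
  move: h1 h2 h3 h4 (e0 k.+1); move: (eps R _) (eps R _) (modulus _); clear => x y m.
  by lra.
move=> k n _ _ kn; apply/seteqP; split=> // w [h1 h2].
move: kn; rewrite neq_ltn => /orP[kn|kn]; first exact: (aux _ _ _ kn h1 h2).
exact: (aux _ _ _ kn h2 h1).
Qed.

(** Disjoint discs along the radius add up inside one cone. *)
Lemma cone_ge_series q alpha : 0 < q -> exists2 c, 0 < c &
  forall f a t, power_expansion f a ->
    (c%:E * \sum_(k <oo) (modulus (f (dyrad_pt k.+1 t)) `^ q * eps R k.+1 `^ (alpha + 2))%:E
     <= cone_meas q alpha a (coneset t))%E.
Proof.
move=> q0; have [c c0 H] := cone_ball_lower alpha q0.
exists c => // f a t hf.
pose B k := cball (dyrad_pt k.+1 t) (eps R k.+1 / 32).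
have mB k : measurable (B k) by exact: measurable_cball.
have hz m : modulus (dyrad_pt m t - dyrad_pt m t) <= eps R m / 32.
  by rewrite subrr modulus0 divr_ge0// eps_ge0.
have BD : \bigcup_k B k `<=` coneset t.
  move=> w [k _ hw]; apply: (cball_sub_coneset (k := k.+1) _ _ _ hw) => //.
    by rewrite subrr modulus0 divr_ge0// eps_ge0.
  by have := eps_gt0 R k.+1; lra.
have mF := measurable_cone_integrand q alpha a.
apply: (@le_trans _ _ (\int[area R]_(w in \bigcup_k B k) (Upow q a w * (wgt alpha w)%:E))%E).
  rewrite ge0_integral_bigcup//=; last 3 first.
  - exact: measurable_funTS.
  - by move=> w _; exact: cone_integrand_ge0.
  - exact: trivIset_cball_rad.
  rewrite -nneseriesZl; last by move=> k _; rewrite lee_fin mulr_ge0 ?powR_ge0.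
  apply: lee_nneseries => [k _ _|k _]; first by rewrite -EFinM lee_fin !mulr_ge0 ?powR_ge0 ?(ltW c0).
  by rewrite -EFinM; exact: H.
apply: ge0_subset_integral => //.
- by apply: bigcup_measurable => k _; exact: mB.
- exact: measurable_coneset.
- exact: measurable_funTS.
- by move=> w _; exact: cone_integrand_ge0.
Qed.

(** The chord is at most twice the angle, so the point stays within eps / 32 of the neighbouring
    ray. When p < 2 this turns one large value of f into a whole arc of large cone integrals. *)
Lemma cone_ge_point q alpha : 0 < q -> exists2 c, 0 < c &
  forall f a k t t', power_expansion f a -> (0 < k)%N -> `|t - t'| <= eps R k / 64 ->
    ((c * (modulus (f (dyrad_pt k t)) `^ q * eps R k `^ (alpha + 2)))%:E
     <= cone_meas q alpha a (coneset t'))%E.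
Proof.
move=> q0; have [c c0 H] := cone_ball_lower alpha q0.
exists c => // f a k t t' hf k0 tt'.
have hz : modulus (dyrad_pt k t - dyrad_pt k t') <= eps R k / 32.
  rewrite /dyrad_pt -mulrBr modulusM modulus_real ger0_norm ?dyrad_ge0//.
  have := circle_pt_lipschitz t' t; have := dyrad_ge0 R k; have := ltW (dyrad_lt1 R k).
  have := modulus_ge0 (circle_pt t - circle_pt t').
  by move: (modulus _) (dyrad R k) `|_| (eps R k) tt'; clear => x y z e; nra.
apply: le_trans (H f a k t' _ hf k0 hz) _.
apply: ge0_subset_integral.
- exact: measurable_cball.
- exact: measurable_coneset.
- by apply: measurable_funTS; exact: measurable_cone_integrand.
- by move=> w _; exact: cone_integrand_ge0.
- have e0 := eps_gt0 R k; apply: cball_sub_coneset k0 _ _; last by move: e0; clear; lra.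
  by apply: le_trans hz _; move: e0; clear; lra.
Qed.

End cone_lower_bound.

(** * Powers of series with nonnegative terms *)

Section nneseries_tools.
Variable R : realType.
Implicit Types (x y : nat -> R) (r s : R).

Lemma one_powR s : 1 `^ s = 1 :> R.
Proof. by rewrite powR1. Qed.

Lemma powR_exprn (x s : R) k : 0 <= x -> (x ^+ k) `^ s = (x `^ s) ^+ k.
Proof.
move=> x0; elim: k => [|k IH]; first by rewrite !expr0 one_powR.
by rewrite !exprS powRM ?exprn_ge0// IH.
Qed.

Lemma term_le_nneseries (u : nat -> \bar R) k : (forall n, (0 <= u n)%E) ->
  (u k <= \sum_(n <oo) u n)%E.
Proof.
move=> u0; rewrite (nneseriesD1 (n := k))//.
by rewrite leeDl//; apply: nneseries_ge0.
Qed.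

Lemma nneseries_le_of_partial (u : nat -> \bar R) (M : \bar R) : (forall n, (0 <= u n)%E) ->
  (forall n, (\sum_(k < n) u k <= M)%E) -> (\sum_(n <oo) u n <= M)%E.
Proof.
move=> u0 h; apply: lime_le; first exact: is_cvg_nneseries.
by apply: nearW => n; rewrite big_mkord.
Qed.

Lemma nneseries_ge_partial (u : nat -> \bar R) n : (forall n, (0 <= u n)%E) ->
  (\sum_(k < n) u k <= \sum_(k <oo) u k)%E.
Proof.
move=> u0; have := @nneseries_lim_ge R u predT 0 n (fun k _ _ => u0 k).
by rewrite big_mkord.
Qed.

Lemma geometric_sum_le r n : 0 <= r -> r < 1 -> \sum_(k < n) r ^+ k <= (1 - r)^-1.
Proof.
move=> r0 r1; have h : 0 < 1 - r by rewrite subr_gt0.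
have := subrXX (1 : R) r n; rewrite expr1n.
under eq_bigr do rewrite expr1n mul1r.
move=> e; rewrite -div1r ler_pdivlMr// mulrC -e.
by rewrite gerBl exprn_ge0.
Qed.

Lemma geometric_nneseries_le r : 0 <= r -> r < 1 ->
  (\sum_(k <oo) (r ^+ k)%:E <= ((1 - r)^-1)%:E)%E.
Proof.
move=> r0 r1; apply: nneseries_le_of_partial => [n|n]; first by rewrite lee_fin exprn_ge0.
by rewrite sumEFin lee_fin geometric_sum_le.
Qed.

(** Each term satisfies x_k^r <= x_k S^(r - 1), since x_k is at most the full sum S. *)
Lemma nneseries_powR x r : (forall k, 0 <= x k) -> 1 <= r ->
  (\sum_(k <oo) (x k `^ r)%:E <= (\sum_(k <oo) (x k)%:E) `^ r)%E.
Proof.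
move=> x0 r1; set S := (\sum_(k <oo) (x k)%:E)%E.
have r0 : 0 < r by rewrite (lt_le_trans ltr01).
have S0 : (0 <= S)%E by apply: nneseries_ge0 => k _ _; rewrite lee_fin.
have [SE|SE] := eqVneq S +oo%E; first by rewrite SE poweRyr ?leey// gt_eqF.
have [s Ss] : exists s, S = s%:E.
  by exists (fine S); rewrite fineK// ge0_fin_numE// ltey.
have s0 : 0 <= s by rewrite -lee_fin -Ss.
have xs k : x k <= s.
  by rewrite -lee_fin -Ss; apply: (term_le_nneseries (u := fun k => (x k)%:E)) => n; rewrite lee_fin.
rewrite Ss poweR_EFin -(mulr_powRB1 s0 r0) mulrC EFinM -Ss -nneseriesZl; last by move=> k _; rewrite lee_fin.
apply: lee_nneseries => [k _ _|k _]; first by rewrite lee_fin powR_ge0.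
rewrite -EFinM lee_fin -(mulr_powRB1 (x0 k) r0) mulrC ler_wpM2r//.
by apply: ge0_ler_powR; rewrite ?nnegrE ?subr_ge0.
Qed.

(** The case of exponent at least 1, applied to x_k^r with exponent 1 / r. *)
Lemma poweR_nneseries x r : (forall k, 0 <= x k) -> 0 < r -> r <= 1 ->
  ((\sum_(k <oo) (x k)%:E) `^ r <= \sum_(k <oo) (x k `^ r)%:E)%E.
Proof.
move=> x0 r0 r1.
have h := @nneseries_powR (fun k => x k `^ r) r^-1 (fun k => powR_ge0 _ _).
have {}h : (\sum_(k <oo) (x k)%:E <= (\sum_(k <oo) (x k `^ r)%:E) `^ r^-1)%E.
  apply: le_trans (h _); last by rewrite invf_ge1.
  apply: lee_nneseries => [k _ _|k _]; rewrite lee_fin// -powRrM mulfV ?gt_eqF// powRr1//.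
have S0 : (0 <= \sum_(k <oo) (x k)%:E)%E by apply: nneseries_ge0 => k _ _; rewrite lee_fin.
apply: le_trans (poweR_le (ltW r0) S0 h) _.
rewrite -poweRrM mulVf ?gt_eqF// poweRe1// nneseries_ge0// => k _ _.
by rewrite lee_fin powR_ge0.
Qed.

(** A geometric sum is dominated by its largest term; summing downwards from that term gives the
    ratio 2^-p. *)
Lemma sum_pow2_below (p z : R) n : 0 < p -> 0 < z ->
  \sum_(j < n | (2 ^+ j < z)) (2 ^+ j) `^ p <= (1 - 2 `^ (- p))^-1 * z `^ p.
Proof.
move=> p0 z0.
have q0 : 0 < 2 `^ (- p) :> R by rewrite powR_gt0.
have q1 : 2 `^ (- p) < 1 :> R.
  rewrite powRN invf_lt1 ?powR_gt0// -[ltLHS](one_powR p).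
  by apply: gt0_ltr_powR; rewrite ?nnegrE// ltr1n.
have C0 : 0 <= (1 - 2 `^ (- p))^-1 :> R by rewrite invr_ge0 subr_ge0 ltW.
elim: n => [|n IH]; first by rewrite big_ord0 mulr_ge0 ?powR_ge0.
have [hn|hn] := ltP (2 ^+ n : R) z; last first.
  by rewrite big_mkcond big_ord_recr /= ltNge hn /= addr0 -big_mkcond.
apply: (@le_trans _ _ (\sum_(j < n.+1) (2 ^+ j) `^ p)).
  rewrite big_mkcond; apply: ler_sum => j _; case: ifP => // _; exact: powR_ge0.
apply: (@le_trans _ _ ((2 ^+ n) `^ p * \sum_(j < n.+1) (2 `^ (- p)) ^+ j)).
  rewrite mulr_sumr (reindex_inj rev_ord_inj)/=; apply: eq_ler; apply: eq_bigr => j _.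
  rewrite subSS powRN exprVn.
  have -> : (2 ^+ n : R) = 2 ^+ (n - j) * 2 ^+ j by rewrite -exprD subnK// -ltnS.
  rewrite powRM ?exprn_ge0// (powR_exprn p j)//.
  by rewrite mulfK// expf_neq0// gt_eqF// powR_gt0.
rewrite mulrC; apply: ler_pM.
- by apply: sumr_ge0 => j _; rewrite exprn_ge0// ltW.
- exact: powR_ge0.
- by apply: geometric_sum_le => //; exact: ltW.
- by apply: ge0_ler_powR; rewrite ?nnegrE ?exprn_ge0 ?(ltW p0) ?(ltW z0) ?(ltW hn).
Qed.

(** Induction on n with z free: dropping the term k = 0 halves every eps, which amounts to replacing
    z by 2 z. *)
Lemma sum_eps_below (s z : R) n : 0 < s -> 0 < z ->
  \sum_(k < n | (eps R k <= z)) eps R k `^ s <= (1 - 2^-1 `^ s)^-1 * z `^ s.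
Proof.
move=> s0; have q0 : 0 < 2^-1 `^ s :> R by rewrite powR_gt0// invr_gt0.
have q1 : 2^-1 `^ s < 1 :> R.
  rewrite -[ltRHS](one_powR s); apply: gt0_ltr_powR; rewrite ?nnegrE ?invr_ge0//.
  by rewrite invf_lt1// ltr1n.
have C0 : 0 <= (1 - 2^-1 `^ s)^-1 :> R by rewrite invr_ge0 subr_ge0 ltW.
elim: n z => [|n IH] z z0; first by rewrite big_ord0 mulr_ge0 ?powR_ge0.
have epsP k : eps R k `^ s = (2^-1 `^ s) ^+ k.
  by rewrite /eps powR_exprn// invr_ge0.
have [hz|hz] := leP 1 z.
  apply: (@le_trans _ _ (\sum_(k < n.+1) (2^-1 `^ s) ^+ k)).
    rewrite big_mkcond; apply: ler_sum => j _; rewrite epsP; case: ifP => _; first exact: lexx.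
    by apply: exprn_ge0; exact: ltW.
  apply: le_trans (geometric_sum_le _ (ltW q0) q1) _.
  rewrite ler_peMr// -[leLHS](one_powR s); apply: ge0_ler_powR; rewrite ?nnegrE ?(ltW s0) ?(ltW z0)//.
rewrite big_mkcond big_ord_recl /= eps0 (lt_geF hz) add0r -big_mkcond.
have := IH (2 * z) (mulr_gt0 (ltr0n _ 2) z0).
rewrite powRM ?(ltW z0)// => h.
apply: (@le_trans _ _ (2^-1 `^ s * \sum_(k < n | eps R k <= 2 * z) eps R k `^ s)).
  rewrite mulr_sumr [leLHS]big_mkcond [leRHS]big_mkcond; apply: ler_sum => k _.
  rewrite /bump /= add1n epsS ler_pdivrMr// [z * 2]mulrC; case: ifP => // _.
  by rewrite mulrC powRM ?eps_ge0 ?invr_ge0.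
apply: le_trans (ler_wpM2l (ltW q0) h) _.
apply: eq_ler; rewrite mulrCA; congr (_ * _); rewrite mulrA -powRM ?invr_ge0//.
by rewrite mulVf// powR1 mul1r.
Qed.

End nneseries_tools.

(** * Square means on circles *)

Section square_mean.
Variable R : realType.
Implicit Types (a : nat -> Cplx R) (f : Cplx R -> Cplx R) (r t : R).
Local Notation mu := (@lebesgue_measure R).
Local Notation circ := (`[0%R, (2 * pi)%R]%classic : set R).

Definition sq_terms a r : nat -> R := fun k => modulus (a k) ^+ 2 * r ^+ (2 * k).

Definition M2sq a r : R := limn (series (sq_terms a r)).

Lemma sq_terms_ge0 a r k : 0 <= r -> 0 <= sq_terms a r k.
Proof. by move=> r0; rewrite mulr_ge0 ?sqr_ge0 ?exprn_ge0. Qed.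

Lemma is_cvg_sq_terms a r : absconv a -> 0 <= r -> r < 1 -> cvgn (series (sq_terms a r)).
Proof.
move=> ha r0 r1; have c := ha r r0 r1.
have [M [_ hM]] := cvg_seq_bounded (cvgP _ (cvg_series_cvg_0 c)).
have {}hM k : abs_terms a r k <= M + 1.
  by apply: le_trans (ler_norm _) _; apply: hM => //; rewrite ltrDl.
have h1 : cvgn (series (fun k => (M + 1) * abs_terms a r k)) by exact: is_cvg_seriesZ.
have M0 : 0 <= M + 1 by apply: le_trans (hM 0%N); exact: abs_terms_ge0.
apply: series_le_cvg h1 => k; first exact: sq_terms_ge0.
  by rewrite mulr_ge0// abs_terms_ge0.
have -> : sq_terms a r k = abs_terms a r k * abs_terms a r k.
  by rewrite /sq_terms /abs_terms mulnC exprM mulrACA -!expr2.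
by rewrite ler_wpM2r// abs_terms_ge0.
Qed.

Lemma sq_terms_partial_le a r n : absconv a -> 0 <= r -> r < 1 ->
  \sum_(k < n) sq_terms a r k <= M2sq a r.
Proof.
move=> ha r0 r1.
have := @nondecreasing_cvgn_le _ (series (sq_terms a r)) _ (is_cvg_sq_terms ha r0 r1) n.
rewrite /series /= big_mkord; apply.
by apply: nondecreasing_series => k _ _; exact: sq_terms_ge0.
Qed.

Lemma M2sq_ge0 a r : absconv a -> 0 <= r -> r < 1 -> 0 <= M2sq a r.
Proof. by move=> ha r0 r1; have := sq_terms_partial_le 0 ha r0 r1; rewrite big_ord0. Qed.

Lemma M2sq_le_of_partial a r (M : R) : absconv a -> 0 <= r -> r < 1 ->
  (forall n, \sum_(k < n) sq_terms a r k <= M) -> M2sq a r <= M.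
Proof.
move=> ha r0 r1 h; apply: limr_le; first exact: is_cvg_sq_terms.
by apply: nearW => n; rewrite /series /= big_mkord.
Qed.

Lemma M2sq_mono a r s : absconv a -> 0 <= r -> r <= s -> s < 1 -> M2sq a r <= M2sq a s.
Proof.
move=> ha r0 rs s1; have s0 := le_trans r0 rs.
apply: M2sq_le_of_partial => //; first exact: le_lt_trans rs s1.
move=> n; apply: le_trans (sq_terms_partial_le n ha s0 s1).
by apply: ler_sum => k _; rewrite ler_wpM2l ?sqr_ge0// lerXn2r ?nnegrE.
Qed.

Lemma measurable_circle_power_expansion f a r : power_expansion f a -> 0 <= r -> r < 1 ->
  measurable_fun setT (fun t => modulus (f (r%:C%C * circle_pt t))).
Proof.
move=> hf r0 r1.
have hd t : disk R (r%:C%C * circle_pt t).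
  by rewrite /disk /mkset modulusM modulus_circle_pt mulr1 modulus_real ger0_norm.
apply: (@measurable_fun_cvg _ _ _ _ (fun n t => modulus (psum a n (r%:C%C * circle_pt t)))).
  move=> n; apply: cmeas_modulus; apply: (cmeas_psum (a := fun=> a)) => [k|].
    exact: cmeas_cst.
  by apply: cmeasM; [exact: cmeas_cst|exact: cmeas_circle_pt].
by move=> t _; apply: cvg_modulus; exact: power_expansion_cvg hf (hd t).
Qed.

(** Dominated convergence from partial sums, with the constant bound given by absolute convergence
    at radius r. *)
Lemma parseval f a r : power_expansion f a -> 0 <= r -> r < 1 ->
  (\int[mu]_(t in circ) (modulus (f (r%:C%C * circle_pt t)) ^+ 2)%:E =
    (2 * pi * M2sq a r)%:E)%E.
Proof.
move=> hf r0 r1; have ha := power_expansion_absconv hf.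
have zr t : modulus (r%:C%C * circle_pt t) <= r.
  by rewrite modulusM modulus_circle_pt mulr1 modulus_real ger0_norm.
have hd t : disk R (r%:C%C * circle_pt t) by exact: le_lt_trans (zr t) r1.
pose B := limn (series (abs_terms a r)).
have B0 : 0 <= B.
  apply: limr_ge; first exact: ha.
  by apply: nearW => n; rewrite /series /=; apply: sumr_ge0 => k _; exact: abs_terms_ge0.
have hB n t : modulus (psum a n (r%:C%C * circle_pt t)) <= B.
  apply: (@le_trans _ _ (series (abs_terms a r) n)).
    have := psum_dist_le a r0 (zr t) (leq0n n).
    by rewrite [psum a 0 _]big_ord0 subr0 {2}/series /= big_geq// subr0.
  apply: nondecreasing_cvgn_le; last exact: ha.
  by apply: nondecreasing_series => k _ _; exact: abs_terms_ge0.
have mf := measurable_circle_power_expansion hf r0 r1.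
have [] := @dominated_convergence _ _ _ mu circ (measurable_itv _)
  (fun n t => (modulus (psum a n (r%:C%C * circle_pt t)) ^+ 2)%:E)
  (fun t => (modulus (f (r%:C%C * circle_pt t)) ^+ 2)%:E) (fun=> (B ^+ 2)%:E).
- move=> n; apply/measurable_EFinP; apply: measurable_funTS; apply: continuous_measurable_fun.
  by have [] := parseval_poly a n r.
- by apply/measurable_EFinP; apply: measurable_funTS; exact: measurable_funX.
- apply: aeW => t _; apply: cvg_EFin; first exact: nearW.
  under eq_cvg do rewrite /= expr2.
  by rewrite expr2; apply: cvgM; apply: cvg_modulus; exact: power_expansion_cvg hf (hd t).
- apply: (@integrable_period _ (fun=> B ^+ 2)); exact: cst_continuous.
- by apply: aeW => t n _; rewrite abse_EFin lee_fin ger0_norm ?sqr_ge0// lerXn2r ?nnegrE ?modulus_ge0.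
move=> _ _ h; rewrite -(cvg_lim _ h)//; apply: cvg_lim => //.
rewrite (_ : (fun n => _) = (fun n => (2 * pi * \sum_(k < n) sq_terms a r k)%:E)); last first.
  by apply/funext => n; have [_] := parseval_poly a n r.
apply: cvg_EFin; first exact: nearW.
apply: cvgM; first exact: cvg_cst.
have := is_cvg_sq_terms ha r0 r1; rewrite /M2sq /series /=.
by under eq_fun do rewrite big_mkord.
Qed.

End square_mean.

(** * From tent spaces to dyadic square means *)

Section tent_to_square_mean.
Variable R : realType.
Implicit Types (a : nat -> Cplx R) (f : Cplx R -> Cplx R) (r s t p q u v alpha : R).
Local Notation mu := (@lebesgue_measure R).
Local Notation circ := (`[0%R, (2 * pi)%R]%classic : set R).

(** The square of eps^s M_2, hence the exponent [u / 2] in [block_sum]. Radii start at [dyrad 1]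
    because the discs about a ray point lie in the cone only from there on. *)
Definition block a s k : R := eps R k.+1 `^ (2 * s) * M2sq a (dyrad R k.+1).

Definition block_sum u s a : \bar R := (\sum_(k <oo) (block a s k `^ (u / 2))%:E)%E.

Lemma block_ge0 a s k : absconv a -> 0 <= block a s k.
Proof. by move=> ha; rewrite mulr_ge0 ?powR_ge0// M2sq_ge0// ?dyrad_ge0// dyrad_lt1. Qed.

Lemma block_shift a s s' k : block a s' k = eps R k.+1 `^ (2 * (s' - s)) * block a s k.
Proof.
rewrite /block mulrA -powRD ?(gt_eqF (eps_gt0 _ _)) ?implybT//.
by congr (_ `^ _ * _); ring.
Qed.

Lemma nneseries_lty_bounded (x : nat -> R) : (forall k, 0 <= x k) ->
  (\sum_(k <oo) (x k)%:E < +oo)%E -> exists2 M, 0 < M & forall k, x k <= M.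
Proof.
move=> x0 h; set S := (\sum_(k <oo) (x k)%:E)%E in h.
have S0 : (0 <= S)%E by apply: nneseries_ge0 => k _ _; rewrite lee_fin.
exists (fine S + 1) => [|k]; first by rewrite ltr_wpDl// fine_ge0.
have : ((x k)%:E <= S)%E by apply: (term_le_nneseries (u := fun k => (x k)%:E)) => n; rewrite lee_fin.
rewrite -(fineK (_ : S \is a fin_num)) ?ge0_fin_numE// lee_fin => h1.
by apply: le_trans h1 _; rewrite lerDl.
Qed.

(** If s increases, boundedness of the old terms suffices, since the new ones gain a geometric
    factor. If s is unchanged, this is the inclusion of l^u into l^u'. *)
Lemma block_sum_mono a u s u' s' : absconv a -> 0 < u -> 0 < u' ->
  s < s' \/ s = s' /\ u <= u' ->
  (block_sum u s a < +oo)%E -> (block_sum u' s' a < +oo)%E.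
Proof.
move=> ha u0 u'0 hs hS.
have b0 k : 0 <= block a s k by exact: block_ge0.
have [M M0 hM] := nneseries_lty_bounded (fun k => powR_ge0 _ _) hS.
have [{hs}ss'|[<- uu']] := hs; last first.
  have h k : block a s k `^ (u' / 2) <= M `^ ((u' - u) / u) * block a s k `^ (u / 2).
    have -> : u' / 2 = u / 2 * (u' / u) by field; rewrite gt_eqF.
    rewrite powRrM -(mulr_powRB1 (powR_ge0 _ _)) ?divr_gt0// mulrC ler_wpM2r ?powR_ge0//.
    have -> : u' / u - 1 = (u' - u) / u by field; rewrite gt_eqF.
    by apply: ge0_ler_powR; rewrite ?nnegrE ?powR_ge0 ?divr_ge0 ?subr_ge0 ?(ltW M0) ?(ltW u0).
  apply: (@le_lt_trans _ _ ((M `^ ((u' - u) / u))%:E * block_sum u s a)%E).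
    rewrite /block_sum -nneseriesZl; last by move=> k _; rewrite lee_fin powR_ge0.
    apply: lee_nneseries => [k _ _|k _]; first by rewrite lee_fin powR_ge0.
    by rewrite -EFinM lee_fin.
  by rewrite lte_mul_pinfty ?lee_fin ?powR_ge0.
pose d := 2 * (s' - s) * (u' / 2).
have d0 : 0 < d by rewrite !mulr_gt0 ?divr_gt0 ?subr_gt0.
have hb k : block a s k `^ (u' / 2) <= M `^ (u' / u).
  have -> : u' / 2 = u / 2 * (u' / u) by field; rewrite gt_eqF.
  rewrite powRrM; apply: ge0_ler_powR; rewrite ?nnegrE ?powR_ge0 ?(ltW M0)//.
  by rewrite divr_ge0 ?(ltW u0) ?(ltW u'0).
have q0 : 0 < 2^-1 `^ d :> R by rewrite powR_gt0// invr_gt0.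
have q1 : 2^-1 `^ d < 1 :> R.
  rewrite -[ltRHS](one_powR d); apply: gt0_ltr_powR; rewrite ?nnegrE ?invr_ge0//.
  by rewrite invf_lt1// ltr1n.
have h k : block a s' k `^ (u' / 2) <= M `^ (u' / u) * (2^-1 `^ d) ^+ k.
  rewrite (block_shift a s) powRM ?powR_ge0// mulrC; apply: ler_pM; rewrite ?powR_ge0//.
  rewrite -powRrM -/d -powR_exprn ?invr_ge0//.
  by apply: ge0_ler_powR; rewrite ?nnegrE ?eps_ge0 ?exprn_ge0 ?invr_ge0 ?(ltW d0)//; exact: eps_anti.
apply: (@le_lt_trans _ _ ((M `^ (u' / u))%:E * ((1 - 2^-1 `^ d)^-1)%:E)%E); last by rewrite -EFinM ltry.
apply: (@le_trans _ _ ((M `^ (u' / u))%:E * \sum_(k <oo) ((2^-1 `^ d) ^+ k)%:E)%E); last first.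
  by apply: lee_wpmul2l; [rewrite lee_fin powR_ge0|apply: geometric_nneseries_le => //; exact: ltW].
rewrite -nneseriesZl; last by move=> k _; rewrite lee_fin exprn_ge0 ?(ltW q0).
apply: lee_nneseries => [k _ _|k _]; first by rewrite lee_fin powR_ge0.
by rewrite -EFinM lee_fin.
Qed.

Definition ray_term f s k t : R := eps R k.+1 `^ s * modulus (f (dyrad_pt k.+1 t)).

Lemma ray_term_ge0 f s k t : 0 <= ray_term f s k t.
Proof. by rewrite mulr_ge0 ?powR_ge0 ?modulus_ge0. Qed.

Lemma measurable_ray_term f a s k : power_expansion f a -> measurable_fun setT (ray_term f s k).
Proof.
move=> hf; apply: measurable_funM; first exact: measurable_cst.
by apply: measurable_circle_power_expansion hf _ _; [exact: dyrad_ge0|exact: dyrad_lt1].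
Qed.

Lemma integral_ray_term_sq f a s k : power_expansion f a ->
  (\int[mu]_(t in circ) (ray_term f s k t ^+ 2)%:E = (2 * pi * block a s k)%:E)%E.
Proof.
move=> hf; under eq_integral do rewrite /ray_term exprMn EFinM.
rewrite ge0_integralZl_EFin ?sqr_ge0//.
- rewrite (parseval hf (dyrad_ge0 R _) (dyrad_lt1 R _)) -EFinM; congr (_%:E).
  rewrite /block mulrCA; congr (_ * (_ * _)).
  by rewrite -powR_mulrn ?powR_ge0// -powRrM mulrC.
- by move=> t _; rewrite lee_fin sqr_ge0.
- apply/measurable_EFinP; apply: measurable_funTS; apply: measurable_funX.
  by apply: measurable_circle_power_expansion hf _ _; [exact: dyrad_ge0|exact: dyrad_lt1].
Qed.

Lemma ray_term_powR f q alpha k t : 0 < q ->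
  ray_term f ((alpha + 2) / q) k t `^ q = modulus (f (dyrad_pt k.+1 t)) `^ q * eps R k.+1 `^ (alpha + 2).
Proof.
move=> q0; rewrite powRM ?powR_ge0 ?modulus_ge0// -powRrM divfK ?gt_eqF//.
by rewrite mulrC.
Qed.

Lemma measurable_cone_integral q alpha f a : 0 < q -> power_expansion f a ->
  measurable_fun setT (fun t => cone_integral q alpha f (circle_pt t)).
Proof.
move=> q0 hf.
rewrite (_ : (fun t => _) = (fun t => cone_meas q alpha a
    [set w | [set tw : R * (R * R) | coneset tw.1 tw.2] (t, w)])); last first.
  by apply/funext => t; exact: cone_integralE.
exact: measurable_cone_meas1 (@measurable_coneset2 R).
Qed.

Lemma cone_integral_ge0 q alpha f t : (0 <= cone_integral q alpha f (circle_pt t))%E.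
Proof. by apply: integral_ge0 => w _; rewrite lee_fin mulr_ge0 ?powR_ge0. Qed.

Definition ray_sum f q s t : \bar R := (\sum_(k <oo) (ray_term f s k t `^ q)%:E)%E.

Lemma ray_sum_ge0 f q s t : (0 <= ray_sum f q s t)%E.
Proof. by apply: nneseries_ge0 => k _ _; rewrite lee_fin powR_ge0. Qed.

Lemma measurable_ray_sum f a q s : power_expansion f a -> measurable_fun setT (ray_sum f q s).
Proof.
move=> hf; apply: ge0_emeasurable_sum => [k t _ _|k _]; first by rewrite lee_fin powR_ge0.
apply/measurable_EFinP; apply: (meas_comp (f := fun x => x `^ q)); first exact: measurable_powR.
exact: measurable_ray_term hf.
Qed.

Lemma ray_sum_le_cone q alpha : 0 < q -> exists2 c, 0 < c & forall f a t,
  power_expansion f a ->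
  (c%:E * ray_sum f q ((alpha + 2) / q) t <= cone_integral q alpha f (circle_pt t))%E.
Proof.
move=> q0; have [c c0 H] := cone_ge_series alpha q0.
exists c => // f a t hf; rewrite (cone_integralE _ _ q0 hf); apply: le_trans (H f a t hf).
apply: lee_wpmul2l; first by rewrite lee_fin ltW.
by rewrite /ray_sum; under eq_eseriesr do rewrite ray_term_powR//.
Qed.

Lemma poweR_le_1D (x : \bar R) r s : (0 <= x)%E -> 0 <= r -> r <= s -> (x `^ r <= 1 + x `^ s)%E.
Proof.
move=> x0 r0 rs; case: x x0 => [x| |]//.
  rewrite lee_fin => x0; rewrite !poweR_EFin -EFinD lee_fin.
  have [x1|x1] := leP x 1.
    rewrite -[leLHS]addr0 lerD ?powR_ge0//.
    rewrite -[leRHS](one_powR r); apply: ge0_ler_powR; rewrite ?nnegrE//.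
  by rewrite -[leLHS]add0r lerD// ler_powR// ltW.
move=> _; have [->|r0'] := eqVneq r 0; first by rewrite poweRe0 leeDl ?poweR_ge0.
by rewrite (@poweRyr _ s) ?addey ?leey// gt_eqF// (lt_le_trans _ rs)// lt_def r0'.
Qed.

(** The circle has finite measure, so x^r <= 1 + x^s lowers the exponent of integrability. *)
Lemma integral_poweR_1D (g : R -> \bar R) r s : measurable_fun setT g -> (forall t, (0 <= g t)%E) ->
  0 <= r -> r <= s -> (\int[mu]_(t in circ) (g t `^ s) < +oo)%E ->
  (\int[mu]_(t in circ) (g t `^ r) < +oo)%E.
Proof.
move=> mg g0 r0 rs h.
have m r' : measurable_fun circ (fun t => g t `^ r')%E.
  by apply: measurable_funTS; apply: (meas_comp (f := fun x => (x `^ r')%E)) => //; exact: measurable_poweR.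
apply: (@le_lt_trans _ _ (\int[mu]_(t in circ) (1 + g t `^ s))%E).
  apply: ge0_le_integral => //.
  - by move=> t _; exact: poweR_ge0.
  - exact: m.
  - exact: emeasurable_funD (measurable_cst _) (m s).
  - by move=> t _; exact: poweR_le_1D.
rewrite ge0_integralD//; last 2 first.
- by move=> t _; exact: poweR_ge0.
- exact: m.
rewrite lte_add_pinfty// integral_cst//= mul1e lebesgue_measure_itv/=.
by case: ifP => _; rewrite ?ltry// -EFinB ltry.
Qed.

Lemma powR_div (x y r : R) : 0 <= x -> 0 < y -> (x / y) `^ r = x `^ r / y `^ r.
Proof.
move=> x0 y0; rewrite powRM ?invr_ge0 ?(ltW y0)//; congr (_ * _).
by rewrite -[LHS]mulr1 -(mulfV (lt0r_neq0 (powR_gt0 r y0))) mulrA -powRM ?invr_ge0 ?(ltW y0)// mulVf ?gt_eqF// one_powR mul1r.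
Qed.

Lemma young_normalized (w y A Y b : R) : 1 < b -> 0 <= w -> 0 <= y -> 0 < A -> 0 < Y ->
  w `^ (b - 1) / A `^ (1 - b^-1) * (y / Y `^ (b^-1)) <=
  w `^ b / A * (1 - b^-1) + y `^ b / Y * b^-1.
Proof.
move=> b1 w0 y0 A0 Y0; have b0 : 0 < b by apply: lt_trans b1.
have bb : 0 < b - 1 by rewrite subr_gt0.
pose b' := b / (b - 1).
have b'0 : 0 < b' by rewrite divr_gt0.
have e : b'^-1 = 1 - b^-1 by rewrite /b'; field; rewrite !gt_eqF.
have bb' : b'^-1 + b^-1 = 1 by rewrite e subrK.
have u0 : 0 <= w `^ (b - 1) / A `^ (1 - b^-1) by rewrite divr_ge0 ?powR_ge0.
have v0 : 0 <= y / Y `^ (b^-1) by rewrite divr_ge0 ?powR_ge0.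
apply: le_trans (conjugate_powR u0 v0 b'0 b0 bb') _.
apply: eq_ler; rewrite e; congr (_ * _ + _ * _).
  rewrite powR_div ?powR_ge0 ?powR_gt0// -!powRrM; congr (_ `^ _ / _).
    by rewrite /b'; field; rewrite gt_eqF.
  have -> : (1 - b^-1) * b' = 1 by rewrite /b'; field; rewrite !gt_eqF.
  by rewrite powRr1 ?(ltW A0).
rewrite powR_div ?powR_gt0// -powRrM mulVf ?gt_eqF//.
by rewrite powRr1 ?(ltW Y0).
Qed.

(** The weights w^(b - 1) are extremal in l^b duality: at the point of use w is the circle average
    of y, so the left side averages to the sum of w^b. *)
Lemma holder_finite n (w y : nat -> R) (b : R) : 1 < b -> (forall k, 0 <= w k) -> (forall k, 0 <= y k) ->
  \sum_(k < n) w k `^ (b - 1) * y k <=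
  (\sum_(k < n) w k `^ b) `^ (1 - b^-1) * (\sum_(k < n) y k `^ b) `^ (b^-1).
Proof.
move=> b1 w0 y0; have b0 : 0 < b by apply: lt_trans b1.
have bb : 0 < b - 1 by rewrite subr_gt0.
set A := \sum_(k < n) w k `^ b; set Y := \sum_(k < n) y k `^ b.
have A0 : 0 <= A by apply: sumr_ge0 => k _; exact: powR_ge0.
have Y0 : 0 <= Y by apply: sumr_ge0 => k _; exact: powR_ge0.
have zero (v : nat -> R) : \sum_(k < n) v k `^ b = 0 -> forall k : 'I_n, v k = 0.
  move=> /eqP; rewrite psumr_eq0 => [/allP h k|k _]; last exact: powR_ge0.
  by have := h k (mem_index_enum _); rewrite /= powR_eq0 => /andP[/eqP].
have [A00|Ap] := eqVneq A 0.
  rewrite big1 ?mulr_ge0 ?powR_ge0// => k _.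
  by rewrite (zero w A00) powR0 ?mul0r// gt_eqF.
have [Y00|Yp] := eqVneq Y 0.
  by rewrite big1 ?mulr_ge0 ?powR_ge0// => k _; rewrite (zero y Y00) mulr0.
have {}A0 : 0 < A by rewrite lt_def Ap.
have {}Y0 : 0 < Y by rewrite lt_def Yp.
pose U := A `^ (1 - b^-1) * Y `^ (b^-1).
have U0 : 0 < U by rewrite mulr_gt0 ?powR_gt0.
suff h : \sum_(k < n) (w k `^ (b - 1) / A `^ (1 - b^-1)) * (y k / Y `^ (b^-1)) <= 1.
  have -> : \sum_(k < n) w k `^ (b - 1) * y k =
    U * \sum_(k < n) (w k `^ (b - 1) / A `^ (1 - b^-1)) * (y k / Y `^ (b^-1)).
    rewrite mulr_sumr; apply: eq_bigr => k _; rewrite /U.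
    move: (powR_gt0 (1 - b^-1) A0) (powR_gt0 (b^-1) Y0).
    move: (A `^ _) (Y `^ _) (w k `^ _) (y k); clear => A Y w y A0 Y0.
    by field; rewrite !gt_eqF.
  by rewrite -[leRHS]mulr1 ler_pM2l.
apply: (@le_trans _ _ (\sum_(k < n) ((w k `^ b / A) * (1 - b^-1) + (y k `^ b / Y) * b^-1))).
  by apply: ler_sum => k _; exact: young_normalized.
rewrite big_split /= -!mulr_suml -/A -/Y !divff ?gt_eqF// !mul1r.
by rewrite subrK.
Qed.

(** As p >= 2, the circle exponent can be lowered to 2 / q, which leaves the integral of the q-th
    ray sum to that power. For q <= 2 the inclusion of l^q into l^2 and Parseval conclude; for q > 2
    the sum over radii and the integral are exchanged by duality. *)
Theorem tent_block_sum_ge2 p q alpha f a : 0 < q -> 2 <= p -> power_expansion f a ->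
  (tent_norm_pow p q alpha f < +oo)%E ->
  (block_sum (Num.max 2 q)%R ((alpha + 2) / q) a < +oo)%E.
Proof.
move=> q0 p2 hf hJ; set s := (alpha + 2) / q.
have ha := power_expansion_absconv hf.
have [c c0 hc] := ray_sum_le_cone alpha q0.
have p0 : 0 < p by apply: lt_le_trans p2.
have pi20 : 0 < 2 * pi :> R by rewrite mulr_gt0// pi_gt0.
have mG := measurable_ray_sum q s hf.
have mGr r : measurable_fun circ (fun t => ray_sum f q s t `^ r)%E.
  by apply: measurable_funTS; apply: (meas_comp (f := fun x => (x `^ r)%E)) => //; exact: measurable_poweR.
have mC := measurable_cone_integral alpha q0 hf.
have hK : (\int[mu]_(t in circ) (ray_sum f q s t `^ (2 / q)) < +oo)%E.
  have h := integral_poweR_1D (r := 2 / q) mC (fun t => cone_integral_ge0 _ _ _ _) _ _ hJ.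
  have {}h : (\int[mu]_(t in circ) (cone_integral q alpha f (circle_pt t) `^ (2 / q)) < +oo)%E.
    by apply: h; rewrite ?divr_ge0 ?(ltW q0)// ler_pM2r// invr_gt0.
  apply: (@le_lt_trans _ _ (\int[mu]_(t in circ) ((c^-1 `^ (2 / q))%:E * (cone_integral q alpha f (circle_pt t) `^ (2 / q))))%E).
    apply: ge0_le_integral => //.
    - by move=> t _; exact: poweR_ge0.
    - exact: mGr.
    - apply: emeasurable_funM; first exact: measurable_cst.
      by apply: measurable_funTS; apply: (meas_comp (f := fun x => (x `^ (2 / q))%E)) => //; exact: measurable_poweR.
    - move=> t _; rewrite -poweR_EFin -poweRM ?lee_fin ?invr_ge0 ?(ltW c0) ?cone_integral_ge0//.
      apply: poweR_le; rewrite ?divr_ge0 ?(ltW q0) ?ray_sum_ge0//.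
      rewrite -[leLHS]mul1e -(mulVf (lt0r_neq0 c0)) EFinM -muleA.
      by apply: lee_wpmul2l; [rewrite lee_fin invr_ge0 ltW|exact: hc hf].
  rewrite ge0_integralZl_EFin ?powR_ge0//.
  - by rewrite lte_mul_pinfty ?lee_fin ?powR_ge0.
  - by move=> t _; exact: poweR_ge0.
  - by apply: measurable_funTS; apply: (meas_comp (f := fun x => (x `^ (2 / q))%E)) => //; exact: measurable_poweR.
have [q2|q2] := leP q 2.
  rewrite /block_sum; under eq_eseriesr do rewrite divff// powRr1 ?block_ge0//.
  apply: (@le_lt_trans _ _ (\sum_(k <oo) ((2 * pi)^-1)%:E * (2 * pi * block a s k)%:E)%E).
    apply: lee_nneseries => [k _ _|k _]; first by rewrite lee_fin block_ge0.
    by rewrite -EFinM mulKf ?gt_eqF.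
  rewrite nneseriesZl; last by move=> k _; rewrite lee_fin mulr_ge0 ?(ltW pi20)// block_ge0.
  rewrite lte_mul_pinfty ?lee_fin ?invr_ge0 ?(ltW pi20)//.
  under eq_eseriesr do rewrite -(integral_ray_term_sq _ _ hf).
  rewrite -integral_nneseries//; last 2 first.
  - move=> k; apply/measurable_EFinP; apply: measurable_funTS; apply: measurable_funX.
    exact: measurable_ray_term hf.
  - by move=> k t _; rewrite lee_fin sqr_ge0.
  apply: le_lt_trans hK; apply: ge0_le_integral => //.
  - by move=> t _; apply: nneseries_ge0 => k _ _; rewrite lee_fin sqr_ge0.
  - apply: measurable_funTS; apply: ge0_emeasurable_sum => [k t _ _|k _]; first by rewrite lee_fin sqr_ge0.
    by apply/measurable_EFinP; apply: measurable_funX; exact: measurable_ray_term hf.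
  - exact: mGr.
  - move=> t _; apply: le_trans (nneseries_powR (x := fun k => ray_term f s k t `^ q) _ _).
    + apply: lee_nneseries => [k _ _|k _]; first by rewrite lee_fin sqr_ge0.
      rewrite lee_fin -powRrM mulrCA divff ?gt_eqF// mulr1 powR_mulrn//.
      exact: ray_term_ge0.
    + by move=> k; exact: powR_ge0.
    + by rewrite ler_pdivlMr// mul1r.
have b1 : 1 < q / 2 by rewrite ltr_pdivlMr// mul1r.
have b0 : 0 < q / 2 by apply: lt_trans b1.
set K := (\int[mu]_(t in circ) _)%E in hK.
have K0 : (0 <= K)%E by apply: integral_ge0 => t _; exact: poweR_ge0.
have [k0 Kk] : exists k0, K = k0%:E.
  by exists (fine K); rewrite fineK// ge0_fin_numE.
suff h n : \sum_(k < n) block a s k `^ (q / 2) <= (k0 / (2 * pi)) `^ (q / 2).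
  apply: (@le_lt_trans _ _ ((k0 / (2 * pi)) `^ (q / 2))%:E); last exact: ltry.
  apply: nneseries_le_of_partial => [k|n]; first by rewrite lee_fin powR_ge0.
  by rewrite sumEFin lee_fin.
set W := \sum_(k < n) _.
have W0 : 0 <= W by apply: sumr_ge0 => k _; exact: powR_ge0.
have [->|Wn] := eqVneq W 0; first exact: powR_ge0.
have {}W0 : 0 < W by rewrite lt_def Wn.
pose b := q / 2.
(* Parseval at each radius produces one factor [block], which the weight completes to the b-th
   power. *)
have key : (2 * pi * W)%:E = (\int[mu]_(t in circ) (\sum_(k < n) block a s k `^ (b - 1) * ray_term f s k t ^+ 2)%:E)%E.
  under eq_integral do rewrite -sumEFin.
  rewrite ge0_integral_sum//; last 2 first.
  - move=> k; apply/measurable_EFinP; apply: measurable_funTS; apply: measurable_funM; first exact: measurable_cst.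
    by apply: measurable_funX; exact: measurable_ray_term hf.
  - by move=> k t _; rewrite lee_fin mulr_ge0 ?powR_ge0 ?sqr_ge0.
  rewrite /W mulr_sumr -sumEFin; apply: eq_bigr => k _.
  under eq_integral do rewrite EFinM.
  rewrite ge0_integralZl_EFin ?powR_ge0//.
  - rewrite (integral_ray_term_sq _ _ hf) -EFinM; congr (_%:E).
    by rewrite mulrCA -/b -(mulr_powRB1 (block_ge0 _ _ ha) b0) [X in _ = _ * X]mulrC.
  - by move=> t _; rewrite lee_fin sqr_ge0.
  - apply/measurable_EFinP; apply: measurable_funTS; apply: measurable_funX.
    exact: measurable_ray_term hf.
have : ((2 * pi * W)%:E <= (W `^ (1 - b^-1))%:E * K)%E.
  rewrite key /K -ge0_integralZl_EFin ?powR_ge0//; last 2 first.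
  - by move=> t _; exact: poweR_ge0.
  - exact: mGr.
  apply: ge0_le_integral => //.
  - by move=> t _; rewrite lee_fin; apply: sumr_ge0 => k _; rewrite mulr_ge0 ?powR_ge0 ?sqr_ge0.
  - apply/measurable_EFinP; apply: measurable_funTS; apply: measurable_sum => k.
    apply: measurable_funM; first exact: measurable_cst.
    by apply: measurable_funX; exact: measurable_ray_term hf.
  - exact: emeasurable_funM (measurable_cst _) (mGr _).
  - move=> t _; apply: (@le_trans _ _ ((W `^ (1 - b^-1) * (\sum_(k < n) ray_term f s k t `^ q) `^ (2 / q))%:E)).
      rewrite lee_fin; apply: le_trans (holder_finite _ b1 (fun k => block_ge0 s k ha) (fun k => sqr_ge0 (ray_term f s k t))) _.
      rewrite ler_wpM2l ?powR_ge0// /b invf_div; apply: eq_ler; congr (_ `^ _).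
      apply: eq_bigr => k _; rewrite -powR_mulrn ?ray_term_ge0// -powRrM mulrCA divff ?mulr1//.
    rewrite EFinM; apply: lee_wpmul2l; first by rewrite lee_fin powR_ge0.
    rewrite -poweR_EFin; apply: poweR_le; first by rewrite divr_ge0 ?(ltW q0).
      by rewrite lee_fin; apply: sumr_ge0 => k _; exact: powR_ge0.
    rewrite -sumEFin; apply: (nneseries_ge_partial (u := fun k => (ray_term f s k t `^ q)%:E)).
    by move=> k; rewrite lee_fin powR_ge0.
rewrite Kk -EFinM lee_fin => h.
(* Dividing by W^(1 - 1/b) is legitimate because W is a finite nonzero partial sum; the resulting
   bound does not depend on n. *)
have h2 : W `^ b^-1 <= k0 / (2 * pi).
  rewrite ler_pdivlMr// -(ler_pM2l (powR_gt0 (1 - b^-1) W0)) mulrA -powRD; last by rewrite Wn implybT.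
  by rewrite subrK powRr1 ?(ltW W0)// mulrC.
have -> : W = (W `^ b^-1) `^ (q / 2) by rewrite -powRrM mulVf ?gt_eqF// powRr1// ltW.
by apply: ge0_ler_powR; rewrite ?nnegrE ?powR_ge0 ?(ltW b0)//; apply: le_trans h2; exact: powR_ge0.
Qed.

(** For x > 1 the single level with 2^j < x <= 2^(j + 1) already contributes 4^(j + 1) >= x^2. *)
Lemma sqr_le_dyadic_levels (x : R) : 0 <= x ->
  ((x ^+ 2)%:E <= 1 + \sum_(j <oo) (4 ^+ j.+1 * ((2 ^+ j < x)%R : nat)%:R)%:E)%E.
Proof.
move=> x0.
have S0 : (0 <= \sum_(j <oo) (4 ^+ j.+1 * ((2 ^+ j < x)%R : nat)%:R : R)%:E)%E.
  by apply: nneseries_ge0 => j _ _; rewrite lee_fin mulr_ge0 ?exprn_ge0.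
have [x1|x1] := leP x 1.
  by rewrite -[leLHS]adde0 leeD// lee_fin expr_le1.
have [j [h1 h2]] : exists j, 2 ^+ j < x /\ x <= 2 ^+ j.+1.
  have ex : exists n, x <= 2 ^+ n.
    exists (Num.truncn x).+1; apply: le_trans (ltW (truncnS_gt _)) _.
    by rewrite -natrX ler_nat ltnW// ltn_expl.
  case: (ex_minnP ex) => -[|n]; first by rewrite expr0 leNgt x1.
  move=> h2 hn; exists n; split => //; rewrite ltNge; apply/negP => /hn.
  by rewrite ltnn.
rewrite -[leLHS]add0e leeD//.
apply: le_trans (term_le_nneseries (u := fun j => (4 ^+ j.+1 * ((2 ^+ j < x)%R : nat)%:R : R)%:E) j _).
  rewrite h1 mulr1 lee_fin.
  have -> : (4 : R) = 2 ^+ 2 by rewrite -natrX.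
  by rewrite exprAC lerXn2r ?nnegrE ?exprn_ge0.
by move=> n; rewrite lee_fin mulr_ge0 ?exprn_ge0.
Qed.

End tent_to_square_mean.

(** * Tent spaces with p < 2 *)

Section tent_lt2.
Variable R : realType.
Implicit Types (a : nat -> Cplx R) (f : Cplx R -> Cplx R) (r s t p q u v alpha : R).
Local Notation mu := (@lebesgue_measure R).
Local Notation circ := (`[0%R, (2 * pi)%R]%classic : set R).

Lemma sum_epsS_below (s z : R) n : 0 < s -> 0 <= z ->
  \sum_(k < n | (eps R k.+1 <= z)) eps R k.+1 `^ s <= (1 - 2^-1 `^ s)^-1 * z `^ s.
Proof.
move=> s0 z0; have [z00|zn] := eqVneq z 0.
  rewrite big1 => [|k]; first by rewrite z00 powR0 ?mulr0// gt_eqF.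
  by rewrite z00 leNgt eps_gt0.
apply: le_trans (sum_eps_below n.+1 s0 (_ : 0 < z)); last by rewrite lt_def zn.
rewrite [leLHS]big_mkcond [leRHS]big_mkcond big_ord_recl /= -[leLHS]add0r lerD//.
by case: ifP => // _; exact: powR_ge0.
Qed.

Lemma poweR_1D_le (x : \bar R) r : (0 <= x)%E -> 0 < r ->
  ((1 + x) `^ r <= (2 `^ r)%:E * (1 + x `^ r))%E.
Proof.
move=> x0 r0; case: x x0 => [x| |]//; last first.
  by move=> _; rewrite !(@poweRyr _ r) ?gt_eqF// addey// muleC gt0_mulye ?leey// lte_fin powR_gt0.
rewrite lee_fin => x0.
change (((1 + x) `^ r)%:E <= (2 `^ r * (1 + x `^ r))%:E)%E; rewrite lee_fin.
have [x1|x1] := leP x 1.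
  apply: (@le_trans _ _ (2 `^ r)).
    by apply: ge0_ler_powR; rewrite ?nnegrE ?(ltW r0)//; lra.
  by rewrite ler_peMr ?powR_ge0// lerDl powR_ge0.
apply: (@le_trans _ _ ((2 * x) `^ r)).
  by apply: ge0_ler_powR; rewrite ?nnegrE ?(ltW r0)//; lra.
by rewrite powRM// ler_wpM2l ?powR_ge0// lerDr.
Qed.

(** Layer-cake at dyadic heights: for fixed t the levels with c 2^(j q) < g(t) give a geometric sum
    of 2^(j p), dominated by g(t)^(p/q) up to a constant. *)
Lemma dyadic_level_sum (g : R -> \bar R) p q c : 0 < p -> 0 < q -> 0 < c ->
  measurable_fun setT g -> (forall t, (0 <= g t)%E) ->
  (\sum_(j <oo) ((2 ^+ j) `^ p)%:E *
      mu ([set t | ((c * (2 ^+ j) `^ q)%:E < g t)%E] `&` circ) <=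
   ((1 - 2 `^ (- p))^-1 * c^-1 `^ (p / q))%:E * \int[mu]_(t in circ) (g t `^ (p / q)))%E.
Proof.
move=> p0 q0 c0 mg g0; set E := fun j => [set t | ((c * (2 ^+ j) `^ q)%:E < g t)%E].
have mE j : measurable (E j).
  by rewrite -[E j]setTI; exact: emeasurable_fun_o_infty.
set K := (1 - 2 `^ (- p))^-1.
have K0 : 0 <= K.
  rewrite invr_ge0 subr_ge0 powRN invf_le1 ?powR_gt0// -[leLHS](one_powR p).
  by apply: ge0_ler_powR; rewrite ?nnegrE ?(ltW p0)// ler1n.
apply: nneseries_le_of_partial => [j|n]; first by rewrite mule_ge0 ?lee_fin ?powR_ge0.
have -> : (\sum_(j < n) ((2 ^+ j) `^ p)%:E * mu (E j `&` circ) =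
   \int[mu]_(t in circ) \sum_(j < n) (((2 ^+ j) `^ p)%:E * (\1_(E j) t)%:E))%E.
  rewrite ge0_integral_sum//; last first.
  - move=> j; apply: emeasurable_funM; first exact: measurable_cst.
    by apply: measurable_funTS; apply/measurable_EFinP; exact: measurable_indic (mE j).
  apply: eq_bigr => j _; rewrite ge0_integralZl_EFin ?powR_ge0//.
  - by rewrite (@integral_indic _ _ _ mu _ (measurable_itv _) _ (mE j)).
  - by apply: measurable_funTS; apply/measurable_EFinP; exact: measurable_indic (mE j).
have mgp : measurable_fun circ (fun t => g t `^ (p / q))%E.
  by apply: measurable_funTS; apply: (meas_comp (f := fun x => (x `^ (p / q))%E)) => //; exact: measurable_poweR.
rewrite -ge0_integralZl_EFin ?mulr_ge0 ?powR_ge0//; last by move=> t _; exact: poweR_ge0.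
apply: ge0_le_integral => //.
- by move=> t _; apply: sume_ge0 => j _; rewrite mule_ge0 ?lee_fin ?powR_ge0.
- apply: measurable_funTS; apply: emeasurable_sum => j; apply: emeasurable_funM => //.
  by apply/measurable_EFinP; exact: measurable_indic (mE j).
- exact: emeasurable_funM (measurable_cst _) mgp.
move=> t _.
have pq0 : p / q != 0 by rewrite gt_eqF// divr_gt0.
have c1 : 0 < c^-1 `^ (p / q) by rewrite powR_gt0// invr_gt0.
(* At an infinite value the constant in front must be shown nonzero, as 0 times infinity is 0. *)
have [->|gty] := eqVneq (g t) +oo%E.
  rewrite poweRyr// muleC.
  have [Kz|Kz] := eqVneq K 0; last by rewrite gt0_mulye ?leey// lte_fin mulr_gt0// lt_def Kz.
  exfalso; move/eqP: Kz; rewrite /K invr_eq0 subr_eq0 => /eqP Kz.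
  have : 2 `^ (- p) < 1 :> R.
    rewrite powRN invf_lt1 ?powR_gt0// -[ltLHS](one_powR p).
    by apply: gt0_ltr_powR; rewrite ?nnegrE// ltr1n.
  by rewrite -Kz ltxx.
have [x gx] : exists x, g t = x%:E.
  by exists (fine (g t)); rewrite fineK// ge0_fin_numE// ltey.
have x0 : 0 <= x by rewrite -lee_fin -gx.
rewrite gx poweR_EFin -EFinM.
under eq_bigr do rewrite -EFinM.
rewrite sumEFin lee_fin.
have hE (j : nat) : (\1_(E j) t : R) = ((2 ^+ j < (x / c) `^ q^-1)%R : nat)%:R.
  rewrite indicE; congr (nat_of_bool _)%:R; apply/idP/idP; rewrite inE /E /= gx lte_fin.
    move=> h; have -> : 2 ^+ j = ((2 ^+ j) `^ q) `^ q^-1 :> R.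
      by rewrite -powRrM mulfV ?gt_eqF// powRr1// exprn_ge0.
    apply: gt0_ltr_powR; rewrite ?nnegrE ?invr_gt0 ?powR_ge0 ?divr_ge0 ?(ltW c0)//.
    by rewrite ltr_pdivlMr// mulrC.
  move=> h; rewrite mulrC -ltr_pdivlMr//.
  have -> : x / c = ((x / c) `^ q^-1) `^ q.
    by rewrite -powRrM mulVf ?gt_eqF// powRr1// divr_ge0// ltW.
  by apply: gt0_ltr_powR; rewrite ?nnegrE ?powR_ge0 ?exprn_ge0.
under eq_bigr do rewrite hE.
have [x00|xn] := eqVneq x 0.
  rewrite big1 => [|j _]; first by rewrite !mulr_ge0 ?powR_ge0.
  rewrite x00 mul0r powR0 ?invr_eq0 ?gt_eqF// ltNge exprn_ge0//.
  by rewrite mulr0.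
have z0 : 0 < (x / c) `^ q^-1 by rewrite powR_gt0// divr_gt0// lt_def xn.
have := sum_pow2_below n p0 z0; rewrite -/K => h.
apply: le_trans (le_trans h _).
  rewrite [leRHS]big_mkcond; apply: eq_ler; apply: eq_bigr => j _.
  by case: ifP => _; rewrite ?mulr1 ?mulr0.
rewrite -powRrM -mulrA ler_wpM2l// mulrC [q^-1 * p]mulrC powRM ?invr_ge0 ?(ltW c0)//.
Qed.

(** Here m_j stands for the measure of the j-th level set, and level j acts at radius k only if eps
    <= 64 m_j. After raising to p / 2 < 1 termwise and exchanging sums, the admissible k contribute
    m_j^(1 - p/2), which joins m_j^(p/2) to restore m_j. *)
Lemma dyadic_weighted_sum (m b : nat -> R) p : 0 < p -> p < 2 ->
  (forall j, 0 <= m j) -> (forall k, 0 <= b k) ->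
  (\sum_(j <oo) ((2 ^+ j) `^ p * m j)%:E < +oo)%E ->
  (forall k, ((b k)%:E <= 1 + \sum_(j <oo) (4 ^+ j.+1 * m j * ((eps R k.+1 <= 64 * m j)%R : nat)%:R)%:E)%E) ->
  (\sum_(k <oo) (eps R k.+1 `^ (1 - p / 2) * b k `^ (p / 2))%:E < +oo)%E.
Proof.
move=> p0 p2 m0 b0 hm hb; set r := p / 2; set s := 1 - r.
have r0 : 0 < r by rewrite divr_gt0.
have r1 : r < 1 by rewrite ltr_pdivrMr// mul1r.
have s0 : 0 < s by rewrite subr_gt0.
set K := (1 - 2^-1 `^ s)^-1.
pose sel j k : R := ((eps R k.+1 <= 64 * m j)%R : nat)%:R.
pose y j k := 4 ^+ j.+1 * m j * sel j k.
have y0 j k : 0 <= y j k by rewrite !mulr_ge0 ?exprn_ge0// /sel; case: ifP.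
have key k : ((b k `^ r)%:E <= (2 `^ r)%:E * (1 + \sum_(j <oo) (y j k `^ r)%:E))%E.
  rewrite -poweR_EFin; apply: le_trans (poweR_le (ltW r0) _ (hb k)) _; first by rewrite lee_fin.
  apply: le_trans (poweR_1D_le _ r0) _.
    by apply: nneseries_ge0 => j _ _; rewrite lee_fin; exact: y0.
  apply: lee_wpmul2l; first by rewrite lee_fin powR_ge0.
  rewrite leeD2l//; apply: (poweR_nneseries (x := fun j => y j k)) => //; exact: ltW.
pose e k := eps R k.+1 `^ s.
have e0 k : 0 <= e k by exact: powR_ge0.
apply: (@le_lt_trans _ _ ((2 `^ r)%:E * (\sum_(k <oo) ((e k)%:E + \sum_(j <oo) (e k * y j k `^ r)%:E)))%E).
  rewrite -nneseriesZl; last first.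
    move=> k _; rewrite adde_ge0// ?lee_fin//; apply: nneseries_ge0 => j _ _.
    by rewrite lee_fin mulr_ge0 ?powR_ge0.
  apply: lee_nneseries => [k _ _|k _]; first by rewrite lee_fin mulr_ge0 ?powR_ge0.
  rewrite EFinM; apply: le_trans (lee_wpmul2l _ (key k)) _; first by rewrite lee_fin; exact: e0.
  rewrite muleCA; apply: lee_wpmul2l; first by rewrite lee_fin powR_ge0.
  have -> : (\sum_(j <oo) (e k * y j k `^ r)%:E = (e k)%:E * \sum_(j <oo) (y j k `^ r)%:E)%E.
    by rewrite -nneseriesZl// => j _; rewrite lee_fin powR_ge0.
  rewrite ge0_muleDr ?mule1//; apply: nneseries_ge0 => j _ _; rewrite lee_fin powR_ge0//.
rewrite lte_mul_pinfty ?lee_fin ?powR_ge0// nneseriesD; last 2 first.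
- by move=> k _; rewrite lee_fin.
- by move=> k _ _; apply: nneseries_ge0 => j _ _; rewrite lee_fin mulr_ge0 ?powR_ge0.
rewrite lte_add_pinfty//.
  apply: (@le_lt_trans _ _ K%:E); last exact: ltry.
  apply: nneseries_le_of_partial => [k|n]; first by rewrite lee_fin.
  rewrite sumEFin lee_fin; have := sum_epsS_below n s0 (@ler01 R).
  rewrite one_powR mulr1 => h; apply: le_trans h; apply: eq_ler.
  by rewrite [RHS]big_mkcond; apply: eq_bigr => k _; rewrite eps_le1.
rewrite nneseries_interchange; last by move=> k j; rewrite lee_fin mulr_ge0 ?powR_ge0.
pose C := K * 64 `^ s * 4 `^ r.
apply: (@le_lt_trans _ _ (C%:E * \sum_(j <oo) ((2 ^+ j) `^ p * m j)%:E)%E); last first.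
  rewrite lte_mul_pinfty// lee_fin !mulr_ge0 ?powR_ge0// invr_ge0 subr_ge0.
  rewrite -[leRHS](one_powR s); apply: ge0_ler_powR; rewrite ?nnegrE ?invr_ge0 ?(ltW s0)//.
  by rewrite invf_le1// ler1n.
rewrite -nneseriesZl; last by move=> j _; rewrite lee_fin mulr_ge0 ?powR_ge0.
apply: lee_nneseries => [j _ _|j _].
  by apply: nneseries_ge0 => k _ _; rewrite lee_fin mulr_ge0 ?powR_ge0.
apply: nneseries_le_of_partial => [k|n]; first by rewrite lee_fin mulr_ge0 ?powR_ge0.
rewrite sumEFin -EFinM lee_fin.
have m64 : 0 <= 64 * m j by rewrite mulr_ge0.
have h := sum_epsS_below n s0 m64.
apply: (@le_trans _ _ ((4 ^+ j.+1 * m j) `^ r * \sum_(k < n | eps R k.+1 <= 64 * m j) eps R k.+1 `^ s)).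
  rewrite mulr_sumr [leRHS]big_mkcond; apply: ler_sum => k _.
  rewrite /y /sel; case: ifP => _; first by rewrite mulr1 mulrC.
  by rewrite mulr0 powR0 ?mulr0// gt_eqF.
apply: le_trans (ler_wpM2l (powR_ge0 _ _) h) _.
rewrite -/K /C; apply: eq_ler.
have -> : (2 ^+ j) `^ p = (4 ^+ j) `^ r :> R.
  rewrite (_ : (4 : R) = 2 `^ 2); last by rewrite powR_mulrn// -natrX.
  by rewrite -powR_exprn ?exprn_ge0// !powR_exprn ?powR_ge0// -powRrM /r mulrCA divff// mulr1.
have hmj : m j = m j `^ s * m j `^ r.
  have [->|mn] := eqVneq (m j) 0; first by rewrite !powR0 ?mul0r// gt_eqF.
  by rewrite -powRD ?mn ?implybT// subrK powRr1.
rewrite exprS !powRM ?mulr_ge0 ?exprn_ge0// {3}hmj.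
by move: (_ `^ _) => A; ring.
Qed.

(** One half of the arc about t stays in [0, 2 pi]: the right half when t <= pi, the left half
    otherwise, as e <= pi. *)
Lemma arc_measure_ge t (e : R) (E : set R) : measurable E -> 0 < e -> e <= pi ->
  0 <= t -> t <= 2 * pi -> (forall t', 0 <= t' -> t' <= 2 * pi -> `|t - t'| <= e -> E t') ->
  (e%:E <= mu (E `&` circ))%E.
Proof.
move=> mE e0 epi t0 t2 h.
have [c [c0 c2 ct]] : exists c : R, [/\ 0 <= c, c + e <= 2 * pi & forall x, c <= x <= c + e -> `|t - x| <= e].
  have [tp|tp] := leP t pi.
    exists t; split => //; first by lra.
    by move=> x /andP[h1 h2]; rewrite distrC ger0_norm; lra.
  exists (t - e); split; [lra|lra|].
  by move=> x /andP[h1 h2]; rewrite ger0_norm; lra.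
have -> : e%:E = mu `[c, c + e]%classic.
  by rewrite lebesgue_measure_itv/= lte_fin ltrDl e0 -EFinB addrAC subrr add0r.
apply: le_measure; rewrite ?inE//.
  by apply: measurableI => //; exact: measurable_itv.
move=> x /=; rewrite !in_itv/= => /andP[h1 h2].
have x0 : 0 <= x by lra.
have x2 : x <= 2 * pi by lra.
by split; [apply: h => //; apply: ct; rewrite h1|rewrite x0].
Qed.

(** A ray term above 2^j at one angle forces the cone integral above c 2^(j q) on an arc of length
    comparable to eps. Levels whose set is shorter than that arc are therefore absent at radius k,
    and the square mean is summed over the remaining ones. *)
Theorem tent_block_sum_lt2 p q alpha f a : 0 < p -> 0 < q -> p < 2 -> power_expansion f a ->
  (tent_norm_pow p q alpha f < +oo)%E ->
  (block_sum p ((alpha + 2) / q + 1 / p - 1 / 2) a < +oo)%E.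
Proof.
move=> p0 q0 p2 hf hJ; set s := (alpha + 2) / q.
have ha := power_expansion_absconv hf.
have [c c0 hc] := cone_ge_point alpha q0.
have pi20 : 0 < 2 * pi :> R by rewrite mulr_gt0// pi_gt0.
have mC := measurable_cone_integral alpha q0 hf.
pose C t := cone_integral q alpha f (circle_pt t).
have C0 t : (0 <= C t)%E by exact: cone_integral_ge0.
pose E j := [set t | ((c * (2 ^+ j) `^ q)%:E < C t)%E].
have mE j : measurable (E j).
  rewrite -[E j]setTI; apply: emeasurable_fun_o_infty => //.
pose m j := fine (mu (E j `&` circ)).
have mcirc : mu circ = (2 * pi)%:E.
  by rewrite lebesgue_measure_itv/= lte_fin pi20 -EFinB subr0.
have mEfin j : mu (E j `&` circ) = (m j)%:E.
  rewrite /m fineK// ge0_fin_numE//; apply: (@le_lt_trans _ _ (mu circ)); last by rewrite mcirc ltry.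
  exact: (@measureIr _ _ _ mu _ _ (mE j) (measurable_itv _)).
have m0 j : 0 <= m j by rewrite fine_ge0.
have ray_E j k t t' : 2 ^+ j < ray_term f s k t -> `|t - t'| <= eps R k.+1 / 64 -> E j t'.
  move=> h1 h2; rewrite /E /C /= (cone_integralE _ _ q0 hf).
  apply: lt_le_trans (hc f a k.+1 t t' hf (ltn0Sn k) h2).
  rewrite lte_fin ltr_pM2l// -ray_term_powR//.
  by apply: gt0_ltr_powR; rewrite ?nnegrE ?exprn_ge0 ?ray_term_ge0.
(* An arc of length eps / 64 next to t lies in the level set, whose measure is m_j. *)
have ray_m j k t : circ t -> 2 ^+ j < ray_term f s k t -> eps R k.+1 <= 64 * m j.
  rewrite /= in_itv/= => /andP[t0 t2] h1.
  rewrite mulrC -ler_pdivrMr// -lee_fin -mEfin.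
  apply: (arc_measure_ge (t := t)) => //.
  - by rewrite divr_gt0// eps_gt0.
  - by have := eps_le1 R k.+1; have := pi_ge2 R; lra.
  - by move=> t' _ _; exact: ray_E h1.
pose sel j k : R := ((eps R k.+1 <= 64 * m j)%R : nat)%:R.
have sel0 j k : 0 <= sel j k by rewrite /sel ler0n.
pose L k j t : R := 4 ^+ j.+1 * ((2 ^+ j < ray_term f s k t)%R : nat)%:R.
have mL k j : measurable_fun setT (L k j).
  apply: measurable_funM; first exact: measurable_cst.
  pose A := [set t | 2 ^+ j < ray_term f s k t].
  have mA : measurable A.
    by apply: measurable_lt_set; [exact: measurable_cst|exact: measurable_ray_term hf].
  rewrite (_ : (fun t => _) = \1_A); first exact: measurable_indic mA.
  by apply/funext => t; rewrite indicE; congr (nat_of_bool _)%:R; apply/idP/idP; rewrite inE.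
have L0 k j t : 0 <= L k j t by rewrite mulr_ge0 ?exprn_ge0.
have intL k j : (\int[mu]_(t in circ) (L k j t)%:E <= (4 ^+ j.+1 * m j * sel j k)%:E)%E.
  rewrite /sel; case: (boolP (eps R k.+1 <= 64 * m j)) => hk; last first.
    rewrite mulr0 (@eq_integral _ _ _ _ _ (fun=> 0%E)) ?integral0// => t; rewrite inE => ht.
    rewrite /L; case: (boolP (_ < _)) => [h1|]; last by rewrite mulr0.
    by rewrite (ray_m j k t ht h1) in hk.
  rewrite mulr1.
  apply: (@le_trans _ _ (\int[mu]_(t in circ) ((4 ^+ j.+1)%:E * (\1_(E j) t)%:E))%E).
    apply: ge0_le_integral => //.
    - by move=> t _; rewrite lee_fin.
    - by apply/measurable_EFinP; apply: measurable_funTS; exact: mL.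
    - apply: emeasurable_funM; first exact: measurable_cst.
      by apply: measurable_funTS; apply/measurable_EFinP; exact: measurable_indic (mE j).
    - move=> t ht; rewrite -EFinM lee_fin ler_wpM2l ?exprn_ge0//.
      case: (boolP (_ < _)) => [h1|_]; last by rewrite indicE ler0n.
      rewrite indicE mem_set//; apply: ray_E h1 _.
      by rewrite subrr normr0 divr_ge0// eps_ge0.
  rewrite ge0_integralZl_EFin ?exprn_ge0//.
  - by rewrite (@integral_indic _ _ _ mu _ (measurable_itv _) _ (mE j)) EFinM -mEfin.
  - by apply: measurable_funTS; apply/measurable_EFinP; exact: measurable_indic (mE j).
have B_le k : ((2 * pi * block a s k)%:E <= (2 * pi)%:E + \sum_(j <oo) (4 ^+ j.+1 * m j * sel j k)%:E)%E.
  rewrite -(integral_ray_term_sq s k hf).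
  have mS : measurable_fun circ (fun t => \sum_(j <oo) (L k j t)%:E)%E.
    apply: measurable_funTS; apply: ge0_emeasurable_sum => [j t _ _|j _]; first by rewrite lee_fin.
    by apply/measurable_EFinP.
  apply: (@le_trans _ _ (\int[mu]_(t in circ) (1 + \sum_(j <oo) (L k j t)%:E))%E).
    apply: ge0_le_integral => //.
    - by move=> t _; rewrite lee_fin sqr_ge0.
    - apply/measurable_EFinP; apply: measurable_funTS; apply: measurable_funX.
      exact: measurable_ray_term hf.
    - exact: emeasurable_funD (measurable_cst _) mS.
    - by move=> t _; apply: sqr_le_dyadic_levels; exact: ray_term_ge0.
  rewrite ge0_integralD//; last by move=> t _; apply: nneseries_ge0 => j _ _; rewrite lee_fin.
  apply: leeD; first by rewrite integral_cst//= mul1e lebesgue_measure_itv/= lte_fin pi20 -EFinB subr0.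
  rewrite integral_nneseries//; last 2 first.
  - by move=> j; apply/measurable_EFinP; apply: measurable_funTS; exact: mL.
  - by move=> j t _; rewrite lee_fin.
  by apply: lee_nneseries => [j _ _|j _]; [apply: integral_ge0 => t _; rewrite lee_fin|exact: intL].
have hm : (\sum_(j <oo) ((2 ^+ j) `^ p * m j)%:E < +oo)%E.
  have := dyadic_level_sum p0 q0 c0 mC C0.
  rewrite (@eq_eseriesr _ _ (fun j => ((2 ^+ j) `^ p * m j)%:E)); last first.
    by move=> j _; rewrite [RHS]EFinM -mEfin.
  move=> h; apply: le_lt_trans h _.
  rewrite lte_mul_pinfty// lee_fin mulr_ge0 ?powR_ge0// invr_ge0 subr_ge0 powRN invf_le1 ?powR_gt0//.
  rewrite -[leLHS](one_powR p).
  by apply: ge0_ler_powR; rewrite ?nnegrE ?(ltW p0)// ler1n.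
have := dyadic_weighted_sum p0 p2 m0 (fun k => block_ge0 s k ha) hm.
have pi1 : (2 * pi)^-1 <= 1 :> R by rewrite invf_le1//; have := pi_ge2 R; lra.
move=> H; apply: le_lt_trans (H _).
  apply: lee_nneseries => [k _ _|k _]; first by rewrite lee_fin powR_ge0.
  rewrite lee_fin (block_shift a s) powRM ?powR_ge0 ?block_ge0// -powRrM.
  apply: eq_ler; congr (_ `^ _ * _); field.
  by rewrite gt_eqF.
move=> k; have hk := B_le k.
rewrite -(@lee_pmul2l _ (2 * pi)%:E) ?lte_fin// -EFinM; apply: le_trans hk _.
have S0 : (0 <= \sum_(j <oo) (4 ^+ j.+1 * m j * sel j k)%:E)%E.
  by apply: nneseries_ge0 => j _ _; rewrite lee_fin !mulr_ge0 ?exprn_ge0.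
rewrite ge0_muleDr// mule1 leeD2l//.
rewrite -[leLHS]mul1e; apply: lee_wpmul2r => //.
by rewrite lee_fin; have := pi_ge2 R; lra.
Qed.

End tent_lt2.

(** * Dyadic annuli *)

Section annuli.
Variable R : realType.
Implicit Types (a : nat -> Cplx R) (f : Cplx R -> Cplx R) (t u beta : R).

Definition annulus n : set (R * R) :=
  [set w | eps R n.+1 < 1 - modulus (of_plane w) <= eps R n].

Lemma measurable_annulus n : measurable (annulus n).
Proof.
have m : measurable_fun setT (fun w : R * R => 1 - modulus (of_plane w)).
  apply: measurable_funB; first exact: measurable_cst.
  by apply: cmeas_modulus; exact: cmeas_of_plane.
rewrite (_ : annulus n = [set w | eps R n.+1 < 1 - modulus (of_plane w)] `&`
    [set w | 1 - modulus (of_plane w) <= eps R n]); last first.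
  by apply/seteqP; split => w /=; rewrite /annulus /mkset => /andP.
apply: measurableI.
  by apply: measurable_lt_set => //; exact: measurable_cst.
by apply: measurable_le_set => //; exact: measurable_cst.
Qed.

Lemma trivIset_annulus : trivIset setT annulus.
Proof.
have aux k n w : (k < n)%N -> annulus k w -> annulus n w -> False.
  move=> kn /andP[h1 _] /andP[_ h2].
  by have := eps_anti R kn; rewrite leNgt (lt_le_trans h1 h2).
apply/trivIsetP => k n _ _ kn; apply/seteqP; split=> // w [h1 h2].
move: kn; rewrite neq_ltn => /orP[kn|kn]; first exact: (aux _ _ _ kn h1 h2).
exact: (aux _ _ _ kn h2 h1).
Qed.

Lemma eps_lt (x : R) : 0 < x -> exists n, eps R n < x.
Proof.
move=> x0.
have h : eps R n @[n --> \oo] --> 0 by apply: cvg_expr; rewrite ger0_norm ?invr_ge0// invf_lt1// ltr1n.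
have := cvgr_lt _ h _ x0; case=> n _ hn; exists n; exact: (hn n (leqnn n)).
Qed.

Lemma coneset_annulus t : coneset t = \bigcup_n (coneset t `&` annulus n).
Proof.
apply/seteqP; split=> w; last by case=> n _ [].
move=> hw; have /= [hd _] := hw.
have h0 : 0 < 1 - modulus (of_plane w) by rewrite subr_gt0.
have ex : exists n, eps R n < 1 - modulus (of_plane w) by exact: eps_lt.
case: (ex_minnP ex) => -[|n]; first by rewrite eps0 ltNge gerBl modulus_ge0.
move=> h1 h2; exists n => //; split=> //; rewrite /annulus /mkset h1 leNgt.
by apply/negP => /h2; rewrite ltnn.
Qed.

Lemma annulus_wgt beta n w : annulus n w ->
  wgt beta w <= 4 `^ `|beta| * eps R n `^ beta.
Proof.
move=> /andP[h1 h2]; have e0 := eps_gt0 R n.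
have [] : eps R n / 4 <= 1 - modulus (of_plane w) ^+ 2 /\ 1 - modulus (of_plane w) ^+ 2 <= 4 * eps R n.
  have := modulus_ge0 (of_plane w).
  by move: (modulus (of_plane w)) h1 h2; rewrite epsS => x h1 h2 h3; split; nra.
by move=> h3 h4; have /andP[] := powR_comparable beta e0 h3 h4.
Qed.

(** In the cone |xi - w| < 1 - |w|^2 <= 2 (1 - |w|), so a slice of height eps has area of order
    eps^2. *)
Lemma cone_annulus_sub t n : coneset t `&` annulus n `<=` cball (circle_pt t) (2 * eps R n).
Proof.
move=> w [] /Gamma_circleE h1 /andP[h2 h3].
rewrite /cball /mkset modulus_distC; apply: lt_le_trans h1 _.
have := modulus_ge0 (of_plane w); have := eps_gt0 R n.+1.
by move: (modulus _) (eps R n.+1) (eps R n) h2 h3; clear => x y z; nra.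
Qed.

Lemma measurable_cone_annulus t n : measurable (coneset t `&` annulus n).
Proof. by apply: measurableI; [exact: measurable_coneset|exact: measurable_annulus]. Qed.

Lemma area_cone_annulus t n : (area R (coneset t `&` annulus n) <= (16 * eps R n ^+ 2)%:E)%E.
Proof.
have e0 := eps_gt0 R n.
have -> : 16 * eps R n ^+ 2 = 4 * (2 * eps R n) ^+ 2 by ring.
apply: le_trans (area_cball_le (circle_pt t) (_ : 0 < 2 * eps R n)); last by rewrite mulr_gt0.
apply: le_measure; rewrite ?inE; [exact: measurable_cone_annulus|exact: measurable_cball|].
exact: cone_annulus_sub.
Qed.

Lemma integral_le_cst (F : R * R -> \bar R) (D : set (R * R)) (c : R) :
  measurable D -> measurable_fun setT F -> (forall w, D w -> (0 <= F w)%E) ->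
  (forall w, D w -> (F w <= c%:E)%E) ->
  (\int[area R]_(w in D) F w <= c%:E * area R D)%E.
Proof.
move=> mD mF F0 h; rewrite -integral_cst//.
apply: ge0_le_integral => //; exact: measurable_funTS.
Qed.

Lemma integral_wgt_annulus beta t n :
  (\int[area R]_(w in coneset t `&` annulus n) (wgt beta w)%:E <=
    (16 * 4 `^ `|beta| * eps R n `^ (beta + 2))%:E)%E.
Proof.
have e0 := eps_gt0 R n.
apply: le_trans (integral_le_cst (c := 4 `^ `|beta| * eps R n `^ beta) (measurable_cone_annulus _ _) _ _ _) _.
- by apply/measurable_EFinP; exact: measurable_wgt.
- by move=> w _; rewrite lee_fin wgt_ge0.
- by move=> w [_ hw]; rewrite lee_fin; exact: annulus_wgt.
apply: le_trans (lee_wpmul2l _ (area_cone_annulus t n)) _; first by rewrite lee_fin mulr_ge0 ?powR_ge0.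
rewrite -EFinM lee_fin powRD; last by rewrite (gt_eqF e0) implybT.
rewrite (powR_mulrn 2 (ltW e0)); apply: eq_ler; ring.
Qed.

Lemma cone_meas_annuli u beta a t :
  cone_meas u beta a (coneset t) =
  (\sum_(n <oo) cone_meas u beta a (coneset t `&` annulus n))%E.
Proof.
rewrite {1}/cone_meas [X in integral _ X _](coneset_annulus t) ge0_integral_bigcup//.
- by move=> n; exact: measurable_cone_annulus.
- by apply: measurable_funTS; exact: measurable_cone_integrand.
- by move=> w _; exact: cone_integrand_ge0.
apply/trivIsetP => k n _ _ kn; apply/seteqP; split=> // w [[_ h1] [_ h2]].
have /trivIsetP/(_ k n I I kn) := trivIset_annulus.
by move/seteqP => [/(_ w (conj h1 h2))].
Qed.

Lemma annulus_modulus n w : annulus n w -> modulus (of_plane w) <= dyrad R n.+1.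
Proof. by move=> /andP[h _]; rewrite /dyrad lerBrDr addrC -lerBrDr ltW. Qed.

End annuli.

(** * Independence and subgaussian laws *)

Section layer_cake.
Variable R : realType.
Local Notation leb := (@lebesgue_measure R).

(** Its integral in s over the whole line is x when x >= 0, which keeps the layer-cake formula free
    of restricted domains. *)
Definition layer (x s : R) : R := \1_[set z | 0 <= z < x] s.

Lemma layerE x : layer x = \1_(`[0%R, x[%classic).
Proof. by apply/funext => s; rewrite /layer; congr (\1_ _ s); apply/seteqP; split => z /=; rewrite in_itv. Qed.

Lemma integral_layer x : 0 <= x -> (\int[leb]_s (layer x s)%:E = x%:E)%E.
Proof.
move=> x0; rewrite layerE integral_indic ?setIT//.
apply: (etrans (lebesgue_measure_itv _)); rewrite /= lte_fin EFinN sube0.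
by move: x0; rewrite le_eqVlt => /orP[/eqP<-|->//]; rewrite ltxx.
Qed.

Lemma layer_ge0 x s : 0 <= layer x s. Proof. by rewrite /layer indicE ler0n. Qed.

Lemma measurable_layer d (T : measurableType d) (f : T -> R) : measurable_fun setT f ->
  measurable_fun setT (fun xs : T * measurableTypeR R => layer (f xs.1) xs.2).
Proof.
move=> mf; pose A := [set xs : T * measurableTypeR R | 0 <= xs.2] `&` [set xs : T * measurableTypeR R | xs.2 < f xs.1].
rewrite (_ : (fun _ => _) = \1_A).
  apply: measurable_indic; apply: measurableI.
    by apply: (@measurable_le_set _ _ _ (fun=> 0) snd).
  by apply: (@measurable_lt_set _ _ _ snd (f \o fst)) => //; exact: measurableT_comp.
apply/funext => -[x s]; rewrite /layer !indicE; congr (nat_of_bool _)%:R.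
by apply/idP/idP; rewrite !inE /A /= => /andP.
Qed.

Lemma measurable_layer_integral d (T : measurableType d) (mu : {sigma_finite_measure set T -> \bar R}) (H f : T -> R) :
  measurable_fun setT H -> (forall x, 0 <= H x) -> measurable_fun setT f ->
  measurable_fun setT (fun s : measurableTypeR R => \int[mu]_x (H x * layer (f x) s)%:E)%E.
Proof.
move=> mH H0 mf.
apply: (@measurable_fun_fubini_tonelli_G _ _ T (measurableTypeR R) R mu (fun xs : T * measurableTypeR R => (H xs.1 * layer (f xs.1) xs.2)%:E)).
  apply/measurable_EFinP; apply: measurable_funM; last exact: measurable_layer.
  by apply: (@measurableT_comp _ _ _ _ _ _ H).
by move=> xs; rewrite lee_fin mulr_ge0// layer_ge0.
Qed.

Lemma layer_cake d (T : measurableType d) (mu : {sigma_finite_measure set T -> \bar R}) (H f : T -> R) :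
  measurable_fun setT H -> (forall x, 0 <= H x) ->
  measurable_fun setT f -> (forall x, 0 <= f x) ->
  (\int[mu]_x (H x * f x)%:E = \int[leb]_s \int[mu]_x (H x * layer (f x) s)%:E)%E.
Proof.
move=> mH H0 mf f0.
pose F (xs : T * measurableTypeR R) := (H xs.1 * layer (f xs.1) xs.2)%:E.
have mF : measurable_fun setT F.
  apply/measurable_EFinP; apply: measurable_funM; last exact: measurable_layer.
  by apply: (@measurableT_comp _ _ _ _ _ _ H) => //.
transitivity (\int[mu]_x \int[leb]_s F (x, s))%E.
  apply: eq_integral => x _; rewrite /F /=.
  under eq_integral do rewrite EFinM.
  rewrite ge0_integralZl_EFin//.
  - by rewrite integral_layer.
  - by move=> s _; rewrite lee_fin layer_ge0.
  - apply/measurable_EFinP; rewrite layerE.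
    by apply: measurable_indic; exact: measurable_itv.
by apply: (fubini_tonelli F) => // xs; rewrite lee_fin mulr_ge0// layer_ge0.
Qed.

(** Identities known on superlevel sets pass to integrals by the layer-cake formula. The factors
    [H1] and [H2] carry either the variables already treated in a product or the density of a
    law. *)
Lemma integral_transfer d1 d2 (T1 : measurableType d1) (T2 : measurableType d2)
    (mu1 : {sigma_finite_measure set T1 -> \bar R}) (mu2 : {sigma_finite_measure set T2 -> \bar R})
    (H1 f1 : T1 -> R) (H2 f2 : T2 -> R) (c : \bar R) :
  measurable_fun setT H1 -> (forall x, 0 <= H1 x) ->
  measurable_fun setT f1 -> (forall x, 0 <= f1 x) ->
  measurable_fun setT H2 -> (forall x, 0 <= H2 x) ->
  measurable_fun setT f2 -> (forall x, 0 <= f2 x) -> (0 <= c)%E ->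
  (forall s, \int[mu1]_x (H1 x * \1_[set x | s < f1 x] x)%:E =
     c * \int[mu2]_x (H2 x * \1_[set x | s < f2 x] x)%:E)%E ->
  (\int[mu1]_x (H1 x * f1 x)%:E = c * \int[mu2]_x (H2 x * f2 x)%:E)%E.
Proof.
move=> mH1 H10 mf1 f10 mH2 H20 mf2 f20 c0 h.
rewrite (layer_cake mu1 mH1 H10 mf1 f10) (layer_cake mu2 mH2 H20 mf2 f20).
rewrite -ge0_integralZl//; last 2 first.
- exact: measurable_layer_integral.
- by move=> s _; apply: integral_ge0 => om _; rewrite lee_fin mulr_ge0// layer_ge0.
apply: eq_integral => s _.
have aux d (T : measurableType d) (mu : {sigma_finite_measure set T -> \bar R}) (H f : T -> R) :
    (\int[mu]_x (H x * layer (f x) s)%:E =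
      if (0 <= s)%R then \int[mu]_x (H x * \1_[set x | (s < f x)%R] x)%:E else 0)%E.
  have [s0|s0] := boolP (0 <= s)%R; last first.
    apply: integral0_eq => x _; rewrite /layer indicE (_ : (s \in _) = false) ?mulr0//.
    by apply/negbTE; rewrite notin_setE /= (negbTE s0).
  apply: eq_integral => x _; rewrite /layer !indicE; congr (_ * (nat_of_bool _)%:R)%:E.
  by apply/idP/idP; rewrite !inE /= s0.
by rewrite !aux; case: ifP => _; rewrite ?mule0// h.
Qed.

End layer_cake.

Section independence.
Context (R : realType) (d : measure_display) (Omega : measurableType d).
Variable P : probability Omega R.
Implicit Types (X : nat -> Omega -> Cplx R) (g : nat -> R * R -> R).
Local Notation pl := (@to_plane R).

Lemma cmeas_of_complex_rv (Y : Omega -> Cplx R) : complex_rv Y -> cmeas Y.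
Proof.
move=> mY; split.
  exact: (meas_comp (f := fst) (g := fun om => pl (Y om))).
exact: (meas_comp (f := snd) (g := fun om => pl (Y om))).
Qed.

Lemma measurable_rv_event (Y : Omega -> Cplx R) B : complex_rv Y -> measurable B ->
  measurable (rv_event Y B).
Proof. by move=> mY mB; have := mY measurableT B mB; rewrite setTI. Qed.

Lemma integral_mul_independent (Y : Omega -> Cplx R) (H : Omega -> R) (g : R * R -> R) (c : \bar R) :
  complex_rv Y -> measurable_fun setT H -> (forall om, 0 <= H om) ->
  measurable_fun setT g -> (forall w, 0 <= g w) -> (0 <= c)%E ->
  (forall B, measurable B -> (\int[P]_om (H om * \1_(rv_event Y B) om)%:E = c * P (rv_event Y B))%E) ->
  (\int[P]_om (H om * g (pl (Y om)))%:E = c * \int[P]_om (g (pl (Y om)))%:E)%E.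
Proof.
move=> mY mH H0 mg g0 c0 h.
have mgY : measurable_fun setT (fun om => g (pl (Y om))).
  exact: (meas_comp (f := g) (g := fun om => pl (Y om))).
transitivity (c * \int[P]_om (1 * g (pl (Y om)))%:E)%E; last first.
  by under eq_integral do rewrite mul1r.
apply: integral_transfer => // s.
have mB : measurable [set w | s < g w].
  by apply: measurable_lt_set => //; exact: measurable_cst.
rewrite (h [set w | s < g w] mB); congr (_ * _)%E.
rewrite -[X in P X]setIT -integral_indic//; last exact: measurable_rv_event.
by apply: eq_integral => om _; rewrite mul1r.
Qed.

(** The induction needs the later variables in event form: indices below j appear as functions,
    those in s as events of index at least j. Turning the event of index j into a function is one
    use of [integral_mul_independent]. *)
Lemma independent_prod X g : (forall n, complex_rv (X n)) -> mutually_independent P X ->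
  (forall k, measurable_fun setT (g k)) -> (forall k w, 0 <= g k w) ->
  forall j s B, uniq s -> all (leq j) s -> (forall n, measurable (B n)) ->
  (\int[P]_om ((\prod_(k < j) g k (pl (X k om))) * \1_(\bigcap_(n in [set` s]) rv_event (X n) (B n)) om)%:E =
   (\prod_(k < j) \int[P]_om (g k (pl (X k om)))%:E) * P (\bigcap_(n in [set` s]) rv_event (X n) (B n)))%E.
Proof.
move=> mX indX mg g0.
have mA (s : seq nat) B : (forall n, measurable (B n)) -> measurable (\bigcap_(n in [set` s]) rv_event (X n) (B n)).
  by move=> mB; apply: bigcap_measurableType => k _; exact: measurable_rv_event.
have mgX k : measurable_fun setT (fun om => g k (pl (X k om))).
  by apply: (meas_comp (f := g k) (g := fun om => pl (X k om))) => //; exact: mX.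
elim=> [|j IH] s B us js mB.
  under eq_integral do rewrite big_ord0 mul1r.
  by rewrite integral_indic ?setIT ?big_ord0 ?mul1e//; exact: mA.
have js' : all (leq j) s by apply: sub_all js => k; exact: ltnW.
have jns : j \notin s by apply/negP => /(allP js); rewrite ltnn.
pose A := \bigcap_(n in [set` s]) rv_event (X n) (B n).
pose H om := (\prod_(k < j) g k (pl (X k om))) * \1_A om.
have H0 om : 0 <= H om by rewrite mulr_ge0 ?indicE ?ler0n//; apply: prodr_ge0.
have mH : measurable_fun setT H.
  apply: measurable_funM; last by apply: measurable_indic; exact: mA.
  exact: measurable_prod.
transitivity (\int[P]_om (H om * g j (pl (X j om)))%:E)%E.
  by apply: eq_integral => om _; rewrite /H big_ord_recr /= mulrAC.
rewrite (@integral_mul_independent _ _ _ ((\prod_(k < j) \int[P]_om (g k (pl (X k om)))%:E) * P A)%E)//.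
- by rewrite big_ord_recr /= muleAC.
- rewrite mule_ge0//; elim/big_ind: _ => // [x y x0 y0|k _]; first exact: mule_ge0.
  by apply: integral_ge0 => om _; rewrite lee_fin.
move=> B0 mB0.
(* The event of index j is adjoined by overwriting one entry of the family; s does not contain j, so
   the other events are unchanged. *)
pose B' n := if n == j then B0 else B n.
have mB' n : measurable (B' n) by rewrite /B'; case: ifP.
have hA : A = \bigcap_(n in [set` s]) rv_event (X n) (B' n).
  apply: eq_bigcapr => n /= ns; rewrite /B' (_ : (n == j) = false)//.
  by apply/negP => /eqP nj; rewrite nj (negbTE jns) in ns.
have hjA : \bigcap_(n in [set` j :: s]) rv_event (X n) (B' n) = A `&` rv_event (X j) B0.
  rewrite hA; apply/seteqP; split => om /=.
    move=> h; split=> [n /= ns|]; first by apply: h; rewrite /= inE ns orbT.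
    by have := h j; rewrite /= inE eqxx /B' eqxx; apply.
  move=> [h1 h2] n /=; rewrite inE => /orP[/eqP->|ns]; last exact: h1.
  by rewrite /B' eqxx.
transitivity (\int[P]_om ((\prod_(k < j) g k (pl (X k om))) * \1_(\bigcap_(n in [set` j :: s]) rv_event (X n) (B' n)) om)%:E)%E.
  by apply: eq_integral => om _; rewrite hjA indicI /= mulrA.
rewrite IH//=; [|by rewrite jns|by rewrite leqnn].
have -> : P (\bigcap_(n in [set` j :: s]) rv_event (X n) (B' n)) = (P A * P (rv_event (X j) B0))%E.
  rewrite indX//=; last by rewrite jns.
  by rewrite big_cons hA indX// muleC; congr (_ * P (rv_event _ _))%E; rewrite /B' eqxx.
by rewrite muleA.
Qed.

Lemma expectation_prod_independent X g n : (forall n, complex_rv (X n)) -> mutually_independent P X ->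
  (forall k, measurable_fun setT (g k)) -> (forall k w, 0 <= g k w) ->
  (\int[P]_om (\prod_(k < n) g k (pl (X k om)))%:E =
   \prod_(k < n) \int[P]_om (g k (pl (X k om)))%:E)%E.
Proof.
move=> mX iX mg g0; have := independent_prod mX iX mg g0 (j := n) (s := [::]) (B := fun=> setT) isT isT (fun=> measurableT).
rewrite (_ : \bigcap_(n in _) _ = setT); last by apply/seteqP; split => // om _ k.
rewrite probability_setT mule1 => <-.
by apply: eq_integral => om _; rewrite indicT mulr1.
Qed.

End independence.

(** * Exponential inequalities *)

Section exponential_inequalities.
Variable R : realType.
Implicit Types (y : R).

Lemma expR_le_inv y : y < 1 -> expR y <= (1 - y)^-1.
Proof.
move=> y1; rewrite -[leLHS]invrK lef_pV2 ?posrE ?invr_gt0 ?expR_gt0 ?subr_gt0//.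
by rewrite -expRN; exact: expR_ge1Dx.
Qed.

(** Square of 1 + y / 2 <= exp (y / 2), whose left side is nonnegative exactly when y >= -2. *)
Lemma expR_ge_sqr y : -2 <= y -> 1 + y + y ^+ 2 / 4 <= expR y.
Proof.
move=> y2; have -> : expR y = expR (y / 2) ^+ 2.
  by rewrite expr2 -expRD -splitr.
have -> : 1 + y + y ^+ 2 / 4 = (1 + y / 2) ^+ 2 by field.
have h : 0 <= 1 + y / 2 by lra.
by rewrite lerXn2r ?nnegrE ?expR_ge0// expR_ge1Dx.
Qed.

(** The linear term averages to zero against a centred law, leaving a Gaussian bound. *)
Lemma expR_le_hoeffding y : expR y <= y + expR (2 * y ^+ 2).
Proof.
have h0 : 1 + 2 * y ^+ 2 <= expR (2 * y ^+ 2) by exact: expR_ge1Dx.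
have [y0|y0] := leP y 0.
  have [y1|y1] := leP (-1) y.
    apply: (@le_trans _ _ (1 - y)^-1); first by apply: expR_le_inv; lra.
    apply: (@le_trans _ _ (1 + y + 2 * y ^+ 2)); last by lra.
    rewrite -div1r ler_pdivrMr; last by lra.
    by nra.
  have : expR y <= 1 by rewrite -expR0 ler_expR.
  by nra.
have [y1|y1] := leP y 1.
  have -> : expR y = expR (y / 2) ^+ 2 by rewrite expr2 -expRD -splitr.
  apply: (@le_trans _ _ ((1 - y / 2)^-1 ^+ 2)).
    rewrite lerXn2r ?nnegrE ?expR_ge0 ?invr_ge0//; first by lra.
    by apply: expR_le_inv; lra.
  apply: (@le_trans _ _ (1 + y + 2 * y ^+ 2)); last by lra.
  rewrite exprVn -div1r ler_pdivrMr; last by apply: exprn_gt0; lra.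
  have -> : (1 + y + 2 * y ^+ 2) * (1 - y / 2) ^+ 2 = 1 + y ^+ 2 * ((1 - y) * (5 - 2 * y) / 4) by field.
  rewrite lerDl; apply: mulr_ge0; first exact: sqr_ge0.
  by apply: divr_ge0 => //; apply: mulr_ge0; lra.
apply: (@le_trans _ _ (expR (2 * y ^+ 2))); last by lra.
by rewrite ler_expR; nra.
Qed.

End exponential_inequalities.

(** * Exponential moments of the three laws *)

Section laws.
Context (R : realType) (d : measure_display) (Omega : measurableType d).
Variable P : probability Omega R.
Implicit Types (Y : Omega -> Cplx R) (c : Cplx R).
Local Notation pl := (@to_plane R).
Local Notation leb := (@lebesgue_measure R).

Definition exp_moment Y c : \bar R := (\int[P]_om (expR (complex.Re (c * Y om)))%:E)%E.

(** The last clause joins c and ic because a real variable only sees Re c, and the squares of Re c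
    and Re (ic) add up to |c|^2. All clauses concern positive exponentials, so no signed expectation
    occurs. For the bounded laws |c| <= 1 keeps the quadratic lower bound for exp valid. *)
Definition subgaussian Y : Prop := forall c,
  [/\ modulus c <= 1 -> (1 <= exp_moment Y c)%E,
      (exp_moment Y c <= (expR (2 * modulus c ^+ 2))%:E)%E
    & modulus c <= 1 ->
      ((2 + modulus c ^+ 2 / 4)%:E <= exp_moment Y c + exp_moment Y ('i%C * c)%R)%E].

Definition exp_kernel c (w : R * R) : R := expR (complex.Re (c * of_plane w)).

Lemma exp_kernel_ge0 c w : 0 <= exp_kernel c w. Proof. exact: expR_ge0. Qed.

Lemma of_planeK (z : Cplx R) : of_plane (pl z) = z.
Proof. by case: z. Qed.

Lemma measurable_exp_kernel c : measurable_fun setT (exp_kernel c).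
Proof.
apply: measurableT_comp; first exact: measurable_expR.
by have [] : cmeas (fun w : R * R => c * of_plane w) by
  apply: cmeasM; [exact: cmeas_cst|exact: cmeas_of_plane].
Qed.

Lemma exp_momentE Y c : exp_moment Y c = (\int[P]_om (exp_kernel c (pl (Y om)))%:E)%E.
Proof. by apply: eq_integral => om _; rewrite /exp_kernel of_planeK. Qed.

Lemma Re_sqr_Im c : complex.Re c ^+ 2 + complex.Re ('i%C * c) ^+ 2 = modulus c ^+ 2.
Proof. by rewrite modulus_sqr; case: c => x y /=; ring. Qed.

Lemma modulus_i c : modulus ('i%C * c) = modulus c.
Proof.
rewrite modulusM (_ : modulus 'i%C = 1) ?mul1r//.
by rewrite /modulus /= expr0n expr1n add0r sqrtr1.
Qed.

(** Completing the square shifts the normal density by Re c. *)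
Lemma gaussian_exp_moment Y c : complex_rv Y -> gaussian_law P Y ->
  exp_moment Y c = (expR (complex.Re c ^+ 2 / 2))%:E.
Proof.
move=> mY hY; set b := complex.Re c.
have hk x : exp_kernel c (x, 0) = expR (b * x).
  by rewrite /exp_kernel /b; case: (c) => u v /=; rewrite mulr0 subr0.
have mk := measurable_exp_kernel c.
have mkY : measurable_fun setT (fun om => exp_kernel c (pl (Y om))).
  by apply: (meas_comp (f := exp_kernel c) (g := fun om => pl (Y om))).
have mk0 : measurable_fun setT (fun x : R => exp_kernel c (x, 0)).
  apply: (meas_comp (f := exp_kernel c) (g := fun x : R => (x, 0))) => //.
have := @integral_transfer R _ _ _ _ P leb (fun=> 1) (fun om => exp_kernel c (pl (Y om)))
  (normal_pdf 0 1) (fun x => exp_kernel c (x, 0)) 1%E.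
rewrite mul1e; under eq_integral do rewrite mul1r.
rewrite -exp_momentE => ->//; [|by move=> om; exact: exp_kernel_ge0|exact: measurable_normal_pdf|by move=> x; exact: normal_pdf_ge0|by move=> x; exact: exp_kernel_ge0|]; last first.
- move=> s; have mB : measurable [set w | s < exp_kernel c w].
    by apply: measurable_lt_set => //; exact: measurable_cst.
  have := hY _ mB; rewrite mul1e /normal_prob.
  rewrite -[X in P X]setIT -integral_indic//; last exact: measurable_rv_event.
  under eq_integral do rewrite -[\1_ _ _]mul1r.
  move=> ->; rewrite [LHS]integral_mkcond; apply: eq_integral => x _.
  by rewrite patchE indicE /=; case: ifP => _; rewrite ?mulr1 ?mulr0.
transitivity (\int[leb]_x ((expR (b ^+ 2 / 2))%:E * (normal_pdf b 1 x)%:E))%E.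
  apply: eq_integral => x _; rewrite hk -EFinM; congr (_%:E).
  rewrite !normal_pdfE ?oner_neq0// /normal_fun -mulrA -expRD mulrCA -expRD.
  by congr (_ * expR _); field.
rewrite ge0_integralZl_EFin ?expR_ge0//.
- by rewrite integral_normal_pdf mule1.
- by move=> x _; rewrite lee_fin normal_pdf_ge0.
- by apply/measurable_EFinP; exact: measurable_normal_pdf.
Qed.

Lemma gaussian_subgaussian Y : complex_rv Y -> gaussian_law P Y -> subgaussian Y.
Proof.
move=> mY hY c; rewrite !gaussian_exp_moment// -EFinD !lee_fin.
have h := Re_sqr_Im c; split.
- by move=> _; rewrite -expR0 ler_expR divr_ge0 ?sqr_ge0.
- rewrite ler_expR -h.
  by have := sqr_ge0 (complex.Re c); have := sqr_ge0 (complex.Re ('i%C * c)); lra.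
- move=> _; apply: le_trans (lerD (expR_ge1Dx _) (expR_ge1Dx _)).
  have := sqr_ge0 (modulus c); rewrite -h; lra.
Qed.

Lemma steinhaus_exp_moment Y c : complex_rv Y -> steinhaus_law P Y ->
  exp_moment Y c = (((2 * pi)^-1)%:E *
    \int[leb]_(t in `[0%R, (2 * pi)%R]) (expR (complex.Re (c * circle_pt t)))%:E)%E.
Proof.
move=> mY hY.
have mk := measurable_exp_kernel c.
have mkY : measurable_fun setT (fun om => exp_kernel c (pl (Y om))).
  by apply: (meas_comp (f := exp_kernel c) (g := fun om => pl (Y om))).
have mcp : measurable_fun setT (fun t : R => pl (circle_pt t)).
  have [m1 m2] := cmeas_circle_pt (@measurable_id _ (measurableTypeR R) setT).
  exact: measurable_fun_pair.
have mkc : measurable_fun setT (fun t : R => exp_kernel c (pl (circle_pt t))).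
  by apply: (meas_comp (f := exp_kernel c) (g := fun t : R => pl (circle_pt t))).
have pi0 : 0 <= (2 * pi)^-1 :> R by rewrite invr_ge0 mulr_ge0// pi_ge0.
have := @integral_transfer R _ _ _ _ P leb (fun=> 1) (fun om => exp_kernel c (pl (Y om)))
  (\1_(`[0%R, (2 * pi)%R[%classic)) (fun t => exp_kernel c (pl (circle_pt t))) ((2 * pi)^-1)%:E.
under eq_integral do rewrite mul1r.
rewrite -exp_momentE => ->//; [|by move=> om; exact: exp_kernel_ge0|by move=> t; exact: exp_kernel_ge0|]; last first.
- move=> s; have mB : measurable [set w | s < exp_kernel c w].
    by apply: measurable_lt_set => //; exact: measurable_cst.
  have := hY _ mB.
  rewrite -[X in P X]setIT -integral_indic//; last exact: measurable_rv_event.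
  under eq_integral do rewrite -[\1_ _ _]mul1r.
  move=> ->; congr (_ * _)%E.
  rewrite -[X in leb X]setIT -integral_indic//; last first.
    apply: measurableI; first exact: measurable_itv.
    by apply: measurable_lt_set => //; exact: measurable_cst.
  by apply: eq_integral => x _; rewrite indicI.
congr (_ * _)%E.
rewrite (_ : (fun x => _) = ((fun t => (exp_kernel c (pl (circle_pt t)))%:E) \_ `[0%R, (2 * pi)%R[)); last first.
  by apply/funext => t; rewrite patchE indicE; case: ifP => _; rewrite ?mul1r ?mul0r.
rewrite -integral_mkcond integral_itv_bndo_bndc; last by apply/measurable_EFinP; exact: measurable_funTS.
by apply: eq_integral => t _; rewrite /exp_kernel of_planeK.
Qed.

Lemma integral_circle_affine c (b : R) :
  (forall t, 0 <= complex.Re (c * circle_pt t) + b) ->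
  (\int[leb]_(t in `[0%R, (2 * pi)%R]) (complex.Re (c * circle_pt t) + b)%:E = (2 * pi * b)%:E)%E.
Proof.
move=> h.
have cf : continuous (fun t => complex.Re (c * circle_pt t)).
  have [h1 _] := integral_circle_sum (fun=> c) 1.
  by move: h1; under eq_fun do rewrite big_ord1 mul1r.
have := integral_circle_harmonic c (ltn0Sn 0); under eq_integral do rewrite mul1r.
move=> h0; under eq_integral do rewrite EFinD.
rewrite integralD//; last 2 first.
- exact: integrable_period.
- by apply: (@integrable_period _ (fun=> b)); exact: cst_continuous.
rewrite h0 add0e integral_cst//= lebesgue_measure_itv/= lte_fin mulr_gt0 ?pi_gt0//.
by rewrite -EFinB subr0 -EFinM mulrC.
Qed.

(** Exponentials are compared pointwise on the circle with affine functions of Re (c xi), whose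
    harmonic part has zero mean. *)
Lemma steinhaus_subgaussian Y : complex_rv Y -> steinhaus_law P Y -> subgaussian Y.
Proof.
move=> mY hY c; rewrite !steinhaus_exp_moment//.
have pi0 : 0 < 2 * pi :> R by rewrite mulr_gt0// pi_gt0.
have pi1 : 0 <= (2 * pi)^-1 :> R by rewrite invr_ge0 ltW.
have hy c' t : `|complex.Re (c' * circle_pt t)| <= modulus c'.
  by apply: le_trans (Re_le_modulus _) _; rewrite modulusM modulus_circle_pt mulr1.
have m c' : measurable_fun (`[0%R, (2 * pi)%R]%classic : set R) (fun t => complex.Re (c' * circle_pt t)).
  apply: measurable_funTS.
  by have [] : cmeas (fun t : R => c' * circle_pt t) by
    apply: cmeasM; [exact: cmeas_cst|exact: cmeas_circle_pt].
have me c' : measurable_fun (`[0%R, (2 * pi)%R]%classic : set R) (fun t => (expR (complex.Re (c' * circle_pt t)))%:E).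
  by apply/measurable_EFinP; apply: measurableT_comp.
have scale (x : R) : x%:E = ((2 * pi)^-1%:E * (2 * pi * x)%:E)%E.
  by rewrite -EFinM mulKf// gt_eqF.
have mm c' b : measurable_fun (`[0%R, (2 * pi)%R]%classic : set R) (fun t => (complex.Re (c' * circle_pt t) + b)%:E).
  by apply/measurable_EFinP; apply: measurable_funD; [exact: m|exact: measurable_cst].
split.
- move=> c1; rewrite [leLHS]scale; apply: lee_wpmul2l; first by rewrite lee_fin.
  have h0 t : 0 <= complex.Re (c * circle_pt t) + 1.
    have := hy c t; rewrite ler_norml => /andP[h _]; lra.
  rewrite -(integral_circle_affine h0); apply: ge0_le_integral => //.
  + by move=> t _; rewrite lee_fin.
  + exact: mm.
  + exact: me.
  + by move=> t _; rewrite lee_fin addrC expR_ge1Dx.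
- rewrite [leRHS]scale; apply: lee_wpmul2l; first by rewrite lee_fin.
  have h t : expR (complex.Re (c * circle_pt t)) <= complex.Re (c * circle_pt t) + expR (2 * modulus c ^+ 2).
    apply: le_trans (expR_le_hoeffding _) _; rewrite lerD2l ler_expR ler_pM2l//.
    by rewrite -real_normK ?num_real// lerXn2r ?nnegrE ?modulus_ge0.
  have h0 t : 0 <= complex.Re (c * circle_pt t) + expR (2 * modulus c ^+ 2).
    by apply: le_trans (h t); exact: expR_ge0.
  rewrite -(integral_circle_affine h0); apply: ge0_le_integral => //.
  + exact: me.
  + exact: mm.
  + by move=> t _; rewrite lee_fin.
move=> c1; rewrite [leLHS]scale -ge0_muleDr ?integral_ge0//.
apply: lee_wpmul2l; first by rewrite lee_fin.
rewrite -ge0_integralD//; last 2 first.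
- exact: me.
- exact: me.
pose c' := c + 'i%C * c.
have ReE t : complex.Re (c' * circle_pt t) = complex.Re (c * circle_pt t) + complex.Re ('i%C * c * circle_pt t).
  by rewrite /c' mulrDl ReD.
have ci1 : modulus ('i%C * c) <= 1 by rewrite modulus_i.
have hyl c2 t : modulus c2 <= 1 -> -1 <= complex.Re (c2 * circle_pt t).
  by move=> h2; have := hy c2 t; rewrite ler_norml => /andP[h _]; lra.
have h0 t : 0 <= complex.Re (c' * circle_pt t) + (2 + modulus c ^+ 2 / 4).
  have := hyl _ t c1; have := hyl _ t ci1; rewrite ReE; have := sqr_ge0 (modulus c); lra.
rewrite -(integral_circle_affine h0); apply: ge0_le_integral => //.
- by move=> t _; rewrite lee_fin.
- exact: mm.
- exact: emeasurable_funD (me _) (me _).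
move=> t _; rewrite -EFinD lee_fin ReE.
have e1 : -2 <= complex.Re (c * circle_pt t) by have := hyl _ t c1; lra.
have e2 : -2 <= complex.Re ('i%C * c * circle_pt t) by have := hyl _ t ci1; lra.
apply: le_trans (lerD (expR_ge_sqr e1) (expR_ge_sqr e2)).
have := Re_sqr_Im (c * circle_pt t); rewrite mulrA modulusM modulus_circle_pt mulr1.
lra.
Qed.

Lemma bernoulli_exp_moment Y c : complex_rv Y -> bernoulli_law P Y ->
  exp_moment Y c = (2^-1 * (expR (complex.Re c) + expR (- complex.Re c)))%:E.
Proof.
move=> mY [h1 h2].
pose A := [set om | Y om = 1]; pose B := [set om | Y om = -1].
have single (z : Cplx R) : measurable [set om | Y om = z].
  have -> : [set om | Y om = z] = rv_event Y ([set complex.Re z] `*` [set complex.Im z]).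
    apply/seteqP; split => om /=; first by move=> h; rewrite /rv_event /= h.
    by rewrite /rv_event /=; case: (Y om) => x y; case: (z) => x' y' /= [-> ->].
  by apply: measurable_rv_event => //; apply: measurableX; exact: measurable_set1.
have mA : measurable A by exact: single.
have mB : measurable B by exact: single.
have AB : A `&` B = set0.
  apply/seteqP; split=> // om [/= a b]; move: (etrans (esym a) b) => /(congr1 (@complex.Re R)) /=.
  by move=> h; have : (1 : R) = -1 by []; lra.
(* The masses of the two prescribed atoms add to 1, so the exponential is almost everywhere a
   two-valued function. *)
have hU : P (~` (A `|` B)) = 0.
  have -> : P (~` (A `|` B)) = (1 - P (A `|` B))%E by rewrite probability_setC//; exact: measurableU.
  have -> : P (A `|` B) = (P A + P B)%E by exact: measureU.
  have h : 2^-1 + 2^-1 = 1 :> R by field.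
  have -> : (P A + P B = 1)%E by rewrite /A /B h1 h2 -EFinD h.
  by rewrite -(EFinN 1) -EFinD subrr.
pose F om := ((expR (complex.Re c))%:E * (\1_A om)%:E + (expR (- complex.Re c))%:E * (\1_B om)%:E)%E.
have mk : measurable_fun setT (fun om => exp_kernel c (pl (Y om))).
  by apply: (meas_comp (f := exp_kernel c) (g := fun om => pl (Y om))) => //; exact: measurable_exp_kernel.
have mi (b : R) E : measurable E -> measurable_fun setT (fun om : Omega => b%:E * (\1_E om)%:E)%E.
  by move=> mE; apply: emeasurable_funM; [exact: measurable_cst|apply/measurable_EFinP; exact: measurable_indic].
rewrite exp_momentE (@ge0_ae_eq_integral _ _ _ P setT _ F)//.
- rewrite ge0_integralD//; [|exact: mi|exact: mi].
  have mE E : measurable E -> measurable_fun setT (fun om : Omega => (\1_E om : R)%:E).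
    by move=> mE; apply/measurable_EFinP; exact: measurable_indic.
  rewrite !ge0_integralZl_EFin ?expR_ge0//; [|exact: mE|exact: mE].
  have -> : (\int[P]_om (\1_A om)%:E = 2^-1%:E)%E by rewrite integral_indic// setIT; exact: h1.
  have -> : (\int[P]_om (\1_B om)%:E = 2^-1%:E)%E by rewrite integral_indic// setIT; exact: h2.
  rewrite -!EFinM -EFinD; congr (_%:E).
  by rewrite mulrDr mulrC [X in _ + X]mulrC.
- exact/measurable_EFinP.
- by apply: emeasurable_funD; exact: mi.
- by move=> om _; rewrite lee_fin exp_kernel_ge0.
- by move=> om _; rewrite adde_ge0.
- exists (~` (A `|` B)); split=> //; first by apply: measurableC; exact: measurableU.
  move=> om /= h hAB; apply: h => _; rewrite /F !indicE /exp_kernel of_planeK.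
  case: hAB => hh.
    have hB : om \notin B by rewrite notin_setE => hb; have : (A `&` B) om by []; rewrite AB.
    by rewrite mem_set// (negbTE hB) mule1 mule0 adde0; move: hh => /= ->; rewrite mulr1.
  have hA : om \notin A by rewrite notin_setE => ha; have : (A `&` B) om by []; rewrite AB.
  rewrite (negbTE hA) mem_set// mule1 mule0 add0e; move: hh => /= ->; rewrite mulrN1.
  by case: (c).
Qed.

Lemma bernoulli_subgaussian Y : complex_rv Y -> bernoulli_law P Y -> subgaussian Y.
Proof.
move=> mY hY c; rewrite !bernoulli_exp_moment// -EFinD !lee_fin.
set x := complex.Re c; set y := complex.Re ('i%C * c).
have h : x ^+ 2 + y ^+ 2 = modulus c ^+ 2 by exact: Re_sqr_Im.
have xc : `|x| <= modulus c by exact: Re_le_modulus.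
have yc : `|y| <= modulus c by rewrite -modulus_i; exact: Re_le_modulus.
split.
- by move=> _; have := expR_ge1Dx x; have := expR_ge1Dx (- x); lra.
- have := expR_le_hoeffding x; have := expR_le_hoeffding (- x); rewrite sqrrN.
  have : expR (2 * x ^+ 2) <= expR (2 * modulus c ^+ 2).
    by rewrite ler_expR -h; have := sqr_ge0 y; lra.
  by lra.
- move=> c1; move: xc yc; rewrite !ler_norml => /andP[x1 x2] /andP[y1 y2].
  have a1 : -2 <= x by lra.
  have a2 : -2 <= - x by lra.
  have a3 : -2 <= y by lra.
  have a4 : -2 <= - y by lra.
  have := expR_ge_sqr a1; have := expR_ge_sqr a2; have := expR_ge_sqr a3; have := expR_ge_sqr a4.
  by rewrite !sqrrN -h; lra.
Qed.

Lemma standard_subgaussian X : standard_random_sequence P X -> forall n, subgaussian (X n).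
Proof.
move=> [mX _ [h|h|h]] n.
- exact: bernoulli_subgaussian.
- exact: steinhaus_subgaussian.
- exact: gaussian_subgaussian.
Qed.

End laws.

(** * Moments of subgaussian variables *)

Section subgaussian_variables.
Context (R : realType) (d : measure_display) (Omega : measurableType d).
Variable P : probability Omega R.
Implicit Types (Y : Omega -> Cplx R) (X : nat -> Omega -> Cplx R) (c : nat -> Cplx R).
Implicit Types (a : nat -> Cplx R) (z : Cplx R) (V : R).

Lemma exprn_le_expR (x : R) m : 0 <= x -> x ^+ m.+1 <= m.+1%:R ^+ m.+1 * expR x.
Proof.
move=> x0; have m0 : (0 : R) < m.+1%:R by rewrite ltr0n.
have -> : expR x = expR (x / m.+1%:R) ^+ m.+1.
  by rewrite -expRM_natr divfK// gt_eqF.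
rewrite -exprMn lerXn2r ?nnegrE ?mulr_ge0 ?expR_ge0 ?(ltW m0)//.
rewrite mulrC -ler_pdivrMr//; apply: le_trans (expR_ge1Dx _).
by rewrite lerDr.
Qed.

(** Bounding |w| by 2 max (|x|, |y|) reduces to one coordinate, and one of the four directions 1,
    -1, i, -i makes the exponent equal to its absolute value. *)
Lemma modulus_exprn_le (w : Cplx R) l : (0 < l)%N ->
  modulus w ^+ (2 * l) <= 2 ^+ (2 * l) * (2 * l)%:R ^+ (2 * l) *
    (expR (complex.Re w) + expR (complex.Re (-1 * w)) +
     (expR (complex.Re ('i%C * w)) + expR (complex.Re (- 'i%C * w)))).
Proof.
case: l => // l _; set m := (2 * l.+1)%N.
have [m' mE] : exists m', m = m'.+1 by exists (2 * l + 1)%N; rewrite /m; lia.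
case: w => x y; set w := (x +i* y)%C.
have hx : complex.Re (-1 * w) = - x by rewrite mulN1r.
have hy : complex.Re ('i%C * w) = - y by rewrite /=; ring.
have hy' : complex.Re (- 'i%C * w) = y by rewrite /=; ring.
have hx' : complex.Re w = x by [].
rewrite hx hy hy' hx'.
have one (s : R) : `|s| ^+ m <= m%:R ^+ m * (expR s + expR (- s)).
  rewrite mE; apply: le_trans (exprn_le_expR m' (normr_ge0 s)) _.
  rewrite ler_wpM2l ?exprn_ge0//.
  have := expR_ge0 s; have := expR_ge0 (- s).
  have [s0|s0] := ger0P s; lra.
have hw : modulus w <= 2 * Num.max `|x| `|y|.
  apply: le_trans (modulus_le_ReIm _) _.
  have m1 : `|x| <= Num.max `|x| `|y| by rewrite le_max lexx.
  have m2 : `|y| <= Num.max `|x| `|y| by rewrite le_max lexx orbT.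
  by rewrite /=; lra.
apply: (@le_trans _ _ ((2 * Num.max `|x| `|y|) ^+ m)).
  by rewrite lerXn2r ?nnegrE ?modulus_ge0// mulr_ge0// le_max normr_ge0.
rewrite exprMn -mulrA ler_wpM2l ?exprn_ge0//.
have h1 := one x; have h2 := one y.
have p1 : 0 <= m%:R ^+ m * (expR x + expR (- x)) :> R by rewrite mulr_ge0 ?exprn_ge0 ?addr_ge0 ?expR_ge0.
have p2 : 0 <= m%:R ^+ m * (expR y + expR (- y)) :> R by rewrite mulr_ge0 ?exprn_ge0 ?addr_ge0 ?expR_ge0.
move: h1 h2 p1 p2; rewrite !mulrDr.
case: (leP `|x| `|y|) => _; lra.
Qed.

Lemma measurable_exp_rv Y (lam : Cplx R) : cmeas Y ->
  measurable_fun setT (fun om => (expR (complex.Re (lam * Y om)))%:E).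
Proof.
move=> mY; apply/measurable_EFinP; apply: measurableT_comp; first exact: measurable_expR.
by have [] : cmeas (fun om => lam * Y om) by apply: cmeasM; [exact: cmeas_cst|].
Qed.

(** Scaling by sqrt V makes the four exponential moments at most exp 2, uniformly in Y. *)
Lemma subgaussian_moment l : (0 < l)%N -> exists2 C : R, 0 <= C &
  forall Y V, cmeas Y -> 0 < V ->
  (forall lam, (exp_moment P Y lam <= (expR (2 * modulus lam ^+ 2 * V))%:E)%E) ->
  (\int[P]_om (modulus (Y om) ^+ (2 * l))%:E <= (C * V ^+ l)%:E)%E.
Proof.
move=> l0; set K : R := 2 ^+ (2 * l) * (2 * l)%:R ^+ (2 * l).
have K0 : 0 <= K by rewrite mulr_ge0 ?exprn_ge0.
exists (K * (4 * expR 2)); first by rewrite !mulr_ge0 ?expR_ge0.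
move=> Y V mY V0 hY.
pose r := Num.sqrt V; have r0 : 0 < r by rewrite sqrtr_gt0.
have rV : r ^+ 2 = V by rewrite sqr_sqrtr// ltW.
have hl (zeta : Cplx R) : modulus zeta = 1 -> (exp_moment P Y (zeta * (r^-1)%:C%C)%R <= (expR 2)%:E)%E.
  move=> hz; apply: le_trans (hY _) _; rewrite lee_fin ler_expR.
  rewrite modulusM hz mul1r modulus_real normrV ?unitfE ?gt_eqF// gtr0_norm// exprVn rV -mulrA mulVf ?mulr1//.
  by rewrite gt_eqF.
pose W om : Cplx R := (r^-1)%:C%C * Y om.
have hW om : modulus (Y om) ^+ (2 * l) = V ^+ l * modulus (W om) ^+ (2 * l).
  rewrite /W modulusM modulus_real normrV ?unitfE ?gt_eqF// gtr0_norm// exprMn exprVn.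
  by rewrite -rV -exprM mulVKf// expf_neq0// gt_eqF.
have one : modulus (1 : Cplx R) = 1 by rewrite modulus1.
have mone : modulus (-1 : Cplx R) = 1 by rewrite modulusN modulus1.
have mi : modulus ('i%C : Cplx R) = 1 by have := modulus_i (1 : Cplx R); rewrite mulr1 modulus1.
have mmi : modulus (- 'i%C : Cplx R) = 1 by rewrite modulusN.
pose E (zeta : Cplx R) om : \bar R := (expR (complex.Re (zeta * (r^-1)%:C%C * Y om)))%:E.
have mE zeta : measurable_fun setT (E zeta) by exact: measurable_exp_rv.
have E0 zeta om : (0 <= E zeta om)%E by rewrite lee_fin expR_ge0.
apply: (@le_trans _ _ (\int[P]_om ((V ^+ l * K)%:E * ((E 1%R om + E (-1)%R om) + (E 'i%C om + E (- 'i%C)%R om))))%E).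
  apply: ge0_le_integral => //.
  - by move=> om _; rewrite lee_fin exprn_ge0 ?modulus_ge0.
  - by apply/measurable_EFinP; apply: measurable_funX; exact: cmeas_modulus.
  - apply: emeasurable_funM; first exact: measurable_cst.
    by apply: emeasurable_funD; exact: emeasurable_funD (mE _) (mE _).
  - move=> om _; rewrite hW /E -!EFinD -EFinM lee_fin -[leRHS]mulrA ler_wpM2l ?exprn_ge0 ?(ltW V0)//.
    apply: le_trans (modulus_exprn_le _ l0) _; rewrite -/K /W.
    by rewrite !mulrA mul1r.
rewrite ge0_integralZl_EFin ?mulr_ge0 ?exprn_ge0 ?(ltW V0)//; last 2 first.
- by move=> om _; rewrite !adde_ge0.
- by apply: emeasurable_funD; exact: emeasurable_funD (mE _) (mE _).
rewrite ge0_integralD//; last 4 first.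
- by move=> om _; rewrite adde_ge0.
- exact: emeasurable_funD (mE _) (mE _).
- by move=> om _; rewrite adde_ge0.
- exact: emeasurable_funD (mE _) (mE _).
rewrite !ge0_integralD//.
apply: (@le_trans _ _ ((V ^+ l * K)%:E * (((expR 2)%:E + (expR 2)%:E) + ((expR 2)%:E + (expR 2)%:E)))%E).
  apply: lee_wpmul2l; first by rewrite lee_fin mulr_ge0 ?exprn_ge0 ?(ltW V0).
  by apply: leeD; apply: leeD; exact: hl.
by rewrite -!EFinD -EFinM lee_fin; apply: eq_ler; ring.
Qed.

(* Second moment argument for [exp (Re (lam Y)) + exp (Re (i lam Y))], which is
   nonnegative, so that no signed expectation occurs. *)
Lemma paley_zygmund : exists2 delta : R, 0 < delta &
  forall Y V, cmeas Y -> 0 <= V ->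
  (forall lam, (exp_moment P Y lam <= (expR (2 * modulus lam ^+ 2 * V))%:E)%E) ->
  (forall lam, modulus lam ^+ 2 * V <= 1 ->
     ((2 + modulus lam ^+ 2 * V / 4)%:E <= exp_moment P Y lam + exp_moment P Y ('i%C * lam)%R)%E) ->
  (delta%:E <= P [set om | (V <= (17 * modulus (Y om)) ^+ 2)%R])%E.
Proof.
(* With this value [tau] times the second moment bound 4 exp 8 is 1/16, half of the gap 9/4 - 17/8
   between the mean of [Z] and its size off [A]. *)
pose tau : R := (64 * expR 8)^-1.
have e8 : 0 < expR 8 :> R by exact: expR_gt0.
have tau0 : 0 < tau by rewrite invr_gt0 mulr_gt0.
have tau1 : tau <= 1.
  by rewrite invf_le1 ?mulr_gt0//; have := expR_ge1Dx (8 : R); lra.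
exists (tau / 4) => [|Y V mY]; first by rewrite divr_gt0.
rewrite le_eqVlt => /orP[/eqP<- _ _|V0 ub lb].
  rewrite (_ : [set om | _] = setT); last by apply/seteqP; split => // om _; exact: sqr_ge0.
  by rewrite probability_setT lee_fin; lra.
set A := [set om | _].
pose r := Num.sqrt V; have r0 : 0 < r by rewrite sqrtr_gt0.
have rV : r ^+ 2 = V by rewrite sqr_sqrtr// ltW.
(* Normalised so that |lam|^2 V = 1, the largest value for which the quadratic lower bound is
   available. *)
pose lam : Cplx R := (r^-1)%:C%C.
have mlam : modulus lam = r^-1 by rewrite modulus_real normrV ?unitfE ?gt_eqF// gtr0_norm.
have lamV : modulus lam ^+ 2 * V = 1 by rewrite mlam exprVn rV mulVf// gt_eqF.
pose E (zeta : Cplx R) om : R := expR (complex.Re (zeta * Y om)).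
have mE zeta : measurable_fun setT (fun om => (E zeta om)%:E) by exact: measurable_exp_rv.
have mE' zeta : measurable_fun setT (E zeta) by apply/measurable_EFinP; exact: mE.
have E0 zeta om : 0 <= E zeta om by rewrite expR_ge0.
pose Z om := E lam om + E ('i%C * lam) om.
have mZ : measurable_fun setT Z by exact: measurable_funD.
have Z0 om : 0 <= Z om by rewrite addr_ge0.
have mA : measurable A.
  apply: measurable_le_set; first exact: measurable_cst.
  apply: measurable_funX; apply: measurable_funM; first exact: measurable_cst.
  exact: cmeas_modulus.
have EZ : ((9 / 4)%:E <= \int[P]_om (Z om)%:E)%E.
  have -> : (\int[P]_om (Z om)%:E = exp_moment P Y lam + exp_moment P Y ('i%C * lam)%R)%E.
    under eq_integral do rewrite EFinD.
    by rewrite ge0_integralD// => om _; rewrite lee_fin.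
  apply: le_trans (lb lam _); last by rewrite lamV.
  by rewrite lamV lee_fin; lra.
have EZ2 : (\int[P]_om (Z om ^+ 2)%:E <= (4 * expR 8)%:E)%E.
  have h (zeta : Cplx R) : modulus zeta = modulus lam -> (exp_moment P Y (2 * zeta)%R <= (expR 8)%:E)%E.
    move=> hz; apply: le_trans (ub _) _; rewrite lee_fin ler_expR.
    have -> : modulus (2 * zeta) = 2 * modulus lam.
      by rewrite modulusM hz; congr (_ * _); rewrite -[2 in LHS](rmorph_nat (real_complex R)) modulus_real ger0_norm.
    by rewrite exprMn; move: lamV; move: (modulus lam ^+ 2) => x h; nra.
  apply: (@le_trans _ _ (\int[P]_om (2%:E * ((E (2 * lam)%R om)%:E + (E (2 * ('i%C * lam))%R om)%:E)))%E).
    apply: ge0_le_integral => //.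
    - by move=> om _; rewrite lee_fin sqr_ge0.
    - by apply/measurable_EFinP; exact: measurable_funX.
    - apply: emeasurable_funM; first exact: measurable_cst.
      exact: emeasurable_funD (mE _) (mE _).
    - move=> om _; rewrite -EFinD -EFinM lee_fin.
      have sq (zeta : Cplx R) : E (2 * zeta) om = E zeta om ^+ 2.
        by rewrite /E expr2 -expRD -mulrA mulr_natl mulr2n ReD.
      by rewrite !sq /Z; have := sqr_ge0 (E lam om - E ('i%C * lam) om); lra.
  rewrite ge0_integralZl_EFin//; last 2 first.
  - by move=> om _; rewrite adde_ge0 ?lee_fin.
  - exact: emeasurable_funD (mE _) (mE _).
  rewrite ge0_integralD//; [|by move=> om _; rewrite lee_fin|by move=> om _; rewrite lee_fin].
  apply: (@le_trans _ _ (2%:E * ((expR 8)%:E + (expR 8)%:E))%E).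
    by apply: lee_wpmul2l; [rewrite lee_fin|apply: leeD; apply: h => //; exact: modulus_i].
  by rewrite -EFinD -EFinM lee_fin; lra.
(* Off [A] one has |lam Y| <= 1/17, so each exponential is at most 1 / (1 - 1/17) = 17/16, hence the
   constant 17 in the statement; on [A] the square inequality gives Z <= tau Z^2 + 1 / (4 tau). *)
have pw om : Z om <= 17 / 8 + tau * Z om ^+ 2 + (4 * tau)^-1 * \1_A om.
  rewrite indicE; case: (boolP (om \in A)) => [_|]; last first.
    rewrite notin_setE /A /= mulr0 addr0 => /negP; rewrite -ltNge => h.
    have hY : modulus (Y om) <= r / 17.
      rewrite ler_pdivlMr// mulrC leNgt; apply/negP => hr; move: h; apply/negP; rewrite -leNgt -rV.
      by rewrite lerXn2r ?nnegrE ?mulr_ge0 ?modulus_ge0 ?(ltW r0) ?(ltW hr).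
    have one (zeta : Cplx R) : modulus zeta = r^-1 -> E zeta om <= 17 / 16.
      move=> hz; have hm : modulus (zeta * Y om) <= 1 / 17.
        rewrite modulusM hz; apply: (@le_trans _ _ (r^-1 * (r / 17))).
          by rewrite ler_wpM2l// invr_ge0 ltW.
        by rewrite mulrA mulVf ?gt_eqF.
      have hR := le_trans (Re_le_modulus _) hm.
      have hR' : complex.Re (zeta * Y om) <= 1 / 17 by apply: le_trans (ler_norm _) hR.
      apply: (@le_trans _ _ (expR (1 / 17))); first by rewrite ler_expR.
      apply: le_trans (expR_le_inv _) _; first by lra.
      by rewrite -div1r ler_pdivrMr; lra.
    have := one _ mlam; have := one _ (etrans (modulus_i lam) mlam).
    by rewrite /Z; have := mulr_ge0 (ltW tau0) (sqr_ge0 (Z om)); rewrite /Z; lra.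
  rewrite mulr1; have : 0 <= (2 * tau * Z om - 1) ^+ 2 by exact: sqr_ge0.
  have e : tau * Z om ^+ 2 + (4 * tau)^-1 - Z om = (2 * tau * Z om - 1) ^+ 2 * (4 * tau)^-1.
    by field; rewrite gt_eqF.
  move=> /mulr_ge0 /(_ (_ : 0 <= (4 * tau)^-1)); rewrite -e invr_ge0 mulr_ge0 ?(ltW tau0)// => /(_ isT).
  by lra.
have fin : P A \is a fin_num by exact: fin_num_measure.
pose x := fine (P A).
have Px : P A = x%:E by rewrite /x fineK.
rewrite Px lee_fin.
have : ((9 / 4)%:E <= (17 / 8)%:E + (tau * (4 * expR 8))%:E + ((4 * tau)^-1 * x)%:E)%E.
  apply: le_trans EZ _.
  apply: (@le_trans _ _ (\int[P]_om (((17 / 8)%:E + (tau * Z om ^+ 2)%:E) + ((4 * tau)^-1 * \1_A om)%:E))%E).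
    apply: ge0_le_integral => //.
    - by move=> om _; rewrite lee_fin.
    - exact/measurable_EFinP.
    - apply/measurable_EFinP; apply: measurable_funD; last first.
        by apply: measurable_funM; [exact: measurable_cst|exact: measurable_indic].
      apply: measurable_funD; first exact: measurable_cst.
      by apply: measurable_funM; [exact: measurable_cst|exact: measurable_funX].
    - by move=> om _; rewrite -!EFinD lee_fin.
  rewrite ge0_integralD//; last 4 first.
  - by move=> om _; rewrite -EFinD lee_fin addr_ge0// mulr_ge0 ?sqr_ge0 ?(ltW tau0).
  - apply/measurable_EFinP; apply: measurable_funD; first exact: measurable_cst.
    by apply: measurable_funM; [exact: measurable_cst|exact: measurable_funX].
  - by move=> om _; rewrite lee_fin mulr_ge0 ?invr_ge0 ?mulr_ge0 ?(ltW tau0)// indicE ler0n.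
  - by apply/measurable_EFinP; apply: measurable_funM; [exact: measurable_cst|exact: measurable_indic].
  rewrite ge0_integralD//; last 2 first.
  - by move=> om _; rewrite lee_fin mulr_ge0 ?sqr_ge0 ?(ltW tau0).
  - by apply/measurable_EFinP; apply: measurable_funM; [exact: measurable_cst|exact: measurable_funX].
  apply: leeD; [apply: leeD|].
  - rewrite integral_cst// -[leRHS]mule1; apply: lee_wpmul2l; first by rewrite lee_fin.
    exact: probability_le1.
  - under eq_integral do rewrite EFinM.
    rewrite ge0_integralZl_EFin ?(ltW tau0)//.
    + by rewrite EFinM; apply: lee_wpmul2l => //; rewrite lee_fin ltW.
    + by move=> om _; rewrite lee_fin sqr_ge0.
    + by apply/measurable_EFinP; exact: measurable_funX.
  - under eq_integral do rewrite EFinM.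
    rewrite ge0_integralZl_EFin ?invr_ge0 ?mulr_ge0 ?(ltW tau0)//.
    + have -> : (\int[P]_om (\1_A om)%:E = x%:E)%E by rewrite integral_indic// setIT; exact: Px.
      by rewrite EFinM.
    + by apply/measurable_EFinP; exact: measurable_indic.
rewrite -!EFinD lee_fin.
have -> : tau * (4 * expR 8) = 1 / 16 by rewrite /tau; field; rewrite gt_eqF.
have -> : (4 * tau)^-1 * x = x / (4 * tau) by rewrite mulrC.
move=> h; have : 1 / 16 <= x / (4 * tau) by lra.
by rewrite ler_pdivlMr ?mulr_gt0//; lra.
Qed.

End subgaussian_variables.

(** * Random power series *)

Section random_series.
Context (R : realType) (d : measure_display) (Omega : measurableType d).
Variable P : probability Omega R.
Implicit Types (Y : Omega -> Cplx R) (X : nat -> Omega -> Cplx R) (c : nat -> Cplx R).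
Implicit Types (a : nat -> Cplx R) (z : Cplx R) (V : R).

Lemma prod_ge_1Dsum (x : nat -> R) n : (forall k, (k < n)%N -> 1 <= x k) ->
  1 + \sum_(k < n) (x k - 1) <= \prod_(k < n) x k.
Proof.
elim: n => [|n IH] hx; first by rewrite !big_ord0 addr0.
rewrite !big_ord_recr /=.
have h1 := IH (fun k kn => hx k (ltnW kn)).
have h2 := hx n (ltnSn n).
have h3 : 0 <= \sum_(k < n) (x k - 1).
  by apply: sumr_ge0 => k _; rewrite subr_ge0; apply: hx; rewrite ltnW// ltnS ltn_ord.
move: h1 h2 h3; move: (\sum_(k < n) _) (\prod_(k < n) _) (x n); clear => s p y; nra.
Qed.

Definition rsum X c n om : Cplx R := \sum_(k < n) X k om * c k.

Definition l2 c n : R := \sum_(k < n) modulus (c k) ^+ 2.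

Lemma l2_ge0 c n : 0 <= l2 c n.
Proof. by apply: sumr_ge0 => k _; exact: sqr_ge0. Qed.

Hypothesis (X : nat -> Omega -> Cplx R) (hX : standard_random_sequence P X).

Let mX n : complex_rv (X n). Proof. by case: hX. Qed.
Let cX n : cmeas (X n). Proof. exact: cmeas_of_complex_rv. Qed.

Lemma cmeas_rsum c n : cmeas (rsum X c n).
Proof.
by apply: (cmeas_sum (F := fun k om => X k om * c k)) => k; apply: cmeasM => //; exact: cmeas_cst.
Qed.

Lemma exp_moment_rsum c n lam :
  exp_moment P (rsum X c n) lam = (\prod_(k < n) exp_moment P (X k) (lam * c k)%R)%E.
Proof.
have [_ iX _] := hX.
have := expectation_prod_independent (g := fun k => exp_kernel (lam * c k)) n mX iX
  (fun k => measurable_exp_kernel _) (fun k w => exp_kernel_ge0 _ _).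
under [X in _ = X -> _]eq_bigr do rewrite -exp_momentE.
move=> <-; apply: eq_integral => om _; congr (_%:E).
rewrite /rsum mulr_sumr Re_sum expR_sum; apply: eq_bigr => k _.
by rewrite /exp_kernel of_planeK mulrA mulrAC.
Qed.

Lemma exp_moment_real c lam k : exists2 x, exp_moment P (X k) (lam * c k) = x%:E &
  0 <= x <= expR (2 * modulus lam ^+ 2 * modulus (c k) ^+ 2).
Proof.
have [_ h _] := standard_subgaussian hX k (lam * c k).
have h0 : (0 <= exp_moment P (X k) (lam * c k)%R)%E.
  by apply: integral_ge0 => om _; rewrite lee_fin expR_ge0.
exists (fine (exp_moment P (X k) (lam * c k))).
  by rewrite fineK// ge0_fin_numE// (le_lt_trans h)// ltry.
rewrite fine_ge0//= -lee_fin fineK; last by rewrite ge0_fin_numE// (le_lt_trans h)// ltry.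
by apply: le_trans h _; rewrite modulusM exprMn mulrA.
Qed.

Lemma exp_moment_rsum_ub c n lam :
  (exp_moment P (rsum X c n) lam <= (expR (2 * modulus lam ^+ 2 * l2 c n))%:E)%E.
Proof.
rewrite exp_moment_rsum /l2 mulr_sumr expR_sum.
elim: n => [|n IH]; first by rewrite !big_ord0.
rewrite !big_ord_recr /= EFinM; apply: lee_pmul => //.
- elim/big_ind: _ => // [x y x0 y0|k _]; first exact: mule_ge0.
  by have [x -> /andP[x0 _]] := exp_moment_real c lam k; rewrite lee_fin.
- by have [x -> /andP[x0 _]] := exp_moment_real c lam n; rewrite lee_fin.
by have [x -> /andP[_ h]] := exp_moment_real c lam n; rewrite lee_fin.
Qed.

(** The constraint makes every |lam c_k| at most 1, so all factors are at least 1 and the products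
    for lam and i lam are bounded below by sums of increments; these are then added index by index,
    since neither direction alone has a quadratic lower bound. *)
Lemma exp_moment_rsum_lb c n lam : modulus lam ^+ 2 * l2 c n <= 1 ->
  ((2 + modulus lam ^+ 2 * l2 c n / 4)%:E <=
    exp_moment P (rsum X c n) lam + exp_moment P (rsum X c n) ('i%C * lam)%R)%E.
Proof.
move=> h; rewrite !exp_moment_rsum.
have small k : (k < n)%N -> modulus (lam * c k) <= 1.
  move=> kn; rewrite -(@ler_pXn2r _ 2)// ?nnegrE ?modulus_ge0// expr1n modulusM exprMn.
  apply: le_trans h; rewrite ler_wpM2l ?sqr_ge0// /l2 (bigD1 (Ordinal kn))//= lerDl.
  by apply: sumr_ge0 => i _; exact: sqr_ge0.
pose x k := fine (exp_moment P (X k) (lam * c k)).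
pose y k := fine (exp_moment P (X k) ('i%C * lam * c k)).
have xE k : exp_moment P (X k) (lam * c k) = (x k)%:E.
  by have [x' e _] := exp_moment_real c lam k; rewrite /x e.
have yE k : exp_moment P (X k) ('i%C * lam * c k) = (y k)%:E.
  by have [x' e _] := exp_moment_real c ('i%C * lam) k; rewrite /y e.
have x1 k : (k < n)%N -> 1 <= x k.
  by move=> /small h1; rewrite -lee_fin -xE; have [->] := standard_subgaussian hX k (lam * c k).
have y1 k : (k < n)%N -> 1 <= y k.
  move=> /small h1; rewrite -lee_fin -yE.
  have [->//] := standard_subgaussian hX k ('i%C * lam * c k).
  by rewrite -mulrA modulus_i.
have xy k : (k < n)%N -> modulus lam ^+ 2 * modulus (c k) ^+ 2 / 4 <= (x k - 1) + (y k - 1).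
  move=> /small h1; have [_ _ /(_ h1)] := standard_subgaussian hX k (lam * c k).
  by rewrite mulrA xE yE -EFinD lee_fin modulusM exprMn; lra.
under eq_bigr do rewrite xE.
under [X in (_ <= _ + X)%E]eq_bigr do rewrite yE.
rewrite !prodEFin -EFinD lee_fin.
apply: le_trans (lerD (prod_ge_1Dsum x1) (prod_ge_1Dsum y1)).
rewrite addrACA -big_split /= lerD2l /l2 mulr_sumr mulr_suml.
by apply: ler_sum => k _; apply: xy.
Qed.

(** V is any positive bound for the variance, which avoids normalising by a vanishing [l2]. *)
Lemma rsum_moment l : (0 < l)%N -> exists2 C : R, 0 <= C & forall c n V,
  0 < V -> l2 c n <= V -> (\int[P]_om (modulus (rsum X c n om) ^+ (2 * l))%:E <= (C * V ^+ l)%:E)%E.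
Proof.
move=> l0; have [C C0 H] := subgaussian_moment P l0; exists C => // c n V V0 hV.
apply: H => //; first exact: cmeas_rsum.
move=> lam; apply: le_trans (exp_moment_rsum_ub c n lam) _.
by rewrite lee_fin ler_expR ler_wpM2l// mulr_ge0 ?sqr_ge0.
Qed.

Lemma rsum_lower : exists2 delta : R, 0 < delta & forall c n,
  (delta%:E <= P [set om | (l2 c n <= (17 * modulus (rsum X c n om)) ^+ 2)%R])%E.
Proof.
have [delta d0 H] := paley_zygmund P; exists delta => // c n; apply: H.
- exact: cmeas_rsum.
- exact: l2_ge0.
- exact: exp_moment_rsum_ub.
- exact: exp_moment_rsum_lb.
Qed.

Lemma psum_randomization a z n om :
  psum (randomization X a om) n z = rsum X (fun k => a k * z ^+ k) n om.
Proof. by apply: eq_bigr => k _; rewrite /randomization mulrA. Qed.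

Lemma l2_power a z n : l2 (fun k => a k * z ^+ k) n = \sum_(k < n) sq_terms a (modulus z) k.
Proof.
by apply: eq_bigr => k _; rewrite /sq_terms modulusM modulusX exprMn -exprM mulnC.
Qed.

Lemma cmeas_randomization a k : cmeas (fun om => randomization X a om k).
Proof. by apply: cmeasM => //; exact: cmeas_cst. Qed.

Lemma expectation_modulus : exists2 K : R, 0 <= K & forall k,
  (\int[P]_om (modulus (X k om))%:E <= K%:E)%E.
Proof.
have [C C0 H] := rsum_moment (ltnSn 0).
exists (1 + C) => [|k]; first by rewrite addr_ge0.
(* A unit coefficient at index k alone makes [rsum] equal to X_k. *)
pose c j : Cplx R := (j == k)%:R.
have l2c : l2 c k.+1 <= 1.
  rewrite /l2 big_ord_recr /= /c eqxx modulus1 expr1n big1 ?add0r// => j _.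
  by rewrite (ltn_eqF (ltn_ord j)) modulus0 expr0n.
have rs om : rsum X c k.+1 om = X k om.
  rewrite /rsum big_ord_recr /= /c eqxx mulr1 big1 ?add0r// => j _.
  by rewrite (ltn_eqF (ltn_ord j)) mulr0.
have := H c k.+1 1 ltr01 l2c; under eq_integral do rewrite rs.
rewrite muln1 expr1 mulr1 => h.
have mm : measurable_fun setT (fun om => modulus (X k om)) by exact: cmeas_modulus.
apply: (@le_trans _ _ (\int[P]_om (1 + (modulus (X k om) ^+ 2)%:E))%E).
  apply: ge0_le_integral => //.
  - by move=> om _; rewrite lee_fin modulus_ge0.
  - exact/measurable_EFinP.
  - apply: emeasurable_funD; first exact: measurable_cst.
    by apply/measurable_EFinP; exact: measurable_funX.
  - move=> om _; rewrite -EFinD lee_fin.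
    by have := sqr_ge0 (modulus (X k om) - 1); have := modulus_ge0 (X k om); move: (modulus _) => x; nra.
rewrite ge0_integralD//; last 2 first.
- by move=> om _; rewrite lee_fin sqr_ge0.
- by apply/measurable_EFinP; exact: measurable_funX.
rewrite EFinD; apply: leeD => //.
by rewrite integral_cst// mul1e; exact: probability_le1.
Qed.

(** The first moments of |X_k| are uniformly bounded, so the expected absolute series is finite at
    each dyadic radius, and countably many radii tending to 1 suffice. *)
Lemma ae_absconv a : absconv a -> {ae P, forall om, absconv (randomization X a om)}.
Proof.
move=> ha; have [K K0 HK] := expectation_modulus.
pose F j om := (\sum_(k <oo) (modulus (X k om) * abs_terms a (dyrad R j) k)%:E)%E.
have t0 j k : 0 <= abs_terms a (dyrad R j) k by apply: abs_terms_ge0; exact: dyrad_ge0.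
have mX1 k : measurable_fun setT (fun om => modulus (X k om)) by exact: cmeas_modulus.
have mt j k : measurable_fun setT (fun om => (modulus (X k om) * abs_terms a (dyrad R j) k)%:E).
  by apply/measurable_EFinP; apply: measurable_funM => //; exact: measurable_cst.
have F0 j om : (0 <= F j om)%E.
  by apply: nneseries_ge0 => k _ _; rewrite lee_fin mulr_ge0// modulus_ge0.
have mF j : measurable_fun setT (F j).
  by apply: ge0_emeasurable_sum => [k om _ _|k _//]; rewrite lee_fin mulr_ge0// modulus_ge0.
have EF j : (\int[P]_om F j om < +oo)%E.
  rewrite integral_nneseries//; last by move=> k om _; rewrite lee_fin mulr_ge0// modulus_ge0.
  have hc := ha _ (dyrad_ge0 R j) (dyrad_lt1 R j).
  apply: (@le_lt_trans _ _ (K * limn (series (abs_terms a (dyrad R j))))%:E); last exact: ltry.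
  apply: nneseries_le_of_partial => [k|n].
    by apply: integral_ge0 => om _; rewrite lee_fin mulr_ge0// modulus_ge0.
  apply: (@le_trans _ _ (\sum_(k < n) (K * abs_terms a (dyrad R j) k)%:E)%E).
    apply: lee_sum => k _; under eq_integral do rewrite mulrC EFinM.
    rewrite ge0_integralZl_EFin//.
    - by rewrite mulrC [leRHS]EFinM; apply: lee_wpmul2l; [rewrite lee_fin|exact: HK].
    - by move=> om _; rewrite lee_fin modulus_ge0.
    - exact/measurable_EFinP.
  rewrite sumEFin lee_fin -mulr_sumr ler_wpM2l//.
  have := nondecreasing_cvgn_le (nondecreasing_series (fun k _ _ => t0 j k)) hc n.
  by rewrite /series /= big_mkord.
have aeF : {ae P, forall om, forall j, setT om -> F j om \is a fin_num}.
  apply/ae_foralln => j; apply: integrable_ae => //.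
  apply/integrableP; split; first exact: mF.
  by under eq_integral do rewrite gee0_abs//.
apply: filterS aeF => om h; apply: absconv_of_bounded => r r0 r1.
have [j hj] : exists j, eps R j < 1 - r by apply: eps_lt; rewrite subr_gt0.
have rj : r <= dyrad R j by rewrite /dyrad lerBrDr addrC -lerBrDr ltW.
exists (fine (F j om)) => k.
apply: (@le_trans _ _ (modulus (X k om) * abs_terms a (dyrad R j) k)).
  rewrite /abs_terms /randomization modulusM mulrA ler_wpM2l ?mulr_ge0 ?modulus_ge0//.
  by rewrite lerXn2r ?nnegrE// (le_trans r0).
rewrite -lee_fin fineK; last exact: h.
apply: (term_le_nneseries (u := fun k => (modulus (X k om) * abs_terms a (dyrad R j) k)%:E)) => n.
by rewrite lee_fin mulr_ge0// modulus_ge0.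
Qed.

(** Fatou: [Upow] is a lower limit of quantities whose expectation is bounded uniformly in the
    number of terms. *)
Lemma expectation_Upow_le l : (0 < l)%N -> exists2 C : R, 0 <= C & forall a w V,
  0 < V -> absconv a -> modulus (of_plane w) < 1 -> M2sq a (modulus (of_plane w)) <= V ->
  (\int[P]_om Upow (2 * l)%:R (randomization X a om) w <= (C * V ^+ l)%:E)%E.
Proof.
move=> l0; have [C C0 H] := rsum_moment l0; exists C => // a w V V0 ha w1 hV.
pose g n om := (modulus (psum (randomization X a om) n (of_plane w)) `^ (2 * l)%:R)%:E.
have mg n : measurable_fun setT (g n).
  apply/measurable_EFinP; apply: (meas_comp (f := fun x => x `^ (2 * l)%:R)); first exact: measurable_powR.
  apply: cmeas_modulus; apply: cmeas_psum; last exact: cmeas_cst.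
  by move=> k; exact: cmeas_randomization.
apply: le_trans (fatou P measurableT mg _) _.
  by move=> n om _; rewrite lee_fin powR_ge0.
rewrite limn_einf_lim; apply: lime_le; first exact: is_cvg_einfs.
apply: nearW => n; apply: ereal_inf_le; exists (\int[P]_om g n om)%E; first by exists n => /=.
under eq_integral do rewrite /g powR_mulrn ?modulus_ge0// psum_randomization.
apply: H => //; apply: le_trans hV; rewrite l2_power.
by apply: sq_terms_partial_le => //; exact: modulus_ge0.
Qed.

(** The events for partial sums have probability at least delta, uniformly in n. Their upper limit
    keeps that probability, and on it the inequality holds infinitely often, hence for the limit. *)
Lemma lower_event : exists2 delta : R, 0 < delta & forall a z, absconv a -> modulus z < 1 ->
  exists2 A : set Omega, measurable A /\ (delta%:E <= P A)%E &
  forall om, A om -> absconv (randomization X a om) ->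
    M2sq a (modulus z) <= (17 * modulus (power_sum (randomization X a om) z)) ^+ 2.
Proof.
have [delta d0 H] := rsum_lower; exists delta => // a z ha z1.
pose c k := a k * z ^+ k.
pose B n := [set om | l2 c n <= (17 * modulus (rsum X c n om)) ^+ 2].
have mB n : measurable (B n).
  apply: measurable_le_set; first exact: measurable_cst.
  apply: measurable_funX; apply: measurable_funM; first exact: measurable_cst.
  by apply: cmeas_modulus; exact: cmeas_rsum.
exists (lim_sup_set B).
  have mL : measurable (lim_sup_set B).
    by apply: bigcap_measurableType => n _; apply: bigcup_measurable.
  split=> //.
  have P1 : (P (\bigcup_(k in [set k | (k >= 0)%N]) B k) < +oo)%E.
    by apply: le_lt_trans (probability_le1 _ _) (ltry _); exact: bigcup_measurable.
  have hc := lim_sup_set_cvg P B mB P1.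
  rewrite -(cvg_lim _ hc)//; apply: lime_ge; first exact: cvgP hc.
  apply: nearW => n; apply: le_trans (H c n) _.
  apply: le_measure; rewrite ?inE//; first exact: mB.
    by apply: bigcup_measurable.
  by move=> om hom; exists n => /=.
move=> om hA hom; rewrite leNgt; apply/negP => hlt.
set f := power_sum _ in hlt.
have zd : disk R z by [].
have hf : power_expansion f (randomization X a om) by exact: power_expansion_power_sum.
have c1 : (17 * modulus (rsum X c n om)) ^+ 2 @[n --> \oo] --> (17 * modulus (f z)) ^+ 2.
  have : modulus (rsum X c n om) @[n --> \oo] --> modulus (f z).
    have := cvg_modulus (power_expansion_cvg hf zd).
    by under eq_cvg do rewrite psum_randomization.
  move=> h; have h' : 17 * modulus (rsum X c n om) @[n --> \oo] --> 17 * modulus (f z).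
    by apply: cvgM => //; exact: cvg_cst.
  under eq_cvg do rewrite expr2.
  by rewrite expr2; exact: cvgM.
have c2 : l2 c n @[n --> \oo] --> M2sq a (modulus z).
  have := is_cvg_sq_terms ha (modulus_ge0 z) z1; rewrite /M2sq /series /=.
  by under eq_fun do rewrite big_mkord -l2_power.
have c3 : (l2 c n - (17 * modulus (rsum X c n om)) ^+ 2) @[n --> \oo] --> M2sq a (modulus z) - (17 * modulus (f z)) ^+ 2 by exact: cvgB.
have : 0 < M2sq a (modulus z) - (17 * modulus (f z)) ^+ 2 by rewrite subr_gt0.
move=> h0; have [N _ hN] := cvgr_gt _ c3 _ h0.
have [n /= Nn hn] := hA N I.
by have := hN n Nn; rewrite /= subr_gt0 ltNge hn.
Qed.

End random_series.

(** * Random series over events of probability bounded below *)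

Section frequent_events.
Context (R : realType) (d : measure_display) (Omega : measurableType d).
Variable P : probability Omega R.

Lemma frequent_events_sum (b : nat -> R) (A : nat -> set Omega) (delta : R) :
  (forall k, 0 <= b k) -> 0 < delta -> (forall k, measurable (A k)) ->
  (forall k, (delta%:E <= P (A k))%E) ->
  {ae P, forall om, (\sum_(k <oo) (b k * \1_(A k) om)%:E < +oo)%E} ->
  (\sum_(k <oo) (b k)%:E < +oo)%E.
Proof.
move=> b0 d0 mA hA hT.
pose T om := (\sum_(k <oo) (b k * \1_(A k) om)%:E)%E.
have t0 k om : (0 <= (b k * \1_(A k) om)%:E)%E by rewrite lee_fin mulr_ge0// indicE ler0n.
have mt k : measurable_fun setT (fun om => (b k * \1_(A k) om)%:E).
  by apply/measurable_EFinP; apply: measurable_funM; [exact: measurable_cst|exact: measurable_indic].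
have mT : measurable_fun setT T by apply: ge0_emeasurable_sum => // k om _ _.
pose F n := [set om | (n%:R%:E < T om)%E].
have mF n : measurable (F n).
  by rewrite -[F n]setTI; exact: emeasurable_fun_o_infty.
have F0 : P (\bigcap_n F n) = 0.
  case: hT => N [mN N0 hN]; apply/eqP; rewrite eq_le measure_ge0 andbT.
  rewrite -N0; apply: le_measure; rewrite ?inE//.
    by apply: bigcap_measurableType => n _; exact: mF.
  move=> om hom; apply: hN => /= hlt.
  have [x Tx] : exists x, T om = x%:E.
    by exists (fine (T om)); rewrite fineK// ge0_fin_numE//; apply: nneseries_ge0 => k _ _; exact: t0.
  have := hom (Num.truncn x).+1 I; rewrite /F /= Tx lte_fin => h.
  by have := lt_trans (truncnS_gt x) h; rewrite ltxx.
have Fc : P (F n) @[n --> \oo] --> (0 : \bar R).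
  rewrite -F0; apply: nonincreasing_cvg_mu => //.
  - by apply: le_lt_trans (probability_le1 _ _) (ltry _).
  - by apply: bigcap_measurableType => n _; exact: mF.
  - move=> n m nm; apply/subsetPset => om; rewrite /F /=; apply: le_lt_trans.
    by rewrite lee_fin ler_nat.
have [N hN] : exists N, (P (F N) < (delta / 2)%:E)%E.
  have /fine_cvgP[_ hc] := Fc.
  have d2 : 0 < delta / 2 by rewrite divr_gt0.
  have [N _ h] := cvgr_lt _ hc _ d2; exists N.
  rewrite -(fineK (_ : P (F N) \is a fin_num)) ?lte_fin; last exact: fin_num_measure.
  exact: (h N (leqnn N)).
pose G := ~` F N.
have mG : measurable G by exact: measurableC.
have hAG k : ((delta / 2)%:E <= P (A k `&` G))%E.
  have h1 : (P (A k) <= P (A k `&` G) + P (F N))%E.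
    rewrite (measureDI P (mA k) mG) addeC leeD2l// le_measure ?inE//; last first.
      by rewrite /G => om [_ /= h]; apply: contrapT.
    exact: measurableD.
  have fG : P (A k `&` G) \is a fin_num by apply: fin_num_measure; exact: measurableI.
  have fF : P (F N) \is a fin_num by exact: fin_num_measure.
  move: (le_trans (hA k) h1) hN; rewrite -(fineK fG) -(fineK fF) -EFinD !lee_fin lte_fin.
  by lra.
suff h n : (\sum_(k < n) b k) * (delta / 2) <= N%:R.
  apply: (@le_lt_trans _ _ (N%:R / (delta / 2))%:E); last exact: ltry.
  apply: nneseries_le_of_partial => [k|n]; first by rewrite lee_fin.
  by rewrite sumEFin lee_fin ler_pdivlMr ?divr_gt0.
rewrite -lee_fin; apply: (@le_trans _ _ (\int[P]_(om in G) T om)%E); last first.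
  apply: (@le_trans _ _ (\int[P]_(om in G) N%:R%:E)%E).
    apply: ge0_le_integral => //.
    - by move=> om _; apply: nneseries_ge0 => k _ _; exact: t0.
    - exact: measurable_funTS.
    - by move=> om /= h; rewrite leNgt; apply/negP.
  rewrite integral_cst// -[leRHS]mule1; apply: lee_wpmul2l; first by rewrite lee_fin.
  exact: probability_le1.
apply: (@le_trans _ _ (\int[P]_(om in G) \sum_(k < n) (b k * \1_(A k) om)%:E)%E); last first.
  apply: ge0_le_integral => //.
  - by move=> om _; apply: sume_ge0 => k _; exact: t0.
  - by apply: measurable_funTS; apply: emeasurable_sum => k; exact: mt.
  - exact: measurable_funTS.
  - by move=> om _; apply: (nneseries_ge_partial (u := fun k => (b k * \1_(A k) om)%:E)).
rewrite ge0_integral_sum//; last by move=> k; exact: measurable_funTS.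
rewrite mulr_suml -sumEFin; apply: lee_sum => k _.
under eq_integral do rewrite EFinM.
rewrite ge0_integralZl_EFin//.
- by rewrite EFinM integral_indic//; apply: lee_wpmul2l; [rewrite lee_fin|exact: hAG].
- by apply/measurable_EFinP; exact: measurable_indic.
Qed.

End frequent_events.

(** * The almost sure membership criterion *)

Section criterion.
Context (R : realType) (d : measure_display) (Omega : measurableType d).
Variable P : probability Omega R.
Variables (X : nat -> Omega -> Cplx R) (hX : standard_random_sequence P X).
Implicit Types (a : nat -> Cplx R) (u v beta t : R).
Local Notation mu := (@lebesgue_measure R).
Local Notation circ := (`[0%R, (2 * pi)%R]%classic : set R).
Local Notation rnd a om := (randomization X a om).

Lemma measurable_random_cone u beta a :
  measurable_fun setT (fun x : Omega * measurableTypeR R => cone_meas u beta (rnd a x.1) (coneset x.2)).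
Proof.
apply: (@measurable_cone_meas _ _ _ _ _ (fun om => rnd a om) [set tw : R * (R * R) | coneset tw.1 tw.2]).
  by move=> k; exact: (cmeas_randomization hX).
exact: measurable_coneset2.
Qed.

(** Almost surely the cone integral is finite at almost every angle, whatever the exponent v / u.
    Tonelli exchanges the two quantifiers, and the circle, having positive measure, contains an
    angle outside the exceptional null set. *)
Lemma finite_cone_exists u v beta a : 0 < u -> 0 < v ->
  {ae P, forall om, absconv (rnd a om) /\ (tent_norm_pow v u beta (power_sum (rnd a om)) < +oo)%E} ->
  exists t, {ae P, forall om, (cone_meas u beta (rnd a om) (coneset t) < +oo)%E}.
Proof.
move=> u0 v0 h.
pose F (x : Omega * measurableTypeR R) := cone_meas u beta (rnd a x.1) (coneset x.2).
have mF : measurable_fun setT F by exact: measurable_random_cone.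
have F0 x : (0 <= F x)%E by exact: cone_meas_ge0.
pose B := [set x | F x = +oo%E] `&` [set x | circ x.2].
have mB : measurable B.
  apply: measurableI.
    rewrite (_ : [set x | _] = F @^-1` [set +oo%E])//.
    by rewrite -[X in measurable X]setTI; apply: mF.
  rewrite -[X in measurable X]setTI; apply: (@measurable_snd _ _ Omega (measurableTypeR R)) => //.
pose Psi x : \bar R := (\1_B x)%:E.
have mPsi : measurable_fun setT Psi by apply/measurable_EFinP; exact: measurable_indic.
have Psi0 x : (0 <= Psi x)%E by rewrite lee_fin indicE ler0n.
have z1 : (\int[P]_om \int[mu]_t Psi (om, t) = 0)%E.
  have mI : measurable_fun setT (fun om => \int[mu]_t Psi (om, t))%E.
    exact: (measurable_fun_fubini_tonelli_F (m2 := mu)).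
  rewrite (@ge0_ae_eq_integral _ _ _ P setT _ (cst 0%E))//.
  - by rewrite integral_cst// mul0e.
  - by move=> om _; exact: integral_ge0.
  apply: filterS h => om [ha hJ] _.
  rewrite (@ge0_ae_eq_integral _ _ _ mu setT _ (cst 0%E))//.
  - by rewrite integral_cst// mul0e.
  - by apply: (meas_comp (f := Psi) (g := fun t => (om, t))) => //; exact: measurable_fun_pair.
  have hf := power_expansion_power_sum ha.
  have mC := measurable_cone_integral beta u0 hf.
  have mCp : measurable_fun circ (fun t => cone_integral u beta (power_sum (rnd a om)) (circle_pt t) `^ (v / u))%E.
    by apply: measurable_funTS; apply: (meas_comp (f := fun x => (x `^ (v / u))%E)) => //; exact: measurable_poweR.
  have := @integrable_ae _ _ _ mu circ (measurable_itv _) _ (_ : mu.-integrable circ (fun t => cone_integral u beta (power_sum (rnd a om)) (circle_pt t) `^ (v / u))%E).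
  have hi : mu.-integrable circ (fun t => cone_integral u beta (power_sum (rnd a om)) (circle_pt t) `^ (v / u))%E.
    apply/integrableP; split=> //.
    by under eq_integral do rewrite gee0_abs ?poweR_ge0//.
  move=> /(_ hi); apply: filterS => t ht _.
  rewrite /Psi indicE (_ : (_ \in B) = false)//; apply/negbTE; rewrite notin_setE => -[/= Ft ct].
  have := ht ct; rewrite (cone_integralE _ _ u0 hf) -[cone_meas _ _ _ _]/(F (om, t)) Ft poweRyr//.
  by rewrite gt_eqF// divr_gt0.
have z2 : (\int[mu]_t \int[P]_om Psi (om, t) = 0)%E.
  by rewrite -z1; apply/esym; exact: (fubini_tonelli (m1 := P) (m2 := mu) Psi).
have mI2 : measurable_fun setT (fun t => \int[P]_om Psi (om, t))%E.
  exact: (measurable_fun_fubini_tonelli_G (m1 := P)).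
have I20 t : (0 <= \int[P]_om Psi (om, t))%E by exact: integral_ge0.
have [N [mN N0 hN]] : {ae mu, forall t, setT t -> (\int[P]_om Psi (om, t) = 0)%E}.
  apply/(ae_eq_integral_abs mu measurableT mI2).
  by rewrite -[RHS]z2; apply: eq_integral => t _; rewrite gee0_abs.
have [t [ct Nt]] : exists t, circ t /\ ~ N t.
  apply: contrapT => hno.
  have : (mu circ <= mu N)%E.
    apply: le_measure; rewrite ?inE//.
    by move=> t ct; apply: contrapT => Nt; apply: hno; exists t.
  by rewrite N0 lebesgue_measure_itv/= lte_fin mulr_gt0 ?pi_gt0// -EFinB subr0 lee_fin leNgt mulr_gt0 ?pi_gt0.
exists t.
have It : (\int[P]_om Psi (om, t) = 0)%E by apply: contrapT => h0; apply: Nt; apply: hN => /= /(_ I).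
have mP : measurable_fun setT (fun om => Psi (om, t)).
  by apply: (meas_comp (f := Psi) (g := fun om => (om, t))) => //; exact: measurable_fun_pair.
have [_ hae] := ae_eq_integral_abs P measurableT mP.
have : {ae P, forall om, setT om -> Psi (om, t) = 0%E}.
  apply/(ae_eq_integral_abs P measurableT mP).
  by rewrite -[RHS]It; apply: eq_integral => om _; rewrite gee0_abs.
apply: filterS => om /(_ I) hom; rewrite ltey; apply/eqP => hF.
move: hom; rewrite /Psi indicE mem_set//.
by move=> [] /eqP; rewrite oner_eq0.
Qed.

(** At the angle just found, [lower_event] compares [block] with the square of 17 times the ray
    term; the ray sum is almost surely finite, so [frequent_events_sum] applies to the blocks. *)
Lemma embedding_necessary u v beta a : 0 < u -> 0 < v -> absconv a ->
  {ae P, forall om, absconv (rnd a om) /\ (tent_norm_pow v u beta (power_sum (rnd a om)) < +oo)%E} ->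
  (block_sum u ((beta + 2) / u) a < +oo)%E.
Proof.
move=> u0 v0 ha h; have [t ht] := finite_cone_exists u0 v0 h.
set s := (beta + 2) / u.
have [delta d0 hd] := lower_event hX.
have z1 k : modulus (dyrad_pt k t : Cplx R) < 1 by rewrite modulus_dyrad_pt dyrad_lt1.
have /choice[A hA] k : exists A : set Omega, [/\ measurable A, (delta%:E <= P A)%E &
   forall om, A om -> absconv (rnd a om) ->
    M2sq a (dyrad R k.+1) <= (17 * modulus (power_sum (rnd a om) (dyrad_pt k.+1 t))) ^+ 2].
  have [A [mA PA] H] := hd a _ ha (z1 k.+1); exists A; split=> // om hom hc.
  by have := H om hom hc; rewrite modulus_dyrad_pt.
have [c c0 hray] := ray_sum_le_cone beta u0.
apply: (@frequent_events_sum _ _ _ P (fun k => block a s k `^ (u / 2)) A delta) => //.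
- by move=> k; exact: powR_ge0.
- by move=> k; have [] := hA k.
- by move=> k; have [] := hA k.
apply: filterS2 h ht => om [hom _] hF.
have hf := power_expansion_power_sum hom.
have hr := hray _ _ t hf; rewrite (cone_integralE _ _ u0 hf) in hr.
have hR : (ray_sum (power_sum (rnd a om)) u s t < +oo)%E.
  have : (c%:E * ray_sum (power_sum (rnd a om)) u s t < +oo)%E by exact: le_lt_trans hr hF.
  by apply: contraTT; rewrite -!leNgt !leye_eq => /eqP ->; rewrite gt0_muley.
apply: (@le_lt_trans _ _ ((17 `^ u)%:E * ray_sum (power_sum (rnd a om)) u s t)%E); last first.
  by rewrite lte_mul_pinfty ?lee_fin ?powR_ge0.
rewrite /ray_sum -nneseriesZl; last by move=> k _; rewrite lee_fin powR_ge0.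
apply: lee_nneseries => [k _ _|k _]; first by rewrite lee_fin mulr_ge0 ?powR_ge0// indicE ler0n.
rewrite -EFinM lee_fin indicE; case: (boolP (om \in A k)) => [|_]; last by rewrite mulr0 mulr_ge0 ?powR_ge0.
rewrite inE mulr1 => hAk; have [_ _ hk] := hA k.
have {}hk := hk om hAk hom.
have rt0 := ray_term_ge0 (power_sum (rnd a om)) s k t.
rewrite -powRM//.
have -> : (17 * ray_term (power_sum (rnd a om)) s k t) `^ u = ((17 * ray_term (power_sum (rnd a om)) s k t) ^+ 2) `^ (u / 2).
  have e : 2%:R * (u / 2) = u by field.
  by rewrite -(powR_mulrn 2 (mulr_ge0 (ler0n R 17) rt0)) -powRrM e.
apply: ge0_ler_powR; rewrite ?nnegrE ?sqr_ge0 ?divr_ge0 ?(ltW u0) ?block_ge0//.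
have -> : (17 * ray_term (power_sum (rnd a om)) s k t) ^+ 2 =
    (eps R k.+1 `^ s) ^+ 2 * (17 * modulus (power_sum (rnd a om) (dyrad_pt k.+1 t))) ^+ 2.
  by rewrite /ray_term; move: (_ `^ s) (modulus _); clear => x y; ring.
rewrite /block; apply: ler_pM; rewrite ?powR_ge0 ?M2sq_ge0 ?dyrad_ge0 ?dyrad_lt1//.
by rewrite -(powR_mulrn 2 (powR_ge0 _ _)) -powRrM mulrC.
Qed.

(** Tonelli reduces to a pointwise moment, which is available for even integer exponents. *)
Lemma expectation_cone_meas_le l beta : (0 < l)%N -> exists2 C : R, 0 <= C &
  forall a (D : set (R * R)) V, 0 < V -> absconv a -> measurable D ->
  (forall w, D w -> modulus (of_plane w) < 1 /\ M2sq a (modulus (of_plane w)) <= V) ->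
  (\int[P]_om cone_meas (2 * l)%:R beta (rnd a om) D <=
    (C * V ^+ l)%:E * \int[area R]_(w in D) (wgt beta w)%:E)%E.
Proof.
move=> l0; have [C C0 H] := expectation_Upow_le hX l0; exists C => // a D V V0 ha mD hD.
pose F (x : Omega * (R * R)) : \bar R := (Upow (2 * l)%:R (rnd a x.1) x.2 * (wgt beta x.2)%:E * (\1_D x.2)%:E)%E.
have mU := @measurable_Upow2 _ _ Omega (2 * l)%:R (fun om => rnd a om) (cmeas_randomization hX a).
have mF : measurable_fun setT F.
  apply: emeasurable_funM; first apply: emeasurable_funM => //.
    by apply/measurable_EFinP; apply: (@measurableT_comp _ _ _ _ _ _ (wgt beta)) => //; exact: measurable_wgt.
  by apply/measurable_EFinP; apply: (meas_comp (f := \1_D : R * R -> R) (g := snd)) => //; exact: measurable_indic.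
have F0 x : (0 <= F x)%E by rewrite mule_ge0 ?cone_integrand_ge0// lee_fin indicE ler0n.
have e1 om : cone_meas (2 * l)%:R beta (rnd a om) D = (\int[area R]_w F (om, w))%E.
  rewrite /cone_meas [LHS]integral_mkcond; apply: eq_integral => w _.
  by rewrite /F patchE indicE /=; case: ifP => _; rewrite ?mule1 ?mule0.
under eq_integral do rewrite e1.
rewrite (fubini_tonelli (m1 := P) (m2 := area R) F)// [X in (_ * X)%E]integral_mkcond.
have mW : measurable_fun setT ((fun w => (wgt beta w)%:E) \_ D).
  by apply/(measurable_restrictT _ mD); apply: measurable_funTS; apply/measurable_EFinP; exact: measurable_wgt.
have CV : 0 <= C * V ^+ l by rewrite mulr_ge0 ?exprn_ge0 ?(ltW V0).
rewrite -ge0_integralZl_EFin//; last first.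
  by move=> w _; rewrite patchE; case: ifP => // _; rewrite lee_fin wgt_ge0.
apply: ge0_le_integral => //.
- by move=> w _; exact: integral_ge0.
- exact: (measurable_fun_fubini_tonelli_G (m1 := P)).
- by apply: emeasurable_funM => //; exact: measurable_cst.
move=> w _; rewrite patchE; case: ifPn => hw; last first.
  rewrite mule0 integral0_eq// => om _; rewrite /F /= indicE (negbTE hw) mule0//.
rewrite inE in hw; have [w1 w2] := hD w hw.
under eq_integral do rewrite /F /= indicE mem_set// mule1.
have mUw : measurable_fun setT (fun om => Upow (2 * l)%:R (rnd a om) w).
  apply: (meas_comp (f := fun x : Omega * (R * R) => Upow (2 * l)%:R (rnd a x.1) x.2) (g := fun om => (om, w))) => //.
under eq_integral do rewrite muleC.
rewrite ge0_integralZl_EFin ?wgt_ge0//; last by move=> om _; exact: Upow_ge0.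
by rewrite muleC; apply: lee_wpmul2r; [rewrite lee_fin wgt_ge0|exact: H].
Qed.

(** Above the height H the ratio x / H exceeds 1, so raising it to m only increases it. *)
Lemma split_power (x H m : R) : 0 <= x -> 0 < H -> 1 <= m -> x <= H + H `^ (1 - m) * x `^ m.
Proof.
move=> x0 H0 m1; have [xH|xH] := leP x H; first by rewrite -[leLHS]addr0 lerD ?mulr_ge0 ?powR_ge0.
have m0 : 0 < m by apply: lt_le_trans m1.
have x0' : 0 < x by apply: lt_trans xH.
rewrite -[leLHS]add0r lerD ?(ltW H0)// -(mulr_powRB1 x0 m0) mulrCA ler_peMr//.
have -> : 1 - m = - (m - 1) by ring.
rewrite powRN mulrC -powR_div ?(ltW x0')// -[leLHS](one_powR (m - 1)).
apply: ge0_ler_powR; rewrite ?nnegrE ?subr_ge0 ?divr_ge0 ?(ltW x0') ?(ltW H0)//.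
by rewrite ler_pdivlMr// mul1r ltW.
Qed.

Lemma cone_meas_split u q m beta a f D H : 0 < u -> 1 <= m -> u * m = q -> 0 < H ->
  power_expansion f a -> measurable D -> (forall w, D w -> disk R (of_plane w)) ->
  (cone_meas u beta a D <=
    H%:E * \int[area R]_(w in D) (wgt beta w)%:E + (H `^ (1 - m))%:E * cone_meas q beta a D)%E.
Proof.
move=> u0 m1 umq H0 hf mD hD.
have q0 : 0 < q by rewrite -umq mulr_gt0// (lt_le_trans _ m1).
have mw : measurable_fun D (fun w => (wgt beta w)%:E).
  by apply: measurable_funTS; apply/measurable_EFinP; exact: measurable_wgt.
have mq : measurable_fun D (fun w => Upow q a w * (wgt beta w)%:E)%E.
  by apply: measurable_funTS; exact: measurable_cone_integrand.
rewrite /cone_meas -!ge0_integralZl_EFin ?powR_ge0 ?(ltW H0)//; last 2 first.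
- by move=> w _; exact: cone_integrand_ge0.
- by move=> w _; rewrite lee_fin wgt_ge0.
rewrite -ge0_integralD//; last 4 first.
- by move=> w _; rewrite mule_ge0 ?lee_fin ?wgt_ge0 ?(ltW H0).
- exact: emeasurable_funM (measurable_cst _) mw.
- by move=> w _; rewrite mule_ge0 ?lee_fin ?powR_ge0 ?cone_integrand_ge0.
- exact: emeasurable_funM (measurable_cst _) mq.
apply: (@ge0_le_integral _ _ _ (area R) D mD).
- by move=> w _; exact: cone_integrand_ge0.
- by apply: measurable_funTS; exact: measurable_cone_integrand.
- by apply: emeasurable_funD; [exact: emeasurable_funM (measurable_cst _) mw|exact: emeasurable_funM (measurable_cst _) mq].
move=> w hw; rewrite !(UpowE _ hf (hD w hw))// -!EFinM -EFinD lee_fin mulrA -mulrDl.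
rewrite ler_wpM2r ?wgt_ge0//.
by have := split_power (powR_ge0 (modulus (f (of_plane w))) u) H0 m1; rewrite -powRrM umq.
Qed.

(** The choice K = (1 + G)^(1/m) balances the two terms. *)
Lemma poweR_of_split (x G : \bar R) (B m : R) : (0 <= x)%E -> (0 <= G)%E -> 0 <= B -> 1 <= m ->
  (forall K, 0 < K -> (x <= (B * K)%:E + (K `^ (1 - m))%:E * G)%E) ->
  (x `^ m <= ((B + 1) `^ m)%:E * (1 + G))%E.
Proof.
move=> x0 G0 B0 m1 h; have m0 : 0 < m by apply: lt_le_trans m1.
have B1 : 0 < B + 1 by rewrite ltr_wpDl.
have [->|Gy] := eqVneq G +oo%E; first by rewrite addey// gt0_muley ?leey// lte_fin powR_gt0.
have [g Gg] : exists g, G = g%:E by exists (fine G); rewrite fineK// ge0_fin_numE// ltey.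
have g0 : 0 <= g by rewrite -lee_fin -Gg.
have g1 : 0 < 1 + g by rewrite ltr_pwDl.
pose K := (1 + g) `^ m^-1; have K0 : 0 < K by rewrite powR_gt0.
have Km : K `^ m = 1 + g by rewrite /K -powRrM mulVf ?gt_eqF// powRr1// ltW.
have hx : (x <= ((B + 1) * K)%:E)%E.
  apply: le_trans (h K K0) _; rewrite Gg -EFinM -EFinD lee_fin mulrDl mul1r lerD2l.
  apply: (@le_trans _ _ (K `^ (1 - m) * K `^ m)); first by rewrite Km ler_wpM2l ?powR_ge0// lerDr.
  by rewrite -powRD ?(gt_eqF K0) ?implybT// subrK powRr1// ltW.
apply: le_trans (poweR_le (ltW m0) x0 hx) _.
by rewrite Gg poweR_EFin -EFinD -EFinM lee_fin powRM ?(ltW B1) ?(ltW K0)// Km.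
Qed.

(** The added 1 keeps the later normalisation away from zero, and its contribution is a geometric
    series because beta > -2. *)
Lemma slice_sum_finite u beta a : 0 < u -> -2 < beta -> absconv a ->
  (block_sum u ((beta + 2) / u) a < +oo)%E ->
  (\sum_(n <oo) ((1 + M2sq a (dyrad R n.+1)) `^ (u / 2) * eps R n `^ (beta + 2))%:E < +oo)%E.
Proof.
move=> u0 hb ha hS; set s := (beta + 2) / u.
have b2 : 0 < beta + 2 by lra.
have u2 : 0 < u / 2 by rewrite divr_gt0.
have M0 n : 0 <= M2sq a (dyrad R n.+1) by rewrite M2sq_ge0 ?dyrad_ge0 ?dyrad_lt1.
have q0 : 0 <= 2^-1 `^ (beta + 2) :> R by exact: powR_ge0.
have q1 : 2^-1 `^ (beta + 2) < 1 :> R.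
  rewrite -[ltRHS](one_powR (beta + 2)); apply: gt0_ltr_powR; rewrite ?nnegrE ?invr_ge0//.
  by rewrite invf_lt1// ltr1n.
apply: (@le_lt_trans _ _ (\sum_(n <oo) ((2 `^ (u / 2) * (2^-1 `^ (beta + 2)) ^+ n)%:E + (2 `^ (u / 2) * 2 `^ (beta + 2) * block a s n `^ (u / 2))%:E))%E).
  apply: lee_nneseries => [n _ _|n _]; first by rewrite lee_fin mulr_ge0 ?powR_ge0.
  rewrite -EFinD lee_fin.
  have h1 : (1 + M2sq a (dyrad R n.+1)) `^ (u / 2) <= 2 `^ (u / 2) * (1 + M2sq a (dyrad R n.+1) `^ (u / 2)).
    have := @poweR_1D_le R (M2sq a (dyrad R n.+1))%:E (u / 2) _ u2.
    by rewrite lee_fin; apply; exact: M0.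
  have e1 : eps R n `^ (beta + 2) = (2^-1 `^ (beta + 2)) ^+ n by rewrite /eps powR_exprn// invr_ge0.
  have e2 : block a s n `^ (u / 2) = eps R n.+1 `^ (beta + 2) * M2sq a (dyrad R n.+1) `^ (u / 2).
    rewrite /block powRM ?powR_ge0// -powRrM; congr (_ `^ _ * _).
    by rewrite /s; field; rewrite gt_eqF.
  have e3 : 2 `^ (beta + 2) * eps R n.+1 `^ (beta + 2) = eps R n `^ (beta + 2).
    by rewrite -powRM ?eps_ge0// epsS mulrC divfK.
  apply: le_trans (ler_wpM2r (powR_ge0 _ _) h1) _.
  rewrite e2 mulrA -[2 `^ (u / 2) * _ * eps R n.+1 `^ _]mulrA e3 -e1.
  by apply: eq_ler; ring.
rewrite nneseriesD; last 2 first.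
- by move=> n _ _; rewrite lee_fin mulr_ge0 ?powR_ge0 ?exprn_ge0.
- by move=> n _ _; rewrite lee_fin !mulr_ge0 ?powR_ge0.
rewrite lte_add_pinfty//.
  apply: (@le_lt_trans _ _ ((2 `^ (u / 2))%:E * ((1 - 2^-1 `^ (beta + 2))^-1)%:E)%E); last by rewrite -EFinM ltry.
  apply: le_trans (lee_wpmul2l _ (geometric_nneseries_le q0 q1)); last by rewrite lee_fin powR_ge0.
  rewrite -nneseriesZl; last by move=> n _; rewrite lee_fin exprn_ge0.
  by apply: lee_nneseries => [n _ _|n _]; rewrite -?EFinM// lee_fin mulr_ge0 ?powR_ge0 ?exprn_ge0.
apply: (@le_lt_trans _ _ ((2 `^ (u / 2) * 2 `^ (beta + 2))%:E * block_sum u s a)%E); last first.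
  by rewrite lte_mul_pinfty ?lee_fin ?mulr_ge0 ?powR_ge0.
rewrite /block_sum -nneseriesZl; last by move=> n _; rewrite lee_fin powR_ge0.
by apply: lee_nneseries => [n _ _|n _]; rewrite -?EFinM// lee_fin !mulr_ge0 ?powR_ge0.
Qed.

End criterion.

(** * Sufficiency of the dyadic sum *)

Section sufficiency.
Context (R : realType) (d : measure_display) (Omega : measurableType d).
Variable P : probability Omega R.
Variables (X : nat -> Omega -> Cplx R) (hX : standard_random_sequence P X).
Implicit Types (a : nat -> Cplx R) (u v beta t : R).
Local Notation mu := (@lebesgue_measure R).
Local Notation circ := (`[0%R, (2 * pi)%R]%classic : set R).
Local Notation rnd a om := (randomization X a om).

(** A cone integral of higher exponent in which the weights compensate, slice by slice, for the
    growth of M_2. *)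
Definition slice_sum (q beta : R) (h : nat -> R) b t : \bar R :=
  (\sum_(n <oo) (h n)%:E * cone_meas q beta b (coneset t `&` @annulus R n))%E.

Lemma slice_sum_ge0 q beta h b t : (forall n, 0 <= h n) -> (0 <= slice_sum q beta h b t)%E.
Proof. by move=> h0; apply: nneseries_ge0 => n _ _; rewrite mule_ge0 ?lee_fin ?cone_meas_ge0. Qed.

Lemma measurable_slice2 n :
  measurable [set tw : R * (R * R) | (coneset tw.1 `&` @annulus R n) tw.2].
Proof.
rewrite (_ : [set _ | _] = [set tw : R * (R * R) | coneset tw.1 tw.2] `&` snd @^-1` (@annulus R n)).
  apply: measurableI; first exact: measurable_coneset2.
  have := (@measurable_snd _ _ R (R * R)%type) measurableT _ (measurable_annulus n).
  by rewrite setTI.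
by apply/seteqP; split => tw.
Qed.

Lemma measurable_slice_sum q beta h a : (forall n, 0 <= h n) ->
  measurable_fun setT (fun x : Omega * measurableTypeR R => slice_sum q beta h (rnd a x.1) x.2).
Proof.
move=> h0; apply: ge0_emeasurable_sum => [n x _ _|n _].
  by rewrite mule_ge0 ?lee_fin ?cone_meas_ge0.
apply: emeasurable_funM; first exact: measurable_cst.
apply: (@measurable_cone_meas _ _ _ q beta (fun om => rnd a om) [set tw : R * (R * R) | (coneset tw.1 `&` @annulus R n) tw.2]).
  by move=> k; exact: (cmeas_randomization hX).
exact: measurable_slice2.
Qed.

(** The expectation has a bound independent of the angle, so the integral over the circle has finite
    expectation. *)
Lemma ae_slice_sum_finite l q beta h a (V : nat -> R) : (0 < l)%N -> q = (2 * l)%:R -> absconv a ->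
  (forall n, 0 < V n) -> (forall n, M2sq a (dyrad R n.+1) <= V n) -> (forall n, 0 <= h n) ->
  (\sum_(n <oo) (h n * V n ^+ l * eps R n `^ (beta + 2))%:E < +oo)%E ->
  {ae P, forall om, (\int[mu]_(t in circ) slice_sum q beta h (rnd a om) t < +oo)%E}.
Proof.
move=> l0 ql ha V0 hV h0 hs.
have [C C0 HC] := expectation_cone_meas_le hX beta l0.
set Cb := 16 * 4 `^ `|beta| : R.
have Cb0 : 0 <= Cb by rewrite mulr_ge0 ?powR_ge0.
pose Phi (x : Omega * measurableTypeR R) : \bar R := (slice_sum q beta h (rnd a x.1) x.2 * (\1_circ x.2)%:E)%E.
have mPhi : measurable_fun setT Phi.
  apply: emeasurable_funM; first exact: measurable_slice_sum.
  apply/measurable_EFinP; apply: (meas_comp (f := \1_circ : measurableTypeR R -> R) (g := snd)) => //.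
have Phi0 x : (0 <= Phi x)%E by rewrite mule_ge0 ?slice_sum_ge0// lee_fin indicE ler0n.
have PhiE om : (\int[mu]_(t in circ) slice_sum q beta h (rnd a om) t = \int[mu]_t Phi (om, t))%E.
  rewrite [LHS]integral_mkcond; apply: eq_integral => t _.
  by rewrite /Phi patchE indicE /=; case: ifP => _; rewrite ?mule1 ?mule0.
have bound n t : (\int[P]_om cone_meas q beta (rnd a om) (coneset t `&` @annulus R n) <=
    (C * V n ^+ l * (Cb * eps R n `^ (beta + 2)))%:E)%E.
  rewrite ql; apply: le_trans (HC a _ (V n) (V0 n) ha (measurable_cone_annulus t n) _) _.
    move=> w [[hw _] /annulus_modulus hm]; split=> //.
    apply: le_trans (hV n); apply: M2sq_mono => //; [exact: modulus_ge0|exact: dyrad_lt1].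
  rewrite [leRHS]EFinM; apply: lee_wpmul2l; last exact: integral_wgt_annulus.
  by rewrite lee_fin mulr_ge0 ?exprn_ge0 ?(ltW (V0 n)).
have mc n t : measurable_fun setT (fun om => cone_meas q beta (rnd a om) (coneset t `&` @annulus R n)).
  have := @measurable_cone_meas _ _ _ q beta (fun om => rnd a om) _ (cmeas_randomization hX a) (measurable_slice2 n).
  move=> m; apply: (meas_comp (f := fun x : Omega * R => cone_meas q beta (rnd a x.1) [set w | [set tw : R * (R * R) | (coneset tw.1 `&` @annulus R n) tw.2] (x.2, w)]) (g := fun om => (om, t))) => //.
set S := (\sum_(n <oo) _)%E in hs.
have S0 : (0 <= S)%E by apply: nneseries_ge0 => n _ _; rewrite lee_fin !mulr_ge0 ?powR_ge0 ?exprn_ge0 ?(ltW (V0 n)).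
have EG t : (\int[P]_om slice_sum q beta h (rnd a om) t <= (C * Cb)%:E * S)%E.
  rewrite integral_nneseries//; last 2 first.
  - by move=> n; apply: emeasurable_funM; [exact: measurable_cst|exact: mc].
  - by move=> n om _; rewrite mule_ge0 ?lee_fin ?cone_meas_ge0.
  rewrite /S -nneseriesZl; last by move=> n _; rewrite lee_fin !mulr_ge0 ?powR_ge0 ?exprn_ge0 ?(ltW (V0 n)).
  apply: lee_nneseries => [n _ _|n _].
    by apply: integral_ge0 => om _; rewrite mule_ge0 ?lee_fin ?cone_meas_ge0.
  rewrite ge0_integralZl_EFin//; last by move=> om _; exact: cone_meas_ge0.
  apply: le_trans (lee_wpmul2l _ (bound n t)) _; first by rewrite lee_fin.
  by rewrite -!EFinM lee_fin; apply: eq_ler; ring.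
have fin : (\int[P]_om \int[mu]_t Phi (om, t) < +oo)%E.
  rewrite (fubini_tonelli (m1 := P) (m2 := mu) Phi)//.
  apply: (@le_lt_trans _ _ (\int[mu]_(t in circ) ((C * Cb)%:E * S))%E).
    rewrite [leRHS]integral_mkcond; apply: ge0_le_integral => //.
    - by move=> t _; exact: integral_ge0.
    - exact: (measurable_fun_fubini_tonelli_G (m1 := P)).
    - by apply/(measurable_restrictT _ (measurable_itv _)); exact: measurable_cst.
    - move=> t _; rewrite patchE /Phi /= indicE; case: ifP => _.
        by under eq_integral do rewrite mule1; exact: EG.
      by under eq_integral do rewrite mule0; rewrite integral0.
  rewrite integral_cst//= lebesgue_measure_itv/= lte_fin mulr_gt0 ?pi_gt0// -EFinB.
  have Sf : S \is a fin_num by rewrite ge0_fin_numE.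
  by rewrite -(fineK Sf) -!EFinM ltry.
have mI : measurable_fun setT (fun om => \int[mu]_t Phi (om, t))%E.
  exact: (measurable_fun_fubini_tonelli_F (m2 := mu)).
have hi : P.-integrable setT (fun om => \int[mu]_t Phi (om, t))%E.
  apply/integrableP; split=> //.
  by under eq_integral do rewrite gee0_abs ?integral_ge0//.
have := integrable_ae measurableT hi; apply: filterS => om /(_ I) hf.
by rewrite PhiE -ge0_fin_numE// integral_ge0.
Qed.

(** On slice n the typical size of |Rf|^u is H_n. Splitting at height K H_n bounds the cone integral
    F by a constant times K plus K^(1 - m) G, where G is the slice sum with weights h_n = H_n^(1 -
    m). Optimising K gives F^m <= C (1 + G), and G has finite expectation because h_n V_n^l = H_n.
    The exponent v / u <= m follows by lowering. *)
Lemma embedding_sufficient u v beta a : 0 < u -> 0 < v -> -2 < beta -> absconv a ->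
  (block_sum u ((beta + 2) / u) a < +oo)%E ->
  {ae P, forall om, absconv (rnd a om) /\ (tent_norm_pow v u beta (power_sum (rnd a om)) < +oo)%E}.
Proof.
move=> u0 v0 hb ha hS.
(* An even exponent above both u and v: moments are available there, and m = 2 l / u is at least 1
   and at least v / u. *)
pose l := (Num.truncn (Num.max u v)).+1.
have l2 : Num.max u v <= (2 * l)%:R.
  apply: le_trans (ltW (truncnS_gt _)) _; rewrite ler_nat -/l; lia.
have l0 : (0 < l)%N by [].
pose m : R := (2 * l)%:R / u.
have m1 : 1 <= m by rewrite ler_pdivlMr// mul1r; apply: le_trans l2; rewrite le_max lexx.
have m0 : 0 < m by apply: lt_le_trans m1.
have vm : v / u <= m by rewrite ler_pM2r ?invr_gt0//; apply: le_trans l2; rewrite le_max lexx orbT.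
have um : u * m = (2 * l)%:R by rewrite /m mulrC divfK// gt_eqF.
pose V n := 1 + M2sq a (dyrad R n.+1).
have M0 n : 0 <= M2sq a (dyrad R n.+1) by rewrite M2sq_ge0 ?dyrad_ge0 ?dyrad_lt1.
have V0 n : 0 < V n by rewrite ltr_wpDr.
pose H n := V n `^ (u / 2).
have H0 n : 0 < H n by rewrite powR_gt0.
have Hm n : H n `^ m = V n ^+ l.
  rewrite -powR_mulrn ?(ltW (V0 n))// /H -powRrM; congr (_ `^ _).
  by rewrite mulrAC um natrM; field.
have hsum := slice_sum_finite u0 hb ha hS.
pose h n := H n `^ (1 - m).
have h0 n : 0 <= h n by exact: powR_ge0.
have hHm n : h n * V n ^+ l = H n.
  by rewrite -Hm /h -powRD ?(gt_eqF (H0 n)) ?implybT// subrK powRr1// ltW.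
have hG : {ae P, forall om, (\int[mu]_(t in circ) slice_sum (2 * l)%:R beta h (rnd a om) t < +oo)%E}.
  apply: (ae_slice_sum_finite (V := V) l0) => // [n|]; first by rewrite /V lerDr.
  by under eq_eseriesr do rewrite hHm.
apply: filterS2 (ae_absconv hX ha) hG => om hom hint; split=> //.
set f := power_sum (rnd a om).
have hf : power_expansion f (rnd a om) by exact: power_expansion_power_sum.
set S := (\sum_(n <oo) _)%E in hsum.
have S0 : (0 <= S)%E by apply: nneseries_ge0 => n _ _; rewrite lee_fin mulr_ge0 ?powR_ge0.
pose N := fine S.
have NS : S = N%:E by rewrite /N fineK// ge0_fin_numE.
have N0 : 0 <= N by rewrite fine_ge0.
set Cb := 16 * 4 `^ `|beta| : R.
have Cb0 : 0 <= Cb by rewrite mulr_ge0 ?powR_ge0.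
pose G t := slice_sum (2 * l)%:R beta h (rnd a om) t.
have G0 t : (0 <= G t)%E by exact: slice_sum_ge0.
have mG : measurable_fun setT G.
  have m2 := measurable_slice_sum (2 * l)%:R beta a h0.
  apply: (meas_comp (f := fun x : Omega * measurableTypeR R => slice_sum (2 * l)%:R beta h (rnd a x.1) x.2) (g := fun t => (om, t))) => //.
  by apply: measurable_fun_pair.
pose F t := cone_integral u beta f (circle_pt t).
have F0 t : (0 <= F t)%E by exact: cone_integral_ge0.
have mF : measurable_fun setT F by exact: measurable_cone_integral hf.
have pw t : (F t `^ m <= ((Cb * N + 1) `^ m)%:E * (1 + G t))%E.
  apply: poweR_of_split => //; first exact: mulr_ge0.
  move=> K K0; rewrite /F (cone_integralE _ _ u0 hf) cone_meas_annuli.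
  have e1 : (Cb * N * K)%:E = (\sum_(n <oo) (K * Cb * (V n `^ (u / 2) * eps R n `^ (beta + 2)))%:E)%E.
    under eq_eseriesr do rewrite EFinM.
    rewrite nneseriesZl; last by move=> n _; rewrite lee_fin mulr_ge0 ?powR_ge0.
    by rewrite -/S NS -EFinM; congr (_%:E); ring.
  rewrite e1 /G /slice_sum -nneseriesZl; last by move=> n _; rewrite mule_ge0 ?lee_fin ?cone_meas_ge0.
  rewrite -nneseriesD; last 2 first.
  - by move=> n _ _; rewrite lee_fin !mulr_ge0 ?powR_ge0 ?(ltW K0).
  - by move=> n _ _; rewrite !mule_ge0 ?lee_fin ?powR_ge0 ?cone_meas_ge0.
  apply: lee_nneseries => [n _ _|n _]; first exact: cone_meas_ge0.
  have HK0 : 0 < K * H n by rewrite mulr_gt0.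
  apply: le_trans (cone_meas_split beta u0 m1 um HK0 hf (measurable_cone_annulus t n) _) _.
    by move=> w [[hw _] _].
  apply: leeD.
    apply: le_trans (lee_wpmul2l _ (integral_wgt_annulus beta t n)) _; first by rewrite lee_fin ltW.
    by rewrite -EFinM lee_fin -/Cb -/(H n); apply: eq_ler; ring.
  by rewrite muleA -EFinM powRM ?(ltW K0) ?(ltW (H0 n)).
have fin : (\int[mu]_(t in circ) (F t `^ m) < +oo)%E.
  apply: (@le_lt_trans _ _ (\int[mu]_(t in circ) (((Cb * N + 1) `^ m)%:E * (1 + G t)))%E).
    apply: ge0_le_integral => //.
    - by move=> t _; exact: poweR_ge0.
    - by apply: measurable_funTS; apply: (meas_comp (f := fun x => (x `^ m)%E)) => //; exact: measurable_poweR.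
    - apply: emeasurable_funM; first exact: measurable_cst.
      by apply: emeasurable_funD; [exact: measurable_cst|exact: measurable_funTS].
  rewrite ge0_integralZl_EFin ?powR_ge0//; last 2 first.
  - by move=> t _; rewrite adde_ge0.
  - by apply: emeasurable_funD; [exact: measurable_cst|exact: measurable_funTS].
  rewrite lte_mul_pinfty ?lee_fin ?powR_ge0// ge0_integralD//; last exact: measurable_funTS.
  rewrite lte_add_pinfty// integral_cst//= mul1e lebesgue_measure_itv/= lte_fin mulr_gt0 ?pi_gt0//.
  by rewrite -EFinB ltry.
by apply: integral_poweR_1D mF F0 _ vm fin; rewrite divr_ge0 ?(ltW v0) ?(ltW u0).
Qed.

End sufficiency.

(** * Lacunary series *)

Section series_tools.
Variable R : realType.
Implicit Types (x : nat -> R) (s t lam tau : R).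

(** The distance |k - n|: one of the two truncated differences is zero. *)
Definition gap k n : nat := (k - n + (n - k))%N.

Lemma sum_gap_le lam k n : 0 <= lam -> lam < 1 ->
  \sum_(i < n) lam ^+ gap k i <= 2 / (1 - lam).
Proof.
move=> l0 l1; have h : 0 < 1 - lam by rewrite subr_gt0.
have h' : 0 <= (1 - lam)^-1 by rewrite invr_ge0 ltW.
have -> : 2 / (1 - lam) = (1 - lam)^-1 + (1 - lam)^-1 by rewrite mulr_natl mulr2n.
suff H : \sum_(i < n) lam ^+ gap k i <= \sum_(j < k) lam ^+ j.+1 + (1 - lam)^-1.
  apply: le_trans H _; rewrite lerD2r; apply: le_trans (geometric_sum_le k l0 l1).
  by apply: ler_sum => j _; rewrite exprS ler_piMl ?exprn_ge0// ltW.
elim: k n => [|k IH] n.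
  rewrite big_ord0 add0r; apply: le_trans (geometric_sum_le n l0 l1).
  by apply: eq_ler; apply: eq_bigr => i _; rewrite /gap sub0n subn0.
case: n => [|n].
  by rewrite big_ord0 addr_ge0//; apply: sumr_ge0 => j _; rewrite exprn_ge0.
rewrite big_ord_recl [in leRHS]big_ord_recr /= addrAC addrC.
have -> : gap k.+1 0 = k.+1 by rewrite /gap subn0 sub0n addn0.
rewrite lerD2l; apply: le_trans (IH n).
by apply: eq_ler; apply: eq_bigr => i _; rewrite /bump /= add1n /gap !subSS.
Qed.

Lemma gapC k n : gap k n = gap n k. Proof. by rewrite /gap addnC. Qed.

Lemma nneseries_gap_le lam k : 0 <= lam -> lam < 1 ->
  (\sum_(i <oo) (lam ^+ gap k i)%:E <= (2 / (1 - lam))%:E)%E.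
Proof.
move=> l0 l1; apply: nneseries_le_of_partial => [i|n]; first by rewrite lee_fin exprn_ge0.
by rewrite sumEFin lee_fin sum_gap_le.
Qed.

(* Dominating each term by the [tau]-th root of a weighted sum of [tau]-th
   powers treats [tau < 1] and [tau > 1] alike. *)
Lemma geometric_convolution lam tau : 0 < lam -> lam < 1 -> 0 < tau ->
  exists2 C : R, 0 <= C & forall x, (forall k, 0 <= x k) ->
  (\sum_(n <oo) (\sum_(k <oo) (x k * lam ^+ gap k n)%:E) `^ tau <=
    C%:E * \sum_(k <oo) (x k `^ tau)%:E)%E.
Proof.
(* Half of the decay is spent on summing over k, the other half is kept for summing over n. *)
move=> l0 l1 t0; pose m := Num.sqrt lam.
have m0 : 0 < m by rewrite sqrtr_gt0.
have mm : m * m = lam by rewrite -expr2 sqr_sqrtr// ltW.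
have m1 : m < 1.
  by rewrite -(@ltr_pXn2r _ 2)// ?nnegrE ?(ltW m0)// expr1n expr2 mm.
have mt0 : 0 < m `^ tau by rewrite powR_gt0.
have mt1 : m `^ tau < 1 by rewrite -[ltRHS](one_powR tau); apply: gt0_ltr_powR; rewrite ?nnegrE ?(ltW m0).
pose C1 := 2 / (1 - m); pose C2 := 2 / (1 - m `^ tau).
have C10 : 0 <= C1 by rewrite divr_ge0// subr_ge0 ltW.
have C20 : 0 <= C2 by rewrite divr_ge0// subr_ge0 ltW.
exists (C1 `^ tau * C2); first by rewrite mulr_ge0 ?powR_ge0.
move=> x x0.
pose y k n := x k `^ tau * (m `^ tau) ^+ gap k n.
have y0 k n : 0 <= y k n by rewrite mulr_ge0 ?powR_ge0 ?exprn_ge0 ?(ltW mt0).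
have yE k n : y k n = (x k * m ^+ gap k n) `^ tau.
  by rewrite powRM ?exprn_ge0 ?(ltW m0)// powR_exprn// ltW.
have key n : ((\sum_(k <oo) (x k * lam ^+ gap k n)%:E) `^ tau <= (C1 `^ tau)%:E * \sum_(k <oo) (y k n)%:E)%E.
  set B := (\sum_(k <oo) (y k n)%:E)%E.
  have B0 : (0 <= B)%E by apply: nneseries_ge0 => k _ _; rewrite lee_fin.
  have [BE|BE] := eqVneq B +oo%E.
    by rewrite BE gt0_muley ?leey// lte_fin powR_gt0// divr_gt0// subr_gt0.
  have [b Bb] : exists b, B = b%:E by exists (fine B); rewrite fineK// ge0_fin_numE// ltey.
  have b0 : 0 <= b by rewrite -lee_fin -Bb.
  have yb k : x k * m ^+ gap k n <= b `^ tau^-1.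
    have h : y k n <= b by rewrite -lee_fin -Bb; apply: (term_le_nneseries (u := fun k => (y k n)%:E)) => j; rewrite lee_fin.
    have -> : x k * m ^+ gap k n = (y k n) `^ tau^-1.
      by rewrite yE -powRrM mulfV ?gt_eqF// powRr1// mulr_ge0 ?exprn_ge0 ?(ltW m0).
    by apply: ge0_ler_powR; rewrite ?nnegrE ?invr_ge0 ?(ltW t0).
  have h : (\sum_(k <oo) (x k * lam ^+ gap k n)%:E <= (b `^ tau^-1 * C1)%:E)%E.
    apply: (@le_trans _ _ ((b `^ tau^-1)%:E * \sum_(k <oo) (m ^+ gap n k)%:E)%E); last first.
      by rewrite EFinM; apply: lee_wpmul2l; [rewrite lee_fin powR_ge0|apply: nneseries_gap_le => //; exact: ltW].
    rewrite -nneseriesZl; last by move=> k _; rewrite lee_fin exprn_ge0 ?(ltW m0).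
    apply: lee_nneseries => [k _ _|k _]; first by rewrite lee_fin mulr_ge0 ?exprn_ge0 ?(ltW l0).
    rewrite -EFinM lee_fin -mm exprMn mulrA [in leRHS]gapC; apply: ler_wpM2r; last exact: yb.
    by rewrite exprn_ge0 ?(ltW m0).
  apply: le_trans (poweR_le (ltW t0) _ h) _.
    by apply: nneseries_ge0 => k _ _; rewrite lee_fin mulr_ge0 ?exprn_ge0 ?(ltW l0).
  rewrite Bb poweR_EFin -EFinM lee_fin powRM ?powR_ge0// -powRrM mulVf ?gt_eqF// powRr1//.
  by rewrite mulrC.
apply: (@le_trans _ _ ((C1 `^ tau)%:E * \sum_(n <oo) \sum_(k <oo) (y k n)%:E)%E).
  rewrite -nneseriesZl; last by move=> n _; apply: nneseries_ge0 => k _ _; rewrite lee_fin.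
  by apply: lee_nneseries => [n _ _|n _]; [exact: poweR_ge0|exact: key].
rewrite EFinM -muleA; apply: lee_wpmul2l; first by rewrite lee_fin powR_ge0.
rewrite nneseries_interchange; last by move=> n k; rewrite lee_fin.
rewrite -nneseriesZl; last by move=> k _; rewrite lee_fin powR_ge0.
apply: lee_nneseries => [k _ _|k _]; first by apply: nneseries_ge0 => n _ _; rewrite lee_fin.
apply: (@le_trans _ _ ((x k `^ tau)%:E * \sum_(n <oo) ((m `^ tau) ^+ gap k n)%:E)%E).
  rewrite -nneseriesZl; last by move=> n _; rewrite lee_fin exprn_ge0 ?(ltW mt0).
  by apply: lee_nneseries => [n _ _|n _]; rewrite -?EFinM// lee_fin.
rewrite muleC; apply: lee_wpmul2r; first by rewrite lee_fin powR_ge0.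
by apply: nneseries_gap_le => //; exact: ltW.
Qed.

Lemma sum_dyadic_blocks (F : nat -> R) J :
  \sum_(k < 2 ^ J - 1) F k = \sum_(j < J) \sum_(i < 2 ^ j) F (2 ^ j - 1 + i)%N.
Proof.
elim: J => [|J IH]; first by rewrite expn0 subnn !big_ord0.
rewrite big_ord_recr /= -IH.
have -> : (2 ^ J.+1 - 1 = (2 ^ J - 1) + 2 ^ J)%N by rewrite expnS; have := expn_gt0 2 J; lia.
by rewrite big_split_ord.
Qed.

(** Condensation: in the j-th block k + 1 runs from 2^j to 2^(j + 1) - 1. *)
Lemma nneseries_dyadic_blocks_lty (F : nat -> R) (r C : R) :
  (forall k, 0 <= F k) -> 0 <= r -> r < 1 -> 0 <= C ->
  (forall j, \sum_(i < 2 ^ j) F (2 ^ j - 1 + i)%N <= C * r ^+ j) ->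
  (\sum_(k <oo) (F k)%:E <= (C / (1 - r))%:E)%E.
Proof.
move=> F0 r0 r1 C0 h; apply: nneseries_le_of_partial => [k|n]; first by rewrite lee_fin.
rewrite sumEFin lee_fin; apply: (@le_trans _ _ (\sum_(k < 2 ^ n - 1) F k)).
  have hn : (n <= 2 ^ n - 1)%N by have := ltn_expl n (ltnSn 1); lia.
  rewrite -(subnKC hn) big_split_ord /= lerDl.
  by apply: sumr_ge0 => i _; exact: F0.
rewrite sum_dyadic_blocks; apply: (@le_trans _ _ (C * \sum_(j < n) r ^+ j)).
  by rewrite mulr_sumr; apply: ler_sum => j _.
by rewrite ler_wpM2l//; exact: geometric_sum_le.
Qed.

Lemma harmonic_nneseries : (\sum_(k <oo) (k.+1%:R^-1 : R)%:E)%E = +oo%E.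
Proof.
apply/eqP; rewrite -leye_eq leNgt; apply/negP => h.
apply: (@dvg_harmonic R).
have [M M0 hM] : exists2 M : R, 0 <= M & forall n, \sum_(k < n) (k.+1%:R^-1 : R) <= M.
  set S := (\sum_(k <oo) _)%E in h.
  have p0 k : (0 <= (k.+1%:R^-1 : R)%:E)%E by rewrite lee_fin invr_ge0.
  have S0 : (0 <= S)%E by exact: nneseries_ge0.
  exists (fine S); first exact: fine_ge0.
  move=> n; rewrite -lee_fin fineK ?ge0_fin_numE// -sumEFin.
  exact: (nneseries_ge_partial (u := fun k => (k.+1%:R^-1 : R)%:E)).
apply: nondecreasing_is_cvgn.
  by apply: nondecreasing_series => k _ _; exact: harmonic_ge0.
exists M => _ [n _ <-]; rewrite /series /= big_mkord; exact: hM.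
Qed.

(** Shifting t to 1 + t makes the base at least 1, so the exponent can be rounded up to an integer;
    the shift costs the factor exp 1. *)
Lemma powR_expR_bounded s : 0 <= s -> exists2 C : R, 0 < C & forall t, 0 <= t -> t `^ s * expR (- t) <= C.
Proof.
move=> s0; pose l := Num.truncn s.
have sl : s <= l.+1%:R by rewrite ltW// truncnS_gt.
exists (l.+1%:R ^+ l.+1 * expR 1); first by rewrite mulr_gt0 ?expR_gt0// exprn_gt0.
move=> t t0; have t1 : 0 <= 1 + t by rewrite addr_ge0.
apply: (@le_trans _ _ ((1 + t) ^+ l.+1 * expR (- t))).
  rewrite ler_wpM2r ?expR_ge0//; apply: (@le_trans _ _ ((1 + t) `^ s)).
    by apply: ge0_ler_powR; rewrite ?nnegrE ?lerDr.
  by rewrite -powR_mulrn// ler_powR// lerDl.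
apply: le_trans (ler_wpM2r (expR_ge0 _) (exprn_le_expR l t1)) _.
by rewrite -mulrA -expRD addrK.
Qed.

(** This is min (1, 1 / y) for y > 0, written so that no division by zero occurs at the centre of a
    peak. *)
Definition damp (y : R) : R := (Num.max 1 y)^-1.

Lemma damp_gt0 y : 0 < damp y. Proof. by rewrite invr_gt0 lt_max ltr01. Qed.

Lemma damp_le1 y : damp y <= 1.
Proof. by rewrite invf_le1 ?lt_max ?ltr01// le_max lexx. Qed.

(* Telescoping of [x / (1 + |x|)]. *)
Lemma sum_damp_sqr (y : R) n : \sum_(i < n) damp `|y - i%:R| ^+ 2 <= 18.
Proof.
pose phi (x : R) : R := x / (1 + `|x|).
have phi1 (x : R) : `|phi x| <= 1.
  rewrite /phi normrM normfV (@ger0_norm _ (1 + `|x|)) ?addr_ge0// ler_pdivrMr ?mul1r ?lerDr//.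
(* The derivative 1 / (1 + |x|)^2 of [phi] has the size of the squared damping; 9 covers every
   position of the unit step, and |phi| <= 1 then gives 18. *)
have step (x : R) : damp `|x| ^+ 2 <= 9 * (phi (x + 1) - phi x).
  rewrite /damp exprVn; have mx : 0 < Num.max 1 `|x| by rewrite lt_max ltr01.
  rewrite -div1r ler_pdivrMr ?exprn_gt0//.
  have [x0|x0] := leP 0 x.
    have x1 : 0 <= x + 1 by lra.
    rewrite /phi !ger0_norm//.
    have -> : (x + 1) / (1 + (x + 1)) - x / (1 + x) = ((1 + x) * (2 + x))^-1.
      by field; rewrite !gt_eqF//; lra.
    rewrite mulrAC ler_pdivlMr ?mul1r; last by rewrite mulr_gt0//; lra.
    by case: (leP 1 x) => h; nra.
  have [x1|x1] := leP (x + 1) 0.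
    rewrite /phi !ler0_norm//; last by rewrite ltW.
    have [z zx] : exists z, x = - z by exists (- x); rewrite opprK.
    have z1 : 1 <= z by lra.
    have -> : (x + 1) / (1 + - (x + 1)) - x / (1 + - x) = (z * (1 + z))^-1.
      have e1 : 1 + - (x + 1) = z by rewrite zx; ring.
      have e2 : 1 + - x = 1 + z by rewrite zx; ring.
      by rewrite e1 e2 zx; field; rewrite !gt_eqF//; lra.
    rewrite mulrAC ler_pdivlMr ?mul1r; last by rewrite mulr_gt0//; lra.
    rewrite zx opprK; have -> : Num.max 1 z = z by apply/max_idPr.
    by nra.
  rewrite /phi (ger0_norm (ltW x1)) (ler0_norm (ltW x0)).
  have x2 : - x <= 1 by lra.
  case: (leP 1 (- x)) => [h|h].
    by exfalso; lra.
  rewrite expr1n mulr1.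
  have h1 : (x + 1) / 2 <= (x + 1) / (1 + (x + 1)).
    rewrite ler_pdivlMr; last by lra.
    by nra.
  have h2 : - x / 2 <= - (x / (1 + - x)).
    rewrite -mulNr ler_pdivlMr; last by lra.
    by nra.
  by lra.
apply: (@le_trans _ _ (\sum_(i < n) 9 * (phi (y - i%:R + 1) - phi (y - i%:R)))).
  by apply: ler_sum => i _; exact: step.
rewrite -mulr_sumr.
have -> : \sum_(i < n) (phi (y - i%:R + 1) - phi (y - i%:R)) = phi (y + 1) - phi (y + 1 - n%:R).
  elim: n => [|n IH]; first by rewrite big_ord0 subr0 subrr.
  rewrite big_ord_recr /= IH.
  have -> : y - n%:R + 1 = y + 1 - n%:R by ring.
  have -> : y - n%:R = y + 1 - n.+1%:R by rewrite -natr1; ring.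
  by rewrite addrA subrK.
have := phi1 (y + 1); have := phi1 (y + 1 - n%:R); rewrite !ler_norml => /andP[h1 h2] /andP[h3 h4].
by lra.
Qed.

End series_tools.

(** * Powers of normalised Dirichlet kernels *)

Section kernel.
Variable R : realType.
Implicit Types (m N j L : nat) (z : Cplx R).

Definition mean_poly N : {poly R} := \sum_(i < N) N%:R^-1 *: 'X^i.

Definition kcoef m N j : R := (mean_poly N ^+ m)`_j.

Lemma coef_mean_poly N j : (mean_poly N)`_j = if (j < N)%N then N%:R^-1 else 0.
Proof.
rewrite coef_sum; under eq_bigr do rewrite coefZ coefXn.
case: ifP => jN.
  rewrite (bigD1 (Ordinal jN))//= eqxx mulr1 big1 ?addr0// => i ij.
  case: eqP => [e|]; last by rewrite mulr0.
  by move/eqP: ij; case; apply: val_inj.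
rewrite big1// => i _; case: eqP => [e|]; last by rewrite mulr0.
by move: jN; rewrite e ltn_ord.
Qed.

Lemma kcoef_ge0 m N j : 0 <= kcoef m N j.
Proof.
rewrite /kcoef; elim: m j => [|m IH] j; first by rewrite expr0 coef1 ler0n.
rewrite exprS coefM; apply: sumr_ge0 => i _; rewrite mulr_ge0// coef_mean_poly.
by case: ifP => // _; rewrite invr_ge0.
Qed.

Lemma size_mean_poly N : (size (mean_poly N) <= N)%N.
Proof. by apply/leq_sizeP => j jN; rewrite coef_mean_poly ltnNge jN. Qed.

Lemma size_kernel m N : (0 < m)%N -> (0 < N)%N -> (size (mean_poly N ^+ m) <= m * N)%N.
Proof.
move=> m0 N0; apply: leq_trans (size_poly_exp_leq _ _) _.
have := size_mean_poly N; move: (size _) => n hn.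
by nia.
Qed.

Lemma kcoef_eval m N L z : (0 < m)%N -> (0 < N)%N -> (m * N <= L)%N ->
  \sum_(j < L) (kcoef m N j)%:C%C * z ^+ j = ((N%:R^-1)%:C%C * \sum_(i < N) z ^+ i) ^+ m :> Cplx R.
Proof.
move=> m0 N0 mN.
have := @horner_coef_wide _ L (map_poly (real_complex R) (mean_poly N ^+ m)) z.
rewrite size_map_poly => /(_ (leq_trans (size_kernel m0 N0) mN)).
under [X in _ = X -> _]eq_bigr do rewrite coef_map.
move=> <-; rewrite rmorphXn horner_exp; congr (_ ^+ _).
rewrite /mean_poly rmorph_sum /= horner_sum mulr_sumr; apply: eq_bigr => i _.
by rewrite map_polyZ map_polyXn hornerZ hornerXn.
Qed.

Lemma kcoef_sum m N L : (0 < m)%N -> (0 < N)%N -> (m * N <= L)%N ->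
  \sum_(j < L) kcoef m N j = 1.
Proof.
move=> m0 N0 mN.
have := @horner_coef_wide _ L (mean_poly N ^+ m) 1 (leq_trans (size_kernel m0 N0) mN).
under [X in _ = X -> _]eq_bigr do rewrite expr1n mulr1.
move=> <-; rewrite horner_exp /mean_poly horner_sum.
under eq_bigr do rewrite hornerZ hornerXn expr1n mulr1.
by rewrite sumr_const card_ord -[_ *+ N]mulr_natl mulfV ?expr1n// pnatr_eq0 -lt0n.
Qed.

Lemma kcoef_le1 m N j : (0 < m)%N -> (0 < N)%N -> kcoef m N j <= 1.
Proof.
move=> m0 N0; rewrite -(kcoef_sum m0 N0 (leq_maxl (m * N) j.+1)).
have jL : (j < maxn (m * N) j.+1)%N by rewrite leq_max ltnSn orbT.
by rewrite (bigD1 (Ordinal jL))//= lerDl; apply: sumr_ge0 => i _; exact: kcoef_ge0.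
Qed.

(** Cauchy-Schwarz for m N coefficients of sum 1, read off from the nonnegativity of their variance
    about 1 / (m N). *)
Lemma kcoef_sqr m N L : (0 < m)%N -> (0 < N)%N -> (m * N <= L)%N ->
  (m * N)%:R^-1 <= \sum_(j < L) kcoef m N j ^+ 2.
Proof.
move=> m0 N0 mN; apply: (@le_trans _ _ (\sum_(j < m * N) kcoef m N j ^+ 2)); last first.
  rewrite -(subnKC mN) big_split_ord /= lerDl.
  by apply: sumr_ge0 => i _; exact: sqr_ge0.
set n := (m * N)%N; have n0 : (0 : R) < n%:R by rewrite ltr0n muln_gt0 m0.
have h1 : \sum_(j < n) kcoef m N j = 1 by exact: kcoef_sum.
have : 0 <= \sum_(j < n) (kcoef m N j - n%:R^-1) ^+ 2 by apply: sumr_ge0 => j _; exact: sqr_ge0.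
have -> : \sum_(j < n) (kcoef m N j - n%:R^-1) ^+ 2 =
   \sum_(j < n) kcoef m N j ^+ 2 + \sum_(j < n) n%:R^-1 ^+ 2 - 2 * n%:R^-1 * \sum_(j < n) kcoef m N j.
  by rewrite mulr_sumr -big_split -sumrB; apply: eq_bigr => j _ /=; ring.
rewrite h1 mulr1 sumr_const card_ord -[_ ^+ 2 *+ n]mulr_natl expr2 mulrA mulfV ?gt_eqF// mul1r.
by move: (\sum_(j < n) _) (n%:R^-1); clear => x y; lra.
Qed.

Lemma kernel_le1 N z : (0 < N)%N -> modulus z <= 1 ->
  modulus ((N%:R^-1)%:C%C * \sum_(i < N) z ^+ i) <= 1.
Proof.
move=> N0 z1; have N0' : (0 : R) < N%:R by rewrite ltr0n.
rewrite modulusM modulus_real ger0_norm ?invr_ge0// mulrC ler_pdivrMr// mul1r.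
apply: le_trans (modulus_sum _ _ _) _.
apply: (@le_trans _ _ (\sum_(i < N) (1 : R))); last by rewrite sumr_const card_ord.
by apply: ler_sum => i _; rewrite modulusX exprn_ile1// modulus_ge0.
Qed.

(** The geometric sum telescopes against 1 - z, leaving 1 - z^N. *)
Lemma kernel_decay N z : (0 < N)%N -> modulus z <= 1 ->
  N%:R * modulus (1 - z) * modulus ((N%:R^-1)%:C%C * \sum_(i < N) z ^+ i) <= 2.
Proof.
move=> N0 z1; have N0' : (0 : R) < N%:R by rewrite ltr0n.
rewrite modulusM modulus_real ger0_norm ?invr_ge0//.
have -> : N%:R * modulus (1 - z) * (N%:R^-1 * modulus (\sum_(i < N) z ^+ i)) = modulus ((1 - z) * \sum_(i < N) z ^+ i).
  by rewrite modulusM; field; rewrite gt_eqF.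
have -> : (1 - z) * \sum_(i < N) z ^+ i = 1 - z ^+ N.
  have := subrXX (1 : Cplx R) z N; rewrite expr1n => ->; congr (_ * _).
  by apply: eq_bigr => i _; rewrite expr1n mul1r.
apply: le_trans (modulusB _ _) _; rewrite modulus1 modulusX.
have : modulus z ^+ N <= 1 by rewrite exprn_ile1// modulus_ge0.
lra.
Qed.

End kernel.

(** * Lacunary block series *)

Section lacunary.
Variable R : realType.
Variables (m : nat) (W : nat -> R) (N : nat -> nat) (theta : nat -> R).
Hypotheses (m0 : (0 < m)%N) (W0 : forall k, 0 <= W k).
Hypotheses (N0 : forall k, (0 < N k)%N) (N2 : forall k, (N k <= 2 ^ k)%N).
Implicit Types (z : Cplx R) (k j n : nat).

Let om k : Cplx R := conjc (circle_pt (theta k)).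

(* Coefficients of [sum_k W_k z^(m 2^k) D_k(conj(circle_pt theta_k) z)^m], where
   [D_k] is the normalised Dirichlet kernel of length [N_k]: the [k]-th block has
   degrees in [[m 2^k, m 2^(k+1))]. *)
Definition lac_coef n : Cplx R :=
  if (n < m)%N then 0 else
  let k := trunc_log 2 (n %/ m) in let j := (n - m * 2 ^ k)%N in
  (W k * kcoef R m (N k) j)%:C%C * om k ^+ j.

Definition lac_term k z : Cplx R :=
  (W k)%:C%C * z ^+ (m * 2 ^ k) * (((N k)%:R^-1)%:C%C * \sum_(i < N k) (om k * z) ^+ i) ^+ m.

Lemma lac_coef_block k j : (j < m * 2 ^ k)%N ->
  lac_coef (m * 2 ^ k + j) = (W k * kcoef R m (N k) j)%:C%C * om k ^+ j.
Proof.
move=> hj; rewrite /lac_coef ifF; last first.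
  by apply/negbTE; rewrite -leqNgt (leq_trans _ (leq_addr _ _))// leq_pmulr// expn_gt0.
have -> : ((m * 2 ^ k + j) %/ m = 2 ^ k + j %/ m)%N by rewrite mulnC divnMDl.
have hd : (j %/ m < 2 ^ k)%N by rewrite ltn_divLR// mulnC.
rewrite (@trunc_log_eq 2 k)//; first by rewrite addKn.
by rewrite leq_addr /= expnS mul2n -addnn ltn_add2l.
Qed.

Lemma psum_lac K z : psum lac_coef (m * 2 ^ K) z = \sum_(k < K) lac_term k z.
Proof.
elim: K => [|K IH].
  rewrite expn0 muln1 big_ord0 /psum big1// => n _.
  by rewrite /lac_coef ltn_ord mul0r.
rewrite big_ord_recr /= -IH /psum.
have -> : (m * 2 ^ K.+1 = m * 2 ^ K + m * 2 ^ K)%N by rewrite expnS; lia.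
rewrite big_split_ord /=; congr (_ + _).
have hL : (m * N K <= m * 2 ^ K)%N by rewrite leq_mul2l N2 orbT.
rewrite /lac_term -(kcoef_eval _ m0 (N0 K) hL) mulr_sumr; apply: eq_bigr => j _.
have e : (W K * kcoef R m (N K) j)%:C%C = (W K)%:C%C * (kcoef R m (N K) j)%:C%C :> Cplx R by rewrite rmorphM.
rewrite lac_coef_block// e exprD exprMn.
by move: (_%:C%C) (_%:C%C) (om K ^+ _) (z ^+ _) (z ^+ _) => a b x y w; ring.
Qed.

Lemma modulus_om k : modulus (om k) = 1.
Proof. by rewrite modulus_conjc modulus_circle_pt. Qed.

Lemma modulus_lac_coef_block k j : (j < m * 2 ^ k)%N ->
  modulus (lac_coef (m * 2 ^ k + j)) = W k * kcoef R m (N k) j.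
Proof.
move=> hj; rewrite lac_coef_block// modulusM modulusX modulus_om expr1n mulr1.
by rewrite modulus_real ger0_norm// mulr_ge0// kcoef_ge0.
Qed.

Lemma lac_index n : (m <= n)%N -> exists k j, (j < m * 2 ^ k)%N /\ n = (m * 2 ^ k + j)%N.
Proof.
move=> mn; pose k := trunc_log 2 (n %/ m); exists k, (n - m * 2 ^ k)%N.
have nm0 : (0 < n %/ m)%N by rewrite divn_gt0.
have /andP[h1 h2] := trunc_log_bounds (isT : (1 < 2)%N) nm0.
have h3 : (m * 2 ^ k <= n)%N by rewrite mulnC -leq_divRL.
split; last by rewrite subnKC.
rewrite ltn_subLR//; move: h2; rewrite ltn_divLR// expnS => h2.
by rewrite -/k in h2; lia.
Qed.

(** Terms of block k carry r^(2^k) <= exp (-(1 - r) 2^k), which beats the growth 2^(k s). *)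
Lemma absconv_lac (M s : R) : 0 <= M -> 0 <= s ->
  (forall k, W k <= M * (2 ^+ k) `^ s) -> absconv lac_coef.
Proof.
move=> M0 s0 hW; apply: absconv_of_bounded => r r0 r1.
have d0 : 0 < 1 - r by rewrite subr_gt0.
have [C C0 hC] := powR_expR_bounded s0.
exists (M * (C / (1 - r) `^ s)) => n; rewrite /abs_terms.
have [nm|mn] := ltnP n m.
  rewrite /lac_coef nm modulus0 mul0r !mulr_ge0 ?(ltW C0)// invr_ge0 powR_ge0//.
have [k [j [hj ->]]] := lac_index mn.
rewrite modulus_lac_coef_block//.
have e2 : (0 : R) <= 2 ^+ k by rewrite exprn_ge0.
apply: (@le_trans _ _ (W k * r ^+ (2 ^ k))).
  rewrite -mulrA ler_wpM2l//; apply: (@le_trans _ _ (r ^+ (m * 2 ^ k + j))).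
    by rewrite ler_piMl ?exprn_ge0// kcoef_le1.
  rewrite ler_wiXn2l// ?(ltW r1)// (leq_trans _ (leq_addr _ _))// leq_pmull//.
apply: (@le_trans _ _ (M * ((2 ^+ k) `^ s * expR (- ((1 - r) * 2 ^+ k))))).
  rewrite mulrA; apply: ler_pM => //; first exact: exprn_ge0.
  have hr : r <= expR (- (1 - r)) by apply: le_trans (expR_ge1Dx _); lra.
  apply: (@le_trans _ _ (expR (- (1 - r)) ^+ (2 ^ k))).
    by rewrite lerXn2r ?nnegrE ?expR_ge0.
  by rewrite -expRM_natr natrX mulNr.
rewrite ler_wpM2l// ler_pdivlMr ?powR_gt0//.
have := hC ((1 - r) * 2 ^+ k) (mulr_ge0 (ltW d0) e2).
rewrite powRM ?(ltW d0)// => h; apply: le_trans h; apply: eq_ler.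
by move: (_ `^ s) (_ `^ s) (expR _); clear => x y w; ring.
Qed.

(** Along the partial sums that end with a complete block this is the triangle inequality, and a
    subsequence determines the limit. *)
Lemma modulus_power_sum_lac z : absconv lac_coef -> disk R z ->
  ((modulus (power_sum lac_coef z))%:E <= \sum_(k <oo) (modulus (lac_term k z))%:E)%E.
Proof.
move=> ha hz; set S := (\sum_(k <oo) _)%E.
have p0 k : (0 <= (modulus (lac_term k z))%:E)%E by rewrite lee_fin modulus_ge0.
have [SE|SE] := eqVneq S +oo%E; first by rewrite SE leey.
have S0 : (0 <= S)%E by exact: nneseries_ge0.
have [b Sb] : exists b, S = b%:E by exists (fine S); rewrite fineK// ge0_fin_numE// ltey.
set f := power_sum lac_coef.
have hf : power_expansion f lac_coef by exact: power_expansion_power_sum.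
rewrite Sb lee_fin leNgt; apply/negP => hlt.
have [n0 _ hn] := cvgr_gt _ (cvg_modulus (power_expansion_cvg hf hz)) _ hlt.
have n0m : (n0 <= m * 2 ^ n0)%N by rewrite (leq_trans (ltnW (ltn_expl n0 (ltnSn 1))))// leq_pmull.
have := hn _ n0m; rewrite /= psum_lac ltNge; move/negP; apply.
apply: le_trans (modulus_sum _ _ _) _; rewrite -lee_fin -Sb -sumEFin.
exact: (nneseries_ge_partial (u := fun k => (modulus (lac_term k z))%:E)).
Qed.

(** The inequality (1 - x)^2 >= 1 - 2 x makes (1 - 2^-k)^(2^k) nondecreasing from its value 1/4 at k
    = 1. *)
Lemma dyrad_pow k : (4^-1 : R) <= dyrad R k.+1 ^+ (2 ^ k.+1).
Proof.
elim: k => [|k IH].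
  rewrite /dyrad epsS eps0 expn1; have -> : (1 - 1 / 2 : R) = 2^-1 by field.
  by rewrite expr2 -invfM -natrM.
apply: le_trans IH _; rewrite [in leRHS]expnS exprM lerXn2r ?nnegrE ?exprn_ge0 ?dyrad_ge0//.
have e : eps R k.+1 = eps R k.+2 * 2 by rewrite [eps R k.+2]epsS divfK.
by rewrite /dyrad e; move: (eps R k.+2) => x; nra.
Qed.

(** Only block k is kept. Its degrees are below 2 m 2^k, so r^(2 n) is bounded below by a power of
    1/4, and the squared kernel coefficients sum to at least 1 / (m N_k). *)
Lemma M2sq_lac k : absconv lac_coef ->
  (4^-1 ^+ (2 * m) / m%:R) * (W k ^+ 2 / (N k)%:R) <= M2sq lac_coef (dyrad R k.+1).
Proof.
move=> ha; have r0 := dyrad_ge0 R k.+1; have r1 := dyrad_lt1 R k.+1.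
apply: le_trans (sq_terms_partial_le (m * 2 ^ k + m * 2 ^ k) ha r0 r1).
rewrite big_split_ord /= -[leLHS]add0r; apply: lerD.
  by apply: sumr_ge0 => i _; exact: sq_terms_ge0.
have hL : (m * N k <= m * 2 ^ k)%N by rewrite leq_mul2l N2 orbT.
apply: (@le_trans _ _ (\sum_(j < m * 2 ^ k) (W k ^+ 2 * kcoef R m (N k) j ^+ 2) * 4^-1 ^+ (2 * m))); last first.
  apply: ler_sum => j _; rewrite /sq_terms modulus_lac_coef_block// exprMn.
  apply: ler_wpM2l; first by rewrite mulr_ge0 ?sqr_ge0.
  apply: (@le_trans _ _ ((dyrad R k.+1 ^+ (2 ^ k.+1)) ^+ (2 * m))).
    by rewrite lerXn2r ?nnegrE ?invr_ge0 ?exprn_ge0 ?dyrad_pow.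
  rewrite -exprM ler_wiXn2l// ?(ltW r1)// expnS; have := ltn_ord j; lia.
rewrite -mulr_suml -mulr_sumr.
have := kcoef_sqr R m0 (N0 k) hL; move: (\sum_(j < m * 2 ^ k) _) => x hx.
rewrite natrM invfM in hx.
have -> : 4^-1 ^+ (2 * m) / m%:R * (W k ^+ 2 / (N k)%:R) = W k ^+ 2 * (m%:R^-1 * (N k)%:R^-1) * 4^-1 ^+ (2 * m) :> R by ring.
by rewrite ler_wpM2r ?exprn_ge0 ?invr_ge0// ler_wpM2l// sqr_ge0.
Qed.

End lacunary.

(** * Chords and angles *)

Section chord.
Variable R : realType.
Implicit Types (x y t theta : R).

Lemma cos_ge_sqr x : 1 - x ^+ 2 / 2 <= cos x.
Proof.
have ds (y : R) : is_derive y 1 (@sin R) (cos y) by exact: is_derive_sin.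
have sl y : `|sin y| <= `|y|.
  have := @lipschitz_of_derive R _ _ ds _ 0 y; rewrite sin0 !subr0; apply => z.
  by rewrite ler_norml cos_geN1 cos_le1.
have h := sl (x / 2).
have -> : cos x = 1 - 2 * sin (x / 2) ^+ 2.
  have -> : cos x = cos (x / 2 + x / 2) by congr cos; field.
  by rewrite cosD -!expr2 cos2sin2; ring.
have : sin (x / 2) ^+ 2 <= (x / 2) ^+ 2.
  by rewrite -[leLHS]real_normK ?num_real// -[leRHS]real_normK ?num_real// lerXn2r ?nnegrE.
by lra.
Qed.

(** Up to 1 the mean value theorem with cos >= 1/2 suffices; beyond 1 the point is within distance 1
    of pi / 2, so sin >= 1/2, while y / 6 < 1/2. *)
Lemma sin_ge_linear y : 0 <= y -> y <= (pi + 1) / 2 -> y / 6 <= sin y.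
Proof.
move=> y0 y1; have [h|h] := leP y 1.
  have ds (z : R) : is_derive z 1 (@sin R) (cos z) by exact: is_derive_sin.
  have cs : {within `[0, y], continuous (@sin R)}.
    by apply: continuous_subspaceT; exact: continuous_sin.
  have [c] := MVT_segment y0 (fun z _ => ds z) cs.
  rewrite in_itv /= sin0 !subr0 => /andP[c0 cy] ->.
  have := cos_ge_sqr c; have : c ^+ 2 <= 1 by nra.
  by nra.
have p4 : pi < 4 :> R by have := pihalf_lt2 R; lra.
have p2 := pi_ge2 R.
have -> : sin y = cos (y - pi / 2).
  by rewrite cosB cos_pihalf sin_pihalf mulr0 add0r mulr1.
apply: le_trans (cos_ge_sqr _).
have : (y - pi / 2) ^+ 2 <= 1 by nra.
by nra.
Qed.

(** The chord is twice the sine of half the angle. The range pi + 1 covers an angle in [0, 2 pi]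
    against a peak in [pi, pi + 1], so angles need no reduction modulo 2 pi. *)
Lemma chord_ge t theta : `|t - theta| <= pi + 1 ->
  `|t - theta| / 6 <= modulus (circle_pt t - circle_pt theta).
Proof.
move=> h; rewrite -(@ler_pXn2r _ 2)// ?nnegrE ?modulus_ge0 ?divr_ge0//.
have -> : modulus (circle_pt t - circle_pt theta) ^+ 2 = (2 * sin (`|t - theta| / 2)) ^+ 2.
  have -> : (2 * sin (`|t - theta| / 2)) ^+ 2 = 2 - 2 * cos (t - theta).
    have -> : cos (t - theta) = cos (`|t - theta|) by case: ger0P => // _; rewrite cosN.
    have -> : cos `|t - theta| = cos (`|t - theta| / 2 + `|t - theta| / 2) by congr cos; field.
    by rewrite cosD -!expr2 cos2sin2; ring.
  rewrite modulus_sqr cosB /=.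
  have := cos2Dsin2 t; have := cos2Dsin2 theta.
  by move: (cos t) (sin t) (cos theta) (sin theta) => a b c e; nra.
have hs := sin_ge_linear (_ : 0 <= `|t - theta| / 2) (_ : `|t - theta| / 2 <= (pi + 1) / 2).
have {}hs : `|t - theta| / 2 / 6 <= sin (`|t - theta| / 2).
  by apply: hs; [rewrite divr_ge0|rewrite ler_pM2r ?invr_gt0].
have n0 := normr_ge0 (t - theta).
rewrite lerXn2r ?nnegrE ?divr_ge0//; first by move: hs n0; lra.
by move: hs n0; lra.
Qed.

End chord.

(** * Pointwise bounds for lacunary series *)

Section lacunary_bounds.
Variable R : realType.
Implicit Types (t s : R) (k n : nat).

(* Either [z] is closer to the boundary point than to the centre of the peak,
   and the kernel decays, or it is far from the boundary and [rho] is small. *)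
Lemma factor_bound (rho Q dist chord delta e x Nk Pk : R) :
  0 <= rho -> rho <= expR (- (x / 2)) -> 0 <= Q -> Q <= 1 -> Nk * dist * Q <= 2 ->
  chord - 2 * e <= dist -> 0 <= delta -> delta / 6 <= chord ->
  0 < Nk -> Nk <= Pk -> x = Pk * e -> 0 < e ->
  rho * Q <= 96 * damp (Nk * delta) * expR (- (x / 4)).
Proof.
move=> rho0 hrho Q0 Q1 hQ hd d0 hc N0 NP xE e0.
set E := expR (- (x / 4)).
have E0 : 0 < E by exact: expR_gt0.
have P0 : 0 < Pk by apply: lt_le_trans NP.
have x0 : 0 < x by rewrite xE mulr_gt0.
have EE : expR (- (x / 2)) = E * E by rewrite /E -expRD; congr expR; field.
have E1 : E <= 1 by rewrite /E -expR0 ler_expR oppr_le0 divr_ge0// ltW.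
have xE4 : x * E <= 4.
  have h := expR_le_inv (_ : - (x / 4) < 1).
  have {}h : E <= (1 - - (x / 4))^-1 by apply: h; lra.
  have h1 : 0 < 1 - - (x / 4) by lra.
  have h2 : E * (1 - - (x / 4)) <= 1.
    by rewrite -ler_pdivlMr// mul1r.
  by nra.
have M0 : 0 < Num.max 1 (Nk * delta) by rewrite lt_max ltr01.
rewrite /damp -mulrA mulrCA [_^-1 * _]mulrC ler_pdivlMr//.
have rQ0 : 0 <= rho * Q by rewrite mulr_ge0.
have rE : rho <= E * E by rewrite -EE.
case: (leP 1 (Nk * delta)) => hN; last by rewrite mulr1; nra.
(* If chord >= 4 e then dist >= chord / 2 >= delta / 12 and the kernel decays with constant 24.
   Otherwise delta < 24 e, so Nk delta <= 24 x, and half of the exponential absorbs x with constant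
   4; hence 96. *)
have [h|h] := leP (4 * e) chord.
  have h1 : delta / 12 <= dist by lra.
  have h2 : Q * (Nk * delta) <= 24.
    have : Nk * (delta / 12) * Q <= Nk * dist * Q by rewrite ler_wpM2r// ler_wpM2l// ltW.
    by lra.
  have h3 : 0 <= Q * (Nk * delta) by rewrite !mulr_ge0// ltW.
  rewrite -mulrA; move: (Q * (Nk * delta)) h2 h3 => z h2 h3.
  by nra.
have h1 : Nk * delta <= 24 * x.
  have h4 : delta <= 24 * e by lra.
  have : Nk * delta <= Pk * (24 * e) by apply: ler_pM => //; exact: ltW.
  by rewrite xE; lra.
have h3 : rho * Q <= E * E by nra.
have h5 : 0 <= Nk * delta by rewrite mulr_ge0// ltW.
apply: (@le_trans _ _ (E * E * (24 * x))); first exact: ler_pM.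
by nra.
Qed.

(** For k <= n the power of eps itself decays away from n. For k > n the exponential must undo the
    growth 2^((k - n) s) and leave a decay of the same size, hence the exponent 2 s. *)
Lemma eps_exp_decay s : 0 < s -> exists2 C : R, 0 < C & forall k n,
  eps R k `^ (- s) * expR (- (2 ^+ k * eps R n / 4)) <= C * (eps R n `^ (- s) * (2^-1 `^ s) ^+ gap k n).
Proof.
move=> s0; have [C C0 hC] := @powR_expR_bounded R (2 * s) (mulr_ge0 (ler0n _ 2) (ltW s0)).
exists (1 + C * 4 `^ (2 * s)) => [|k n]; first by rewrite ltr_wpDr ?mulr_ge0 ?powR_ge0 ?(ltW C0).
have e0 j := eps_gt0 R j.
have pe j : 0 < eps R j `^ (- s) by rewrite powR_gt0.
have [kn|nk] := leqP k n.
  have -> : gap k n = (n - k)%N by rewrite /gap (eqP (_ : k - n == 0)%N) ?subn_eq0.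
  have -> : eps R n `^ (- s) * (2^-1 `^ s) ^+ (n - k) = eps R k `^ (- s).
    have -> : eps R n = eps R (n - k) * eps R k by rewrite -epsD subnK.
    rewrite -powR_exprn ?invr_ge0// -/(eps R (n - k)) powRM ?eps_ge0// mulrAC -powRD.
      by rewrite addNr powRr0 mul1r.
    by rewrite (gt_eqF (e0 _)) implybT.
  apply: (@le_trans _ _ (eps R k `^ (- s))).
    rewrite ler_piMr ?(ltW (pe k))// -expR0 ler_expR oppr_le0.
    by rewrite divr_ge0// mulr_ge0 ?exprn_ge0 ?eps_ge0.
  by rewrite ler_peMl ?(ltW (pe k))// lerDl mulr_ge0 ?powR_ge0 ?(ltW C0).
have -> : gap k n = (k - n)%N by rewrite /gap (eqP (_ : n - k == 0)%N) ?addn0// subn_eq0 ltnW.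
set j := (k - n)%N.
have ek : eps R k = eps R j * eps R n by rewrite -epsD subnK// ltnW.
have xE : 2 ^+ k * eps R n = 2 ^+ j :> R.
  have -> : k = (j + n)%N by rewrite /j subnK// ltnW.
  by rewrite exprD -mulrA /eps exprVn mulfV ?mulr1// expf_neq0.
have x0 : (0 : R) < 2 ^+ j by rewrite exprn_gt0.
have ejs : eps R j `^ (- s) = (2 ^+ j) `^ s by rewrite /eps exprVn -powR_inv1 ?(ltW x0)// -powRrM mulN1r opprK.
have ljs : (2^-1 `^ s) ^+ j = ((2 ^+ j) `^ s)^-1 :> R.
  by rewrite -powR_exprn ?invr_ge0// exprVn -powR_inv1 ?(ltW x0)// -powRrM mulN1r powRN.
rewrite xE ek powRM ?eps_ge0// ejs ljs.
have ps : (0 : R) < (2 ^+ j) `^ s by rewrite powR_gt0.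
have h0 : (2 ^+ j) `^ s * expR (- (2 ^+ j / 4)) * (2 ^+ j) `^ s <= 1 + C * 4 `^ (2 * s) :> R.
  have := hC (2 ^+ j / 4) (divr_ge0 (ltW x0) (ler0n _ 4)).
  rewrite powR_div ?(ltW x0)// mulrAC ler_pdivrMr ?powR_gt0// => h.
  have -> : (2 ^+ j) `^ s * expR (- (2 ^+ j / 4)) * (2 ^+ j) `^ s = (2 ^+ j) `^ (2 * s) * expR (- (2 ^+ j / 4)) :> R.
    rewrite mulrAC -powRD; last by rewrite (gt_eqF x0) implybT.
    by rewrite mulr_natl mulr2n.
  by lra.
have pn := pe n; move: h0 ps pn.
move: ((2 ^+ j) `^ s) (eps R n `^ (- s)) (expR _) (1 + _) => A B E L h0 A0 B0.
have -> : A * B * E = A * E * A * (B / A) by field; rewrite gt_eqF.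
by rewrite ler_wpM2r// divr_ge0// ltW.
Qed.

Section cone_bound.
Variables (m : nat) (c : nat -> R) (N : nat -> nat) (theta : nat -> R) (s : R).
Hypotheses (m0 : (0 < m)%N) (c0 : forall k, 0 <= c k) (s0 : 0 < s).
Hypotheses (N0 : forall k, (0 < N k)%N) (N2 : forall k, (N k <= 2 ^ k)%N).
Hypothesis thetaP : forall k, pi <= theta k <= pi + 1.

(** The power of eps gives block k the size c_k at its own scale, once multiplied by eps^s as in the
    tent norm. *)
Definition weight k : R := eps R k `^ (- s) * c k.

(** Angular profile of block k, equal to 1 within 1 / N_k of theta_k; the power m thins its tails at
    will. *)
Definition peak k t : R := damp ((N k)%:R * `|t - theta k|) ^+ m.

Lemma weight_ge0 k : 0 <= weight k. Proof. by rewrite mulr_ge0 ?powR_ge0. Qed.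

Lemma peak_ge0 k t : 0 <= peak k t. Proof. by rewrite exprn_ge0// ltW// damp_gt0. Qed.

(** The m-th power of [factor_bound] with rho = |z|^(2^k) and Q the kernel; one exponential factor
    is kept, the others being at most 1. *)
Lemma lac_term_bound k n t (w : R * R) : 0 <= t -> t <= 2 * pi -> (coneset t `&` @annulus R n) w ->
  modulus (lac_term m weight N theta k (of_plane w)) <=
    96 ^+ m * (weight k * expR (- (2 ^+ k * eps R n / 4))) * peak k t.
Proof.
move=> t0 t2 hw; set z := of_plane w.
have := cone_annulus_sub hw; rewrite /cball /mkset modulus_distC -/z => hz.
have e0 := eps_gt0 R n.
have z1 : modulus z <= 1 - eps R n / 2.
  by have := annulus_modulus (proj2 hw); rewrite /dyrad epsS.
have z1' : modulus z <= 1 by move: z1 e0; lra.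
set omz : Cplx R := conjc (circle_pt (theta k)) * z.
have omz1 : modulus omz <= 1 by rewrite modulusM modulus_conjc modulus_circle_pt mul1r.
set Q := modulus (((N k)%:R^-1)%:C%C * \sum_(i < N k) omz ^+ i).
have Q1 : Q <= 1 by exact: kernel_le1.
have hQ : (N k)%:R * modulus (1 - omz) * Q <= 2 by exact: kernel_decay.
have hd : modulus (circle_pt t - circle_pt (theta k)) - 2 * eps R n <= modulus (1 - omz).
  have -> : modulus (1 - omz) = modulus (circle_pt (theta k) - z).
    have -> : 1 - omz = conjc (circle_pt (theta k)) * (circle_pt (theta k) - z).
      by rewrite mulrBr [conjc _ * circle_pt _]mulrC circle_ptVr.
    by rewrite modulusM modulus_conjc modulus_circle_pt mul1r.
  have := modulusD (circle_pt t - z) (z - circle_pt (theta k)).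
  rewrite addrA subrK [modulus (z - _)]modulus_distC => h.
  by move: h hz; move: (modulus _) (modulus _) (modulus _) => x y v; lra.
have hc : `|t - theta k| / 6 <= modulus (circle_pt t - circle_pt (theta k)).
  apply: chord_ge; have /andP[h1 h2] := thetaP k; have := pi_ge2 R.
  by rewrite ler_norml; lra.
have NP : (N k)%:R <= 2 ^+ k :> R by rewrite -natrX ler_nat.
have NP0 : (0 : R) < (N k)%:R by rewrite ltr0n.
pose rho := modulus z ^+ (2 ^ k).
have rho0 : 0 <= rho by rewrite exprn_ge0// modulus_ge0.
have hrho : rho <= expR (- (2 ^+ k * eps R n / 2)).
  have hr : modulus z <= expR (- (eps R n / 2)) by apply: le_trans (expR_ge1Dx _); move: z1; lra.
  apply: (@le_trans _ _ (expR (- (eps R n / 2)) ^+ (2 ^ k))).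
    by rewrite lerXn2r ?nnegrE ?modulus_ge0 ?expR_ge0.
  rewrite -expRM_natr natrX mulNr ler_expR; apply: eq_ler; congr (- _); ring.
have key := factor_bound rho0 hrho (modulus_ge0 _) Q1 hQ hd (normr_ge0 _) hc NP0 NP erefl e0.
have -> : modulus (lac_term m weight N theta k z) = weight k * (rho * Q) ^+ m.
  rewrite /lac_term !modulusM !modulusX modulus_real (ger0_norm (weight_ge0 k)) -/omz -/Q.
  by rewrite exprMn /rho -exprM [(2 ^ k * m)%N]mulnC mulrA.
set E := expR _ in key *.
have E0 : 0 <= E by exact: expR_ge0.
have E1 : E <= 1 by rewrite /E -expR0 ler_expR oppr_le0 divr_ge0// mulr_ge0 ?exprn_ge0 ?(ltW e0).
apply: (@le_trans _ _ (weight k * (96 * damp ((N k)%:R * `|t - theta k|) * E) ^+ m)).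
  rewrite ler_wpM2l ?weight_ge0// lerXn2r ?nnegrE ?mulr_ge0 ?modulus_ge0//.
  by rewrite ltW// damp_gt0.
rewrite !exprMn -/(peak k t).
have Em : E ^+ m <= E by rewrite -[leRHS]expr1 ler_wiXn2l.
have -> : 96 ^+ m * (weight k * E) * peak k t = weight k * (96 ^+ m * peak k t * E) by ring.
apply: ler_wpM2l; first exact: weight_ge0.
by apply: ler_wpM2l Em; apply: mulr_ge0; [exact: exprn_ge0|exact: peak_ge0].
Qed.

Hypothesis hconv : absconv (lac_coef m weight N theta).

Let f := power_sum (lac_coef m weight N theta).
Let hf : power_expansion f (lac_coef m weight N theta).
Proof. exact: power_expansion_power_sum. Qed.

Let lam : R := 2^-1 `^ s.

Definition peak_sum n t : \bar R := (\sum_(k <oo) (c k * peak k t * lam ^+ gap k n)%:E)%E.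

Let lam0 : 0 < lam. Proof. by rewrite powR_gt0// invr_gt0. Qed.

Let peak_sum_ge0 n t : (0 <= peak_sum n t)%E.
Proof. by apply: nneseries_ge0 => k _ _; rewrite lee_fin !mulr_ge0 ?peak_ge0 ?exprn_ge0 ?(ltW lam0). Qed.

Lemma modulus_lac_bound : exists2 C : R, 0 < C & forall n t (w : R * R), 0 <= t -> t <= 2 * pi ->
  (coneset t `&` @annulus R n) w ->
  ((modulus (f (of_plane w)))%:E <= (C * eps R n `^ (- s))%:E * peak_sum n t)%E.
Proof.
have [C C0 hC] := eps_exp_decay s0.
exists (96 ^+ m * C) => [|n t w t0 t2 hw]; first by rewrite mulr_gt0// exprn_gt0.
have hd : disk R (of_plane w) by case: hw => -[].
apply: le_trans (modulus_power_sum_lac m0 N0 N2 hconv hd) _.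
rewrite -nneseriesZl; last by move=> k _; rewrite lee_fin !mulr_ge0 ?peak_ge0 ?exprn_ge0 ?(ltW lam0).
apply: lee_nneseries => [k _ _|k _]; first by rewrite lee_fin modulus_ge0.
rewrite -EFinM lee_fin; apply: le_trans (lac_term_bound k t0 t2 hw) _.
have h := hC k n; rewrite -/lam in h.
have cb : 0 <= 96 ^+ m * c k * peak k t.
  by apply: mulr_ge0; [apply: mulr_ge0 => //; exact: exprn_ge0|exact: peak_ge0].
have -> : 96 ^+ m * (weight k * expR (- (2 ^+ k * eps R n / 4))) * peak k t =
    96 ^+ m * c k * peak k t * (eps R k `^ (- s) * expR (- (2 ^+ k * eps R n / 4))).
  by rewrite /weight; ring.
apply: le_trans (ler_wpM2l cb h) _; apply: eq_ler.
by move: (eps R n `^ _) (lam ^+ _) (peak k t) (96 ^+ m); clear => a b e v; ring.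
Qed.

Lemma cone_meas_le_bound q alpha (a : nat -> Cplx R) g (D : set (R * R)) (B : R) : 0 < q ->
  power_expansion g a -> measurable D ->
  (forall w, D w -> disk R (of_plane w) /\ modulus (g (of_plane w)) <= B) -> 0 <= B ->
  (cone_meas q alpha a D <= (B `^ q)%:E * \int[area R]_(w in D) (wgt alpha w)%:E)%E.
Proof.
move=> q0 hg mD hD B0.
have mw : measurable_fun D (fun w => (wgt alpha w)%:E).
  by apply: measurable_funTS; apply/measurable_EFinP; exact: measurable_wgt.
rewrite -ge0_integralZl_EFin ?powR_ge0//; last by move=> w _; rewrite lee_fin wgt_ge0.
apply: (@ge0_le_integral _ _ _ (area R) D mD).
- by move=> w _; exact: cone_integrand_ge0.
- by apply: measurable_funTS; exact: measurable_cone_integrand.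
- exact: emeasurable_funM (measurable_cst _) mw.
move=> w hw; have [h1 h2] := hD w hw; rewrite (UpowE q0 hg h1).
apply: lee_wpmul2r; first by rewrite lee_fin wgt_ge0.
by rewrite lee_fin; apply: ge0_ler_powR; rewrite ?nnegrE ?modulus_ge0 ?(ltW q0).
Qed.

(** On slice n the function is at most eps^(-s) times a geometric convolution of the c_k [peak].
    Since s q = alpha + 2, the powers of eps cancel against area and weight of the slice, and
    [geometric_convolution] sums over n. *)
Lemma lacunary_cone_bound q alpha : 0 < q -> s = (alpha + 2) / q -> exists2 C : R, 0 <= C &
  forall t, 0 <= t -> t <= 2 * pi ->
  (cone_integral q alpha f (circle_pt t) <= C%:E * \sum_(k <oo) ((c k * peak k t) `^ q)%:E)%E.
Proof.
move=> q0 sE; have [C1 C10 h1] := modulus_lac_bound.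
have lam1 : lam < 1.
  rewrite -[ltRHS](one_powR s); apply: gt0_ltr_powR; rewrite ?nnegrE ?invr_ge0//.
  by rewrite invf_lt1// ltr1n.
have [C2 C20 h2] := geometric_convolution lam0 lam1 q0.
set Cb := 16 * 4 `^ `|alpha| : R.
have Cb0 : 0 < Cb by rewrite mulr_gt0// powR_gt0.
have CC : 0 < C1 `^ q * Cb by rewrite mulr_gt0// powR_gt0.
exists (C1 `^ q * Cb * C2) => [|t t0 t2]; first by rewrite mulr_ge0// ltW.
rewrite (cone_integralE _ _ q0 hf) cone_meas_annuli.
apply: (@le_trans _ _ ((C1 `^ q * Cb)%:E * \sum_(n <oo) (peak_sum n t `^ q))%E); last first.
  rewrite [(_ * C2)%:E]EFinM -muleA; apply: lee_wpmul2l; first by rewrite lee_fin ltW.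
  by apply: h2 => k; rewrite mulr_ge0// peak_ge0.
rewrite -nneseriesZl; last by move=> n _; exact: poweR_ge0.
apply: lee_nneseries => [n _ _|n _]; first exact: cone_meas_ge0.
have [BE|BE] := eqVneq (peak_sum n t) +oo%E.
  by rewrite BE poweRyr ?gt_eqF// gt0_muley ?leey.
have [b Bb] : exists b, peak_sum n t = b%:E by exists (fine (peak_sum n t)); rewrite fineK// ge0_fin_numE// ltey.
have b0 : 0 <= b by rewrite -lee_fin -Bb.
have e0 := eps_gt0 R n.
have B0 : 0 <= C1 * eps R n `^ (- s) * b by rewrite !mulr_ge0 ?powR_ge0 ?(ltW C10).
apply: le_trans (cone_meas_le_bound (B := C1 * eps R n `^ (- s) * b) alpha q0 hf (measurable_cone_annulus t n) _ B0) _.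
  move=> w hw; split; first by case: hw => -[].
  by have := h1 n t w t0 t2 hw; rewrite Bb -EFinM lee_fin.
apply: le_trans (lee_wpmul2l _ (integral_wgt_annulus alpha t n)) _; first by rewrite lee_fin powR_ge0.
rewrite Bb poweR_EFin -!EFinM lee_fin !powRM ?mulr_ge0 ?powR_ge0 ?(ltW C10)// -/Cb -powRrM.
have -> : - s * q = - (alpha + 2) by rewrite sE mulNr divfK// gt_eqF.
rewrite powRN; apply: eq_ler.
have : eps R n `^ (alpha + 2) != 0 by rewrite gt_eqF// powR_gt0.
move: (eps R n `^ _) (C1 `^ q) (b `^ q) => x y v x0.
have -> : y / x * v * (Cb * x) = y * Cb * v * (x^-1 * x) by ring.
by rewrite mulVf// mulr1.
Qed.

End cone_bound.

End lacunary_bounds.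

(** * Extremal examples *)

Section lacunary_examples.
Variable R : realType.
Implicit Types (p q u s D tau alpha : R).
Local Notation mu := (@lebesgue_measure R).
Local Notation circ := (`[0%R, (2 * pi)%R]%classic : set R).

Section criteria.
Variables (m : nat) (c : nat -> R) (N : nat -> nat) (theta : nat -> R) (s : R).
Hypotheses (m0 : (0 < m)%N) (c0 : forall k, 0 <= c k) (s0 : 0 < s).
Hypotheses (N0 : forall k, (0 < N k)%N) (N2 : forall k, (N k <= 2 ^ k)%N).
Hypothesis thetaP : forall k, pi <= theta k <= pi + 1.

Let a := lac_coef m (weight c s) N theta.

Lemma absconv_weight M e : 0 <= M -> 0 <= e -> (forall k, c k <= M * (2 ^+ k) `^ e) -> absconv a.
Proof.
move=> M0 e0 h; apply: (absconv_lac m0 _ N0 M0 (_ : 0 <= s + e)) => [k||k].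
- exact: weight_ge0.
- by rewrite addr_ge0// ltW.
have p2 : (0 : R) < 2 ^+ k by rewrite exprn_gt0.
rewrite /weight powRD; last by rewrite (gt_eqF p2) implybT.
have -> : eps R k `^ (- s) = (2 ^+ k) `^ s by rewrite /eps exprVn -powR_inv1 ?(ltW p2)// -powRrM mulN1r opprK.
by rewrite mulrCA; apply: ler_wpM2l => //; exact: powR_ge0.
Qed.

Hypothesis hconv : absconv a.

(** The factor 1 / sqrt N_k is the L^2 size of the normalised kernel, by [M2sq_lac]; this loss
    against the height of the peak is what the concentrated examples balance. *)
Lemma block_sum_lac_infty u s1 : 0 < u ->
  (\sum_(k <oo) ((eps R k `^ (s1 - s) * c k * (Num.sqrt (N k)%:R)^-1) `^ u)%:E = +oo)%E ->
  block_sum u s1 a = +oo%E.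
Proof.
move=> u0 hdiv; set K := 4^-1 ^+ (2 * m) / m%:R : R.
have K0 : 0 < K by rewrite divr_gt0 ?exprn_gt0 ?invr_gt0 ?ltr0n.
set L := (2^-1 `^ (2 * s1) * K) `^ (u / 2).
have L0 : 0 < L by rewrite powR_gt0// mulr_gt0// powR_gt0 ?invr_gt0.
apply/eqP; rewrite -leye_eq.
have -> : +oo%E = (L%:E * \sum_(k <oo) ((eps R k `^ (s1 - s) * c k * (Num.sqrt (N k)%:R)^-1) `^ u)%:E)%E.
  by rewrite hdiv gt0_muley.
rewrite -nneseriesZl; last by move=> k _; rewrite lee_fin powR_ge0.
apply: lee_nneseries => [k _ _|k _]; first by rewrite mule_ge0// lee_fin ?powR_ge0// ltW.
rewrite -EFinM lee_fin.
set x := eps R k `^ (s1 - s) * c k * (Num.sqrt (N k)%:R)^-1.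
have x0 : 0 <= x by rewrite !mulr_ge0 ?powR_ge0 ?invr_ge0 ?sqrtr_ge0.
have -> : x `^ u = (x ^+ 2) `^ (u / 2).
  by rewrite -powR_mulrn// -powRrM mulrC divfK.
rewrite -powRM ?sqr_ge0 ?mulr_ge0 ?powR_ge0 ?(ltW K0)//.
have e0 := eps_gt0 R k.
have key : 2^-1 `^ (2 * s1) * K * x ^+ 2 <= block a s1 k.
  have h := M2sq_lac m0 (fun k => @weight_ge0 _ _ s c0 k) N0 N2 k hconv.
  apply: le_trans (ler_wpM2l (powR_ge0 _ _) h); apply: eq_ler.
  rewrite epsS powRM ?eps_ge0 ?invr_ge0// -/K /x /weight !exprMn exprVn sqr_sqrtr//.
  have e2 (y : R) : (eps R k `^ y) ^+ 2 = eps R k `^ (2 * y).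
    by rewrite -powR_mulrn ?powR_ge0// -powRrM mulrC.
  have -> : (eps R k `^ (s1 - s)) ^+ 2 = eps R k `^ (2 * s1) * (eps R k `^ (- s)) ^+ 2.
    rewrite !e2 -powRD; last by rewrite (gt_eqF e0) implybT.
    by congr (_ `^ _); ring.
  by move: (eps R k `^ _) (eps R k `^ _) (2^-1 `^ _) => A B E; ring.
apply: ge0_ler_powR; rewrite ?nnegrE ?divr_ge0 ?(ltW u0)//; last exact: block_ge0.
by rewrite !mulr_ge0 ?powR_ge0 ?sqr_ge0 ?(ltW K0).
Qed.

Definition peak_power q t : \bar R := (\sum_(k <oo) ((c k * peak m N theta k t) `^ q)%:E)%E.

Lemma peak_power_ge0 q t : (0 <= peak_power q t)%E.
Proof. by apply: nneseries_ge0 => k _ _; rewrite lee_fin powR_ge0. Qed.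

Lemma measurable_peak_power q (A : set R) : measurable_fun A (peak_power q).
Proof.
apply: ge0_emeasurable_sum => [k t _ _|k _]; first by rewrite lee_fin powR_ge0.
apply/measurable_EFinP.
apply: (measurableT_comp (measurable_powR _)).
apply: measurable_funM; first exact: measurable_cst.
apply: measurable_funX; rewrite /damp.
under eq_fun do rewrite -powR_inv1 ?le_max ?ler01//.
apply: (measurableT_comp (measurable_powR _)).
apply: measurable_maxr; first exact: measurable_cst.
apply: measurable_funM; first exact: measurable_cst.
apply: measurableT_comp; first exact: normr_measurable.
exact: measurable_funB.
Qed.

Lemma tent_norm_lac_lty p q alpha : 0 < p -> 0 < q -> s = (alpha + 2) / q ->
  (\int[mu]_(t in circ) (peak_power q t `^ (p / q)) < +oo)%E ->
  tent_space p q alpha (power_sum a).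
Proof.
move=> p0 q0 sE hfin; split; first exact: power_sum_derivable.
have [C C0 hC] := lacunary_cone_bound m0 c0 s0 N0 N2 thetaP hconv q0 sE.
have hf : power_expansion (power_sum a) a by exact: power_expansion_power_sum.
have mpow : measurable_fun setT (fun x : \bar R => (x `^ (p / q))%E) by exact: measurable_poweR.
have pq0 : 0 <= p / q by rewrite divr_ge0 ?(ltW p0) ?(ltW q0).
apply: (@le_lt_trans _ _ (\int[mu]_(t in circ) ((C `^ (p / q))%:E * (peak_power q t `^ (p / q))))%E).
  apply: ge0_le_integral => //.
  - by move=> t _; exact: poweR_ge0.
  - apply: measurable_funTS; apply: (meas_comp (f := fun x => (x `^ (p / q))%E)) => //.
    exact: measurable_cone_integral hf.
  - apply: emeasurable_funM; first exact: measurable_cst.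
    by apply: measurable_funTS; apply: (meas_comp (f := fun x => (x `^ (p / q))%E)) => //; exact: measurable_peak_power.
  move=> t; rewrite /= in_itv /= => /andP[t0 t2].
  rewrite -poweR_EFin -poweRM ?peak_power_ge0//.
  apply: poweR_le => //; first exact: cone_integral_ge0.
  exact: hC.
rewrite ge0_integralZl_EFin ?powR_ge0//; last 2 first.
- by move=> t _; exact: poweR_ge0.
- by apply: measurable_funTS; apply: (meas_comp (f := fun x => (x `^ (p / q))%E)) => //; exact: measurable_peak_power.
by rewrite lte_mul_pinfty ?lee_fin ?powR_ge0.
Qed.

Lemma tent_norm_lac_bounded p q alpha B : 0 < p -> 0 < q -> s = (alpha + 2) / q ->
  (forall t, (peak_power q t <= B%:E)%E) -> tent_space p q alpha (power_sum a).
Proof.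
move=> p0 q0 sE hB; apply: (tent_norm_lac_lty p0 q0 sE).
have pq0 : 0 <= p / q by rewrite divr_ge0 ?(ltW p0) ?(ltW q0).
apply: (@le_lt_trans _ _ (\int[mu]_(t in circ) (B `^ (p / q))%:E)%E).
  apply: ge0_le_integral => //.
  - by move=> t _; exact: poweR_ge0.
  - by apply: measurable_funTS; apply: (measurableT_comp (measurable_poweR _)); exact: measurable_peak_power.
  - by move=> t _; rewrite -poweR_EFin; apply: poweR_le => //; exact: peak_power_ge0.
rewrite integral_cst//= lebesgue_measure_itv/= lte_fin mulr_gt0 ?pi_gt0//.
by rewrite -EFinB -EFinM ltry.
Qed.

End criteria.

(** * Critical sequences *)

Section critical_sequence.
Variables (D u : R).
Hypotheses (D0 : 0 <= D) (u0 : 0 < u).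

(** A borderline sequence: multiplied by eps^(-D), its u-th powers form the harmonic series, while
    any gain, D > 0 or an exponent above u, makes it summable. *)
Definition crit k : R := eps R k `^ D * (k.+1%:R `^ u^-1)^-1.

Lemma crit_ge0 k : 0 <= crit k. Proof. by rewrite mulr_ge0 ?invr_ge0 ?powR_ge0. Qed.

Lemma one_le_powR (x r : R) : 1 <= x -> 0 <= r -> 1 <= x `^ r.
Proof.
move=> x1 r0; rewrite -[leLHS](one_powR r); apply: ge0_ler_powR; rewrite ?nnegrE//.
exact: le_trans x1.
Qed.

Lemma powR_le_one (x r : R) : 0 <= x -> x <= 1 -> 0 <= r -> x `^ r <= 1.
Proof.
by move=> x0 x1 r0; rewrite -[leRHS](one_powR r); apply: ge0_ler_powR; rewrite ?nnegrE.
Qed.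

Lemma crit_le1 k : crit k <= 1.
Proof.
rewrite /crit; apply: mulr_ile1; rewrite ?invr_ge0 ?powR_ge0//.
  by rewrite powR_le_one ?eps_ge0 ?eps_le1.
by rewrite invf_le1 ?powR_gt0// one_le_powR ?ler1n// invr_ge0 ltW.
Qed.

Lemma crit_divergent : (\sum_(k <oo) ((eps R k `^ (- D) * crit k) `^ u)%:E = +oo)%E.
Proof.
rewrite -harmonic_nneseries; apply: eq_eseriesr => k _; congr (_%:E).
rewrite /crit mulrA -powRD ?(gt_eqF (eps_gt0 _ _)) ?implybT// addNr powRr0 mul1r.
by rewrite -powRN -powRrM mulNr mulVf ?gt_eqF// powR_inv1.
Qed.

(** With D > 0 the powers of eps give a geometric series; with tau > u condensation applies to (k +
    1)^(-tau / u). *)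
Lemma sum_crit_lty tau : 0 < tau -> 0 < D \/ u < tau ->
  (\sum_(k <oo) (crit k `^ tau)%:E < +oo)%E.
Proof.
move=> t0 [D1|ut].
  set r := 2^-1 `^ (D * tau) : R.
  have r0 : 0 < r by rewrite powR_gt0// invr_gt0.
  have r1 : r < 1.
    rewrite -[ltRHS](one_powR (D * tau)); apply: gt0_ltr_powR; rewrite ?nnegrE ?invr_ge0 ?(mulr_gt0 D1 t0)//.
    by rewrite invf_lt1// ltr1n.
  apply: (@le_lt_trans _ _ (\sum_(k <oo) (r ^+ k)%:E)%E); last first.
    by apply: le_lt_trans (geometric_nneseries_le (ltW r0) r1) _; rewrite ltry.
  apply: lee_nneseries => [k _ _|k _]; first by rewrite lee_fin powR_ge0.
  rewrite lee_fin /r -powR_exprn ?invr_ge0// -/(eps R k) powRrM.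
  apply: ge0_ler_powR; rewrite ?nnegrE ?powR_ge0 ?crit_ge0 ?(ltW t0)//.
  by rewrite ler_piMr ?powR_ge0// invf_le1 ?powR_gt0// one_le_powR ?ler1n// invr_ge0 ltW.
set r := 2 * (2 `^ (tau / u))^-1 : R.
have tu : 1 < tau / u by rewrite ltr_pdivlMr// mul1r.
have r0 : 0 <= r by rewrite mulr_ge0// invr_ge0 powR_ge0.
have r1 : r < 1.
  rewrite /r ltr_pdivrMr ?powR_gt0// mul1r.
  have -> : tau / u = 1 + (tau / u - 1) by ring.
  rewrite powRD ?pnatr_eq0 ?implybT// powRr1// ltr_pMr// -[ltLHS](one_powR (tau / u - 1)).
  by apply: gt0_ltr_powR; rewrite ?nnegrE ?subr_gt0// ltr1n.
have := @nneseries_dyadic_blocks_lty R (fun k => crit k `^ tau) r 1 (fun k => powR_ge0 _ _) r0 r1 ler01.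
move=> H; apply: le_lt_trans (H _) _; last by rewrite ltry.
move=> j; rewrite mul1r.
apply: (@le_trans _ _ (\sum_(i < 2 ^ j) ((2 `^ (tau / u))^-1) ^+ j)); last first.
  by rewrite sumr_const card_ord -[leLHS]mulr_natl natrX -exprMn.
apply: ler_sum => i _.
have n0 : (0 : R) < (2 ^ j - 1 + i).+1%:R by rewrite ltr0n.
apply: (@le_trans _ _ ((((2 ^ j - 1 + i).+1%:R `^ u^-1)^-1) `^ tau)).
  apply: ge0_ler_powR; rewrite ?nnegrE ?invr_ge0 ?powR_ge0 ?crit_ge0 ?(ltW t0)//.
  by rewrite ler_piMl ?invr_ge0 ?powR_ge0// powR_le_one ?eps_ge0 ?eps_le1.
rewrite -powRN -powRrM mulNr powRN [_^-1 * tau]mulrC exprVn -powR_exprn//.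
rewrite lef_pV2 ?posrE ?powR_gt0 ?exprn_gt0//.
apply: ge0_ler_powR; rewrite ?nnegrE ?exprn_ge0 ?(ltW n0) ?(ltW (lt_trans ltr01 tu))//.
by rewrite -natrX ler_nat; have := expn_gt0 2 j; lia.
Qed.

End critical_sequence.

End lacunary_examples.

Section counterexamples.
Variable R : realType.
Implicit Types (p q u s D tau alpha : R).
Local Notation mu := (@lebesgue_measure R).
Local Notation circ := (`[0%R, (2 * pi)%R]%classic : set R).

Lemma damp_exprn_powR_le (y q : R) m : 2 <= m%:R * q -> (damp y ^+ m) `^ q <= damp y ^+ 2.
Proof.
move=> mq; have d0 := damp_gt0 y.
rewrite -[damp y ^+ m]powR_mulrn ?(ltW d0)// -powRrM -[leRHS]powR_mulrn ?(ltW d0)//.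
by rewrite ger_powR ?damp_le1// d0.
Qed.

Lemma exists_mul_ge (x y : R) : 0 < y -> exists2 m : nat, (0 < m)%N & x <= m%:R * y.
Proof.
move=> y0; exists (Num.truncn `|x / y|).+1 => //.
rewrite -ler_pdivrMr//; apply: le_trans (ler_norm _) _.
by rewrite ltW// truncnS_gt.
Qed.

(** With N_k = 1 and m = 1 the blocks are monomials of degree 2^k and the estimates are uniform in
    the angle: the source norm only asks for c in l^q, while the dyadic sum tests eps^(s1 - s) c in
    l^u. *)
Lemma example_single_peak p q alpha u s1 : 0 < p -> 0 < q -> -2 < alpha -> 0 < u ->
  s1 < (alpha + 2) / q \/ s1 = (alpha + 2) / q /\ u < q ->
  exists a, [/\ absconv a, tent_space p q alpha (power_sum a) & block_sum u s1 a = +oo%E].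
Proof.
move=> p0 q0 al u0 h; set s := (alpha + 2) / q in h.
have s0 : 0 < s by rewrite divr_gt0//; lra.
pose D := s - s1.
have D0 : 0 <= D by rewrite /D; lra.
pose c := crit D u; pose N (_ : nat) := 1%N; pose theta (_ : nat) : R := pi.
have c0 k : 0 <= c k by exact: crit_ge0.
have N0 k : (0 < N k)%N by [].
have N2 k : (N k <= 2 ^ k)%N by rewrite expn_gt0.
have hth k : pi <= theta k <= pi + 1 by rewrite lexx lerDl ler01.
have ha : absconv (lac_coef 1 (weight c s) N theta).
  apply: (absconv_weight _ c0 s0 N0 (M := 1) (e := 0)) => // k.
  by rewrite powRr0 mulr1 crit_le1.
exists (lac_coef 1 (weight c s) N theta); split => //.
  have hfin : (\sum_(k <oo) (c k `^ q)%:E < +oo)%E.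
    by apply: sum_crit_lty => //; rewrite subr_gt0; case: h => [|[]]; [left|right].
  set S := (\sum_(k <oo) _)%E in hfin.
  have S0 : (0 <= S)%E by apply: nneseries_ge0 => k _ _; rewrite lee_fin powR_ge0.
  apply: (tent_norm_lac_bounded _ c0 s0 N0 N2 hth ha (B := fine S)) => // t.
  rewrite fineK ?ge0_fin_numE//; apply: lee_nneseries => [k _ _|k _].
    by rewrite lee_fin powR_ge0.
  rewrite lee_fin; apply: ge0_ler_powR; rewrite ?nnegrE ?(ltW q0)//.
    by rewrite mulr_ge0// peak_ge0.
  by rewrite ler_piMr// exprn_ile1 ?damp_le1// ltW// damp_gt0.
apply: block_sum_lac_infty => //; rewrite -(crit_divergent D u0).
apply: eq_eseriesr => k _; congr ((_ `^ _)%:E).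
by rewrite /N sqrtr1 invr1 mulr1 /D opprB.
Qed.

(** For k + 1 = 2^j + i the peaks have N_k = 2^j and are equally spaced over [pi, pi + 1], so each
    angle feels a bounded total per dyadic range and any power decay of c_k suffices in the source.
    The square mean loses sqrt N_k, and eta = 1/u - 1/2 turns c_k / sqrt (k + 1) into (k +
    1)^(-1/u). *)
Lemma example_spread_peaks p q alpha u : 0 < p -> 0 < q -> -2 < alpha -> 0 < u -> u < 2 ->
  exists a, [/\ absconv a, tent_space p q alpha (power_sum a) & block_sum u ((alpha + 2) / q) a = +oo%E].
Proof.
move=> p0 q0 al u0 u2; set s := (alpha + 2) / q.
have s0 : 0 < s by rewrite divr_gt0//; lra.
(* The q-th power of a peak must decay at least like the squared damping, the rate summed by
   [sum_damp_sqr]. *)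
have [m m0 mq] := exists_mul_ge 2 q0.
pose eta := u^-1 - 2^-1 : R.
have eta0 : 0 < eta by rewrite subr_gt0 ltf_pV2 ?posrE.
pose c k : R := (k.+1%:R `^ eta)^-1.
pose N k := (2 ^ trunc_log 2 k.+1)%N.
pose theta k : R := pi + (k.+1 - N k)%:R / (N k)%:R.
have c0 k : 0 <= c k by rewrite invr_ge0 powR_ge0.
have N0 k : (0 < N k)%N by rewrite expn_gt0.
have Nk k : (N k <= k.+1)%N by exact: trunc_logP.
have N2 k : (N k <= 2 ^ k)%N by rewrite (leq_trans (Nk k))// ltn_expl.
have hth k : pi <= theta k <= pi + 1.
  have n0 : (0 : R) < (N k)%:R by rewrite ltr0n.
  rewrite lerDl divr_ge0//= lerD2l ler_pdivrMr// mul1r ler_nat leq_subLR addnn -mul2n -expnS.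
  by rewrite ltnW// trunc_log_ltn.
have ha : absconv (lac_coef m (weight c s) N theta).
  apply: (absconv_weight m0 c0 s0 N0 (M := 1) (e := 0)) => // k.
  by rewrite powRr0 mulr1 invf_le1 ?powR_gt0// one_le_powR ?ler1n// ltW.
exists (lac_coef m (weight c s) N theta); split => //.
  pose r := (2 `^ (eta * q))^-1 : R.
  have r0 : 0 <= r by rewrite invr_ge0 powR_ge0.
  have r1 : r < 1.
    rewrite invf_lt1 ?powR_gt0// -[ltLHS](one_powR (eta * q)).
    by apply: gt0_ltr_powR; rewrite ?nnegrE ?mulr_gt0// ltr1n.
  apply: (tent_norm_lac_bounded m0 c0 s0 N0 N2 hth ha (B := 18 / (1 - r))) => // t.
  apply: nneseries_dyadic_blocks_lty => // [k|j]; first exact: powR_ge0.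
  pose y := 2 ^+ j * (t - pi) : R.
  have p2 : (0 : R) < 2 ^+ j by rewrite exprn_gt0.
  apply: (@le_trans _ _ (\sum_(i < 2 ^ j) r ^+ j * damp `|y - i%:R| ^+ 2)); last first.
    rewrite -mulr_sumr mulrC; apply: ler_wpM2r; first exact: exprn_ge0.
    exact: sum_damp_sqr.
  apply: ler_sum => i _.
  have kE : ((2 ^ j - 1 + i).+1 = 2 ^ j + i)%N by rewrite subn1 -addSn prednK ?expn_gt0.
  have NE : N (2 ^ j - 1 + i)%N = (2 ^ j)%N.
    rewrite /N kE (@trunc_log_eq 2 j)//.
    by rewrite leq_addr /= expnS mul2n -addnn ltn_add2l.
  rewrite powRM ?peak_ge0//; apply: ler_pM; rewrite ?powR_ge0//.
    rewrite /c kE /r exprVn -powRN -powRrM mulNr powRN -powR_exprn//.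
    rewrite lef_pV2 ?posrE ?powR_gt0 ?ltr0n ?addn_gt0 ?expn_gt0//.
    apply: ge0_ler_powR; rewrite ?nnegrE ?exprn_ge0 ?mulr_ge0 ?(ltW eta0) ?(ltW q0)//.
    by rewrite -natrX ler_nat leq_addr.
  apply: le_trans (damp_exprn_powR_le _ mq) _; apply: eq_ler; congr (damp _ ^+ 2).
  rewrite /theta NE kE addKn natrX -{1}(gtr0_norm p2) -normrM; congr `|_|.
  by rewrite /y; field; rewrite gt_eqF.
apply: block_sum_lac_infty => //.
apply/eqP; rewrite -leye_eq -harmonic_nneseries.
apply: lee_nneseries => [k _ _|k _]; first by rewrite lee_fin invr_ge0.
rewrite lee_fin subrr powRr0 mul1r.
have k0 : (0 : R) < k.+1%:R by rewrite ltr0n.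
have -> : k.+1%:R^-1 = (c k * (Num.sqrt k.+1%:R)^-1) `^ u :> R.
  rewrite /c -powR12_sqrt ?(ltW k0)// -!powRN -powRD; last by rewrite (gt_eqF k0) implybT.
  rewrite -powRrM -[LHS]powR_inv1 ?(ltW k0)//; congr (_ `^ _).
  by rewrite /eta; field; rewrite gt_eqF.
apply: ge0_ler_powR; rewrite ?nnegrE ?mulr_ge0 ?invr_ge0 ?sqrtr_ge0 ?(ltW u0)//.
apply: ler_wpM2l => //; rewrite lef_pV2 ?posrE ?sqrtr_gt0 ?ltr0n//.
by rewrite ler_sqrt ?ler_nat ?ltW.
Qed.

Lemma dyadic_ring (y : R) : 0 < y -> y <= 1 -> exists n, eps R n.+1 < y <= eps R n.
Proof.
move=> y0 y1; have [n0 h0] := eps_lt y0.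
have ex : exists n, eps R n < y by exists n0.
have [n hn hmin] := ex_minnP ex.
case: n hn hmin => [|n] hn hmin; first by move: hn; rewrite eps0; lra.
exists n; rewrite hn /= leNgt; apply/negP => /hmin; by rewrite ltnn.
Qed.

(* On the ring [|t - pi| ~ eps n] the [k]-th peak is at most [2 ^ (n - k)]
   to the power [2 / p], so that the critical sequence is seen through a
   geometric convolution. *)
Lemma example_high_peaks p q alpha u s1 : 0 < p -> 0 < q -> -2 < alpha -> 0 < u ->
  s1 + 2^-1 < (alpha + 2) / q + p^-1 \/ s1 + 2^-1 = (alpha + 2) / q + p^-1 /\ u < p ->
  exists a, [/\ absconv a, tent_space p q alpha (power_sum a) & block_sum u s1 a = +oo%E].
Proof.
move=> p0 q0 al u0 h; set s := (alpha + 2) / q in h.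
have s0 : 0 < s by rewrite divr_gt0//; lra.
pose D := s + p^-1 - (s1 + 2^-1).
have D0 : 0 <= D by rewrite /D; lra.
have pV0 : 0 < p^-1 by rewrite invr_gt0.
(* For k > n the peak must decay like 2^(-2 (k - n) / p): one half offsets the growth eps_k^(-1/p)
   of c_k, the other yields the geometric gap factor. *)
have [m m0 mp] := exists_mul_ge (2 / p) (ltr01 : 0 < (1 : R)).
rewrite mulr1 in mp.
pose c k := eps R k `^ (- p^-1) * crit D u k.
pose N k := (2 ^ k)%N; pose theta (_ : nat) : R := pi.
have c0 k : 0 <= c k by rewrite mulr_ge0 ?powR_ge0 ?crit_ge0.
have N0 k : (0 < N k)%N by rewrite expn_gt0.
have N2 k : (N k <= 2 ^ k)%N by [].
have hth k : pi <= theta k <= pi + 1 by rewrite lexx lerDl ler01.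
have ha : absconv (lac_coef m (weight c s) N theta).
  apply: (absconv_weight m0 c0 s0 N0 (M := 1) (e := p^-1)) => //; first exact: ltW.
  move=> k; have p2 : (0 : R) < 2 ^+ k by rewrite exprn_gt0.
  have -> : (2 ^+ k) `^ p^-1 = eps R k `^ (- p^-1).
    by rewrite /eps exprVn -[(2 ^+ k)^-1]powR_inv1 ?(ltW p2)// -powRrM mulN1r opprK.
  by rewrite mul1r ler_piMr ?powR_ge0// crit_le1.
exists (lac_coef m (weight c s) N theta); split => //; last first.
  apply: block_sum_lac_infty => //; rewrite -(crit_divergent D u0).
  apply: eq_eseriesr => k _; congr ((_ `^ _)%:E).
  have e0 := eps_gt0 R k.
  have -> : (Num.sqrt (N k)%:R)^-1 = eps R k `^ 2^-1 :> R.
    rewrite /N natrX -powR12_sqrt ?exprn_ge0// -powRN /eps exprVn.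
    by rewrite -[(2 ^+ k)^-1]powR_inv1 ?exprn_ge0// -powRrM mulN1r.
  rewrite /c mulrA -powRD; last by rewrite (gt_eqF e0) implybT.
  rewrite mulrAC -powRD; last by rewrite (gt_eqF e0) implybT.
  by congr (_ `^ _ * _); rewrite /D; ring.
apply: tent_norm_lac_lty => //.
pose lam := 2^-1 `^ (q / p) : R.
have qp0 : 0 < q / p by rewrite divr_gt0.
have pq0 : 0 < p / q by rewrite divr_gt0.
have lam0 : 0 < lam by rewrite powR_gt0// invr_gt0.
have lam1 : lam < 1.
  rewrite -[ltRHS](one_powR (q / p)); apply: gt0_ltr_powR; rewrite ?nnegrE ?invr_ge0//.
  by rewrite invf_lt1// ltr1n.
have lamE j : lam ^+ j = eps R j `^ (q / p) by rewrite /lam -powR_exprn ?invr_ge0.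
have [C C0 hC] := geometric_convolution lam0 lam1 pq0.
pose x k := crit D u k `^ q.
have x0 k : 0 <= x k by exact: powR_ge0.
pose G n : \bar R := (\sum_(k <oo) (x k * lam ^+ gap k n)%:E)%E.
have G0 n : (0 <= G n)%E by apply: nneseries_ge0 => k _ _; rewrite lee_fin mulr_ge0 ?exprn_ge0 ?(ltW lam0).
have term k n t : eps R n.+1 < `|t - pi| / 4 ->
    (c k * peak m N theta k t) `^ q <= eps R n `^ (- (q / p)) * (x k * lam ^+ gap k n).
  move=> ht; set h1 := peak m N theta k t.
  have h10 : 0 <= h1 by exact: peak_ge0.
  have k0 := crit_ge0 D u k.
  have -> : (c k * h1) `^ q = eps R k `^ (- p^-1 * q) * (x k * h1 `^ q).
    rewrite /c -mulrA powRM; [|exact: powR_ge0|exact: mulr_ge0]. 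
    rewrite powRM//.
    rewrite -powRrM.
    by [].
  have -> : - p^-1 * q = - (q / p) by ring.
  have eP j : 0 < eps R j `^ (- (q / p)) by rewrite powR_gt0// eps_gt0.
  have eN j : eps R j `^ (- (q / p)) = (lam ^+ j)^-1 by rewrite lamE powRN.
  have lj j : 0 < lam ^+ j by rewrite exprn_gt0.
  rewrite mulrCA [leRHS]mulrCA; apply: ler_wpM2l => //.
  rewrite !eN; have [kn|nk] := leqP k n.
    have -> : gap k n = (n - k)%N by rewrite /gap (eqP (_ : k - n == 0)%N) ?subn_eq0.
    have -> : (lam ^+ n)^-1 * lam ^+ (n - k) = (lam ^+ k)^-1.
      by rewrite -{1}(subnK kn) exprD invfM mulrAC mulVf ?mul1r// gt_eqF.
    rewrite ler_piMr ?invr_ge0 ?(ltW (lj k))// powR_le_one ?(ltW q0)//.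
    by rewrite exprn_ile1 ?damp_le1// ltW// damp_gt0.
  have nk' := ltnW nk.
  have -> : gap k n = (k - n)%N by rewrite /gap (eqP (_ : n - k == 0)%N) ?addn0 ?subn_eq0.
  have -> : (lam ^+ k)^-1 * h1 `^ q = (lam ^+ n)^-1 * ((lam ^+ (k - n))^-1 * h1 `^ q).
    by rewrite mulrA -invfM -exprD addnC subnK.
  apply: ler_wpM2l; first by rewrite invr_ge0 ltW.
  rewrite ler_pdivrMl// -expr2 lamE -powR_mulrn ?powR_ge0// -powRrM.
  have -> : q / p * 2 = 2 / p * q by ring.
  rewrite powRrM; apply: ge0_ler_powR; rewrite ?nnegrE ?powR_ge0 ?(ltW q0)//.
  apply: (@le_trans _ _ (eps R (k - n) ^+ m)); last first.
    by rewrite -powR_mulrn ?eps_ge0// ger_powR ?eps_gt0 ?eps_le1.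
  rewrite /h1 /peak lerXn2r ?nnegrE ?eps_ge0 ?(ltW (damp_gt0 _))//.
  rewrite /damp -[leRHS]invrK lef_pV2 ?posrE ?invr_gt0 ?eps_gt0 ?lt_max ?ltr01//.
  rewrite le_max; apply/orP; right; rewrite /N natrX /theta.
  have ek : eps R k = eps R (k - n) * eps R n by rewrite -epsD subnK.
  have e2 : 2 ^+ k = (eps R k)^-1 :> R by rewrite /eps exprVn invrK.
  rewrite e2 ek invfM; move: ht; rewrite epsS.
  have e0 := eps_gt0 R n; have e1 := eps_gt0 R (k - n).
  move: (eps R n) (eps R (k - n)) (`|_|) e0 e1 => y z d y0 z0 ht.
  rewrite -mulrA ler_peMr ?invr_ge0 ?(ltW z0)// ler_pdivlMl// mulr1; lra.
(* An interval of length 8 eps containing the n-th ring; its length cancels the factor 1 / eps left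
   by the power p / q. *)
pose E n : set R := `[pi - 4 * eps R n, pi + 4 * eps R n]%classic.
have mE n : measurable (E n) by exact: measurable_itv.
pose g n t : \bar R := ((((eps R n)^-1)%:E * G n `^ (p / q)) * (\1_(E n) t)%:E)%E.
have cg0 n : (0 <= ((eps R n)^-1)%:E * G n `^ (p / q))%E.
  by rewrite mule_ge0 ?poweR_ge0// lee_fin invr_ge0 eps_ge0.
have g0 n t : (0 <= g n t)%E by rewrite mule_ge0// lee_fin.
have mind n : measurable_fun circ (fun t => (\1_(E n) t : R)%:E).
  by apply/measurable_EFinP; exact: measurable_indic.
have mg n : measurable_fun circ (g n) by exact: emeasurable_funM (measurable_cst _) (mind n).
apply: (@le_lt_trans _ _ (\int[mu]_(t in circ) \sum_(n <oo) g n t)%E).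
  apply: ae_ge0_le_integral => //.
  - by move=> t _; exact: poweR_ge0.
  - by apply: measurable_funTS; apply: (meas_comp (f := fun x => (x `^ (p / q))%E)); [exact: measurable_poweR|exact: measurable_peak_power].
  - by move=> t _; apply: nneseries_ge0.
  - by apply: ge0_emeasurable_sum => [n t _ _|n _]; [exact: g0|exact: mg].
  (* The centre pi lies in no ring and is a null set. *)
  exists [set pi]; split; [exact: measurable_set1|exact: lebesgue_measure_set1|].
  move=> t /= ht; apply: contrapT => tpi; apply: ht => tcirc.
  have y0 : 0 < `|t - pi| / 4 by rewrite divr_gt0// normr_gt0 subr_eq0; apply/eqP.
  have y1 : `|t - pi| / 4 <= 1.
    move: tcirc; rewrite /= in_itv /= => /andP[t0 t2].
    have p4 : pi < 4 :> R by have := pihalf_lt2 R; lra.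
    by rewrite ler_pdivrMr// mul1r ler_norml; lra.
  have [n /andP[hn1 hn2]] := dyadic_ring y0 y1.
  apply: le_trans (term_le_nneseries (u := g ^~ t) n (fun k => g0 k t)).
  rewrite /g indicE mem_set ?mule1; last first.
    move: hn2; rewrite /E /= in_itv /= ler_pdivrMr// ler_norml; lra.
  apply: (@le_trans _ _ (((eps R n `^ (- (q / p)))%:E * G n) `^ (p / q))%E).
    apply: poweR_le; [exact: ltW|exact: peak_power_ge0|].
    rewrite /G -nneseriesZl; last by move=> k _; rewrite lee_fin mulr_ge0 ?exprn_ge0 ?(ltW lam0).
    by apply: lee_nneseries => [k _ _|k _]; [rewrite lee_fin powR_ge0|rewrite -EFinM lee_fin term].
  rewrite poweRM ?lee_fin ?powR_ge0// poweR_EFin -powRrM.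
  have -> : - (q / p) * (p / q) = -1 by field; rewrite !gt_eqF.
  by rewrite powR_inv1 ?eps_ge0.
rewrite integral_nneseries//.
have hI n : (\int[mu]_(t in circ) g n t <= 8%:E * G n `^ (p / q))%E.
  rewrite ge0_integralZl//; last exact: mind.
  have -> : (\int[mu]_(t in circ) (\1_(E n) t : R)%:E = mu (E n `&` circ))%E.
    by rewrite (@integral_indic _ _ _ mu _ (measurable_itv _) _ (mE n)).
  apply: (@le_trans _ _ (((eps R n)^-1)%:E * G n `^ (p / q) * (8 * eps R n)%:E)%E).
    apply: lee_wpmul2l => //; apply: (@le_trans _ _ (mu (E n))).
      have mEc : measurable (E n `&` circ) by exact: (measurableI _ _ (mE n) (measurable_itv _)).
      by apply: (le_measure mu (mem_set mEc) (mem_set (mE n))); exact: subIsetl.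
    have e0 := eps_gt0 R n.
    rewrite /E lebesgue_measure_itv/= lte_fin ifT; last by lra.
    by rewrite -EFinB lee_fin; lra.
  rewrite muleAC -EFinM; apply: lee_wpmul2r; first exact: poweR_ge0.
  by rewrite lee_fin mulrCA mulVf ?mulr1// gt_eqF// eps_gt0.
apply: (@le_lt_trans _ _ (8%:E * (C%:E * \sum_(k <oo) (crit D u k `^ p)%:E))%E).
  apply: (@le_trans _ _ (8%:E * \sum_(n <oo) G n `^ (p / q))%E).
    rewrite -nneseriesZl; last by move=> n _; exact: poweR_ge0.
    by apply: lee_nneseries => [n _ _|n _]; [exact: integral_ge0|exact: hI].
  apply: lee_wpmul2l; first by rewrite lee_fin.
  have := hC x x0; rewrite /x.
  under [X in (_ <= _ * X)%E -> _]eq_eseriesr do rewrite -powRrM mulrCA mulfV ?(gt_eqF q0)// mulr1.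
  by [].
rewrite lte_mul_pinfty ?lee_fin// lte_mul_pinfty ?lee_fin//.
by apply: sum_crit_lty => //; rewrite /D; case: h => [h|[_ h]]; [left; lra|right].
Qed.

End counterexamples.

(** * From the dyadic sum to the embedding *)

Section embedding.
Context (R : realType) (d : measure_display) (Omega : measurableType d).
Variables (P : probability Omega R) (X : nat -> Omega -> Cplx R).
Hypothesis hX : standard_random_sequence P X.

Lemma embedding_block_sum (A : set (Cplx R -> Cplx R)) u v beta a : 0 < u -> 0 < v -> absconv a ->
  A (power_sum a) -> random_embedding P X A (tent_space v u beta) ->
  (block_sum u ((beta + 2) / u) a < +oo)%E.
Proof.
move=> u0 v0 ha hA hR; apply: (embedding_necessary hX u0 v0 ha).
apply: filterS2 (ae_absconv hX ha) (hR _ _ hA (power_expansion_power_sum ha)) => om h1 [_ [_ h2]].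
exact: conj h1 h2.
Qed.

Lemma block_sum_embedding (A : set (Cplx R -> Cplx R)) u v beta : 0 < u -> 0 < v -> -2 < beta ->
  (forall f a, A f -> power_expansion f a -> (block_sum u ((beta + 2) / u) a < +oo)%E) ->
  random_embedding P X A (tent_space v u beta).
Proof.
move=> u0 v0 hb h f a hA hf; have ha := power_expansion_absconv hf.
apply: filterS (embedding_sufficient hX u0 v0 hb ha (h f a hA hf)) => om [h1 h2].
split; last exact: (conj (power_sum_derivable h1) h2).
by move=> z hz; exact: cvgP (power_sum_cvg h1 hz).
Qed.

End embedding.

Theorem theorem1p7 (R : realType) (d : measure_display)
  (Omega : measurableType d) (P : probability Omega R)
  (X : nat -> Omega -> Cplx R) (p q u v alpha beta : R) :
  0 < p -> 0 < q -> 0 < u -> 0 < v -> -2 < alpha -> -2 < beta ->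
  standard_random_sequence P X ->
  random_embedding P X (tent_space p q alpha) (tent_space v u beta) <->
  ((p < 2 /\
     ((p <= u /\ 1 / p + (alpha + 2) / q = 1 / 2 + (beta + 2) / u) \/
      1 / p + (alpha + 2) / q < 1 / 2 + (beta + 2) / u)) \/
   (2 <= p /\
     ((Num.max 2 q <= u /\ (alpha + 2) / q = (beta + 2) / u) \/
      (alpha + 2) / q < (beta + 2) / u))).
Proof.
move=> p0 q0 u0 v0 hal hbe hX.
set s := (alpha + 2) / q; set s1 := (beta + 2) / u.
split => [hR|hcond].
  (* One function of the source space with infinite dyadic sum refutes the embedding; each way for
     the conditions to fail supplies one. *)
  have contra : ~ exists a, [/\ absconv a, tent_space p q alpha (power_sum a) & block_sum u s1 a = +oo%E].
    move=> [a [ha hA hS]]; have := embedding_block_sum hX u0 v0 ha hA hR.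
    by rewrite -/s1 hS ltxx.
  rewrite !div1r; have [p2|p2] := ltP p 2.
    left; split => //.
    have [h|h] := ltP (p^-1 + s) (2^-1 + s1); first by right.
    left; have [h1|h1] := ltP (2^-1 + s1) (p^-1 + s).
      by case: contra; apply: example_high_peaks => //; left; rewrite -/s; lra.
    have e : p^-1 + s = 2^-1 + s1 by lra.
    split=> //; rewrite leNgt; apply/negP => up; case: contra.
    by apply: example_high_peaks => //; right; rewrite -/s; split => //; lra.
  right; split => //.
  have [h|h] := ltP s s1; first by right.
  left; have [h1|h1] := ltP s1 s.
    by case: contra; apply: example_single_peak => //; left.
  have e : s = s1 by lra.
  split=> //; rewrite leNgt lt_max; apply/negP => /orP[h2|h2]; case: contra.
    by rewrite -e; exact: example_spread_peaks.
  by apply: example_single_peak => //; right; rewrite -/s.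
apply: block_sum_embedding => // f a [_ hf] ha; have hac := power_expansion_absconv ha.
(* The source gives summability at one pair of exponents, and [block_sum_mono] moves it to the pair
   of the target under the stated conditions. *)
case: hcond => -[hp h].
  apply: (block_sum_mono hac p0 u0 _ (tent_block_sum_lt2 p0 q0 hp ha hf)).
  by rewrite -/s -/s1; case: h => [[h1 h2]|h2]; [right; split => //; lra|left; lra].
have m0 : 0 < Num.max 2 q by rewrite lt_max ltr0n.
apply: (block_sum_mono hac m0 u0 _ (tent_block_sum_ge2 q0 hp ha hf)).
by rewrite -/s -/s1; case: h => [[h1 h2]|h2]; [right|left].
Qed.
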